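(* Let $q\ge 1$ be an integer and let $\mathcal{X}$ be a complex Hilbert manifold. Then $\mathcal{X}$ satisfies the $q$-Levi extension condition if and only if $\mathcal{X}$ is $q$-Hartogs.
   Context: Complex Hilbert manifolds are Hausdorff, second countable topological spaces locally homeomorphic to open subsets of the complex Hilbert space $\ell^2$ of square-summable complex sequences, with biholomorphic transition mappings (holomorphic means complex Fr\'echet differentiable). Notation: $\Delta(r)=\Delta_r\subset\mathbb{C}$ is the open disk of radius $r$ centered at $0$, $\Delta=\Delta(1)$; $\Delta^q(r)=\Delta_r^q$ is the polydisk $\Delta(r)^q\subset\mathbb{C}^q$, $\Delta^q=\Delta^q(1)$; $A^q_{1-r,1}=\Delta^q\setminus\overline{\Delta}{}^q_{1-r}$. For $0<r<1$ the $q$-concave Hartogs figure in $\mathbb{C}^{q+1}$ is $$H_q^1(r)=\bigl(\Delta^q\times\Delta(r)\bigr)\cup\bigl(A^q_{1-r,1}\times\Delta\bigr).$$ $q$-Hartogs: a complex Hilbert manifold $\mathcal{X}$ is called $q$-Hartogs (or $q$-Hilbert-Hartogs) if for every $0<r<1$ every holomorphic mapping $f:H_q^1(r)\to\mathcal{X}$ extends to a holomorphic mapping $\tilde f:\Delta^{q+1}\to\mathcal{X}$. $q$-pseudoconcavity: let $D$ be a domain with $\mathcal{C}^2$ boundary in $\mathbb{C}^n$ and let $p\in\partial D$. $D$ (or $\partial D$) is called $q$-pseudoconcave at $p$ if the Levi form of a defining function $u$ of $D$ near $p$ (so $D=\{u<0\}$ near $p$, $u$ of class $\mathcal{C}^2$,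 $\nabla u\ne0$) has at least $q$ negative eigenvalues on the complex tangent space $T^c_p\partial D$. $q$-Levi extension condition: $\mathcal{X}$ satisfies the $q$-Levi extension condition if for every $n$, every domain $D\subset\mathbb{C}^n$ with $\mathcal{C}^2$ boundary and every $p\in\partial D$ such that $\partial D$ is $q$-pseudoconcave at $p$, every holomorphic map $f:D\to\mathcal{X}$ extends holomorphically to a neighborhood of $p$. *)

(* Defs.v *)
From HB Require Import structures.
From mathcomp Require Import all_boot all_order all_algebra.
From mathcomp Require Import complex.
From mathcomp Require Import all_classical all_reals all_analysis.
From mathcomp Require Import ring lra.
Set Implicit Arguments.
Unset Strict Implicit.
Unset Printing Implicit Defensive.
Import Order.TTheory GRing.Theory Num.Theory.
Import numFieldNormedType.Exports.
Local Open Scope classical_set_scope.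
Local Open Scope ring_scope.
Local Open Scope complex_scope.

(* [R[i]] behind a constant of type [numClosedFieldType], so that it inherits
   the topology and the norm (with values in the field itself) that the
   library puts on every [numClosedFieldType]. *)
Definition Cx (R : realType) : numClosedFieldType := R[i].

Definition toC (R : realType) (x : R) : Cx R := x%:C.

Section SquareSummable.
Variable R : realType.
Local Notation C := (Cx R).

Definition sqmod (z : C) : R := complex.Re z ^+ 2 + complex.Im z ^+ 2.

Lemma sqmodE z : toC (sqmod z) = `|z| ^+ 2.
Proof. exact: add_Re2_Im2. Qed.

Lemma sqmod_ge0 z : 0 <= sqmod z.
Proof. by rewrite addr_ge0 // sqr_ge0. Qed.

Lemma sqmod_eq0 z : sqmod z = 0 -> z = 0.
Proof.
move=> z0; apply/eqP; rewrite -normr_eq0 -sqrf_eq0 -sqmodE z0.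
exact/eqP.
Qed.

Lemma sqmodM a z : sqmod (a * z) = sqmod a * sqmod z.
Proof. by case: a z => a b [c d]; rewrite /sqmod /=; ring. Qed.

Lemma sqmodD_le (s t : R) x y : 0 < s -> 0 < t ->
  sqmod (x + y) <= (s + t) * (s^-1 * sqmod x + t^-1 * sqmod y).
Proof.
move=> s0 t0; case: x y => a b [c d]; rewrite /sqmod /=.
have key (a1 c1 : R) :
    (a1 + c1) ^+ 2 <= (s + t) * (s^-1 * a1 ^+ 2 + t^-1 * c1 ^+ 2).
  rewrite -subr_ge0.
  rewrite (_ : _ - _ = s^-1 * t^-1 * (t * a1 - s * c1) ^+ 2); last first.
    by field; rewrite !gt_eqF.
  by rewrite mulr_ge0 ?sqr_ge0 // mulr_ge0 // invr_ge0 ltW.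
have := key a c; have := key b d; lra.
Qed.

Definition sqseries (u : nat -> C) : R^nat := series (fun k => sqmod (u k)).

Definition square_summable : {pred nat -> C} :=
  fun u => `[< cvgn (sqseries u) >].

Lemma square_summableP u : reflect (cvgn (sqseries u)) (u \in square_summable).
Proof. exact: asboolP. Qed.

Lemma sqseriesZ a u : sqseries (a *: u) = sqmod a *: sqseries u.
Proof.
rewrite -seriesZ /sqseries; congr series.
by apply/funext => k; exact: (sqmodM a (u k)).
Qed.

Lemma sqseries_le (u v w : nat -> C) (a b : R) :
  (forall k, sqmod (w k) <= a * sqmod (u k) + b * sqmod (v k)) ->
  u \in square_summable -> v \in square_summable ->
  w \in square_summable /\
  limn (sqseries w) <= a * limn (sqseries u) + b * limn (sqseries v).
Proof.
move=> le /square_summableP cu /square_summableP cv.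
pose S := a *: sqseries u + b *: sqseries v.
have cS : S @ \oo --> a * limn (sqseries u) + b * limn (sqseries v).
  by apply: cvgD; [apply: cvgZr|apply: cvgZr].
have SE : S = series (fun k => a * sqmod (u k) + b * sqmod (v k)).
  by rewrite /S /sqseries -!seriesZ -seriesD.
have cw : cvgn (sqseries w).
  apply: (@series_le_cvg _ _ (fun k => a * sqmod (u k) + b * sqmod (v k))).
  - by move=> k; exact: sqmod_ge0.
  - by move=> k; apply: le_trans (le k); exact: sqmod_ge0.
  - exact: le.
  - by rewrite -SE; apply/cvg_ex; eexists; exact: cS.
split; first exact/square_summableP.
rewrite -(cvg_lim _ cS) //; apply: ler_lim => //.
  by apply/cvg_ex; eexists; exact: cS.
by apply: nearW => n; rewrite SE; apply: ler_sum => k _; exact: le.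
Qed.

Lemma square_summable_submod : submod_closed square_summable.
Proof.
split=> [|a u v su sv].
  apply/square_summableP; rewrite (_ : sqseries 0 = cst 0).
    exact: is_cvg_cst.
  apply/funext => n; rewrite /sqseries /series /= big1 // => k _.
  by rewrite /sqmod /= expr0n addr0.
have [|//] := @sqseries_le u v (a *: u + v) (2 * sqmod a) 2 _ su sv.
move=> k; apply: le_trans (sqmodD_le _ _ ltr01 ltr01) _.
by rewrite -[(a *: u) k]/(a * u k) sqmodM invr1; lra.
Qed.

HB.instance Definition _ :=
  GRing.isSubmodClosed.Build C (nat -> C) square_summable
    square_summable_submod.

Record ell2 := Ell2 {
  ell2_val :> nat -> C;
  ell2P : ell2_val \in square_summable }.

HB.instance Definition _ := [isSub for ell2_val].
HB.instance Definition _ := [Choice of ell2 by <:].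
HB.instance Definition _ := [SubChoice_isSubLmodule of ell2 by <:].

Definition sqnorm (u : ell2) : R := limn (sqseries u).

Definition ell2_norm (u : ell2) : C := toC (Num.sqrt (sqnorm u)).

Lemma sqnorm_ge (u : ell2) n : sqseries u n <= sqnorm u.
Proof.
apply: nondecreasing_cvgn_le; last exact/square_summableP/ell2P.
by apply: nondecreasing_series => k _ _; exact: sqmod_ge0.
Qed.

Lemma sqnorm_ge0 u : 0 <= sqnorm u.
Proof. by apply: le_trans (sqnorm_ge u 0); rewrite /sqseries /series /= big_geq. Qed.

Lemma sqnorm_eq0 u : sqnorm u = 0 -> u = 0.
Proof.
move=> u0; apply/val_inj/funext => k /=; apply: sqmod_eq0.
apply/eqP; rewrite eq_le sqmod_ge0 andbT -u0.
apply: le_trans (sqnorm_ge u k.+1); rewrite /sqseries /series /= big_nat_recr //=.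
by rewrite lerDr sumr_ge0 // => i _; exact: sqmod_ge0.
Qed.

Lemma ell2_norm_eq0 u : ell2_norm u = 0 -> u = 0.
Proof.
move=> /complexI /eqP; rewrite sqrtr_eq0 => u0.
by apply/sqnorm_eq0/eqP; rewrite eq_le u0 sqnorm_ge0.
Qed.

Lemma ell2_normZ (a : C) u : ell2_norm (a *: u) = `|a| * ell2_norm u.
Proof.
have su : cvgn (sqseries u) by exact/square_summableP/ell2P.
have aE : `|a| = toC (Num.sqrt (sqmod a)) by exact: normc_def.
have auE : sqnorm (a *: u) = sqmod a * sqnorm u.
  rewrite /sqnorm (_ : sqseries (a *: u) = sqmod a *: sqseries u).
    by apply: cvg_lim => //; exact: cvgZr.
  exact: sqseriesZ.
by rewrite /ell2_norm auE aE sqrtrM ?sqmod_ge0 // /toC rmorphM.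
Qed.

Lemma ell2_normD u v : ell2_norm (u + v) <= ell2_norm u + ell2_norm v.
Proof.
rewrite /ell2_norm /toC -rmorphD lecR.
have [/eqP|u0] := eqVneq (sqnorm u) 0.
  by move/eqP/sqnorm_eq0 => ->; rewrite add0r lerDr sqrtr_ge0.
have [/eqP|v0] := eqVneq (sqnorm v) 0.
  by move/eqP/sqnorm_eq0 => ->; rewrite addr0 lerDl sqrtr_ge0.
set s := Num.sqrt (sqnorm u); set t := Num.sqrt (sqnorm v).
have s0 : 0 < s by rewrite sqrtr_gt0 lt_neqAle eq_sym u0 sqnorm_ge0.
have t0 : 0 < t by rewrite sqrtr_gt0 lt_neqAle eq_sym v0 sqnorm_ge0.
have s2 : sqnorm u = s ^+ 2 by rewrite sqr_sqrtr ?sqnorm_ge0.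
have t2 : sqnorm v = t ^+ 2 by rewrite sqr_sqrtr ?sqnorm_ge0.
rewrite -[leRHS]gtr0_norm ?addr_gt0 // -sqrtr_sqr ler_sqrt ?sqr_ge0 //.
have [|_] := @sqseries_le u v (u + v) ((s + t) * s^-1) ((s + t) * t^-1) _
  (ell2P u) (ell2P v).
  move=> k; apply: le_trans (sqmodD_le _ _ s0 t0) _.
  by rewrite mulrDr !mulrA.
move=> h; apply: le_trans h _; rewrite -!/(sqnorm _) s2 t2.
by rewrite le_eqVlt; apply/orP; left; apply/eqP; field; rewrite !gt_eqF.
Qed.

HB.instance Definition _ :=
  Lmodule_isNormed.Build C ell2 ell2_normD ell2_normZ ell2_norm_eq0.

End SquareSummable.

Section HilbertManifold.
Variable R : realType.

(* [chart_inv] is only meaningful on [chart_cod]; no chart exists on the empty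
   space, whose only atlas is empty. *)
Record chart (X : topologicalType) := Chart {
  chart_dom : set X;
  chart_cod : set (ell2 R);
  chart_map : X -> ell2 R;
  chart_inv : ell2 R -> X;
  chart_dom_open : open chart_dom;
  chart_cod_open : open chart_cod;
  chart_mapP : forall x, chart_dom x -> chart_cod (chart_map x);
  chart_invP : forall e, chart_cod e -> chart_dom (chart_inv e);
  chart_mapK : forall x, chart_dom x -> chart_inv (chart_map x) = x;
  chart_invK : forall e, chart_cod e -> chart_map (chart_inv e) = e;
  chart_map_cont : forall x, chart_dom x -> {for x, continuous chart_map};
  chart_inv_cont : forall e, chart_cod e -> {for e, continuous chart_inv} }.

Record hilbert_manifold := HilbertManifold {
  mspace :> topologicalType;
  mspace_hausdorff : hausdorff_space mspace;
  mspace_second_countable : @second_countable mspace;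
  atlas : set (chart mspace);
  atlas_cover : forall x, exists2 c, atlas c & chart_dom c x;
  atlas_compat : forall c d, atlas c -> atlas d ->
    forall e, chart_cod c e -> chart_dom d (chart_inv c e) ->
      differentiable (chart_map d \o chart_inv c) e }.

End HilbertManifold.

Section Extension.
Variable R : realType.
Local Notation C := (Cx R).
Implicit Types X : hilbert_manifold R.

(* Meant for open [D]: a map from [D] to [X] is represented by a total function
   whose values outside [D] are irrelevant. *)
Definition holomorphic_on n X (D : set 'rV[C]_n) (f : 'rV[C]_n -> X) : Prop :=
  forall z, D z -> {for z, continuous f} /\
    forall c, atlas c -> chart_dom c (f z) ->
      differentiable (chart_map c \o f) z.

Definition polydisk n (r : R) : set 'rV[C]_n :=
  [set z | forall i, `|z 0 i| < toC r].

(* In ['rV_q.+1] the last coordinate is the distinguished one. *)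
Definition hartogs_figure q (r : R) : set 'rV[C]_q.+1 :=
  [set z | (polydisk 1 (col' ord_max z) /\ `|z 0 ord_max| < toC r) \/
           ((polydisk 1 `\` closure (polydisk (1 - r))) (col' ord_max z) /\
            `|z 0 ord_max| < 1)].

Definition q_hartogs q X : Prop :=
  forall r : R, 0 < r < 1 ->
  forall f : 'rV[C]_q.+1 -> X, holomorphic_on (hartogs_figure r) f ->
  exists2 g : 'rV[C]_q.+1 -> X, holomorphic_on (polydisk 1) g &
    forall z, hartogs_figure r z -> g z = f z.

(* Derivative along [v] for the real structure of C^n. *)
Definition along n (u : 'rV[C]_n -> R) (z v : 'rV[C]_n) : R -> R :=
  fun t => u (z + toC t *: v).

Definition rderiv n (v : 'rV[C]_n) (u : 'rV[C]_n -> R) : 'rV[C]_n -> R :=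
  fun z => derive1 (along u z v) 0.

Fixpoint Ck_on n k (U : set 'rV[C]_n) (u : 'rV[C]_n -> R) : Prop :=
  (forall z, U z -> {for z, continuous u}) /\
  if k is k'.+1 then
    forall v : 'rV[C]_n,
      (forall z, U z -> derivable (along u z v) 0 1) /\
      Ck_on k' U (rderiv v u)
  else True.

Definition e_ n (j : 'I_n) : 'rV[C]_n := delta_mx 0 j.
Definition ie_ n (j : 'I_n) : 'rV[C]_n := 'i%R *: delta_mx 0 j.

(* d/dz_j = (d/dx_j - i d/dy_j) / 2 *)
Definition dz n (u : 'rV[C]_n -> R) (p : 'rV[C]_n) : 'rV[C]_n :=
  \row_j ((toC (rderiv (e_ j) u p) - 'i%R * toC (rderiv (ie_ j) u p)) / 2).

(* d^2u / dz_j d\bar z_k *)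
Definition levi_mx n (u : 'rV[C]_n -> R) (p : 'rV[C]_n) : 'M[C]_n :=
  \matrix_(j, k)
    ((toC (rderiv (e_ j) (rderiv (e_ k) u) p +
           rderiv (ie_ j) (rderiv (ie_ k) u) p) +
      'i%R * toC (rderiv (e_ j) (rderiv (ie_ k) u) p -
                  rderiv (ie_ j) (rderiv (e_ k) u) p)) / 4).

(* The row space of this matrix is T^c_p = {w | \sum_j du/dz_j(p) w_j = 0}. *)
Definition complex_tangent n (u : 'rV[C]_n -> R) (p : 'rV[C]_n) : 'M[C]_n :=
  kermx (dz u p)^T.

Definition neg_eigenvalues_ge m q (M : 'M[C]_m) : Prop :=
  exists2 s : seq C, char_poly M = \prod_(a <- s) ('X - a%:P) &
    (q <= count (fun a => (a < 0)%R) s)%N.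

(* The eigenvalues of the form restricted to T^c are those of its matrix in an
   orthonormal basis of T^c, here the rows of [B]. *)
Definition levi_neg_eigenvalues_ge n q (u : 'rV[C]_n -> R) (p : 'rV[C]_n) :
    Prop :=
  exists m (B : 'M[C]_(m, n)),
    [/\ B \is unitarymx, (B == complex_tangent u p)%MS &
        neg_eigenvalues_ge q
          (B *m levi_mx u p *m (map_mx Num.conj B)^T)].

Definition boundary (T : topologicalType) (D : set T) : set T :=
  closure D `\` interior D.

Definition domain n (D : set 'rV[C]_n) : Prop :=
  [/\ open D, connected D & D !=set0].

Definition defining_function n (D : set 'rV[C]_n) (p : 'rV[C]_n)
    (u : 'rV[C]_n -> R) : Prop :=
  exists U : set 'rV[C]_n,
    [/\ open_nbhs p U, Ck_on 2 U u,
        (forall z, U z -> exists v, rderiv v u z != 0) &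
        forall z, U z -> (D z <-> u z < 0)].

Definition C2_boundary n (D : set 'rV[C]_n) : Prop :=
  forall p, boundary D p -> exists u, defining_function D p u.

Definition pseudoconcave_at n q (D : set 'rV[C]_n) (p : 'rV[C]_n) : Prop :=
  exists2 u, defining_function D p u & levi_neg_eigenvalues_ge q u p.

Definition q_levi_extension q X : Prop :=
  forall n (D : set 'rV[C]_n), domain D -> C2_boundary D ->
  forall p, boundary D p -> pseudoconcave_at q D p ->
  forall f : 'rV[C]_n -> X, holomorphic_on D f ->
  exists V : set 'rV[C]_n, open_nbhs p V /\
    exists2 g : 'rV[C]_n -> X, holomorphic_on (D `|` V) g &
      forall z, D z -> g z = f z.

End Extension.

(* Main.v *)
(* Levi => Hartogs.  A point [x] of the polydisk is good if the map extends to a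
   neighbourhood of the vertical segment joining [x] to [w = 0]; the extensions at
   good points glue.  If some point is bad, let [x] minimise
   [|w|^2 - eps * |z'|^2] over the bad points.  A bounded domain with polynomial
   boundary, q-pseudoconcave at [x], lies among the smaller values and touches [x];
   the Levi condition extends the map across [x], and [x] is good after all.

   Hartogs => Levi.  Near [p], quadratic maps [(z, s) |-> p + rho z W +
   rho^2 (s v - H(z W) nu)] send a Hartogs figure into [D], for all [v] in a ball:
   the rows of [W] span negative directions of the Levi form and [H] is the
   holomorphic part of the second order term.  So the map extends along each of
   them.  Putting [y = s v], these extensions fit together holomorphically in
   [(z, y)] where [|z|] is close to 1, and this joint holomorphy propagates to
   [z = 0]: in a chart, the Taylor coefficients in [z] are holomorphic in [y] and
   bounded on each ray of a cone, hence, by Baire and the maximum principle,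
   uniformly bounded near [y = 0].  The resulting map agrees with the given one on a
   cone in [D] with apex [p], then along segments parallel to its axis. *)

Require Import Defs.
From HB Require Import structures.
From mathcomp Require Import all_boot all_order all_algebra.
From mathcomp Require Import complex.
From mathcomp Require Import all_classical all_reals all_analysis.
From mathcomp Require Import ring lra.
Set Implicit Arguments.
Unset Strict Implicit.
Unset Printing Implicit Defensive.
Import Order.TTheory GRing.Theory Num.Theory.
Import numFieldNormedType.Exports.
Local Open Scope classical_set_scope.
Local Open Scope ring_scope.
Local Open Scope complex_scope.

(** * Norms and differentiability over the complex field *)

Section RealNorm.
Variable R : realType.
Local Notation C := (Cx R).
Implicit Types V W : normedModType C.

(** The Levi condition speaks only of maps on a whole domain with smooth boundary, so a piece of a
    sublevel set near a bad point is not admissible; an explicit quartic domain inside the sublevel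
    set replaces it. Its [q] negative eigenvalues come from [- eps * |z'|^2]: a bad point has
    [|w| >= r], so complex tangent vectors are almost horizontal and [|w|^2] contributes little on
    them. Smallness of [eps] also keeps the minimising point away from [|w| = 1]. In the other
    direction [n] may exceed [q + 1], so each [v] gives an extension on its own slice, and [X] has
    no metric that would make neighbourhoods uniform in [v]. The slices meet in the core curve
    [y = 0], common to all [v]: charts along it fix the length of the steps, and within one chart
    only Taylor coefficients have to be made uniform. Maps into [ell2] are reduced to scalar
    functions by pairing with finitely supported sequences. Remainders are explicit, because bounds
    have to survive limits and changes of radius. The identity theorem along segments, resting on
    the Hausdorff property, does the gluing. *)

Definition nm V (v : V) : R := complex.Re (`|v| : C).

(** An element of the field that is nonnegative for its partial order is real, so passing to the
    real part loses nothing and estimates can be made in [R]. *)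
Lemma nmE V (v : V) : `|v| = toC (nm v).
Proof.
have : 0 <= `|v| by [].
rewrite /nm; case: (`|v| : R[i]) => a b; rewrite lecE /= => /andP[/eqP -> _].
by [].
Qed.

Lemma toC_le (a b : R) : (toC a <= toC b) = (a <= b).
Proof. exact: lecR. Qed.

Lemma toC_lt (a b : R) : (toC a < toC b) = (a < b).
Proof. exact: ltcR. Qed.

Lemma toC_inj : injective (@toC R).
Proof. exact: complexI. Qed.

Lemma nm_ge0 V (v : V) : 0 <= nm v.
Proof. by rewrite -toC_le -nmE; exact: normr_ge0. Qed.

Lemma nm0 V : nm (0 : V) = 0.
Proof. by rewrite /nm normr0. Qed.

Lemma nm_eq0 V (v : V) : (nm v == 0) = (v == 0).
Proof.
rewrite -(normr_eq0 v) nmE; apply/eqP/eqP => [->//|h].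
exact: toC_inj.
Qed.

Lemma toCD (a b : R) : toC (a + b) = toC a + toC b.
Proof. exact: rmorphD. Qed.

Lemma toCM (a b : R) : toC (a * b) = toC a * toC b.
Proof. exact: rmorphM. Qed.

Lemma nmD V (v w : V) : nm (v + w) <= nm v + nm w.
Proof. by rewrite -toC_le toCD -!nmE ler_normD. Qed.

Lemma nmN V (v : V) : nm (- v) = nm v.
Proof. by rewrite /nm normrN. Qed.

Lemma nmBC V (v w : V) : nm (v - w) = nm (w - v).
Proof. by rewrite -nmN opprB. Qed.

Lemma nmZ V (a : C) (v : V) : nm (a *: v) = nm a * nm v.
Proof. by apply: toC_inj; rewrite toCM -!nmE normrZ. Qed.

Lemma nmM (a b : C) : nm (a * b) = nm a * nm b.
Proof. exact: nmZ. Qed.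

Lemma nm1 : nm (1 : C) = 1.
Proof. by rewrite /nm normr1. Qed.

Lemma nm_toC (x : R) : nm (toC x) = `|x|.
Proof. by rewrite /nm normc_def /= expr0n addr0 sqrtr_sqr. Qed.

Lemma nm_sqmod (z : C) : nm z ^+ 2 = sqmod z.
Proof. by apply: toC_inj; rewrite sqmodE nmE !expr2 toCM. Qed.

Lemma nm_le_abs (z : C) : nm z <= `|complex.Re z| + `|complex.Im z|.
Proof.
rewrite -(@ler_sqr _ (nm z)) ?nnegrE ?nm_ge0 ?addr_ge0 // nm_sqmod /sqmod.
rewrite -[complex.Re z ^+ 2]real_normK ?num_real // -[complex.Im z ^+ 2]real_normK ?num_real //.
have := normr_ge0 (complex.Re z); have := normr_ge0 (complex.Im z); nra.
Qed.

Lemma Re_le_nm (z : C) : `|complex.Re z| <= nm z.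
Proof.
rewrite -(@ler_sqr _ _ (nm z)) ?nnegrE ?nm_ge0 // nm_sqmod /sqmod.
by rewrite real_normK ?num_real// lerDl sqr_ge0.
Qed.

Lemma Im_le_nm (z : C) : `|complex.Im z| <= nm z.
Proof.
rewrite -(@ler_sqr _ _ (nm z)) ?nnegrE ?nm_ge0 // nm_sqmod /sqmod.
by rewrite real_normK ?num_real// lerDr sqr_ge0.
Qed.

Lemma nbhs_nmP V (x : V) (A : set V) :
  nbhs x A <-> exists2 e : R, 0 < e & forall y, nm (y - x) < e -> A y.
Proof.
split=> [/nbhs_ballP [e /= e0 eA]|[e e0 eA]].
  exists (complex.Re e).
    by move: e0; case: e {eA} => a b; rewrite ltcE /= => /andP[].
  move=> y yx; apply: eA; rewrite -ball_normE /= distrC nmE.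
  move: e0 yx; case: e => a b; rewrite !ltcE /= => /andP[/eqP -> _] ->.
  by rewrite eqxx.
apply/nbhs_ballP; exists (toC e); first by rewrite /= (toC_lt 0).
move=> y; rewrite -ball_normE /= distrC nmE toC_lt; exact: eA.
Qed.

Lemma cont_nmP V (T : topologicalType) (f : V -> T) x :
  {for x, continuous f} <-> forall A, nbhs (f x) A ->
    exists2 e : R, 0 < e & forall y, nm (y - x) < e -> A (f y).
Proof.
by split=> [fx A /fx /nbhs_nmP //|fx A /fx]; move/nbhs_nmP.
Qed.

Lemma contP V W (f : V -> W) x :
  {for x, continuous f} <-> forall e : R, 0 < e ->
    exists2 d : R, 0 < d & forall y, nm (y - x) < d -> nm (f y - f x) < e.
Proof.
split=> [/cont_nmP fx e e0|fx].
  by apply: (fx [set z | nm (z - f x) < e]); apply/nbhs_nmP; exists e.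
apply/cont_nmP => A /nbhs_nmP[e e0 eA].
have [d d0 df] := fx e e0; exists d => // y /df; exact: eA.
Qed.

(** Little-o and continuity of the differential become explicit inequalities. By uniqueness of the
    differential, any bounded linear map with the right remainder may serve as witness. *)
Lemma diffP_nm V W (f : V -> W) x :
  differentiable f x <-> exists L : {linear V -> W},
    (exists K : R, forall v, nm (L v) <= K * nm v) /\
    forall e : R, 0 < e -> exists2 d : R, 0 < d & forall h, nm h < d ->
      nm (f (x + h) - f x - L h) <= e * nm h.
Proof.
split.
  move=> /diff_locallyP[Lc Lo]; exists ('d f x); split.
    have /contP/(_ 1 ltr01)[d d0 dL] := Lc 0.
    (* [v] is rescaled to norm [d / 2], where continuity at 0 bounds the differential by 1. *)
    exists (2 / d) => v; have [->|v0] := eqVneq v 0.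
      by rewrite linear0 !nm0 mulr0.
    have nv0 : 0 < nm v by rewrite lt_neqAle eq_sym nm_eq0 v0 nm_ge0.
    have := dL (toC (d / 2 / nm v) *: v).
    rewrite subr0 (linear0 ('d f x)) subr0 linearZZ !nmZ nm_toC ger0_norm; last first.
      by rewrite divr_ge0 ?nm_ge0 // divr_ge0 // ltW.
    rewrite divfK ?gt_eqF // => /(_ _) h.
    have {h} : d / 2 / nm v * nm ('d f x v) < 1 by apply: h; lra.
    have -> : 2 / d * nm v = (d / 2 / nm v)^-1.
      by field; rewrite !gt_eqF.
    move=> h; apply: ltW; rewrite -[X in _ < X]mulr1 ltr_pdivlMl //.
    by rewrite !divr_gt0.
  move=> e e0; move: Lo => /eqaddoP/(_ (toC e)).
  rewrite -(toC_lt 0) in e0.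
  move=> /(_ e0)/nbhs_nmP[d d0 dh]; exists d => // h hd.
  have := dh h; rewrite subr0 => /(_ hd) /=.
  by rewrite !nmE -toCM toC_le fctE /= opprD addrA [h + x]addrC.
move=> [L [[K LK] Lo]].
have Lc : continuous L.
  move=> y; apply/contP => e e0; exists (e / (`|K| + 1)).
    by rewrite divr_gt0 // ltr_wpDl.
  move=> z zy; rewrite -linearB.
  apply: le_lt_trans (LK _) _; apply: (@le_lt_trans _ _ ((`|K| + 1) * nm (z - y))).
    by rewrite ler_wpM2r ?nm_ge0 // ler_wpDr // ler_norm.
  by rewrite mulrC -ltr_pdivlMr // ltr_wpDl.
have Lo' : f \o shift x = cst (f x) + L +o_ 0 id.
  apply/eqaddoP => e e0; apply/nbhs_nmP.
  have e0' : 0 < complex.Re e.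
    by move: e0; case: e => a b; rewrite ltcE /= => /andP[].
  have [d d0 dh] := Lo _ e0'; exists d => // h; rewrite subr0 => /dh.
  have eE : e = toC (complex.Re e).
    by move: e0; case: e {e0' dh} => a b; rewrite ltcE /= => /andP[/eqP ->].
  by rewrite [in X in _ -> X]eE !nmE -toCM toC_le fctE /= opprD addrA [h + x]addrC.
have dL := diff_unique Lc Lo'.
by apply/diff_locallyP; rewrite dL.
Qed.

End RealNorm.

(** * Derivatives along a real variable, as first order estimates *)

Section RealVariable.
Variable R : realType.
Local Notation C := (Cx R).

(** The increment estimate is free of division, so that [h = 0] needs no separate treatment; [dR]
    and [cd] follow the same pattern for complex curves and for complex derivatives. *)
Definition rd (f : R -> R) (t d : R) := forall e : R, 0 < e ->
  exists2 k : R, 0 < k & forall h, `|h| < k -> `|f (t + h) - f t - h * d| <= e * `|h|.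

Lemma rdP (f : R -> R) (t d : R) : rd f t d <-> is_derive t (1 : R) f d.
Proof.
split=> [fd|[fd <-] e e0].
  suff h : (fun h => h^-1 *: ((f \o shift t) (h *: (1 : R)) - f t)) @ 0^' --> d.
    by split; [apply/cvg_ex; exists d|apply/cvg_lim].
  apply/cvgrPdist_le => e e0; have [k k0 fk] := fd e e0.
  near=> h.
  have h0 : h != 0 by near: h; exact: nbhs_dnbhs_neq.
  have hk : `|h| < k by near: h; exact: dnbhs0_lt.
  have := fk h hk.
  rewrite /= [h *: 1]mulr1 [h + t]addrC.
  have dE : d = h^-1 *: (h * d) by rewrite /GRing.scale /= mulKf.
  rewrite [in d - _]dE -scalerBr normrZ normfV.
  by move=> H; rewrite ler_pdivrMl ?normr_gt0 // distrC [leRHS]mulrC.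
have := derivable_nbhsx fd.
have /cvgrPdist_le/(_ e e0) := fd.
rewrite near_withinE => /nbhs_normP[k /= k0 fk].
move=> _; exists k => // h hk.
have [->|h0] := eqVneq h 0; first by rewrite addr0 subrr mul0r subrr normr0 mulr0.
have := fk h; rewrite /ball_ /= sub0r normrN => /(_ hk h0).
rewrite -/(derive f t 1) [h *: 1]mulr1 [h + t]addrC distrC => H.
rewrite -[X in X - _](mulVKf h0) -mulrBr normrM mulrC ler_wpM2r //.
Unshelve. all: by end_near. Qed.

Definition dR (P : R -> C) (t : R) (d : C) := forall e : R, 0 < e ->
  exists2 k : R, 0 < k & forall h : R, `|h| < k ->
    nm (P (t + h) - P t - toC h * d) <= e * `|h|.

Lemma dRP P t d : dR P t d <->
  rd (fun s => complex.Re (P s)) t (complex.Re d) /\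
  rd (fun s => complex.Im (P s)) t (complex.Im d).
Proof.
have ReE h : complex.Re (P (t + h) - P t - toC h * d) =
    complex.Re (P (t + h)) - complex.Re (P t) - h * complex.Re d.
  by case: (P (t + h)) (P t) (d) => a b [a' b'] [x y] /=; ring.
have ImE h : complex.Im (P (t + h) - P t - toC h * d) =
    complex.Im (P (t + h)) - complex.Im (P t) - h * complex.Im d.
  by case: (P (t + h)) (P t) (d) => a b [a' b'] [x y] /=; ring.
split=> [dP|[d1 d2] e e0].
  split=> e /dP[k k0 kP]; exists k => // h /kP; apply: le_trans.
    by rewrite -ReE Re_le_nm.
  by rewrite -ImE Im_le_nm.
have e2 : 0 < e / 2 by lra.
have [k1 k10 h1] := d1 _ e2; have [k2 k20 h2] := d2 _ e2.
exists (Num.min k1 k2) => [|h]; first by rewrite lt_min k10.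
rewrite lt_min => /andP[/h1 H1 /h2 H2].
by apply: le_trans (nm_le_abs _) _; rewrite ReE ImE; lra.
Qed.

Lemma dRD P Q t p q : dR P t p -> dR Q t q ->
  dR (fun s => P s + Q s) t (p + q).
Proof.
move=> dP dQ e e0; have e2 : 0 < e / 2 by lra.
have [k1 k10 h1] := dP _ e2; have [k2 k20 h2] := dQ _ e2.
exists (Num.min k1 k2) => [|h]; first by rewrite lt_min k10.
rewrite lt_min => /andP[/h1 H1 /h2 H2].
rewrite (_ : _ - _ = (P (t + h) - P t - toC h * p) + (Q (t + h) - Q t - toC h * q)).
  by apply: le_trans (nmD _ _) _; lra.
by ring.
Qed.

Lemma dRM (c : C) P t p : dR P t p -> dR (fun s => c * P s) t (c * p).
Proof.
move=> dP e e0.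
have e2 : 0 < e / (nm c + 1) by rewrite divr_gt0 // ltr_wpDl ?nm_ge0.
have [k k0 h1] := dP _ e2; exists k => // h /h1 H.
rewrite (_ : _ - _ = c * (P (t + h) - P t - toC h * p)); last by ring.
rewrite nmM; have c0 := nm_ge0 c.
have : nm c * (e / (nm c + 1)) <= e.
  by rewrite mulrCA ger_pMr // ler_pdivrMr ?mul1r; lra.
have := normr_ge0 h; move: H; set x := nm (_ - _); set y := e / _; set z := `|h|.
move=> H z0 yc; apply: (@le_trans _ _ (nm c * (y * z))).
  by rewrite ler_wpM2l.
by rewrite mulrA ler_wpM2r.
Qed.

Lemma dRB P Q t p q : dR P t p -> dR Q t q ->
  dR (fun s => P s - Q s) t (p - q).
Proof.
move=> dP dQ; have := dRD dP (dRM (-1) dQ).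
by rewrite mulN1r (_ : (fun s => _) = (fun s => P s - Q s)) //; apply/funext => s; rewrite mulN1r.
Qed.

Lemma dR_cst (c : C) t : dR (fun _ => c) t 0.
Proof. by move=> e e0; exists 1 => // h _; rewrite subrr mulr0 subrr nm0 mulr_ge0 // ltW. Qed.

Lemma dR_affine P (a b t : R) p : dR P (a + b * t) p ->
  dR (fun s => P (a + b * s)) t (toC b * p).
Proof.
move=> dP e e0.
have e2 : 0 < e / (`|b| + 1) by rewrite divr_gt0 // ltr_wpDl.
have b0 := normr_ge0 b.
have [k k0 h1] := dP _ e2; exists (k / (`|b| + 1)).
  by rewrite divr_gt0 // ltr_wpDl.
move=> h; rewrite ltr_pdivlMr ?ltr_wpDl // => hk.
have /h1 : `|b * h| < k.
  by rewrite normrM; apply: le_lt_trans hk; rewrite mulrC ler_wpM2l // lerDl.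
rewrite mulrDr addrA toCM -mulrA [X in _ - X]mulrCA => H.
apply: le_trans H _; rewrite normrM mulrA ler_wpM2r //.
by rewrite mulrAC ler_pdivrMr ?ler_wpM2l ?ltW //; lra.
Qed.

Lemma dR_cont P t d : dR P t d -> forall e : R, 0 < e ->
  exists2 k : R, 0 < k & forall h, `|h| < k -> nm (P (t + h) - P t) < e.
Proof.
move=> dP e e0; have [k k0 kP] := dP 1 ltr01.
have d0 := nm_ge0 d.
exists (Num.min k (e / (nm d + 2))) => [|h].
  by rewrite lt_min k0 divr_gt0 //; lra.
rewrite lt_min => /andP[/kP H]; rewrite ltr_pdivlMr; last by lra.
move=> he; rewrite -[X in nm X](subrK (toC h * d)).
apply: le_lt_trans (nmD _ _) _; rewrite nmM nm_toC.
apply: (@le_lt_trans _ _ (`|h| * (nm d + 1))); first by lra.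
by apply: le_lt_trans he; rewrite ler_wpM2l //; lra.
Qed.

Definition cd (f : C -> C) (z d : C) := forall e : R, 0 < e ->
  exists2 k : R, 0 < k & forall h : C, nm h < k ->
    nm (f (z + h) - f z - h * d) <= e * nm h.

Lemma dR_comp f P t d p : cd f (P t) d -> dR P t p ->
  dR (fun s => f (P s)) t (p * d).
Proof.
move=> df dP e e0.
have n0 := nm_ge0 p; have d0 := nm_ge0 d.
have e1 : 0 < e / 2 / (nm p + 1) by rewrite !divr_gt0 //; lra.
have e2 : 0 < Num.min 1 (e / 2 / (nm d + 1)).
  by rewrite lt_min ltr01 !divr_gt0 //; lra.
have [k k0 kP] := df _ e1; have [l l0 lP] := dP _ e2.
have [m m0 mP] := dR_cont dP k0.
exists (Num.min l m) => [|h]; first by rewrite lt_min l0.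
rewrite lt_min => /andP[/lP H1 /mP H2].
have := kP _ H2; rewrite [P t + _]addrC subrK => H3.
set D := P (t + h) - P t in H1 H2 H3.
rewrite (_ : _ - _ = (f (P (t + h)) - f (P t) - D * d) + (D - toC h * p) * d); last first.
  by rewrite /D; ring.
apply: le_trans (nmD _ _) _; rewrite nmM.
have H4 : nm D <= (nm p + 1) * `|h|.
  rewrite -[X in nm X](subrK (toC h * p)); apply: le_trans (nmD _ _) _.
  rewrite nmM nm_toC.
  have : Num.min 1 (e / 2 / (nm d + 1)) * `|h| <= 1 * `|h|.
    by rewrite ler_wpM2r // ge_min lexx.
  lra.
have H5 : nm (f (P (t + h)) - f (P t) - D * d) <= e / 2 * `|h|.
  apply: le_trans H3 _; apply: (@le_trans _ _ (e / 2 / (nm p + 1) * ((nm p + 1) * `|h|))).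
    by rewrite ler_wpM2l // ltW.
  by rewrite mulrA divfK // gt_eqF //; lra.
have H6 : nm (D - toC h * p) * nm d <= e / 2 * `|h|.
  apply: (@le_trans _ _ (e / 2 / (nm d + 1) * `|h| * nm d)).
    rewrite ler_wpM2r //; apply: le_trans H1 _.
    by rewrite ler_wpM2r // ge_min lexx orbT.
  rewrite mulrAC ler_wpM2r //.
  by rewrite mulrAC ler_pdivrMr; [rewrite ler_wpM2l|]; lra.
by lra.
Qed.

(** Complex curves obey no mean value equality. Multiplying by the conjugate of the total increment
    [w] and taking real parts gives a real function [phi] that increases by [nm w ^+ 2], to which
    the real theorem applies. *)
Lemma dR_bound P g M : (forall t : R, 0 <= t <= 1 -> dR P t (g t)) ->
  (forall t : R, 0 <= t <= 1 -> nm (g t) <= M) -> nm (P 1 - P 0) <= M.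
Proof.
move=> dP gM; set w := P 1 - P 0.
pose w' : C := complex.Re w -i* complex.Im w.
pose phi (t : R) := complex.Re (w' * P t).
have dphi (t : R) : 0 <= t <= 1 -> is_derive t (1 : R) phi (complex.Re (w' * g t)).
  by move=> t01; apply/rdP; have /dRP[] := dRM w' (dP t t01).
have [] := @MVT R phi (fun t => complex.Re (w' * g t)) 0 1 ltr01.
- by move=> x; rewrite in_itv /= => /andP[/ltW x0 /ltW x1]; apply: dphi; rewrite x0.
- apply: derivable_within_continuous => x; rewrite in_itv /= => /dphi [].
  done.
move=> c; rewrite in_itv /= => /andP[/ltW c0 /ltW c1].
have -> : phi 1 - phi 0 = nm w ^+ 2.
  rewrite nm_sqmod /phi /w' /w /sqmod.
  by case: (P 1) (P 0) => a b [a' b'] /=; ring.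
rewrite subr0 mulr1 => H.
have : nm w ^+ 2 <= nm w * M.
  rewrite H; apply: le_trans (ler_norm _) _; apply: le_trans (Re_le_nm _) _.
  rewrite nmM (_ : nm w' = nm w); last first.
    by apply/eqP; rewrite -(@eqrXn2 _ 2) ?nm_ge0 // !nm_sqmod /w' /sqmod /= sqrrN.
  by rewrite ler_wpM2l ?nm_ge0 // gM // c0.
have := nm_ge0 w; rewrite le_eqVlt => /orP[/eqP <- _|w0].
  by apply: le_trans (gM 0 _); rewrite ?nm_ge0 // lexx ler01.
by rewrite expr2 ler_pM2l.
Qed.

End RealVariable.

(** * Circle integrals and Taylor expansions *)

Section Integral.
Variable R : realType.
Local Notation C := (Cx R).

Lemma contRP (g : R -> C) t : {for t, continuous g} <-> forall e : R, 0 < e ->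
  exists2 k : R, 0 < k & forall h, `|h| < k -> nm (g (t + h) - g t) < e.
Proof.
split=> [gt e e0|H].
  have /gt : nbhs (g t) [set z | nm (z - g t) < e] by apply/nbhs_nmP; exists e.
  move/nbhs_normP => [k /= k0 kg]; exists k => // h hk.
  by apply: kg; rewrite /ball_ /= opprD addNKr normrN.
move=> A /nbhs_nmP[e e0 eA]; have [k k0 kg] := H e e0.
apply/nbhs_normP; exists k => // s; rewrite /ball_ /= => sk; apply: eA.
by rewrite -[s](subrKC t); apply: kg; rewrite distrC.
Qed.

Lemma Re_cont : continuous (fun z : C => complex.Re z : R).
Proof.
move=> z; apply/cont_nmP => A /nbhs_normP[e /= e0 eA]; exists e => // y H.
apply: eA; rewrite /ball_ /= distrC; apply: le_lt_trans H.
by apply: le_trans (Re_le_nm _); case: y z => a b [].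
Qed.

Lemma Im_cont : continuous (fun z : C => complex.Im z : R).
Proof.
move=> z; apply/cont_nmP => A /nbhs_normP[e /= e0 eA]; exists e => // y H.
apply: eA; rewrite /ball_ /= distrC; apply: le_lt_trans H.
by apply: le_trans (Im_le_nm _); case: y z => a b [].
Qed.

Lemma real_primitive (f : R -> R) : continuous f ->
  exists F : R -> R, forall t : R, 0 <= t <= 1 -> rd F t (f t).
Proof.
move=> cf.
(* The primitive starts at -1 and is studied on [-1, 2], so that every point of [0, 1] is
   interior. *)
exists (fun x => \int[lebesgue_measure]_(t in `[(-1), x]) (f t))%R => t /andP[t0 t1].
apply/rdP.
have [|||] := @continuous_FTC1_closed R f (-1) t 2 _ _ _ (cf t).
- by apply: le_lt_trans t1 _; lra.
- apply: continuous_compact_integrable; first exact: segment_compact.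
  exact: continuous_subspaceT.
- by apply: lt_le_trans t0; lra.
by move=> H1; rewrite derive1E => H2; split.
Qed.

Lemma primitive_ex (g : R -> C) : continuous g ->
  exists P : R -> C, forall t : R, 0 <= t <= 1 -> dR P t (g t).
Proof.
move=> cg.
have [F1 h1] := @real_primitive (fun t => complex.Re (g t))
   (fun t => continuous_comp (cg t) (@Re_cont _)).
have [F2 h2] := @real_primitive (fun t => complex.Im (g t))
   (fun t => continuous_comp (cg t) (@Im_cont _)).
exists (fun t => F1 t +i* F2 t) => t t01; apply/dRP; split=> /=.
  exact: h1.
exact: h2.
Qed.

(** The integral over [0, 1] as the increment of a primitive. As a relation it takes linearity,
    bounds and changes of variable directly from derivatives; [cint] turns it into a function, with
    value 0 where no primitive exists. *)
Definition isI (g : R -> C) (w : C) := exists P : R -> C,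
  (forall t : R, 0 <= t <= 1 -> dR P t (g t)) /\ w = P 1 - P 0.

Definition cint (g : R -> C) : C := xget 0 [set w | isI g w].

Lemma isI_uniq g w w' : isI g w -> isI g w' -> w = w'.
Proof.
move=> [P [dP ->]] [Q [dQ ->]].
have : nm ((P 1 - Q 1) - (P 0 - Q 0)) <= 0.
  apply: (@dR_bound _ (fun t => P t - Q t) (fun=> 0)) => [t t01|t _]; last by rewrite nm0.
  by rewrite -(subrr (g t)); apply: dRB; [exact: dP|exact: dQ].
have := nm_ge0 ((P 1 - Q 1) - (P 0 - Q 0)) => h1 h2.
have /eqP : nm ((P 1 - Q 1) - (P 0 - Q 0)) = 0 by apply/eqP; rewrite eq_le h2 h1.
rewrite nm_eq0 => /eqP h.
by apply/eqP; rewrite -subr_eq0 -h; apply/eqP; ring.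
Qed.

Lemma isIE g w : isI g w -> cint g = w.
Proof.
move=> gw; rewrite /cint; case: xgetP => [y -> /= gy|/(_ w)//].
exact: isI_uniq gy gw.
Qed.

Lemma cintP g : continuous g -> isI g (cint g).
Proof.
move=> /primitive_ex[P dP]; rewrite (@isIE g (P 1 - P 0)); by exists P.
Qed.

Lemma isI_ext g g' w : (forall t : R, 0 <= t <= 1 -> g t = g' t) -> isI g w -> isI g' w.
Proof. by move=> gg' [P [dP ->]]; exists P; split => // t t01; rewrite -gg' //; exact: dP. Qed.

Lemma isID g g' w w' : isI g w -> isI g' w' -> isI (fun t => g t + g' t) (w + w').
Proof.
move=> [P [dP ->]] [Q [dQ ->]]; exists (fun t => P t + Q t); split=> [t t01|]; last by ring.
by apply: dRD; [exact: dP|exact: dQ].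
Qed.

Lemma isIM c g w : isI g w -> isI (fun t => c * g t) (c * w).
Proof.
move=> [P [dP ->]]; exists (fun t => c * P t); split=> [t t01|]; last by ring.
by apply: dRM; exact: dP.
Qed.

Lemma isIB g g' w w' : isI g w -> isI g' w' -> isI (fun t => g t - g' t) (w - w').
Proof.
move=> [P [dP ->]] [Q [dQ ->]]; exists (fun t => P t - Q t); split=> [t t01|]; last by ring.
by apply: dRB; [exact: dP|exact: dQ].
Qed.

Lemma isI_bound g w M : isI g w -> (forall t : R, 0 <= t <= 1 -> nm (g t) <= M) -> nm w <= M.
Proof. by move=> [P [dP ->]]; exact: dR_bound. Qed.

Lemma isI_sum n (g : nat -> R -> C) (w : nat -> C) :
  (forall j, isI (g j) (w j)) ->
  isI (fun t => \sum_(j < n) g j t) (\sum_(j < n) w j).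
Proof.
move=> H; elim: n => [|n IH].
  rewrite big_ord0; exists (fun=> 0); split; last by rewrite subrr.
  by move=> t _; rewrite big_ord0; exact: dR_cst.
rewrite big_ord_recr /=; apply: isI_ext (isID IH (H n)) => t _.
by rewrite big_ord_recr.
Qed.

(** Retraction of the line onto [0, 1]: it extends integrands that are continuous along a segment
    only, since primitives are built for functions continuous on the whole line. *)
Definition clamp (t : R) : R := Num.max 0 (Num.min t 1).

Lemma clamp_in t : 0 <= clamp t <= 1.
Proof.
rewrite /clamp le_max lexx /= ge_max ler01 /= ge_min lexx orbT //.
Qed.

Lemma clampE t : 0 <= t <= 1 -> clamp t = t.
Proof. by move=> /andP[t0 t1]; rewrite /clamp min_l // max_r. Qed.

Lemma clamp_lip s t : `|clamp s - clamp t| <= `|s - t|.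
Proof.
have nle (x y : R) : x <= y -> - x <= y -> `|x| <= y.
  by move=> h1 h2; rewrite ler_norml h1 andbT lerNl.
rewrite /clamp; have H1 : `|Num.min s 1 - Num.min t 1| <= `|s - t|.
  have := ler_norm (s - t); have := ler_norm (t - s); rewrite (distrC t s).
  by case: (lerP s 1) => h1; case: (lerP t 1) => h2 h3 h4; apply: nle; lra.
apply: le_trans H1; move: (Num.min s 1) (Num.min t 1) => x y.
have := ler_norm (x - y); have := ler_norm (y - x); rewrite (distrC y x).
by case: (lerP 0 x) => h1; case: (lerP 0 y) => h2 h3 h4; apply: nle; lra.
Qed.

Definition sg (a b : C) (t : R) : C := a + toC t * (b - a).

(** Line integral along the oriented segment from [a] to [b]; the factor [b - a] comes from the
    parametrisation [sg]. *)
Definition isJ (f : C -> C) (a b w : C) := isI (fun t => f (sg a b t) * (b - a)) w.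

Definition J f a b := cint (fun t => f (sg a b t) * (b - a)).

Lemma isJE f a b w : isJ f a b w -> J f a b = w.
Proof. exact: isIE. Qed.

Lemma isJ_uniq f a b w w' : isJ f a b w -> isJ f a b w' -> w = w'.
Proof. exact: isI_uniq. Qed.

Lemma JP f a b : (forall t : R, 0 <= t <= 1 -> {for sg a b t, continuous f}) ->
  isJ f a b (J f a b).
Proof.
move=> cf.
have : continuous (fun t => f (sg a b (clamp t)) * (b - a)).
  move=> t; apply/contRP => e e0.
  have /contP := cf _ (clamp_in t).
  have e1 : 0 < e / (nm (b - a) + 1) by rewrite divr_gt0 // ltr_wpDl ?nm_ge0.
  move=> /(_ _ e1)[d d0 df]; exists (d / (nm (b - a) + 1)).
    by rewrite divr_gt0 // ltr_wpDl ?nm_ge0.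
  have n0 := nm_ge0 (b - a).
  move=> h; rewrite ltr_pdivlMr; last by lra.
  move=> hd; rewrite -mulrBl nmM.
  have : nm (f (sg a b (clamp (t + h))) - f (sg a b (clamp t))) < e / (nm (b - a) + 1).
    apply: df; rewrite /sg opprD addrACA subrr add0r -mulrBl nmM.
    have -> : toC (clamp (t + h)) - toC (clamp t) = toC (clamp (t + h) - clamp t).
      by rewrite /toC rmorphB.
    rewrite nm_toC; apply: le_lt_trans hd.
    apply: ler_pM => //; last by lra.
    by apply: le_trans (clamp_lip _ _) _; rewrite addrAC subrr add0r.
  rewrite ltr_pdivlMr; last by lra.
  apply: le_lt_trans; rewrite ler_wpM2l ?nm_ge0 //; lra.
move=> /cintP H.
have H' : isJ f a b (cint (fun t => f (sg a b (clamp t)) * (b - a))).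
  by apply: isI_ext H => t t01; rewrite clampE.
by rewrite (isJE H').
Qed.

Lemma isJ_rev f a b w : isJ f a b w -> isJ f b a (- w).
Proof.
move=> [P [dP ->]]; exists (fun t => P (1 + (-1) * t)); split; last first.
  by rewrite mulr0 mulr1 addr0 subrr opprB.
move=> t /andP[t0 t1].
have /dP/dR_affine : 0 <= 1 + (-1) * t <= 1 by apply/andP; split; lra.
congr (dR _ _ _).
have -> : sg a b (1 + (-1) * t) = sg b a t.
  rewrite /sg toCD toCM; have -> : toC (1 : R) = 1 by []; have -> : toC (-1 : R) = -1 by rewrite /toC rmorphN.
  by ring.
have -> : toC (-1 : R) = -1 by rewrite /toC rmorphN.
by ring.
Qed.

Lemma isJ_part f a b w (s : R) : 0 <= s <= 1 -> (exists2 P : R -> C,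
  (forall t : R, 0 <= t <= 1 -> dR P t (f (sg a b t) * (b - a))) & w = P s - P 0) ->
  isJ f a (sg a b s) w.
Proof.
move=> /andP[s0 s1] [P dP ->]; exists (fun t => P (0 + s * t)); split; last first.
  by rewrite mulr0 mulr1 !add0r.
move=> t /andP[t0 t1].
have /dP/dR_affine : 0 <= 0 + s * t <= 1.
  by rewrite add0r mulr_ge0 //= mulr_ile1.
congr (dR _ _ _); rewrite mulrCA; congr (f _ * _).
  rewrite /sg toCD toCM; have -> : toC (0 : R) = 0 by []; ring.
by rewrite /sg addrAC subrr add0r.
Qed.

Definition mid (a b : C) : C := sg a b 2^-1.

Lemma isJ_mid f a b w w1 w2 :
  isJ f a b w -> isJ f a (mid a b) w1 -> isJ f (mid a b) b w2 -> w = w1 + w2.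
Proof.
move=> [P [dP ->]] h1 h2.
have h1' : isJ f a (mid a b) (P 2^-1 - P 0).
  by apply: isJ_part; [apply/andP; split; lra|exists P].
rewrite (isJ_uniq h1 h1').
suff h2' : isJ f (mid a b) b (P 1 - P 2^-1).
  by rewrite (isJ_uniq h2 h2'); ring.
exists (fun t => P (2^-1 + 2^-1 * t)); split; last first.
  have -> : 2^-1 + 2^-1 * 1 = 1 :> R by field.
  by rewrite mulr0 addr0.
move=> t /andP[t0 t1].
have /dP/dR_affine : 0 <= 2^-1 + 2^-1 * t <= 1 by apply/andP; split; lra.
have tw : toC (2^-1 : R) = 2^-1 by rewrite /toC rmorphV ?rmorph_nat // unitfE pnatr_eq0.
congr (dR _ _ _); rewrite mulrCA; congr (f _ * _).
  by rewrite /mid /sg toCD toCM tw; field.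
by rewrite /mid /sg tw; field.
Qed.

(** The affine function has an explicit primitive, whose increments cancel around a closed polygon;
    only the deviation [m] times the length remains. *)
Lemma isJ_approx f a b w al be z m :
  isJ f a b w -> (forall t : R, 0 <= t <= 1 ->
    nm (f (sg a b t) - (al + be * (sg a b t - z))) <= m) ->
  nm (w - (al * (b - a) + be / 2 * ((b - z) ^+ 2 - (a - z) ^+ 2))) <= m * nm (b - a).
Proof.
move=> Jw H.
have sgd t : dR (sg a b) t (b - a).
  move=> e e0; exists 1 => // h _.
  rewrite /sg toCD (_ : _ - _ = 0) ?nm0 ?mulr_ge0 // ?ltW //.
  by ring.
have Id : isI (fun t => (al + be * (sg a b t - z)) * (b - a))
    (al * (b - a) + be / 2 * ((b - z) ^+ 2 - (a - z) ^+ 2)).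
  exists (fun t => al * sg a b t + be / 2 * (sg a b t - z) ^+ 2); split; last first.
    have -> : sg a b 1 = b by rewrite /sg mul1r subrKC.
    have -> : sg a b 0 = a by rewrite /sg mul0r addr0.
    by ring.
  move=> t _.
  rewrite (_ : (al + be * (sg a b t - z)) * (b - a) = al * (b - a) + be / 2 * ((b - a) * (2 * (sg a b t - z)))); last by field.
  apply: dRD; first exact: dRM.
  apply: dRM; apply: (@dR_comp _ (fun y => (y - z) ^+ 2)) => //.
  move=> e e0; exists e => // h he.
  rewrite (_ : _ - _ = h * h); last by ring.
  by rewrite nmM ler_wpM2r ?nm_ge0 // ltW.
apply: (isI_bound (isIB Jw Id)) => t t01 /=.
by rewrite -mulrBl nmM ler_wpM2r ?nm_ge0 // H.
Qed.

End Integral.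

(** * Completeness with explicit rates *)

Section Complete.
Variable R : realType.
Local Notation C := (Cx R).

Definition to0 (e : nat -> R) := forall d : R, 0 < d ->
  exists N, forall n, (N <= n)%N -> e n < d.

Lemma R_complete (x : nat -> R) (e : nat -> R) :
  (forall n m, (n <= m)%N -> `|x m - x n| <= e n) -> to0 e ->
  exists l, forall n, `|x n - l| <= e n.
Proof.
move=> xe e0.
have cx : cvgn x.
  apply: cauchy_cvg; apply: cauchy_exP => d d0.
  have [N eN] := e0 _ d0; exists (x N); exists N => // m /= Nm.
  rewrite /ball /= distrC; apply: le_lt_trans (xe _ _ Nm) _; exact: eN.
exists (limn x) => n; rewrite distrC.
have cv : (fun m => `|x m - x n|) @ \oo --> `|limn x - x n|.
  by apply: cvg_norm; apply: cvgB => //; exact: cvg_cst.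
rewrite -(cvg_lim _ cv) //; apply: limr_le; first by apply/cvg_ex; eexists; exact: cv.
by exists n => // m /= nm'; exact: xe.
Qed.

Lemma C_complete (x : nat -> C) (e : nat -> R) :
  (forall n m, (n <= m)%N -> nm (x m - x n) <= e n) -> to0 e ->
  exists l, forall n, nm (x n - l) <= e n.
Proof.
move=> xe e0.
have [|a Ha] := @R_complete (fun n => complex.Re (x n)) e _ e0.
  move=> n m /xe; apply: le_trans; apply: le_trans (Re_le_nm _).
  by case: (x m) (x n) => ? ? [].
have [|b Hb] := @R_complete (fun n => complex.Im (x n)) e _ e0.
  move=> n m /xe; apply: le_trans; apply: le_trans (Im_le_nm _).
  by case: (x m) (x n) => ? ? [].
(* Passing through a later term [m] keeps the rate [e n]; adding the estimates of the two
   coordinates would double it. *)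
exists (a +i* b) => n; apply/ler_addgt0Pr => d d0.
have [N eN] := e0 (d / 2) ltac:(lra).
pose m := maxn N n.
rewrite (_ : x n - _ = (x n - x m) + (x m - (a +i* b))); last by ring.
apply: le_trans (nmD _ _) _; apply: lerD.
  by rewrite nmBC; apply: xe; rewrite leq_maxr.
apply: le_trans (nm_le_abs _) _.
have := Ha m; have := Hb m; have := eN m (leq_maxl _ _).
by case: (x m) => u v /=; lra.
Qed.

Lemma geo_to0 (S : R) : to0 (fun n => S / 2 ^+ n).
Proof.
move=> d d0.
have : (fun n => (`|S| * 2^-1 ^+ n : R)) @ \oo --> (`|S| * 0 : R).
  by apply: cvgMr; apply: cvg_expr; rewrite ger0_norm ?invr_ge0 //; lra.
rewrite mulr0 => /cvgrPdist_lt/(_ d d0)[N _ H]; exists N => n /H /=.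
rewrite sub0r normrN exprVn; apply: le_lt_trans; apply: le_trans (ler_norm _).
by rewrite ler_wpM2r ?invr_ge0 ?exprn_ge0 // ler_norm.
Qed.

Lemma expr_to0 (S b : R) : 0 <= b < 1 -> to0 (fun n => S * b ^+ n).
Proof.
move=> /andP[b0 b1] d d0.
have : (fun n => (`|S| * b ^+ n : R)) @ \oo --> (`|S| * 0 : R).
  by apply: cvgMr; apply: cvg_expr; rewrite ger0_norm.
rewrite mulr0 => /cvgrPdist_lt/(_ d d0)[N _ H]; exists N => n /H /=.
rewrite sub0r normrN; apply: le_lt_trans; apply: le_trans (ler_norm _).
by rewrite ler_wpM2r ?exprn_ge0 // ler_norm.
Qed.

Lemma cd_cont (f : C -> C) z d : cd f z d -> {for z, continuous f}.
Proof.
move=> fd; apply/contP => e e0; have [k k0 kP] := fd 1 ltr01.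
have d0 := nm_ge0 d.
exists (Num.min k (e / (nm d + 2))) => [|y].
  by rewrite lt_min k0 divr_gt0 //; lra.
rewrite lt_min => /andP[/kP]; rewrite subrKC => H.
rewrite ltr_pdivlMr; last by lra.
move=> he; rewrite -[X in nm X](subrK ((y - z) * d)).
apply: le_lt_trans (nmD _ _) _; rewrite nmM.
apply: (@le_lt_trans _ _ (nm (y - z) * (nm d + 1))); first by lra.
by apply: le_lt_trans he; rewrite ler_wpM2l ?nm_ge0 //; lra.
Qed.

End Complete.

(** * Goursat's theorem for triangles in a closed convex set *)

Section Goursat.
Variable R : realType.
Local Notation C := (Cx R).
Variables (f : C -> C) (K : set C).
Hypothesis Kconv : forall a b (t : R), K a -> K b -> 0 <= t <= 1 -> K (sg a b t).
Hypothesis Kclosed : forall z, (forall e : R, 0 < e -> exists2 y, K y & nm (y - z) < e) -> K z.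
Hypothesis Kf : forall z, K z -> exists d, cd f z d.

Let Kc z : K z -> {for z, continuous f}.
Proof. by move=> /Kf[d]; exact: cd_cont. Qed.

Let KJ a b : K a -> K b -> isJ f a b (J f a b).
Proof. by move=> Ka Kb; apply: JP => t t01; apply: Kc; exact: Kconv. Qed.

Let T (s : C * C * C) := J f s.1.1 s.1.2 + J f s.1.2 s.2 + J f s.2 s.1.1.

Let sub1 (s : C * C * C) := (s.1.1, mid s.1.1 s.1.2, mid s.2 s.1.1).
Let sub2 (s : C * C * C) := (mid s.1.1 s.1.2, s.1.2, mid s.1.2 s.2).
Let sub3 (s : C * C * C) := (mid s.2 s.1.1, mid s.1.2 s.2, s.2).
Let sub4 (s : C * C * C) := (mid s.1.1 s.1.2, mid s.1.2 s.2, mid s.2 s.1.1).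

Let inK (s : C * C * C) := [/\ K s.1.1, K s.1.2 & K s.2].

Let half01 : 0 <= (2^-1 : R) <= 1.
Proof. by apply/andP; split; lra. Qed.

Let midK a b : K a -> K b -> K (mid a b).
Proof. by move=> Ka Kb; exact: Kconv. Qed.

(** Each inner edge is run through once in each direction, so the four integrals add up to the one
    around the outer triangle. *)
Let T_sub s : inK s -> T s = T (sub1 s) + T (sub2 s) + T (sub3 s) + T (sub4 s).
Proof.
case: s => -[a b] c [/= Ka Kb Kc']; rewrite /T /=.
have Kab := midK Ka Kb; have Kbc := midK Kb Kc'; have Kca := midK Kc' Ka.
rewrite (isJ_mid (KJ Ka Kb) (KJ Ka Kab) (KJ Kab Kb)).
rewrite (isJ_mid (KJ Kb Kc') (KJ Kb Kbc) (KJ Kbc Kc')).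
rewrite (isJ_mid (KJ Kc' Ka) (KJ Kc' Kca) (KJ Kca Ka)).
rewrite (isJE (isJ_rev (KJ Kca Kab))) (isJE (isJ_rev (KJ Kab Kbc))).
rewrite (isJE (isJ_rev (KJ Kbc Kca))).
by ring.
Qed.

(** Chooses a subtriangle that keeps at least a quarter of the integral; when the first three keep
    less, the fourth keeps it by the triangle inequality. *)
Let step s := if nm (T s) <= 4 * nm (T (sub1 s)) then sub1 s else
  if nm (T s) <= 4 * nm (T (sub2 s)) then sub2 s else
  if nm (T s) <= 4 * nm (T (sub3 s)) then sub3 s else sub4 s.

Let size (s : C * C * C) := nm (s.1.2 - s.1.1) + nm (s.2 - s.1.2) + nm (s.1.1 - s.2).

Let step_in s : inK s -> inK (step s).
Proof.
case: s => -[a b] c [/= Ka Kb Kc'].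
by rewrite /step; repeat case: ifP => _; split => //=; exact: midK.
Qed.

Let step_T s : inK s -> nm (T s) <= 4 * nm (T (step s)).
Proof.
move=> sK; rewrite /step; case: ifP => // /negbT; rewrite -ltNge => h1.
case: ifP => // /negbT; rewrite -ltNge => h2.
case: ifP => // /negbT; rewrite -ltNge => h3.
have : nm (T s) <= nm (T (sub1 s)) + nm (T (sub2 s)) + nm (T (sub3 s)) + nm (T (sub4 s)).
  rewrite {1}(T_sub sK); apply: le_trans (nmD _ _) _; rewrite lerD2r.
  by apply: le_trans (nmD _ _) _; rewrite lerD2r; exact: nmD.
by lra.
Qed.

Let toC_half : toC (2^-1 : R) = 2^-1.
Proof. by rewrite /toC rmorphV ?rmorph_nat // unitfE pnatr_eq0. Qed.

Let nm_half (z : C) : nm (z / 2) = nm z / 2.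
Proof. by rewrite nmM -toC_half nm_toC ger0_norm // invr_ge0. Qed.

Let step_size s : size (step s) = size s / 2.
Proof.
case: s => -[a b] c; rewrite /step /size /=.
have H (x y z x' y' z' : C) : x = x' / 2 -> y = y' / 2 -> z = z' / 2 ->
    nm x + nm y + nm z = (nm x' + nm y' + nm z') / 2.
  by move=> -> -> ->; rewrite !nm_half !mulrDl.
repeat case: ifP => _; rewrite /sub1 /sub2 /sub3 /sub4 /=.
- by apply: H; rewrite /mid /sg toC_half; field.
- by apply: H; rewrite /mid /sg toC_half; field.
- by apply: H; rewrite /mid /sg toC_half; field.
rewrite [nm (b - a)]nmBC [nm (c - b)]nmBC [nm (a - c)]nmBC -addrA addrC.
by apply: H; rewrite /mid /sg toC_half; field.
Qed.

Let step_move s : nm ((step s).1.1 - s.1.1) <= size s.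
Proof.
case: s => -[a b] c; rewrite /step /size /=.
have := nm_ge0 (b - a); have := nm_ge0 (c - b); have := nm_ge0 (a - c) => h1 h2 h3.
repeat case: ifP => _; rewrite /sub1 /sub2 /sub3 /sub4 /=.
- by rewrite subrr nm0; lra.
- rewrite (_ : _ - _ = (b - a) / 2); first by rewrite nm_half; lra.
  by rewrite /mid /sg toC_half; field.
- rewrite (_ : _ - _ = - ((a - c) / 2)); first by rewrite nmN nm_half; lra.
  by rewrite /mid /sg toC_half; field.
rewrite (_ : _ - _ = (b - a) / 2); first by rewrite nm_half; lra.
by rewrite /mid /sg toC_half; field.
Qed.

Theorem goursat a b c : K a -> K b -> K c -> J f a b + J f b c + J f c a = 0.
Proof.
move=> Ka Kb Kc0; pose s0 := (a, b, c).
pose s n := iter n step s0; pose S := size s0.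
have sK n : inK (s n) by elim: n => [//|n]; exact: step_in.
have sS n : size (s n) = S / 2 ^+ n.
  elim: n => [|n IH]; first by rewrite expr0 divr1.
  by rewrite /s iterS step_size -/(s n) IH exprS invfM mulrCA mulrC.
have sT n : nm (T s0) <= 4 ^+ n * nm (T (s n)).
  elim: n => [|n IH]; first by rewrite mul1r.
  apply: le_trans IH _; rewrite exprSr -mulrA ler_wpM2l ?exprn_ge0 //.
  exact: step_T.
have S0 : 0 <= S by rewrite /S /size; rewrite !addr_ge0 ?nm_ge0.
(* The subtracted tail makes the telescoping induction on [k] go through. *)
have sp n k : nm ((s (n + k)%N).1.1 - (s n).1.1) <= (2 * S) / 2 ^+ n - 2 * S / 2 ^+ (n + k).
  elim: k => [|k IH]; first by rewrite addn0 !subrr nm0.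
  rewrite addnS -[X in nm (X - _)](subrK (s (n + k)%N).1.1) -addrA.
  apply: le_trans (nmD _ _) _; have := step_move (s (n + k)%N); rewrite sS.
  rewrite -[step _]/(s (n + k).+1) => h.
  have -> : 2 * S / 2 ^+ (n + k).+1 = S / 2 ^+ (n + k).
    by rewrite exprS invfM; field; rewrite expf_neq0.
  have E : 2 * S / 2 ^+ (n + k) = S / 2 ^+ (n + k) + S / 2 ^+ (n + k) by ring.
  by rewrite E in IH; lra.
have [||z Hz] := @C_complete R (fun n => (s n).1.1) (fun n => 2 * S / 2 ^+ n).
- move=> n m nm'; rewrite -(subnKC nm'); apply: le_trans (sp _ _) _.
  by rewrite gerBl divr_ge0 ?exprn_ge0 // mulr_ge0.
- exact: geo_to0.
have Kz : K z.
  apply: Kclosed => e e0; have [N HN] := geo_to0 (2 * S) e0.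
  exists (s N).1.1; first by have [] := sK N.
  by apply: le_lt_trans (Hz N) (HN _ _).
have [d fd] := Kf Kz.
suff : nm (T s0) <= 0.
  move=> h; apply/eqP; rewrite -nm_eq0 eq_le nm_ge0 andbT; exact: h.
apply/ler_addgt0Pr => e e0; rewrite add0r.
(* At depth [N] the triangle has perimeter [S / 2 ^+ N] and lies within three times that of the
   limit point [z]. The affine approximation errs by [eta * 3 * S ^+ 2 / 4 ^+ N], and the factor
   [4 ^+ N] leaves [3 * eta * S ^+ 2]. *)
have e1 : 0 < e / (3 * S ^+ 2 + 1).
  by rewrite divr_gt0 // ltr_wpDl // mulr_ge0 // sqr_ge0.
have [k k0 kP] := fd _ e1; set eta := e / _ in e1 kP.
have [N HN] := geo_to0 (3 * S) k0; have {}HN := HN N (leqnn N).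
apply: le_trans (sT N) _.
case E : (s N) => [[a' b'] c']; have := sK N; rewrite E => -[/= Ka' Kb' Kc'].
have := sS N; rewrite E /size /= => HS.
have := Hz N; rewrite E /= => Hz'.
have := nm_ge0 (b' - a'); have := nm_ge0 (c' - b'); have := nm_ge0 (a' - c') => n1 n2 n3.
set SN := S / 2 ^+ N in HS.
have E2 : 2 * S / 2 ^+ N = 2 * SN by rewrite mulrA.
have E3 : 3 * S / 2 ^+ N = 3 * SN by rewrite mulrA.
rewrite E2 in Hz'; rewrite E3 in HN.
have dz' y x : nm (y - x) <= SN -> nm (x - z) <= 2 * SN + nm (x - a') -> nm (x - a') + nm (y - x) <= SN -> forall t : R, 0 <= t <= 1 -> nm (sg x y t - z) <= 3 * SN.
  move=> h1 h2 h3 t /andP[t0 t1]; rewrite /sg addrAC; apply: le_trans (nmD _ _) _.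
  rewrite nmM nm_toC ger0_norm //.
  have : t * nm (y - x) <= nm (y - x) by rewrite ler_piMl ?nm_ge0.
  lra.
have ap x y : K x -> K y -> (forall t : R, 0 <= t <= 1 -> nm (sg x y t - z) <= 3 * SN) ->
    nm (J f x y - (f z * (y - x) + d / 2 * ((y - z) ^+ 2 - (x - z) ^+ 2))) <= eta * (3 * SN) * nm (y - x).
  move=> Kx Ky H; apply: isJ_approx; first exact: KJ.
  move=> t t01; have := kP (sg x y t - z); rewrite subrKC => /(_ (le_lt_trans (H _ t01) HN)).
  rewrite opprD addrA [d * _]mulrC => h; apply: le_trans h _.
  by rewrite ler_wpM2l ?H // ltW.
have tri u v : nm (u - z) <= nm (v - z) + nm (u - v).
  by have := nmD (u - v) (v - z); rewrite addrA subrK; lra.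
have A1 := ap _ _ Ka' Kb' ltac:(apply: dz'; rewrite ?subrr ?nm0; lra).
have A2 := ap _ _ Kb' Kc' ltac:(apply: dz'; have := tri b' a'; lra).
have A3 := ap _ _ Kc' Ka' ltac:(apply: dz'; have := tri c' a'; have := nmD (c' - b') (b' - a'); rewrite addrA subrK; rewrite ?[nm (c' - a')]nmBC; lra).
have : nm (T (a', b', c')) <= eta * (3 * SN) * SN.
  rewrite /T /= (_ : _ + _ = (J f a' b' - (f z * (b' - a') + d / 2 * ((b' - z) ^+ 2 - (a' - z) ^+ 2))) +
    (J f b' c' - (f z * (c' - b') + d / 2 * ((c' - z) ^+ 2 - (b' - z) ^+ 2))) +
    (J f c' a' - (f z * (a' - c') + d / 2 * ((a' - z) ^+ 2 - (c' - z) ^+ 2)))); last by ring.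
  apply: le_trans (nmD _ _) _; rewrite -{2}HS.
  by have := nmD (J f a' b' - (f z * (b' - a') + d / 2 * ((b' - z) ^+ 2 - (a' - z) ^+ 2)))
     (J f b' c' - (f z * (c' - b') + d / 2 * ((c' - z) ^+ 2 - (b' - z) ^+ 2))); lra.
move=> H; apply: (@le_trans _ _ (4 ^+ N * (eta * (3 * SN) * SN))).
  by rewrite ler_wpM2l ?exprn_ge0.
have -> : 4 ^+ N * (eta * (3 * SN) * SN) = eta * (3 * S ^+ 2).
  rewrite /SN (_ : 4 = 2 * 2) ?exprMn; last by ring.
  by field; rewrite expf_neq0.
rewrite /eta mulrAC ler_pdivrMr ?ler_pM2l //; first by lra.
by rewrite ltr_wpDl // mulr_ge0 // sqr_ge0.
Qed.

End Goursat.

(** * Difference quotients of holomorphic functions and their primitives *)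

Section Cauchy.
Variable R : realType.
Local Notation C := (Cx R).

(** A linear map of the field to itself is multiplication by its value at 1. *)
Lemma cdP (f : C -> C) z : differentiable f z <-> exists d, cd f z d.
Proof.
split=> [/diffP_nm[L [_ LP]]|[d fd]].
  exists (L 1) => e /LP[k k0 kP]; exists k => // h /kP.
  have -> : L h = h * L 1 by rewrite -[X in L X](mulr1 h) -[h * 1]/(h *: (1 : C)) linearZZ.
  by [].
apply/diffP_nm.
pose m h : C := h * d.
have ml : linear m by move=> x y w; rewrite /m mulrDl -scalerAl.
pose mL := GRing.isLinear.Build _ _ _ _ m ml.
pose L : {linear C -> C} := HB.pack m mL.
exists L; split; last exact: fd.
by exists (nm d) => v; rewrite -[L v]/(m v) /m nmM mulrC.
Qed.

Lemma diff_near (V W : normedModType C) (f g : V -> W) z (e : R) : 0 < e ->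
  (forall y, nm (y - z) < e -> f y = g y) -> differentiable f z -> differentiable g z.
Proof.
move=> e0 fg /diffP_nm[L [LK LP]]; apply/diffP_nm; exists L; split => // u /LP[k k0 kP].
exists (Num.min k e) => [|h]; first by rewrite lt_min k0.
rewrite lt_min => /andP[/kP H he]; rewrite -!fg //.
  by rewrite subrr nm0.
by rewrite addrAC subrr add0r.
Qed.

Section Quotient.
Variables (f : C -> C) (z0 : C) (r : R).
Hypothesis fD : forall z, nm (z - z0) < r -> differentiable f z.
Variables (a d : C).
Hypothesis ar : nm (a - z0) < r.
Hypothesis fa : cd f a d.

(** The difference quotient of [f] at [a], continued by the derivative. At [a] only its continuity
    is at hand, so triangles with vertex [a] are out of the direct reach of [goursat]. *)
Let g z := if z == a then d else (f z - f a) / (z - a).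

Let gD z : nm (z - z0) < r -> z != a -> differentiable g z.
Proof.
move=> zr za; have nza : 0 < nm (z - a).
  by rewrite lt_neqAle eq_sym nm_eq0 subr_eq0 za nm_ge0.
apply: (@diff_near _ _ (fun y => (f y - f a) * (y - a)^-1) _ _ (nm (z - a))) => //.
  move=> y yz; rewrite /g ifN //; apply: contraTN yz => /eqP ->.
  by rewrite nmBC ltxx.
apply: differentiableM.
  by apply: differentiableB => //; exact: fD.
apply: differentiableV; first by apply: differentiableB.
by rewrite subr_eq0.
Qed.

Let gc z : nm (z - z0) < r -> {for z, continuous g}.
Proof.
move=> zr; have [->|za] := eqVneq z a; last exact: differentiable_continuous (gD zr za).
apply/contP => e e0; have e2 : 0 < e / 2 by lra.
have [k k0 kP] := fa e2; exists k => // y ya; rewrite /g eqxx.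
case: eqP => [_|/eqP ya']; first by rewrite subrr nm0.
have nya : 0 < nm (y - a).
  by rewrite lt_neqAle eq_sym nm_eq0 subr_eq0 ya' nm_ge0.
have := kP _ ya; rewrite subrKC => H.
have -> : (f y - f a) / (y - a) - d = (f y - f a - (y - a) * d) / (y - a).
  by field; rewrite subr_eq0.
rewrite nmM; have -> : nm (y - a)^-1 = (nm (y - a))^-1.
  have : nm (y - a) * nm (y - a)^-1 = 1 by rewrite -nmM divff ?nm1 ?subr_eq0.
  by move=> /(canRL (mulKf (lt0r_neq0 nya))); rewrite mulr1.
by rewrite ltr_pdivrMr //; apply: le_lt_trans H _; rewrite ltr_pM2r //; lra.
Qed.

Let diskconv (rho : R) x y (t : R) : nm (x - z0) <= rho -> nm (y - z0) <= rho -> 0 <= t <= 1 ->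
  nm (sg x y t - z0) <= rho.
Proof.
move=> xr yr /andP[t0 t1].
have -> : sg x y t - z0 = toC (1 - t) * (x - z0) + toC t * (y - z0).
  by rewrite /sg /toC rmorphB rmorph1; ring.
apply: le_trans (nmD _ _) _; rewrite !nmM !nm_toC !ger0_norm ?subr_ge0 //.
have := ler_wpM2l t0 yr; have : (1 - t) * nm (x - z0) <= (1 - t) * rho by rewrite ler_wpM2l ?subr_ge0.
by lra.
Qed.

Let gJ x y : nm (x - z0) < r -> nm (y - z0) < r -> isJ g x y (J g x y).
Proof.
move=> xr yr; apply: JP => t t01; apply: gc.
apply: (@le_lt_trans _ _ (Num.max (nm (x - z0)) (nm (y - z0)))).
  by apply: diskconv => //; rewrite le_max lexx ?orbT.
by rewrite gt_max xr.
Qed.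

Let ip (v y : C) : R := complex.Re v * complex.Re y + complex.Im v * complex.Im y.

Let ipD v x y : ip v (x + y) = ip v x + ip v y.
Proof. by case: v x y => ? ? [? ?] [? ?]; rewrite /ip /=; ring. Qed.

Let ipZ v (t : R) y : ip v (toC t * y) = t * ip v y.
Proof. by case: v y => ? ? [? ?]; rewrite /ip /=; ring. Qed.

Let ip_le v y : `|ip v y| <= nm v * nm y.
Proof.
have -> : ip v y = complex.Re ((complex.Re v -i* complex.Im v : C) * y).
  by case: v y => ? ? [? ?]; rewrite /ip /=; ring.
apply: le_trans (Re_le_nm _) _; rewrite nmM ler_wpM2r ?nm_ge0 //.
by rewrite -(@ler_sqr _ _ (nm v)) ?nnegrE ?nm_ge0 // !nm_sqmod /sqmod /= sqrrN.
Qed.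

Let ip_self v : ip v v = nm v ^+ 2.
Proof. by rewrite nm_sqmod /ip /sqmod !expr2. Qed.

Let tri_off v (del : R) x y w : 0 < del ->
  nm (x - z0) < r -> nm (y - z0) < r -> nm (w - z0) < r ->
  del <= ip v (x - a) -> del <= ip v (y - a) -> del <= ip v (w - a) ->
  J g x y + J g y w + J g w x = 0.
Proof.
move=> d0 xr yr wr xd yd wd.
pose rho := Num.max (nm (x - z0)) (Num.max (nm (y - z0)) (nm (w - z0))).
have rr : rho < r by rewrite !gt_max xr yr.
(* The disc is cut by a closed half plane that does not contain [a]. *)
apply: (@goursat _ g [set u | nm (u - z0) <= rho /\ del <= ip v (u - a)]).
- move=> b c t [b1 b2] [c1 c2] t01; split; first exact: diskconv.
  have -> : sg b c t - a = toC (1 - t) * (b - a) + toC t * (c - a).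
    by rewrite /sg /toC rmorphB rmorph1; ring.
  move: t01 => /andP[t0 t1]; rewrite ipD !ipZ.
  have := ler_wpM2l t0 c2; have : (1 - t) * del <= (1 - t) * ip v (b - a) by rewrite ler_wpM2l ?subr_ge0.
  by lra.
- move=> z H; split; apply/ler_addgt0Pr => e e0.
    have [y' [h1 _] h2] := H _ e0; rewrite -[z](subrK y') -addrA.
    apply: le_trans (nmD _ _) _; rewrite nmBC; lra.
  have e1 : 0 < e / (nm v + 1) by rewrite divr_gt0 // ltr_wpDl ?nm_ge0.
  have [y' [_ h1] h2] := H _ e1.
  have := ip_le v (y' - z); rewrite ler_norml => /andP[_ h3].
  have h4 : ip v (y' - a) = ip v (y' - z) + ip v (z - a) by rewrite -ipD addrA subrK.
  have v0 := nm_ge0 v.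
  move: h2; rewrite ltr_pdivlMr; last by lra.
  have := nm_ge0 (y' - z); nra.
- move=> z [zr zd]; apply/cdP/gD; first exact: le_lt_trans rr.
  apply: contraTN zd => /eqP ->; rewrite subrr /ip !mulr0 addr0; rewrite -ltNge //.
- by split=> //; rewrite !le_max lexx.
- by split=> //; rewrite !le_max lexx orbT.
- by split=> //; rewrite !le_max lexx !orbT.
Qed.

(** The triangle is shrunk towards [a] by powers of 1/2. Between consecutive scales lies a
    quadrilateral, cut into two triangles to which [goursat] applies: [nm (w - z) < nm (z - a)] puts
    [z] and [w] in one open half plane bounded by a line through [a]. So the integral is the same at
    all scales, and it tends to 0 because [g] is bounded near [a]. *)
Lemma quotient_triangle z w : z != a -> nm (z - z0) < r -> nm (w - z0) < r ->
  nm (w - z) < nm (z - a) -> J g a z + J g z w + J g w a = 0.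
Proof.
move=> za zr wr wz.
pose v := z - a; pose q n : R := 2^-1 ^+ n.
have nza : 0 < nm v.
  by rewrite lt_neqAle eq_sym nm_eq0 subr_eq0 za nm_ge0.
have q01 n : 0 <= q n <= 1.
  by rewrite exprn_ge0 ?invr_ge0 //= exprn_ile1 ?invr_ge0 //; lra.
have q0 n : 0 < q n by rewrite exprn_gt0 // invr_gt0.
pose zn n := sg a z (q n); pose wn n := sg a w (q n).
have inr x n : nm (x - z0) < r -> nm (sg a x (q n) - z0) < r.
  move=> xr; apply: (@le_lt_trans _ _ (Num.max (nm (a - z0)) (nm (x - z0)))).
    by apply: diskconv => //; rewrite le_max lexx ?orbT.
  by rewrite gt_max ar.
have znr n := inr z n zr; have wnr n := inr w n wr.
have midE x n : mid a (sg a x (q n)) = sg a x (q n.+1).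
  by rewrite /mid /sg /q exprS toCM; ring.
pose T3 n := J g a (zn n) + J g (zn n) (wn n) + J g (wn n) a.
have mm : 0 < Num.min (nm v ^+ 2) (ip v (w - a)).
  rewrite lt_min exprn_gt0 //=.
  have -> : w - a = (w - z) + v by rewrite /v addrA subrK.
  rewrite ipD ip_self.
  have := ip_le v (w - z); rewrite ler_norml => /andP[h _].
  have : nm v * nm (w - z) < nm v * nm v by rewrite ltr_pM2l.
  by rewrite expr2; lra.
have T3E n : T3 n = T3 n.+1.
  have zr' := znr n; have wr' := wnr n; have zr2 := znr n.+1; have wr2 := wnr n.+1.
  have JzE : J g a (zn n) = J g a (zn n.+1) + J g (zn n.+1) (zn n).
    have := midE z n; rewrite -/(zn n) => E.
    by apply: (@isJ_mid _ g a (zn n)); rewrite ?E; apply: gJ.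
  have JwE : J g a (wn n) = J g a (wn n.+1) + J g (wn n.+1) (wn n).
    have := midE w n; rewrite -/(wn n) => E.
    by apply: (@isJ_mid _ g a (wn n)); rewrite ?E; apply: gJ.
  have d0 : 0 < q n.+1 * Num.min (nm v ^+ 2) (ip v (w - a)) by rewrite mulr_gt0.
  have qS : q n.+1 <= q n.
    by rewrite /q exprS ler_piMl ?exprn_ge0 ?invr_ge0 //; lra.
  have ipe x m : Num.min (nm v ^+ 2) (ip v (w - a)) <= ip v (x - a) -> q n.+1 <= q m ->
      q n.+1 * Num.min (nm v ^+ 2) (ip v (w - a)) <= ip v (sg a x (q m) - a).
    move=> h1 h2; rewrite /sg addrAC subrr add0r ipZ; apply: ler_pM => //; exact: ltW.
  have hz : Num.min (nm v ^+ 2) (ip v (w - a)) <= ip v (z - a).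
    by rewrite ip_self ge_min lexx.
  have hw : Num.min (nm v ^+ 2) (ip v (w - a)) <= ip v (w - a).
    by rewrite ge_min lexx orbT.
  have G1 := tri_off d0 zr2 zr' wr' (ipe _ _ hz (lexx _)) (ipe _ _ hz qS) (ipe _ _ hw qS).
  have G2 := tri_off d0 zr2 wr' wr2 (ipe _ _ hz (lexx _)) (ipe _ _ hw qS) (ipe _ _ hw (lexx _)).
  rewrite /T3 JzE.
  have e1 := isJE (isJ_rev (gJ ar wr')); have e2 := isJE (isJ_rev (gJ ar wr2)).
  have e3 := isJE (isJ_rev (gJ zr2 wr')); have e4 := isJE (isJ_rev (gJ wr2 wr')).
  have e5 := isJE (isJ_rev (gJ zr2 wr2)).
  rewrite e1 e2 JwE; move: G1 G2; rewrite -/(zn n) -/(wn n) -/(zn n.+1) -/(wn n.+1).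
  rewrite -/(zn n) -/(wn n) -/(zn n.+1) -/(wn n.+1) in e3 e4 e5.
  rewrite e3 e4 e5 => G1 G2.
  apply/eqP; rewrite -subr_eq0; apply/eqP; transitivity ((0 : C) + 0); last by rewrite addr0.
  by rewrite -{1}G1 -G2; ring.
have T30 : T3 0%N = J g a z + J g z w + J g w a.
  have E x : sg a x (q 0%N) = x by rewrite /sg /q expr0 mul1r subrKC.
  by rewrite /T3 /zn /wn !E.
rewrite -T30.
have T3n n : T3 0%N = T3 n by elim: n => [//|n ->].
suff : nm (T3 0%N) <= 0.
  by move=> h; apply/eqP; rewrite -nm_eq0 eq_le nm_ge0 andbT.
apply/ler_addgt0Pr => e e0; rewrite add0r.
have /contP/(_ 1 ltr01)[k k0 kP] := gc ar.
have Gk y : nm (y - a) < k -> nm (g y) <= nm (g a) + 1.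
  move=> /kP h; rewrite -[g y](subrK (g a)); apply: le_trans (nmD _ _) _; lra.
pose S := nm v + nm (w - a).
have S0 : 0 <= S by rewrite addr_ge0 ?nm_ge0.
pose B := nm (g a) + 1.
have B0 : 0 <= B by rewrite addr_ge0 ?nm_ge0.
have [N1 HN1] := geo_to0 S k0; have [N2 HN2] := geo_to0 (2 * B * S) e0.
pose N := maxn N1 N2; rewrite (T3n N).
have {}HN1 := HN1 N (leq_maxl _ _); have {}HN2 := HN2 N (leq_maxr _ _).
have qE : q N = (2 ^+ N)^-1 by rewrite /q exprVn.
have za' : nm (zn N - a) = q N * nm v.
  by rewrite /zn /sg addrAC subrr add0r nmM nm_toC ger0_norm // ltW.
have wa' : nm (wn N - a) = q N * nm (w - a).
  by rewrite /wn /sg addrAC subrr add0r nmM nm_toC ger0_norm // ltW.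
have zk : nm (zn N - a) <= q N * S by rewrite za' ler_wpM2l ?(ltW (q0 _)) // lerDl nm_ge0.
have wk : nm (wn N - a) <= q N * S by rewrite wa' ler_wpM2l ?(ltW (q0 _)) // lerDr nm_ge0.
have aS : nm (a - a) <= q N * S by rewrite subrr nm0 mulr_ge0 // ltW.
rewrite -qE mulrC in HN1; rewrite -qE in HN2.
have JB x y : nm (x - z0) < r -> nm (y - z0) < r -> nm (x - a) <= q N * S -> nm (y - a) <= q N * S ->
    nm (J g x y) <= B * nm (y - x).
  move=> xr yr xa ya.
  suff H (t : R) : 0 <= t <= 1 -> nm (g (sg x y t) - (0 + 0 * (sg x y t - 0))) <= B.
    by have := isJ_approx (gJ xr yr) H; rewrite !mul0r addr0 subr0.
  move=> /andP[t0 t1]; rewrite mul0r addr0 subr0; apply: Gk.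
  apply: le_lt_trans HN1.
  have -> : sg x y t - a = toC (1 - t) * (x - a) + toC t * (y - a).
    by rewrite /sg /toC rmorphB rmorph1; ring.
  apply: le_trans (nmD _ _) _; rewrite !nmM !nm_toC !ger0_norm ?subr_ge0 //.
  have := ler_wpM2l t0 ya; have : (1 - t) * nm (x - a) <= (1 - t) * (q N * S) by rewrite ler_wpM2l ?subr_ge0.
  by lra.
have J1 := JB _ _ ar (znr N) aS zk; have J2 := JB _ _ (znr N) (wnr N) zk wk.
have J3 := JB _ _ (wnr N) ar wk aS.
rewrite -/(zn N) -/(wn N) in J1 J2 J3.
rewrite /T3; apply: le_trans (nmD _ _) _.
have := nmD (J g a (zn N)) (J g (zn N) (wn N)).
have tr : nm (wn N - zn N) <= q N * nm v + q N * nm (w - a).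
  have -> : wn N - zn N = (wn N - a) - (zn N - a) by ring.
  by apply: le_trans (nmD _ _) _; rewrite nmN za' wa' addrC.
rewrite za' in J1; rewrite [nm (a - _)]nmBC wa' in J3.
have := ler_wpM2l B0 tr.
have E : 2 * B * S * q N = B * (q N * nm v + q N * nm (w - a)) + B * (q N * nm v) + B * (q N * nm (w - a)).
  by rewrite /S; ring.
rewrite E in HN2; lra.
Qed.

(** By the triangle identity the increment of [J g a] is the integral of the continuous function [g]
    over the short segment from [z] to [z + h]. Points other than [a] suffice: the circles used
    later avoid [a]. *)
Lemma quotient_primitive z : z != a -> nm (z - z0) < r -> cd (J g a) z (g z).
Proof.
move=> za zr e e0; have nza : 0 < nm (z - a).
  by rewrite lt_neqAle eq_sym nm_eq0 subr_eq0 za nm_ge0.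
have /contP/(_ e e0)[k k0 kP] := gc zr.
exists (Num.min k (Num.min (nm (z - a)) (r - nm (z - z0)))).
  by rewrite !lt_min k0 nza subr_gt0.
move=> h; rewrite !lt_min => /and3P[hk hz hr].
have wr : nm (z + h - z0) < r.
  by rewrite addrAC; apply: le_lt_trans (nmD _ _) _; lra.
have := @quotient_triangle z (z + h) za zr wr.
rewrite {1}[z + h - z]addrAC subrr add0r => /(_ hz).
rewrite (isJE (isJ_rev (gJ ar wr))) => /eqP; rewrite addrAC addr_eq0 => /eqP H.
have -> : J g a (z + h) - J g a z = J g z (z + h).
  by rewrite -opprB H opprK.
have := @isJ_approx _ g z (z + h) _ (g z) 0 0 e (gJ zr wr).
have E : z + h - z = h by rewrite addrAC subrr add0r.
rewrite E !mul0r addr0 [h * _]mulrC; apply => t /andP[t0 t1].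
rewrite mul0r addr0; apply/ltW/kP.
rewrite /sg E addrAC subrr add0r nmM nm_toC ger0_norm //.
by apply: le_lt_trans hk; rewrite ler_piMl ?nm_ge0.
Qed.

End Quotient.

End Cauchy.

(** * Cauchy's formula and Taylor expansions on circles *)

Section Circle.
Variable R : realType.
Local Notation C := (Cx R).
Let tp : R := pi *+ 2.

(** The unit circle, run through once over [0, 1]; [Eb] is its conjugate, hence its inverse. Their
    logarithmic derivatives are [c] and [- c], where [c] is 2 pi i. *)
Definition Ec (t : R) : C := cos (tp * t) +i* sin (tp * t).
Definition Eb (t : R) : C := cos (tp * t) -i* sin (tp * t).

Lemma Ec_Eb t : Ec t * Eb t = 1.
Proof.
rewrite /Ec /Eb; apply/eqP; rewrite eq_complex /= -(cos2Dsin2 (tp * t)).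
by apply/andP; split; apply/eqP; ring.
Qed.

Lemma nm_Ec t : nm (Ec t) = 1.
Proof.
apply/eqP; rewrite -(@eqrXn2 _ 2) ?nm_ge0 // nm_sqmod /sqmod /=.
by rewrite cos2Dsin2 expr1n.
Qed.

Lemma nm_Eb t : nm (Eb t) = 1.
Proof.
apply/eqP; rewrite -(@eqrXn2 _ 2) ?nm_ge0 // nm_sqmod /sqmod /= sqrrN.
by rewrite cos2Dsin2 expr1n.
Qed.

Lemma Eb_exp n t : Eb t ^+ n = Eb (n%:R * t).
Proof.
elim: n => [|n IH].
  by rewrite expr0 /Eb mul0r mulr0 cos0 sin0 oppr0.
have E : n.+1%:R * t = t + n%:R * t by rewrite mulrSr mulrDl mul1r addrC.
rewrite exprS IH E /Eb mulrDr cosD sinD.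
by apply/eqP; rewrite eq_complex /=; apply/andP; split; apply/eqP; ring.
Qed.

Lemma Ec1 : Ec 1 = 1 /\ Ec 0 = 1.
Proof. by rewrite /Ec mulr1 mulr0 cos2pi sin2pi cos0 sin0. Qed.

Lemma Eb_nat n : Eb n%:R = 1.
Proof.
rewrite -[n%:R]mulr1 -Eb_exp (_ : Eb 1 = 1) ?expr1n //.
by rewrite /Eb mulr1 cos2pi sin2pi oppr0.
Qed.

Lemma rd_cos (t : R) : rd cos t (- sin t).
Proof. by apply/rdP; exact: is_derive_cos. Qed.

Lemma rd_sin (t : R) : rd sin t (cos t).
Proof. by apply/rdP; exact: is_derive_sin. Qed.

Lemma rdN (f : R -> R) (t d : R) : rd f t d -> rd (fun s => - f s) t (- d).
Proof.
move=> fd e /fd[k k0 kP]; exists k => // h /kP.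
by rewrite -normrN; congr (Num.norm _ <= _); ring.
Qed.

Let c : C := 0 +i* tp.

Lemma dR_Ec t : dR Ec t (c * Ec t).
Proof.
have : dR (fun s => cos s +i* sin s) (0 + tp * t) ((- sin (tp * t)) +i* cos (tp * t)).
  by rewrite add0r; apply/dRP; split => /=; [exact: rd_cos|exact: rd_sin].
move/dR_affine; have -> : (fun s => cos (0 + tp * s) +i* sin (0 + tp * s)) = Ec.
  by apply/funext => s; rewrite add0r.
congr (dR _ _ _); rewrite /c /Ec /toC.
by apply/eqP; rewrite eq_complex /=; apply/andP; split; apply/eqP; ring.
Qed.

Lemma dR_Eb t : dR Eb t (- c * Eb t).
Proof.
have : dR (fun s => cos s -i* sin s) (0 + tp * t) ((- sin (tp * t)) -i* cos (tp * t)).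
  by rewrite add0r; apply/dRP; split => /=; [exact: rd_cos|exact/rdN/rd_sin].
move/dR_affine; have -> : (fun s => cos (0 + tp * s) -i* sin (0 + tp * s)) = Eb.
  by apply/funext => s; rewrite add0r.
congr (dR _ _ _); rewrite /c /Eb /toC.
by apply/eqP; rewrite eq_complex /=; apply/andP; split; apply/eqP; ring.
Qed.

Lemma dR_continuous P (d : R -> C) : (forall t, dR P t (d t)) -> continuous P.
Proof. by move=> H t; apply/contRP; exact: dR_cont (H t). Qed.

Lemma c_neq0 : c != 0.
Proof. by rewrite /c eq_complex /= eqxx /= mulrn_eq0 /= gt_eqF ?pi_gt0. Qed.

(** For [n > 0] the function is a multiple of the derivative of [Eb (n * t)], which takes the same
    value at 0 and 1. *)
Lemma isI_Eb n : isI (fun t => Eb t ^+ n) (n == 0)%:R.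
Proof.
case: n => [|n].
  exists (fun t => toC t); split; last by rewrite /toC rmorph1 rmorph0 subr0.
  move=> t _ e e0; exists 1 => // h _; rewrite toCD expr0 mulr1.
  have -> : toC t + toC h - toC t - toC h = 0 by ring.
  by rewrite nm0 mulr_ge0 // ltW.
have H : isI (fun t => - c * n.+1%:R * Eb t ^+ n.+1) 0.
  exists (fun t => Eb (0 + n.+1%:R * t)); split => [t _|].
    have := dR_affine (dR_Eb (0 + n.+1%:R * t)).
    rewrite add0r Eb_exp; congr (dR _ _ _).
    rewrite /toC rmorph_nat; ring.
  by rewrite mulr1 mulr0 addr0 add0r Eb_nat (Eb_nat 0) subrr.
have := isIM (- c * n.+1%:R)^-1 H; rewrite mulr0.
apply: isI_ext => t _; rewrite mulKf //.
by rewrite mulf_neq0 ?oppr_eq0 ?c_neq0 // pnatr_eq0.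
Qed.

Section Kernel.
Variable b : C.
Hypothesis b1 : nm b < 1.

(** The Cauchy kernel: on the circle of radius [r] about 0, the form d zeta / (zeta - a) is 2 pi i
    [k t] dt, with [b = a / r]. *)
Let k t := (1 - b * Eb t)^-1.

Let den t : 1 - nm b <= nm (1 - b * Eb t).
Proof.
rewrite lerBlDr -{1}nm1 -{1}[1](subrK (b * Eb t)).
by apply: le_trans (nmD _ _) _; rewrite (nmM b) nm_Eb mulr1.
Qed.

Let den0 t : 1 - b * Eb t != 0.
Proof.
by rewrite -nm_eq0 gt_eqF //; apply: lt_le_trans (den t); rewrite subr_gt0.
Qed.

Let kb t : nm (k t) <= (1 - nm b)^-1.
Proof.
have h : nm (1 - b * Eb t) * nm (k t) = 1 by rewrite -nmM divff ?nm1.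
have b0 : 0 < 1 - nm b by rewrite subr_gt0.
rewrite -(ler_pM2l b0) divff ?gt_eqF // -[leRHS]h.
by rewrite ler_wpM2r ?nm_ge0.
Qed.

Lemma kernel_cont : continuous k.
Proof.
move=> t.
have h1 : {for t, continuous (fun s => b * Eb s)}.
  exact: (continuousM (@cst_continuous _ _ b t) (dR_continuous dR_Eb (x:=t))).
have h2 : {for t, continuous (fun s => 1 - b * Eb s)}.
  exact: (continuousB (@cst_continuous _ _ (1 : C) t) h1).
by apply: (continuousV _ h2); exact: den0.
Qed.

Let geo n t : k t = \sum_(j < n) b ^+ j * Eb t ^+ j + b ^+ n * Eb t ^+ n * k t.
Proof.
elim: n => [|n IH]; first by rewrite big_ord0 add0r !expr0 !mul1r.
rewrite [LHS]IH big_ord_recr /= -addrA; congr (_ + _).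
rewrite /k !exprS; field; exact: den0.
Qed.

(** The geometric series of the kernel is cut after [n] terms with its exact remainder, which avoids
    interchanging sum and integral. *)
Lemma kernel_expansion (h : R -> C) (w : C) (cf : nat -> C) (M : R) n :
  (forall t : R, 0 <= t <= 1 -> nm (h t) <= M) ->
  isI (fun t => h t * k t) w ->
  (forall j, isI (fun t => h t * Eb t ^+ j) (cf j)) ->
  nm (w - \sum_(j < n) b ^+ j * cf j) <= M * (nm b ^+ n / (1 - nm b)).
Proof.
move=> hM Iw Icf.
have := isIB Iw (@isI_sum R n (fun j t => b ^+ j * (h t * Eb t ^+ j)) (fun j => b ^+ j * cf j)
   (fun j => isIM (b ^+ j) (Icf j))).
move/isI_bound; apply => t t01.
rewrite (_ : _ - _ = h t * (b ^+ n * Eb t ^+ n * k t)); last first.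
  have -> : \sum_(j < n) b ^+ j * (h t * Eb t ^+ j) = h t * \sum_(j < n) b ^+ j * Eb t ^+ j.
    by rewrite mulr_sumr; apply: eq_bigr => j _; rewrite mulrCA.
  by rewrite [in LHS](geo n); ring.
have nX (z : C) m : nm (z ^+ m) = nm z ^+ m.
  by elim: m => [|m IH]; rewrite ?expr0 ?nm1 // !exprS nmM IH.
rewrite !nmM !nX nm_Eb expr1n mulr1.
by apply: ler_pM; rewrite ?nm_ge0 ?mulr_ge0 ?exprn_ge0 ?nm_ge0 ?hM // ler_wpM2l ?exprn_ge0 ?nm_ge0.
Qed.

(** Only the constant term of the geometric series has a nonzero mean. *)
Lemma isI_kernel : isI k 1.
Proof.
have Ik := cintP kernel_cont.
have -> : (1 : C) = cint k; last exact: Ik.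
apply/eqP; rewrite -subr_eq0 -nm_eq0 eq_le nm_ge0 andbT nmBC.
apply/ler_addgt0Pr => e e0; rewrite add0r.
have [|N HN] := @expr_to0 R (1 - nm b)^-1 (nm b) _ e e0.
  by rewrite nm_ge0 b1.
have := @kernel_expansion (fun=> 1) (cint k) (fun j => (j == 0)%:R) 1 N.+1.
rewrite big_ord_recl /= expr0 !mul1r big1 ?addr0; last by move=> i _; rewrite mulr0.
move=> H; apply: le_trans (H _ _ _) _.
- by move=> t _; rewrite nm1.
- by apply: isI_ext Ik => t _; rewrite mul1r.
- by move=> j; apply: isI_ext (isI_Eb j) => t _; rewrite mul1r.
by rewrite mulrC; apply/ltW/HN.
Qed.

End Kernel.

Section Taylor.
Variables (f : C -> C) (z0 : C) (r' r : R).
Hypotheses (r0 : 0 < r) (rr' : r < r').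
Hypothesis fD : forall z, nm (z - z0) < r' -> differentiable f z.

Let ga t := z0 + toC r * Ec t.

Let ga_r t : nm (ga t - z0) = r.
Proof. by rewrite /ga addrAC subrr add0r nmM nm_Ec mulr1 nm_toC gtr0_norm. Qed.

(** A rescaled Fourier coefficient on the circle of radius [s]; for holomorphic [g] it is the j-th
    Taylor coefficient at [z]. *)
Definition tcoef (g : C -> C) (z : C) (s : R) (j : nat) : C :=
  toC (s ^- j) * cint (fun t => g (z + toC s * Ec t) * Eb t ^+ j).

Let cf : continuous (fun t => f (ga t)).
Proof.
move=> t; apply: (@continuous_comp _ _ _ ga f).
  apply: (@dR_continuous ga (fun t => toC r * (c * Ec t))) => s.
  rewrite -[X in dR _ _ X]add0r; apply: dRD; first exact: dR_cst.
  by apply: dRM; exact: dR_Ec.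
by apply: differentiable_continuous; apply: fD; rewrite ga_r.
Qed.

Lemma tcoef_isI j : isI (fun t => f (ga t) * Eb t ^+ j) (toC (r ^+ j) * tcoef f z0 r j).
Proof.
rewrite /tcoef mulrA -toCM divff ?expf_neq0 ?gt_eqF // mul1r.
have h2 : continuous (fun t => Eb t ^+ j).
  rewrite (_ : (fun t => _) = (fun t => Eb (0 + j%:R * t))); last first.
    by apply/funext => t; rewrite add0r Eb_exp.
  apply: (@dR_continuous _ (fun t => toC j%:R * (- c * Eb (0 + j%:R * t)))) => t.
  exact: dR_affine (dR_Eb _).
by apply: cintP => t; exact: (continuousM (@cf t) (h2 t)).
Qed.

(** The difference quotient at [z0 + a] has a primitive along the circle, so its integral vanishes;
    the part with the constant [f (z0 + a)] is evaluated by the mean of the kernel. *)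
Lemma cauchy_formula (a : C) : nm a < r ->
  isI (fun t => f (ga t) * (1 - a / toC r * Eb t)^-1) (f (z0 + a)).
Proof.
move=> ar.
have b1 : nm (a / toC r) < 1.
  rewrite nmM; have -> : nm (toC r)^-1 = r^-1.
    by rewrite /toC -fmorphV -/(toC _) nm_toC gtr0_norm // invr_gt0.
  by rewrite ltr_pdivrMr // mul1r.
have ar' : nm (z0 + a - z0) < r' by rewrite addrAC subrr add0r; exact: lt_trans rr'.
have [d fa] := (cdP f (z0 + a)).1 (fD ar').
pose g z := if z == z0 + a then d else (f z - f (z0 + a)) / (z - (z0 + a)).
have ga_a t : ga t != z0 + a.
  apply/eqP => E; have := ga_r t; rewrite E addrAC subrr add0r => H.
  by rewrite H ltxx in ar.
have H0 : isI (fun t => toC r * (c * Ec t) * g (ga t)) 0.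
  exists (fun t => J g (z0 + a) (ga t)); split; last first.
    by rewrite /ga; have [-> ->] := Ec1; rewrite subrr.
  move=> t _; apply: dR_comp.
    by apply: (quotient_primitive fD ar' fa) => //; rewrite ga_r.
  rewrite -[X in dR _ _ X]add0r; apply: dRD; first exact: dR_cst.
  by apply: dRM; exact: dR_Ec.
(* Dividing by 2 pi i turns the integrand into the difference of the two kernel terms. *)
have := isIM c^-1 H0; rewrite mulr0 => /(isI_ext _).
move=> /(_ (fun t => f (ga t) * (1 - a / toC r * Eb t)^-1 - f (z0 + a) * (1 - a / toC r * Eb t)^-1)) H1.
have H2 := isID (H1 _) (isIM (f (z0 + a)) (isI_kernel b1)).
rewrite add0r mulr1 in H2; apply: isI_ext (H2 _) => [t _|t _].
  by rewrite subrK.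
have tr0 : toC r != 0.
  by rewrite -nm_eq0 nm_toC normr_eq0 gt_eqF.
have EE : Ec t != 0 by rewrite -nm_eq0 nm_Ec oner_eq0.
have -> : Eb t = (Ec t)^-1.
  by apply: (mulfI EE); rewrite Ec_Eb divff.
rewrite /g ifN // /ga; field.
have := c_neq0 => cn0.
have := ga_a t; rewrite /ga (inj_eq (addrI z0)) => h.
rewrite EE tr0 cn0 /= !andbT.
have h1 : toC r * Ec t - a != 0 by rewrite subr_eq0.
by rewrite ?h1 ?andbT //= ?[z0 + _ - _]opprD ?(_ : z0 + toC r * Ec t - (z0 + a) = toC r * Ec t - a) ?h1 //; ring.
Qed.

Variable M : R.
Hypothesis fM : forall t : R, 0 <= t <= 1 -> nm (f (z0 + toC r * Ec t)) <= M.

Lemma tcoef_bound j : nm (tcoef f z0 r j) <= M / r ^+ j.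
Proof.
rewrite ler_pdivlMr ?exprn_gt0 // mulrC.
have := isI_bound (tcoef_isI j) => /(_ M) H.
rewrite -[r ^+ j]gtr0_norm ?exprn_gt0 // -nm_toC -nmM; apply: H => t t01.
rewrite nmM; have nX (z : C) m : nm (z ^+ m) = nm z ^+ m.
  by elim: m => [|m IH]; rewrite ?expr0 ?nm1 // !exprS nmM IH.
by rewrite nX nm_Eb expr1n mulr1; exact: fM.
Qed.

Lemma taylor (a : C) n : nm a < r ->
  nm (f (z0 + a) - \sum_(j < n) a ^+ j * tcoef f z0 r j) <=
  M * ((nm a / r) ^+ n / (1 - nm a / r)).
Proof.
move=> ar.
have nb : nm (a / toC r) = nm a / r.
  rewrite nmM; have -> // : nm (toC r)^-1 = r^-1.
  by rewrite /toC -fmorphV -/(toC _) nm_toC gtr0_norm // invr_gt0.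
have b1 : nm (a / toC r) < 1 by rewrite nb ltr_pdivrMr // mul1r.
have tr0 : toC r != 0 by rewrite -nm_eq0 nm_toC normr_eq0 gt_eqF.
have := kernel_expansion b1 n _ (cauchy_formula ar) tcoef_isI.
rewrite nb (eq_bigr (fun j : 'I_n => a ^+ j * tcoef f z0 r j)).
  by apply => t; exact: fM.
move=> j _; rewrite /toC rmorphXn -/(toC r) exprMn exprVn.
by field; rewrite expf_neq0.
Qed.

End Taylor.
End Circle.

(** * Square-summable sequences through finite pairings *)

Section Ell2.
Variable R : realType.
Local Notation C := (Cx R).
Local Notation W := (ell2 R).

Lemma ell2D (u v : W) k : (u + v) k = u k + v k.
Proof. by []. Qed.

Lemma ell2B (u v : W) k : (u - v) k = u k - v k.
Proof. by []. Qed.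

Lemma ell2Z (a : C) (u : W) k : (a *: u) k = a * u k.
Proof. by []. Qed.

Lemma ell2_sum n (F : 'I_n -> W) k : (\sum_(j < n) F j) k = \sum_(j < n) F j k.
Proof.
elim: n F => [F|n IH F]; first by rewrite !big_ord0.
by rewrite [in LHS]big_ord_recr ell2D IH [in RHS]big_ord_recr.
Qed.

Lemma nm_ell2 (u : W) : nm u ^+ 2 = sqnorm u.
Proof. by rewrite /nm /= sqr_sqrtr // sqnorm_ge0. Qed.

Lemma sqseries_ord (u : nat -> C) n : sqseries u n = \sum_(k < n) sqmod (u k).
Proof. by rewrite /sqseries /series /= big_mkord. Qed.

Lemma ell2_part (u : W) n : \sum_(k < n) sqmod (u k) <= nm u ^+ 2.
Proof. by rewrite nm_ell2 -sqseries_ord sqnorm_ge. Qed.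

Lemma ell2_ext (u v : W) : (forall k, u k = v k) -> u = v.
Proof. by move=> uv; apply/val_inj/funext. Qed.

(** Pairing with a finitely supported sequence. Such pairings determine the norm, which reduces
    estimates for [ell2]-valued maps to scalar ones. *)
Definition hdot (K : nat) (y x : nat -> C) : C := \sum_(k < K) Num.conj (y k) * x k.

Lemma nm_conj (z : C) : nm (Num.conj z : C) = nm z.
Proof.
by apply/eqP; rewrite -(@eqrXn2 _ 2) ?nm_ge0 // !nm_sqmod; case: z => a b; rewrite /sqmod /= sqrrN.
Qed.

Lemma nm_sum (V : normedModType C) n (F : 'I_n -> V) : nm (\sum_(j < n) F j) <= \sum_(j < n) nm (F j).
Proof.
elim: n F => [F|n IH F]; first by rewrite !big_ord0 nm0.
by rewrite !big_ord_recr /=; apply: le_trans (nmD _ _) _; rewrite lerD2r.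
Qed.

Lemma hdot_le K (y x : nat -> C) (a b : R) : 0 < a -> 0 < b ->
  \sum_(k < K) sqmod (y k) <= a ^+ 2 -> \sum_(k < K) sqmod (x k) <= b ^+ 2 ->
  nm (hdot K y x) <= a * b.
Proof.
move=> a0 b0 ya xb; apply: le_trans (nm_sum _) _.
(* Cauchy-Schwarz from the weighted arithmetic-geometric inequality, with weights balanced at the
   two given bounds. *)
have -> : a * b = b / a / 2 * a ^+ 2 + a / b / 2 * b ^+ 2 by field; rewrite !gt_eqF.
have c1 : 0 <= b / a / 2 by rewrite !divr_ge0 // ltW.
have c2 : 0 <= a / b / 2 by rewrite !divr_ge0 // ltW.
apply: le_trans (lerD (ler_wpM2l c1 ya) (ler_wpM2l c2 xb)).
rewrite !mulr_sumr -big_split /=; apply: ler_sum => k _.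
rewrite nmM nm_conj -!nm_sqmod -subr_ge0.
rewrite (_ : _ - _ = (b * nm (y k) - a * nm (x k)) ^+ 2 / (2 * a * b)); last first.
  by field; rewrite !gt_eqF.
by rewrite divr_ge0 ?sqr_ge0 // ltW // !mulr_gt0.
Qed.

Lemma hdot_ell2 K (y : nat -> C) (u : W) (a b : R) : 0 < a ->
  \sum_(k < K) sqmod (y k) <= a ^+ 2 -> nm u <= b -> nm (hdot K y u) <= a * b.
Proof.
move=> a0 ya ub; apply/ler_addgt0Pr => e e0.
(* The bound [b] may be 0, so it is enlarged before [hdot_le] is applied. *)
have e1 : 0 < e / a by rewrite divr_gt0.
have -> : a * b + e = a * (b + e / a) by field; rewrite gt_eqF.
have u0 := nm_ge0 u.
apply: hdot_le => //; first by lra.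
apply: le_trans (ell2_part _ _) _; rewrite ler_sqr ?nnegrE //; lra.
Qed.

(** The sequence is tested against itself, with [a] the square root of its truncated square sum. *)
Lemma hdot_dual K (x : nat -> C) (M : R) : 0 <= M ->
  (forall (y : nat -> C) (a : R), 0 < a -> \sum_(k < K) sqmod (y k) <= a ^+ 2 -> nm (hdot K y x) <= a * M) ->
  \sum_(k < K) sqmod (x k) <= M ^+ 2.
Proof.
move=> M0 H; set S := \sum_(k < K) _.
have S0 : 0 <= S by apply: sumr_ge0 => k _; exact: sqmod_ge0.
have [->|Sn] := eqVneq S 0; first exact: sqr_ge0.
have Sp : 0 < S by rewrite lt_neqAle eq_sym Sn.
have sp : 0 < Num.sqrt S by rewrite sqrtr_gt0.
have := H x (Num.sqrt S) sp; rewrite sqr_sqrtr // => /(_ (lexx _)).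
have -> : hdot K x x = toC S.
  rewrite /hdot /S /toC rmorph_sum /=; apply: eq_bigr => k _.
  by rewrite -/(toC _) sqmodE mulrC normCK.
rewrite nm_toC ger0_norm // -{1}(sqr_sqrtr S0) expr2 ler_pM2l // => h.
by rewrite -(sqr_sqrtr S0) ler_sqr ?nnegrE // sqrtr_ge0.
Qed.

Lemma ell2_make (x : nat -> C) (M : R) : 0 <= M ->
  (forall K, \sum_(k < K) sqmod (x k) <= M ^+ 2) ->
  exists2 u : W, (forall k, u k = x k) & nm u <= M.
Proof.
move=> M0 H.
have cx : cvgn (sqseries x).
  apply: nondecreasing_is_cvgn.
    by apply: nondecreasing_series => k _ _; exact: sqmod_ge0.
  by exists (M ^+ 2) => _ [n _ <-]; rewrite sqseries_ord.
have sx : x \in @square_summable R by exact/square_summableP.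
exists (Ell2 sx) => //.
rewrite -(@ler_sqr _ _ M) ?nnegrE ?nm_ge0 // nm_ell2 /sqnorm.
apply: limr_le => //; apply: nearW => n; rewrite sqseries_ord; exact: H.
Qed.

Lemma nm_le_ell2 (u : W) (M : R) : 0 <= M ->
  (forall K (y : nat -> C) (a : R), 0 < a -> \sum_(k < K) sqmod (y k) <= a ^+ 2 -> nm (hdot K y u) <= a * M) ->
  nm u <= M.
Proof.
move=> M0 H; have [K|v uv vM] := @ell2_make u M M0.
  by apply: hdot_dual => // y a; exact: H.
by rewrite -(ell2_ext uv).
Qed.

Lemma hdotD K (y : nat -> C) x x' : hdot K y (fun k => x k + x' k) = hdot K y x + hdot K y x'.
Proof. by rewrite /hdot -big_split; apply: eq_bigr => k _; rewrite mulrDr. Qed.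

Lemma hdotZ K (y : nat -> C) a x : hdot K y (fun k => a * x k) = a * hdot K y x.
Proof. by rewrite /hdot mulr_sumr; apply: eq_bigr => k _; rewrite mulrCA. Qed.

Lemma hdotB K (y : nat -> C) x x' : hdot K y (fun k => x k - x' k) = hdot K y x - hdot K y x'.
Proof. by rewrite /hdot -sumrB; apply: eq_bigr => k _; rewrite mulrBr. Qed.

Lemma hdot_sum K y n (F : 'I_n -> nat -> C) :
  hdot K y (fun k => \sum_(j < n) F j k) = \sum_(j < n) hdot K y (F j).
Proof. by rewrite /hdot exchange_big; apply: eq_bigr => k _; rewrite mulr_sumr. Qed.

Lemma hdot_bound K (y : nat -> C) (u : W) : exists2 a : R, 0 < a & forall u : W, nm (hdot K y u) <= a * nm u.
Proof.
pose S := \sum_(k < K) sqmod (y k).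
have S0 : 0 <= S by apply: sumr_ge0 => k _; exact: sqmod_ge0.
exists (S + 1) => [|v]; first by rewrite ltr_wpDl.
by apply: hdot_ell2; rewrite ?ltr_wpDl // -/S; nra.
Qed.

Lemma bounded_linear_diff (V V' : normedModType C) (phi : {linear V -> V'}) (K : R) x :
  (forall v, nm (phi v) <= K * nm v) -> differentiable phi x.
Proof.
move=> phiK; apply/diffP_nm; exists phi; split; first by exists K.
move=> e e0; exists 1 => // h _.
rewrite linearD [phi x + _]addrC addrK subrr nm0; by rewrite mulr_ge0 ?nm_ge0 // ltW.
Qed.

Lemma hdot_diff (V : normedModType C) K y (h : V -> W) z :
  differentiable h z -> differentiable (fun v => hdot K y (h v)) z.
Proof.
move=> hz.
pose m (u : W) : C := hdot K y u.
have ml : linear m.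
  by move=> a u v; rewrite /m (hdotD K y (a *: u) v) hdotZ.
pose phi : {linear W -> C} := HB.pack m (GRing.isLinear.Build _ _ _ _ m ml).
have [a a0 am] := hdot_bound K (y : nat -> C) (0 : W).
have dphi : differentiable phi (h z) by apply: (@bounded_linear_diff _ _ phi a).
exact: differentiable_comp hz dphi.
Qed.

(** The coordinates converge, and the rate [e n] passes to the limit on each finite pairing;
    [ell2_make] assembles the difference between the term of index 0 and the limit. *)
Lemma ell2_complete (u : nat -> W) (e : nat -> R) :
  (forall n m, (n <= m)%N -> nm (u m - u n) <= e n) -> to0 e ->
  exists l, forall n, nm (u n - l) <= e n.
Proof.
move=> ue e0.
have e_ge n : 0 <= e n by apply: le_trans (ue n n (leqnn n)); exact: nm_ge0.
have coordle (v : W) k : nm (v k) <= nm v.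
  rewrite -(@ler_sqr _ _ (nm v)) ?nnegrE ?nm_ge0 // nm_sqmod.
  apply: le_trans (ell2_part v k.+1); rewrite big_ord_recr /= lerDr.
  by apply: sumr_ge0 => j _; exact: sqmod_ge0.
have /choice[x Hx] k : exists x, forall n, nm (u n k - x) <= e n.
  apply: C_complete => // n m /ue; apply: le_trans.
  by rewrite -ell2B coordle.
have H n K (y : nat -> C) (a : R) : 0 < a -> \sum_(k < K) sqmod (y k) <= a ^+ 2 ->
    nm (hdot K y (fun k => u n k - x k)) <= a * e n.
  move=> a0 ya; apply/ler_addgt0Pr => d d0.
  pose S := \sum_(k < K) nm (y k).
  have S0 : 0 <= S by apply: sumr_ge0 => k _; exact: nm_ge0.
  have d1 : 0 < d / (S + 1) by rewrite divr_gt0 // ltr_wpDl.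
  have [N HN] := e0 _ d1; pose m := maxn n N.
  have {}HN := HN m (leq_maxr _ _).
  have -> : (fun k => u n k - x k) = (fun k => (u n - u m) k + (u m k - x k)).
    by apply/funext => k; rewrite ell2B addrA subrK.
  rewrite hdotD; apply: le_trans (nmD _ _) _; apply: lerD.
    by apply: hdot_ell2 => //; rewrite nmBC; apply: ue; rewrite leq_maxl.
  apply: le_trans (nm_sum _) _.
  apply: (@le_trans _ _ (\sum_(k < K) nm (y k) * e m)).
    by apply: ler_sum => k _; rewrite nmM nm_conj ler_wpM2l ?nm_ge0.
  rewrite -mulr_suml -/S; apply: (@le_trans _ _ (S * (d / (S + 1)))).
    by rewrite ler_wpM2l // ltW.
  by rewrite mulrCA ger_pMr // ler_pdivrMr ?ltr_wpDl // mul1r lerDl.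
have [K|w ww _] := @ell2_make (fun k => u 0%N k - x k) (e 0%N) (e_ge 0%N).
  by apply: (@hdot_dual _ (fun k => u 0%N k - x k)) => // y a a0 ya; exact: H.
exists (u 0%N - w) => n; apply: nm_le_ell2 => // K y a a0 ya.
rewrite (_ : ell2_val _ = (fun k => u n k - x k)); first exact: H.
by apply/funext => k; rewrite !ell2B ww; ring.
Qed.

End Ell2.

(** * Taylor expansions with values in [ell2] *)

Section VectorTaylor.
Variable R : realType.
Local Notation C := (Cx R).
Local Notation W := (ell2 R).

Definition expansion (V : normedModType C) (h : C -> V) (z0 : C) (c : nat -> V) (r M : R) :=
  forall a n, nm a < r ->
    nm (h (z0 + a) - \sum_(j < n) a ^+ j *: c j) <= M * ((nm a / r) ^+ n / (1 - nm a / r)).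

(** Every finite pairing of [h] is a scalar holomorphic function, whose coefficients are the
    pairings of the coordinatewise coefficients [x]. The scalar Cauchy estimates, uniform over
    pairings of a given norm, therefore bound the vectors of coefficients in [ell2]. *)
Lemma vtaylor (h : C -> W) (z0 : C) (r' r M : R) : 0 < r -> r < r' -> 
  (forall z, nm (z - z0) < r' -> differentiable h z) ->
  (forall t : R, 0 <= t <= 1 -> nm (h (z0 + toC r * Ec t)) <= M) ->
  exists2 c : nat -> W, (forall j, nm (c j) <= M / r ^+ j) & expansion h z0 c r M.
Proof.
move=> r0 rr' hD hM.
have M0 : 0 <= M.
  by apply: le_trans (hM 0 _); rewrite ?nm_ge0 // lexx ler01.
pose x j k := tcoef (fun z => h z k) z0 r j.
have hdD K y z : nm (z - z0) < r' -> differentiable (fun z => hdot K y (h z)) z.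
  by move=> zr; apply: hdot_diff; exact: hD.
have kD k z : nm (z - z0) < r' -> differentiable (fun z => h z k) z.
  move=> zr; have := hdD k.+1 (fun i => (i == k)%:R) z zr.
  rewrite (_ : (fun z => _) = (fun z => h z k)) //; apply/funext => v.
  rewrite /hdot big_ord_recr /= eqxx rmorph1 mul1r big1 ?add0r // => i _.
  by rewrite ltn_eqF ?rmorph0 ?mul0r.
have xE K y j : hdot K y (x j) = tcoef (fun z => hdot K y (h z)) z0 r j.
  have tr : toC (r ^+ j) != 0 by rewrite -nm_eq0 nm_toC normr_eq0 expf_neq0 // gt_eqF.
  apply: (mulfI tr); apply: isI_uniq (tcoef_isI r0 rr' (hdD K y) j).
  rewrite -hdotZ /hdot.
  pose G k t := (Num.conj (y k) * (h (z0 + toC r * Ec t) k * Eb t ^+ j)).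
  have := @isI_sum R K G (fun k => Num.conj (y k) * (toC (r ^+ j) * x j k)).
  move=> /(_ (fun k => isIM _ (tcoef_isI r0 rr' (kD k) j))).
  apply: isI_ext => t _; rewrite /G /hdot mulr_suml.
  by apply: eq_bigr => k _; rewrite mulrA.
have hdM K (y : nat -> C) (a : R) : 0 < a -> \sum_(k < K) sqmod (y k) <= a ^+ 2 ->
    forall t : R, 0 <= t <= 1 -> nm (hdot K y (h (z0 + toC r * Ec t))) <= a * M.
  by move=> a0 ya t t01; apply: hdot_ell2 => //; exact: hM.
have /choice[c Hc] j : exists c : W, (forall k, c k = x j k) /\ nm c <= M / r ^+ j.
  have [||c c1 c2] := @ell2_make R (x j) (M / r ^+ j); last by exists c.
    by rewrite divr_ge0 // exprn_ge0 // ltW.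
  move=> K; apply: hdot_dual; first by rewrite divr_ge0 // exprn_ge0 // ltW.
  move=> y a a0 ya; rewrite xE mulrA; apply: (tcoef_bound r0 rr' (hdD K y)).
  exact: hdM.
exists c => [j|a n ar]; first by have [] := Hc j.
have nb : 0 <= nm a / r < 1 by rewrite divr_ge0 ?nm_ge0 ?(ltW r0) //= ltr_pdivrMr // mul1r.
have /andP[b0 b1] := nb.
have e0 : 0 <= (nm a / r) ^+ n / (1 - nm a / r).
  by rewrite divr_ge0 ?exprn_ge0 // subr_ge0 ltW.
apply: nm_le_ell2; first by rewrite mulr_ge0.
move=> K y s s0 ys; rewrite mulrA.
have := taylor r0 rr' (hdD K y) (hdM _ _ _ s0 ys) n ar.
congr (nm _ <= _).
transitivity (hdot K y (fun k => h (z0 + a) k - \sum_(j < n) a ^+ j * x j k)).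
  rewrite hdotB hdot_sum; congr (_ - _); apply: eq_bigr => j _.
  by rewrite hdotZ xE.
congr hdot; apply/funext => k; rewrite ell2B ell2_sum; congr (_ - _).
by apply: eq_bigr => j _; rewrite ell2Z; have [-> _] := Hc j.
Qed.

Lemma nmX (z : C) m : nm (z ^+ m) = nm z ^+ m.
Proof. by elim: m => [|m IH]; rewrite ?expr0 ?nm1 // !exprS nmM IH. Qed.

(** On half the radius the denominator [1 - nm a / r] of the remainder is at least 1/2. *)
Lemma expansion_half (V : normedModType C) (h : C -> V) z0 c (r M : R) a n : 0 < r ->
  expansion h z0 c r M -> nm a <= r / 2 ->
  nm (h (z0 + a) - \sum_(j < n) a ^+ j *: c j) <= 2 * `|M| / r ^+ n * nm a ^+ n.
Proof.
move=> r0 hc ar; have an := nm_ge0 a.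
have ar' : nm a < r by lra.
apply: le_trans (hc a n ar') _.
have x0 : 0 <= nm a / r by rewrite divr_ge0 // ltW.
have x1 : nm a / r <= 2^-1 by rewrite ler_pdivrMr // mulrC; lra.
apply: (@le_trans _ _ (`|M| * ((nm a / r) ^+ n * 2))).
  apply: (@le_trans _ _ (`|M| * ((nm a / r) ^+ n / (1 - nm a / r)))).
    by rewrite ler_wpM2r ?ler_norm // divr_ge0 ?exprn_ge0 // subr_ge0; lra.
  rewrite ler_wpM2l // ler_wpM2l ?exprn_ge0 //.
  by rewrite -[X in X <= _]mulr1 ler_pdivrMl; lra.
rewrite exprMn exprVn le_eqVlt; apply/orP; left; apply/eqP.
by field; rewrite expf_neq0 // gt_eqF.
Qed.

(** If the coefficients agree below [j], the two remainders bound [s ^+ j] times the j-th difference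
    by a multiple of [s ^+ j.+1]; then [s] tends to 0. The radii may differ, which later carries
    bounds from a large disc to a germ. *)
Lemma expansion_uniq (V : normedModType C) (h : C -> V) z0 c c' (r r' M M' : R) :
  0 < r -> 0 < r' -> expansion h z0 c r M -> expansion h z0 c' r' M' -> c = c'.
Proof.
move=> r0 r0' hc hc'; apply/funext => j; elim/ltn_ind: j => j IH.
apply/eqP; rewrite -subr_eq0 -nm_eq0 eq_le nm_ge0 andbT.
pose B := 2 * `|M| / r ^+ j.+1 + 2 * `|M'| / r' ^+ j.+1.
have B0 : 0 <= B by rewrite addr_ge0 // divr_ge0 ?mulr_ge0 ?exprn_ge0 // ltW.
have key (s : R) : 0 < s -> s <= r / 2 -> s <= r' / 2 -> nm (c j - c' j) <= B * s.
  move=> s0 sr sr'; have ns : nm (toC s) = s by rewrite nm_toC gtr0_norm.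
  have := @expansion_half V h z0 c r M (toC s) j.+1 r0 hc.
  have := @expansion_half V h z0 c' r' M' (toC s) j.+1 r0' hc'.
  rewrite ns !big_ord_recr /= => /(_ sr') H' /(_ sr) H.
  have E : \sum_(i < j) toC s ^+ i *: c i = \sum_(i < j) toC s ^+ i *: c' i.
    by apply: eq_bigr => i _; rewrite IH.
  rewrite E in H.
  have : nm (toC s ^+ j *: (c j - c' j)) <= B * s ^+ j.+1.
    rewrite scalerBr.
    set A := \sum_(i < j) _ in H H'; set X := h _ in H H'.
    rewrite (_ : _ - _ = (X - (A + toC s ^+ j *: c' j)) - (X - (A + toC s ^+ j *: c j))); last first.
      by rewrite [RHS]addrC opprB subrKA opprD addrACA subrr add0r.
    apply: le_trans (nmD _ _) _; rewrite nmN /B mulrDl; lra.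
  rewrite nmZ nmX ns exprSr (_ : B * (s ^+ j * s) = s ^+ j * (B * s)); last by ring.
  by rewrite ler_pM2l ?exprn_gt0.
apply/ler_addgt0Pr => e e0; rewrite add0r.
pose s := Num.min (Num.min (r / 2) (r' / 2)) (e / (B + 1)).
have s0 : 0 < s by rewrite !lt_min !divr_gt0 //; lra.
have sr : s <= r / 2 by rewrite /s !ge_min lexx.
have sr' : s <= r' / 2 by rewrite /s !ge_min lexx orbT.
have kh := key s s0 sr sr'.
apply: le_trans kh _; apply: (@le_trans _ _ (B * (e / (B + 1)))).
  by rewrite ler_wpM2l // ge_min lexx orbT.
by rewrite mulrCA ger_pMr // ler_pdivrMr; lra.
Qed.

End VectorTaylor.

(** * Holomorphic maps *)

Section HolomorphicLimits.
Variable R : realType.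
Local Notation C := (Cx R).
Local Notation W := (ell2 R).

Lemma ell2N (u : W) k : (- u) k = - u k.
Proof. by []. Qed.

Ltac ell2_ring := apply: ell2_ext => ?; rewrite !(ell2B, ell2N, ell2D, ell2Z); ring.

Lemma line_diff (V : normedModType C) (x v : V) (z : C) :
  differentiable (fun a : C => x + a *: v) z.
Proof.
apply: differentiableD; first exact: differentiable_cst.
apply: differentiableZl; exact: ex_diff.
Qed.

Lemma comp_line_diff (V U : normedModType C) (h : V -> U) (x v : V) (z : C) :
  differentiable h (x + z *: v) -> differentiable (fun a : C => h (x + a *: v)) z.
Proof. by move=> hD; apply: (differentiable_comp (line_diff x v z)). Qed.

(** By uniqueness the expansion at the centre vanishes with the germ, and its remainder tends to 0
    on a disc of any radius below [r']. *)
Lemma holomorphic_zero (h : C -> W) (z1 : C) (r' d M : R) : 0 < d ->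
  (forall z, nm (z - z1) < r' -> differentiable h z) ->
  (forall z, nm (z - z1) < r' -> nm (h z) <= M) ->
  (forall z, nm (z - z1) < d -> h z = 0) ->
  forall z, nm (z - z1) < r' -> h z = 0.
Proof.
move=> d0 hD hM h0 z zr; pose a := z - z1; pose r := (nm a + r') / 2.
have an := nm_ge0 a.
have ar : nm a < r by rewrite /r /a; lra.
have rr : r < r' by rewrite /r /a; lra.
have r0 : 0 < r by lra.
have cM (t : R) : 0 <= t <= 1 -> nm (h (z1 + toC r * Ec t)) <= M.
  by move=> _; apply: hM; rewrite addrAC subrr add0r nmM nm_Ec mulr1 nm_toC gtr0_norm.
have [c _ hc] := vtaylor r0 rr hD cM.
have hc0 : expansion h z1 (fun=> 0) d 0.
  move=> b n bd; rewrite mul0r h0; last by rewrite addrAC subrr add0r.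
  by rewrite big1 ?subrr ?nm0 // => i _; rewrite scaler0.
have cE := expansion_uniq r0 d0 hc hc0.
have zE : z = z1 + a by rewrite /a subrKC.
apply/eqP; rewrite -nm_eq0 eq_le nm_ge0 andbT; apply/ler_addgt0Pr => e e0; rewrite add0r.
have b01 : 0 <= nm a / r < 1 by rewrite divr_ge0 ?(ltW r0) //= ltr_pdivrMr // mul1r.
have [N HN] := expr_to0 (M / (1 - nm a / r)) b01 e0.
have := hc a N ar; rewrite cE big1 ?subr0 => [|i _]; last by rewrite scaler0.
rewrite zE => H; apply: le_trans H _; apply: le_trans (ltW (HN N (leqnn N))).
by rewrite mulrAC mulrA.
Qed.

(** The value at the centre is the zeroth coefficient, which Cauchy's estimate bounds by the values
    on the circle. *)
Lemma max_modulus (h : C -> W) (z0 : C) (r' r M : R) : 0 < r -> r < r' ->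
  (forall z, nm (z - z0) < r' -> differentiable h z) ->
  (forall z, nm (z - z0) = r -> nm (h z) <= M) -> nm (h z0) <= M.
Proof.
move=> r0 rr hD hM.
have cM (t : R) : 0 <= t <= 1 -> nm (h (z0 + toC r * Ec t)) <= M.
  by move=> _; apply: hM; rewrite addrAC subrr add0r nmM nm_Ec mulr1 nm_toC gtr0_norm.
have [c cb hc] := vtaylor r0 rr hD cM.
have := hc 0 1%N; rewrite nm0 mul0r expr1 mul0r mulr0 big_ord_recl big_ord0 /= expr0 scale1r !addr0.
move=> /(_ r0) H; have /eqP : nm (h z0 - c 0%N) == 0 by rewrite eq_le H nm_ge0.
move/eqP; rewrite nm_eq0 subr_eq0 => /eqP ->.
by have := cb 0%N; rewrite expr0 divr1.
Qed.

(** On the complex line [x + a *: v] the available radius is [R0 / nm v]; Cauchy's estimates with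
    half of it bound the differential and the quadratic remainder by constants that involve only
    [R0] and [M], and such bounds survive a uniform limit. *)
Lemma second_order (V : normedModType C) (h : V -> W) (x : V) (R0 M : R)
    (L : {linear V -> W}) : 0 < R0 ->
  (forall y, nm (y - x) < R0 -> differentiable h y) ->
  (forall y, nm (y - x) < R0 -> nm (h y) <= M) ->
  (forall e : R, 0 < e -> exists2 d : R, 0 < d & forall v, nm v < d ->
      nm (h (x + v) - h x - L v) <= e * nm v) ->
  (forall v, nm (L v) <= 2 * M / R0 * nm v) /\
  forall v, nm v <= R0 / 4 -> nm (h (x + v) - h x - L v) <= 8 * M / R0 ^+ 2 * nm v ^+ 2.
Proof.
move=> R00 hD hM hL.
have M0 : 0 <= M by apply: le_trans (hM x _); rewrite ?nm_ge0 // subrr nm0.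
have key v : v != 0 -> nm (L v) <= 2 * M / R0 * nm v /\
    (nm v <= R0 / 4 -> nm (h (x + v) - h x - L v) <= 8 * M / R0 ^+ 2 * nm v ^+ 2).
  move=> v0; have s0 : 0 < nm v by rewrite lt_neqAle eq_sym nm_eq0 v0 nm_ge0.
  pose r' := R0 / nm v; pose r := r' / 2.
  have r'0 : 0 < r' by rewrite divr_gt0.
  have r0 : 0 < r by rewrite divr_gt0.
  have rr : r < r' by rewrite /r; lra.
  pose H (a : C) := h (x + a *: v).
  have inb (a : C) : nm (a - 0) < r' -> nm (x + a *: v - x) < R0.
    by rewrite subr0 addrAC subrr add0r nmZ => ar; rewrite -ltr_pdivlMr.
  have HD z : nm (z - 0) < r' -> differentiable H z.
    by move=> zr; apply: comp_line_diff; apply: hD; exact: inb.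
  have HM (t : R) : 0 <= t <= 1 -> nm (H (0 + toC r * Ec t)) <= M.
    move=> _; apply: hM; apply: inb.
    by rewrite add0r subr0 nmM nm_Ec mulr1 nm_toC gtr0_norm.
  have [c cb hc] := vtaylor r0 rr HD HM.
  have c0 : c 0%N = h x.
    have := hc 0 1%N; rewrite nm0 mul0r expr1 mul0r mulr0 big_ord_recl big_ord0 /= expr0 scale1r !addr0.
    move=> /(_ r0) H1; have : nm (H 0 - c 0%N) == 0 by rewrite eq_le H1 nm_ge0.
    by rewrite nm_eq0 subr_eq0 => /eqP <-; rewrite /H scale0r addr0.
  have sumE (a : C) : \sum_(j < 2) a ^+ j *: c j = h x + a *: c 1%N.
    by rewrite !big_ord_recl big_ord0 /= addr0 expr0 scale1r c0.
  (* Both are the first order term along [v]: their remainders are compared at [toC s *: v] for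
     small [s]. *)
  have c1 : c 1%N = L v.
    apply/eqP; rewrite -subr_eq0 -nm_eq0 eq_le nm_ge0 andbT.
    apply/ler_addgt0Pr => e e0; rewrite add0r.
    have e1 : 0 < e / 2 / nm v by rewrite !divr_gt0.
    have [d d0 dL] := hL _ e1.
    pose B := 2 * `|M| / r ^+ 2.
    have B0 : 0 <= B by apply: divr_ge0; [exact: mulr_ge0|exact: sqr_ge0].
    pose s := Num.min (Num.min (r / 2) (d / 2 / nm v)) (e / 2 / (B + 1)).
    have sp : 0 < s by rewrite !lt_min !divr_gt0 //; lra.
    have s1 : s <= r / 2 by rewrite /s !ge_min lexx.
    have s2 : s <= d / 2 / nm v by rewrite /s !ge_min lexx orbT.
    have s3 : s <= e / 2 / (B + 1) by rewrite /s !ge_min lexx !orbT.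
    have ns : nm (toC s) = s by rewrite nm_toC gtr0_norm.
    have := @expansion_half R W H 0 c r M (toC s) 2 r0 hc; rewrite ns add0r sumE => /(_ s1) h1.
    have sv : nm (toC s *: v) < d.
      by rewrite nmZ ns; move: s2; rewrite ler_pdivlMr //; lra.
    have := dL _ sv; rewrite linearZZ nmZ ns => h2.
    have : nm (toC s *: (c 1%N - L v)) <= B * s ^+ 2 + e / 2 / nm v * (s * nm v).
      rewrite scalerBr.
      rewrite (_ : _ - _ = (h (x + toC s *: v) - h x - toC s *: L v) - (H (toC s) - (h x + toC s *: c 1%N))); last first.
        by rewrite /H -[_ - h x - _]addrA -opprD [RHS]addrC opprB subrKA opprD addrACA subrr add0r.
      by apply: le_trans (nmD _ _) _; rewrite nmN addrC; apply: lerD.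
    rewrite nmZ ns.
    have -> : B * s ^+ 2 + e / 2 / nm v * (s * nm v) = s * (B * s + e / 2).
      by field; rewrite gt_eqF.
    rewrite ler_pM2l // => h3; apply: le_trans h3 _.
    have : B * s <= e / 2; last by lra.
    apply: (@le_trans _ _ (B * (e / 2 / (B + 1)))); first by rewrite ler_wpM2l.
    by rewrite mulrCA ger_pMr ?divr_gt0 // ler_pdivrMr; lra.
  split; first by have := cb 1%N; rewrite c1 expr1 /r /r'; congr (_ <= _); field; rewrite !gt_eqF.
  move=> v4; have r1 : nm (1 : C) <= r / 2.
    rewrite nm1 /r /r' (_ : R0 / nm v / 2 / 2 = R0 / 4 / nm v); last by field; rewrite gt_eqF.
    by rewrite ler_pdivlMr // mul1r.
  have H1 := expansion_half 2 r0 hc r1.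
  rewrite nm1 add0r sumE scale1r c1 expr1n mulr1 in H1.
  have H1E : H 1 = h (x + v) by rewrite /H scale1r.
  rewrite H1E opprD addrA in H1.
  apply: le_trans H1 _; rewrite ger0_norm // le_eqVlt; apply/orP; left; apply/eqP.
  by rewrite /r /r'; field; rewrite !gt_eqF.
split=> v; have [->|/key[]//] := eqVneq v 0.
  by rewrite linear0 !nm0 mulr0.
by rewrite addr0 linear0 !subr0 subrr !nm0 expr0n mulr0.
Qed.

(** [second_order] applied to differences [hn m - hn n] shows that the differentials form a Cauchy
    sequence on each vector; their limit is linear, and the quadratic remainder estimate passes to
    the limit. *)
Lemma uniform_limit_diff (V : normedModType C) (hn : nat -> V -> W) (h : V -> W)
    (x : V) (R0 M : R) (e : nat -> R) : 0 < R0 ->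
  (forall n y, nm (y - x) < R0 -> differentiable (hn n) y) ->
  (forall n y, nm (y - x) < R0 -> nm (hn n y) <= M) ->
  (forall n y, nm (y - x) < R0 -> nm (hn n y - h y) <= e n) ->
  (forall n m, (n <= m)%N -> e m <= e n) -> to0 e ->
  differentiable h x.
Proof.
move=> R00 hD hM he ea e0.
have xx : nm (x - x) < R0 by rewrite subrr nm0.
have M0 : 0 <= M by apply: le_trans (hM 0%N x xx); exact: nm_ge0.
have en0 n : 0 <= e n by apply: le_trans (he n x xx); exact: nm_ge0.
have /choice[L HL] n : exists L : {linear V -> W}, 
   forall e : R, 0 < e -> exists2 d : R, 0 < d & forall v, nm v < d ->
      nm (hn n (x + v) - hn n x - L v) <= e * nm v.
  by have /diffP_nm[L [_ LP]] := hD n x xx; exists L.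
have so n := second_order R00 (hD n) (hM n) (HL n).
have Ld n m v : (n <= m)%N -> nm (L m v - L n v) <= 4 * nm v / R0 * e n.
  move=> nm'.
  pose D : {linear V -> W} := (L m \- L n)%R.
  have dD y : nm (y - x) < R0 -> differentiable (fun y => hn m y - hn n y) y.
    by move=> yx; apply: differentiableB; exact: hD.
  have [] := @second_order V (fun y => hn m y - hn n y) x R0 (2 * e n) D R00 dD.
  - move=> y yx; have -> : hn m y - hn n y = (hn m y - h y) - (hn n y - h y).
      by rewrite opprB addrA subrK.
    apply: le_trans (nmD _ _) _; rewrite nmN.
    rewrite (_ : 2 * e n = e n + e n); last by ring.
    by apply: lerD; [apply: le_trans (he m y yx) (ea _ _ nm')|exact: he].
  - move=> d d0; have d2 : 0 < d / 2 by lra.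
    have [d1 d10 h1] := HL m _ d2; have [d3 d30 h3] := HL n _ d2.
    exists (Num.min d1 d3) => [|u]; first by rewrite lt_min d10.
    rewrite lt_min => /andP[/h1 H1 /h3 H3].
    rewrite (_ : _ - _ - _ = (hn m (x + u) - hn m x - L m u) - (hn n (x + u) - hn n x - L n u)).
      by apply: le_trans (nmD _ _) _; rewrite nmN; lra.
    rewrite -[D u]/(L m u - L n u); ell2_ring.
  move=> H _; have := H v; rewrite /D /=.
  by congr (_ <= _); field; rewrite gt_eqF.
have /choice[l Hl] v : exists l, forall n, nm (L n v - l) <= 4 * nm v / R0 * e n.
  apply: ell2_complete => [n m nm'|]; first exact: Ld.
  move=> d d0; have c0 : 0 <= 4 * nm v / R0 by rewrite divr_ge0 ?mulr_ge0 ?nm_ge0 // ltW.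
  have d1 : 0 < d / (4 * nm v / R0 + 1) by rewrite divr_gt0 // ltr_wpDl.
  have [N HN] := e0 _ d1; exists N => n /HN.
  rewrite ltr_pdivlMr ?ltr_wpDl // => h1; apply: le_lt_trans h1.
  by rewrite mulrC ler_wpM2l // lerDl.
have small (v w : W) (K : R) : 0 <= K -> (forall n, nm (v - w) <= K * e n) -> v = w.
  move=> K0 H; apply/eqP; rewrite -subr_eq0 -nm_eq0 eq_le nm_ge0 andbT.
  apply/ler_addgt0Pr => d d0; rewrite add0r.
  have d1 : 0 < d / (K + 1) by rewrite divr_gt0 // ltr_wpDl.
  have [N HN] := e0 _ d1; apply: le_trans (H N) _.
  have := HN N (leqnn N); rewrite ltr_pdivlMr ?ltr_wpDl // => h1.
  by apply: ltW; apply: le_lt_trans h1; rewrite mulrC ler_wpM2l // lerDl.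
have ll : linear l.
  move=> a u v; apply: (@small _ _ (4 * nm (a *: u + v) / R0 + nm a * (4 * nm u / R0) + 4 * nm v / R0)).
    by rewrite !addr_ge0 ?mulr_ge0 ?nm_ge0 ?invr_ge0 // ltW.
  move=> n.
  have -> : l (a *: u + v) - (a *: l u + l v) =
    - (L n (a *: u + v) - l (a *: u + v)) + (a *: (L n u - l u) + (L n v - l v)).
    by rewrite linearP; ell2_ring.
  apply: le_trans (nmD _ _) _; rewrite nmN.
  have n1 := Hl (a *: u + v) n; have n2 := ler_wpM2l (nm_ge0 a) (Hl u n); have n3 := Hl v n.
  have n4 := nmD (a *: (L n u - l u)) (L n v - l v); rewrite nmZ in n4.
  by rewrite 2!mulrDl; rewrite mulrA in n2; lra.
pose lL : {linear V -> W} := HB.pack l (GRing.isLinear.Build _ _ _ _ l ll).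
have fin v : nm v <= R0 / 4 -> nm (h (x + v) - h x - l v) <= 8 * M / R0 ^+ 2 * nm v ^+ 2.
  move=> v4; apply/ler_addgt0Pr => d d0.
  have v0 := nm_ge0 v.
  have c0 : 0 <= 4 * nm v / R0 by rewrite divr_ge0 ?mulr_ge0 ?nm_ge0 // ltW.
  have d1 : 0 < d / (4 * nm v / R0 + 2) by rewrite divr_gt0 //; lra.
  have [N HN] := e0 _ d1; have := HN N (leqnn N); rewrite ltr_pdivlMr; last by lra.
  move=> {}HN; have [_ /(_ v v4) H1] := so N.
  have xv : nm (x + v - x) < R0 by rewrite addrAC subrr add0r; lra.
  have H2 := he N _ xv; have H3 := he N _ xx; have H4 := Hl v N.
  rewrite (_ : _ - _ - _ = (hn N (x + v) - hn N x - L N v) - (hn N (x + v) - h (x + v)) + (hn N x - h x) + (L N v - l v)).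
    apply: le_trans (nmD _ _) _; apply: le_trans (lerD (nmD _ _) (lexx _)) _.
    apply: le_trans (lerD (lerD (nmD _ _) (lexx _)) (lexx _)) _; rewrite nmN.
    by rewrite mulrDr in HN; lra.
  by ell2_ring.
apply/diffP_nm; exists lL; split.
  exists (2 * M / R0 + 4 / R0 * e 0%N) => v; rewrite -[lL v]/(l v).
  have [/(_ v) h1 _] := so 0%N; have h2 := Hl v 0%N.
  have h3 := nmD (L 0%N v) (- (L 0%N v - l v)); rewrite nmN opprB addrC subrK in h3.
  by rewrite mulrDl; lra.
move=> d d0; pose B := 8 * M / R0 ^+ 2.
have B0 : 0 <= B by rewrite divr_ge0 ?mulr_ge0 ?exprn_ge0 // ltW.
exists (Num.min (R0 / 4) (d / (B + 1))) => [|v]; first by rewrite lt_min !divr_gt0 //; lra.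
rewrite lt_min => /andP[v4 vd]; apply: le_trans (fin v (ltW v4)) _.
rewrite expr2 mulrA ler_wpM2r ?nm_ge0 //.
move: vd; rewrite ltr_pdivlMr; last by lra.
by have := nm_ge0 v; rewrite -/B; nra.
Qed.

End HolomorphicLimits.

(** * Taylor coefficients depending on a parameter *)

Section Coefficients.
Variable R : realType.
Local Notation C := (Cx R).
Local Notation W := (ell2 R).

(** The j-th coefficient is the limit of [hn n]: the value at [tau n] minus the lower terms, divided
    by [tau n ^+ j]. These are holomorphic in [y] by induction on [j], and they converge uniformly
    since the expansions share one radius and one bound. *)
Lemma coef_diff (V : normedModType C) (H : C -> V -> W) (c : nat -> V -> W)
    (y0 : V) (eta r' r M : R) : 0 < r -> r < r' ->
  (forall a y, nm a < r' -> nm (y - y0) < eta -> differentiable (H a) y) ->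
  (forall j y, nm (y - y0) < eta -> nm (c j y) <= M / r ^+ j) ->
  (forall y, nm (y - y0) < eta -> expansion (fun a => H a y) 0 (fun j => c j y) r M) ->
  forall j y, nm (y - y0) < eta -> differentiable (c j) y.
Proof.
move=> r0 rr HD cM cE; elim/ltn_ind => j IH y yr.
have M0 : 0 <= M.
  by have := cM 0%N _ yr; rewrite expr0 divr1; apply: le_trans; exact: nm_ge0.
pose tau n : C := toC (r / 2 / 2 ^+ n).
have taup n : 0 < r / 2 / 2 ^+ n by rewrite !divr_gt0 ?exprn_gt0.
have ntau n : nm (tau n) = r / 2 / 2 ^+ n by rewrite nm_toC gtr0_norm.
have tau0 n : tau n != 0 by rewrite -nm_eq0 ntau gt_eqF.
have tau_le n : nm (tau n) <= r / 2.
  by rewrite ntau ler_pdivrMr ?exprn_gt0 //; apply: ler_peMr; [lra|apply: exprn_ege1; lra].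
have inb v : nm (v - y) < eta - nm (y - y0) -> nm (v - y0) < eta.
  by move=> h; rewrite -[v](subrK y) -addrA; apply: le_lt_trans (nmD _ _) _; lra.
pose K := 2 * `|M| / r ^+ j.+1.
have K0 : 0 <= K by rewrite /K; apply: divr_ge0; [exact: mulr_ge0|rewrite exprn_ge0 // ltW].
pose e n := K * (r / 2 / 2 ^+ n).
pose hn n v := (tau n ^+ j)^-1 *: (H (tau n) v - \sum_(i < j) tau n ^+ i *: c i v).
have he n v : nm (v - y) < eta - nm (y - y0) -> nm (hn n v - c j v) <= e n.
  move=> /inb vr; have := expansion_half j.+1 r0 (cE v vr) (tau_le n).
  rewrite add0r big_ord_recr /= => h.
  have E : tau n ^+ j *: (hn n v - c j v) = H (tau n) v - (\sum_(i < j) tau n ^+ i *: c i v + tau n ^+ j *: c j v).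
    by rewrite /hn scalerBr scalerA divff ?expf_neq0 // scale1r opprD addrA.
  rewrite -E nmZ nmX ntau -/K in h.
  rewrite -(@ler_pM2l _ ((r / 2 / 2 ^+ n) ^+ j)) ?exprn_gt0 //.
  by apply: le_trans h _; rewrite /e exprSr; rewrite le_eqVlt; apply/orP; left; apply/eqP; ring.
have e_anti n m : (n <= m)%N -> e m <= e n.
  move=> nm'; apply: ler_wpM2l => //; apply: ler_wpM2l; first lra.
  by rewrite lef_pV2 ?posrE ?exprn_gt0 // ler_eXn2l ?ltr1n.
apply: (@uniform_limit_diff R V hn (c j) y (eta - nm (y - y0)) (M / r ^+ j + e 0%N) e).
- by rewrite subr_gt0.
- move=> n v /inb vr; apply: differentiableZ; apply: differentiableB.
    by apply: HD => //; have := tau_le n; lra.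
  rewrite (_ : (fun u => _) = \sum_(i < j) (fun u => tau n ^+ i *: c i u)); last first.
    by apply/funext => u; rewrite fct_sumE.
  apply: differentiable_sum => i; apply: differentiableZ; exact: IH.
- move=> n v vr; rewrite -[hn n v](subrK (c j v)) addrC.
  apply: le_trans (nmD _ _) _; apply: lerD; first by apply: cM; exact: inb.
  by apply: le_trans (he n v vr) _; exact: e_anti.
- exact: he.
- exact: e_anti.
- move=> d d0; have [N HN] := geo_to0 (K * (r / 2)) d0; exists N => n /HN.
  by move=> h; rewrite /e [X in X < _]mulrA.
Qed.

End Coefficients.

(** * Holomorphic maps into a manifold and the identity theorem *)

Section Manifold.
Variable R : realType.
Local Notation C := (Cx R).
Local Notation W := (ell2 R).
Variable X : hilbert_manifold R.
Implicit Types V : normedModType C.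

(** The pointwise content of [holomorphic_on], for maps from any normed space, because joint maps on
    products will occur. *)
Definition hol_at V (f : V -> X) (z : V) : Prop := {for z, continuous f} /\
  forall c, atlas c -> chart_dom c (f z) -> differentiable (chart_map c \o f) z.

Lemma hol_at_comp V (U : normedModType C) (f : V -> X) (phi : U -> V) z :
  differentiable phi z -> hol_at f (phi z) -> hol_at (f \o phi) z.
Proof.
move=> dp [fc fd]; split.
  by apply: continuous_comp => //; exact: differentiable_continuous.
move=> c ac cz; exact: (differentiable_comp dp (fd c ac cz)).
Qed.

Lemma hol_at_near V (f g : V -> X) z (e : R) : 0 < e ->
  (forall y, nm (y - z) < e -> f y = g y) -> hol_at f z -> hol_at g z.
Proof.
move=> e0 fg [fc fd].
have fz : f z = g z by apply: fg; rewrite subrr nm0.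
split.
  apply/cont_nmP => A; rewrite -fz => /((cont_nmP _ _).1 fc)[d d0 dA].
  exists (Num.min d e) => [|y]; first by rewrite lt_min d0.
  by rewrite lt_min => /andP[/dA fA /fg <-].
move=> c ac; rewrite -fz => /(fd c ac) => h; apply: diff_near h; first exact: e0.
by move=> y /fg /= ->.
Qed.

Lemma hol_at_chart_inv V (h : V -> W) z (c : chart R X) : atlas c ->
  differentiable h z -> chart_cod c (h z) -> hol_at (chart_inv c \o h) z.
Proof.
move=> ac dh cz; split.
  apply: (@continuous_comp _ _ _ h (chart_inv c)).
    exact: differentiable_continuous.
  exact: (chart_inv_cont cz).
move=> d ad dz; exact: (differentiable_comp dh (atlas_compat ac ad cz dz)).
Qed.

(** Connectedness of [0, 1]: the local rule at the supremum of the points with [P] leads from a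
    point just below it to one beyond it, unless it is 1. *)
Lemma interval_chain (P : R -> Prop) :
  (forall s : R, 0 <= s <= 1 -> exists2 rho : R, 0 < rho & forall t t' : R,
     0 <= t <= 1 -> 0 <= t' <= 1 -> `|t - s| < rho -> `|t' - s| < rho -> P t -> P t') ->
  P 0 -> P 1.
Proof.
move=> loc P0; pose S := [set t : R | 0 <= t <= 1 /\ P t].
have S0 : S 0 by split => //; rewrite lexx ler01.
have Sub : has_ubound S by exists 1 => t [/andP[]].
have hS : has_sup S by split => //; exists 0.
pose s := sup S.
have s01 : 0 <= s <= 1.
  apply/andP; split; first exact: ub_le_sup.
  by apply: ge_sup; [exists 0|move=> t [/andP[]]].
have [rho r0 H] := loc s s01.
have [t St ts] := sup_adherent r0 hS; have [t01 Pt] := St.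
have ts' : t <= s by exact: ub_le_sup.
pose t' := Num.min 1 (s + rho / 2).
have /andP[s0 s1] := s01.
have t'01 : 0 <= t' <= 1 by rewrite le_min ler01 ge_min lexx /= andbT; lra.
have st' : s <= t' by rewrite le_min s1 /=; lra.
have t'r : `|t' - s| < rho.
  rewrite ger0_norm ?subr_ge0 //; have : t' <= s + rho / 2 by rewrite ge_min lexx orbT.
  lra.
have tr : `|t - s| < rho by rewrite ler0_norm ?subr_le0 // -/s in ts *; lra.
have Pt' := H t t' t01 t'01 tr t'r Pt.
have : t' <= s by apply: ub_le_sup.
rewrite /t' ge_min => /orP[h|h]; last by lra.
have s1E : s = 1 by apply/eqP; rewrite eq_le s1 h.
by move: Pt'; rewrite /t' s1E min_l //; lra.
Qed.

(** Agreement near a point is propagated along [0, 1]. Where the two values differ, the Hausdorff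
    property rules out agreement nearby; where they coincide, one chart contains both maps, and
    their difference in it is treated by [holomorphic_zero]. *)
Lemma identity_line (f g : C -> X) (d : R) : 0 < d ->
  (forall s : R, 0 <= s <= 1 -> exists2 rho : R, 0 < rho &
     forall z, nm (z - toC s) < rho -> hol_at f z /\ hol_at g z) ->
  (forall z, nm z < d -> f z = g z) -> f 1 = g 1.
Proof.
move=> d0 fgh fg0.
pose P (s : R) := exists2 e : R, 0 < e & forall z, nm (z - toC s) < e -> f z = g z.
suff [e e0 He] : P 1 by apply: He; rewrite subrr nm0.
apply: interval_chain; last first.
  by exists d => // z; rewrite subr0; exact: fg0.
move=> s s01; have [rho r0 Hr] := fgh s s01.
have ss : nm (toC s - toC s) < rho by rewrite subrr nm0.
have [[fc fd] [gc gd]] := Hr _ ss.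
have dist (t u : R) : nm (toC t - toC u) = `|t - u|.
  by rewrite -nm_toC /toC rmorphB.
have [fgs|fgs] := pselect (f (toC s) = g (toC s)); last first.
  have := @mspace_hausdorff _ X; rewrite open_hausdorff.
  move=> /(_ _ _ (introN eqP fgs))[[A B] /= [A1 B1] [oA oB /eqP AB]].
  have /((cont_nmP _ _).1 fc)[e1 e10 HA] : nbhs (f (toC s)) A.
    by apply: open_nbhs_nbhs; split => //; rewrite inE in A1.
  have /((cont_nmP _ _).1 gc)[e2 e20 HB] : nbhs (g (toC s)) B.
    by apply: open_nbhs_nbhs; split => //; rewrite inE in B1.
  exists (Num.min e1 e2) => [|t t' t01 t'01]; first by rewrite lt_min e10.
  rewrite lt_min => /andP[t1 t2] _ [e e0 He].
  exfalso; have : (A `&` B) (f (toC t)).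
    split; first by apply: HA; rewrite dist.
    rewrite He ?subrr ?nm0 //; by apply: HB; rewrite dist.
  by rewrite AB.
have [c ac cs] := @atlas_cover _ X (f (toC s)).
have oc : nbhs (f (toC s)) (chart_dom c).
  by apply: open_nbhs_nbhs; split => //; exact: chart_dom_open.
have /((cont_nmP _ _).1 fc)[e1 e10 H1] := oc.
rewrite fgs in oc; have /((cont_nmP _ _).1 gc)[e2 e20 H2] := oc.
have cs' : chart_dom c (g (toC s)) by rewrite -fgs.
have /contP/(_ 1 ltr01)[e3 e30 H3] := differentiable_continuous (fd c ac cs).
have /contP/(_ 1 ltr01)[e4 e40 H4] := differentiable_continuous (gd c ac cs').
pose e := Num.min rho (Num.min (Num.min e1 e2) (Num.min e3 e4)).
have e0 : 0 < e by rewrite !lt_min r0 e10 e20 e30 e40.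
pose h z : W := chart_map c (f z) - chart_map c (g z).
pose M := nm (chart_map c (f (toC s))) + nm (chart_map c (g (toC s))) + 2.
have he z : nm (z - toC s) < e -> [/\ differentiable h z, nm (h z) <= M & h z = 0 -> f z = g z].
  rewrite !lt_min => /and3P[zr /andP[z1 z2] /andP[z3 z4]].
  have [[_ fdz] [_ gdz]] := Hr _ zr; split.
  - apply: differentiableB; first exact: (fdz c ac (H1 _ z1)).
    exact: (gdz c ac (H2 _ z2)).
  - have := H3 _ z3; have := H4 _ z4 => /= n1 n2.
    rewrite /h /M; apply: le_trans (nmD _ _) _; rewrite nmN.
    have := nmD (chart_map c (f z) - chart_map c (f (toC s))) (chart_map c (f (toC s))).
    have := nmD (chart_map c (g z) - chart_map c (g (toC s))) (chart_map c (g (toC s))).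
    by rewrite !subrK; lra.
  - move=> /eqP; rewrite subr_eq0 => /eqP E.
    by rewrite -(chart_mapK (H1 _ z1)) -(chart_mapK (H2 _ z2)) E.
(* The disc of radius [e / 2] about [t] lies in the disc of radius [e] about [s] and contains
   [t']. *)
exists (e / 4) => [|t t' t01 t'01 ts t's [k k0 Hk]]; first by rewrite divr_gt0.
have inb z : nm (z - toC t) < e / 2 -> nm (z - toC s) < e.
  move=> h1; rewrite -[z](subrK (toC t)) -addrA; apply: le_lt_trans (nmD _ _) _.
  by rewrite dist; lra.
have hz : forall z, nm (z - toC t) < e / 2 -> h z = 0.
  apply: (@holomorphic_zero R h (toC t) (e / 2) k M k0).
  - by move=> z zt; have [] := he z (inb z zt).
  - by move=> z zt; have [] := he z (inb z zt).
  - by move=> z zt; rewrite /h (Hk z zt) subrr.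
have tt' : `|t' - t| < e / 2.
  have -> : t' - t = (t' - s) - (t - s) by ring.
  by apply: le_lt_trans (ler_normB _ _) _; lra.
exists (e / 2 - `|t' - t|) => [|z zt]; first by rewrite subr_gt0.
have zt2 : nm (z - toC t) < e / 2.
  rewrite -[z](subrK (toC t')) -addrA; apply: le_lt_trans (nmD _ _) _.
  by rewrite dist; lra.
by have [_ _] := he z (inb z zt2); apply; exact: hz.
Qed.

(** Reduction to the complex line through [a] and [b], on which the segment becomes [0, 1]. *)
Lemma identity_segment V (D : set V) (f g : V -> X) (a b : V) (d : R) : 0 < d ->
  open D -> (forall z, D z -> hol_at f z /\ hol_at g z) ->
  (forall t : R, 0 <= t <= 1 -> D (a + toC t *: (b - a))) ->
  (forall z, nm (z - a) < d -> f z = g z) -> f b = g b.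
Proof.
move=> d0 oD fgh seg fga.
pose phi (t : C) := a + t *: (b - a).
have phi1 : phi 1 = b by rewrite /phi scale1r subrKC.
rewrite -phi1; apply: (@identity_line (f \o phi) (g \o phi) (d / (nm (b - a) + 1))).
- by rewrite divr_gt0 // ltr_wpDl ?nm_ge0.
- move=> s s01.
  have /contP phic := differentiable_continuous (line_diff a (b - a) (toC s)).
  have /nbhs_nmP[e e0 He] : nbhs (phi (toC s)) D.
    by apply: open_nbhs_nbhs; split => //; exact: seg.
  have [rho r0 Hr] := phic e e0; exists rho => // z /Hr /He /fgh[h1 h2].
  by split; apply: hol_at_comp => //; exact: line_diff.
- move=> z; rewrite ltr_pdivlMr ?ltr_wpDl ?nm_ge0 // => zd /=.
  apply: fga; rewrite /phi addrAC subrr add0r nmZ; apply: le_lt_trans zd.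
  by rewrite ler_wpM2l ?nm_ge0 // lerDl.
Qed.

End Manifold.

(** * Touching domains *)

Section RealPolynomials.
Variable R : realType.
Local Notation C := (Cx R).
Variable n : nat.
Local Notation V := 'rV[C]_n.

Definition has_d (u : V -> R) (z v : V) (d : R) := is_derive (0 : R) (1 : R) (along u z v) d.

Lemma has_d_rderiv u z v d : has_d u z v d -> rderiv v u z = d.
Proof. by move=> [h <-]; rewrite /rderiv derive1E. Qed.

Lemma has_d_derivable u z v d : has_d u z v d -> derivable (along u z v) 0 1.
Proof. by case. Qed.

Lemma has_d_cst c z v : has_d (fun=> c) z v 0.
Proof. exact: is_derive_cst. Qed.

Lemma has_dD u w z v d e : has_d u z v d -> has_d w z v e ->
  has_d (fun y => u y + w y) z v (d + e).
Proof. by move=> ud we; apply: is_deriveD. Qed.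

Lemma has_dM u w z v d e : has_d u z v d -> has_d w z v e ->
  has_d (fun y => u y * w y) z v (u z * e + w z * d).
Proof.
move=> ud we; have := is_deriveM ud we.
by rewrite /along /= scale0r addr0.
Qed.

Lemma along_affine u z v (d : R) : (forall t : R, along u z v t = u z + t * d) -> has_d u z v d.
Proof.
move=> H; rewrite /has_d (_ : along u z v = (fun t => u z + t * d)); last exact/funext.
apply/rdP => e e0; exists 1 => // h _.
by rewrite (_ : _ - _ = 0) ?normr0 ?mulr_ge0 // ?ltW //; ring.
Qed.

Lemma has_d_re j z v : has_d (fun y : V => complex.Re (y 0 j)) z v (complex.Re (v 0 j)).
Proof.
apply: along_affine => t; rewrite /along !mxE.
by case: (z 0 j) (v 0 j) => a b [c d] /=; ring.
Qed.

Lemma has_d_im j z v : has_d (fun y : V => complex.Im (y 0 j)) z v (complex.Im (v 0 j)).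
Proof.
apply: along_affine => t; rewrite /along !mxE.
by case: (z 0 j) (v 0 j) => a b [c d] /=; ring.
Qed.

Lemma has_d_sum m (u : 'I_m -> V -> R) z v (d : 'I_m -> R) :
  (forall j, has_d (u j) z v (d j)) ->
  has_d (fun y => \sum_(j < m) u j y) z v (\sum_(j < m) d j).
Proof.
elim: m u d => [|m IH] u d H.
  rewrite big_ord0 (_ : (fun y => _) = fun=> 0); first exact: has_d_cst.
  by apply/funext => y; rewrite big_ord0.
rewrite big_ord_recr /= (_ : (fun y => _) = fun y => (\sum_(j < m) u (widen_ord (leqnSn m) j) y) + u ord_max y).
  by apply: has_dD => //; apply: IH => j.
by apply/funext => y; rewrite big_ord_recr.
Qed.

(** Polynomials in the real and imaginary parts of the coordinates: stable under every [rderiv v],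
    hence of class [Ck_on k] for all [k]. *)
Inductive rpol : (V -> R) -> Prop :=
| rpol_cst c : rpol (fun=> c)
| rpol_re j : rpol (fun y => complex.Re (y 0 j))
| rpol_im j : rpol (fun y => complex.Im (y 0 j))
| rpolD u w : rpol u -> rpol w -> rpol (fun y => u y + w y)
| rpolM u w : rpol u -> rpol w -> rpol (fun y => u y * w y).

Lemma rpol_sum m (u : 'I_m -> V -> R) : (forall j, rpol (u j)) -> rpol (fun y => \sum_(j < m) u j y).
Proof.
elim: m u => [|m IH] u H.
  rewrite (_ : (fun y => _) = fun=> 0); first exact: rpol_cst.
  by apply/funext => y; rewrite big_ord0.
rewrite (_ : (fun y => _) = fun y => (\sum_(j < m) u (widen_ord (leqnSn m) j) y) + u ord_max y).
  by apply: rpolD => //; apply: IH => j.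
by apply/funext => y; rewrite big_ord_recr.
Qed.

Lemma coord_continuous (j : 'I_n) : continuous (fun y : V => (y 0 j : C)).
Proof. exact: coord_continuous. Qed.

Lemma rpol_cont u : rpol u -> continuous u.
Proof.
elim=> [c|j|j|{}u w _ cu _ cw|{}u w _ cu _ cw] z.
- exact: cst_continuous.
- exact: (continuous_comp (@coord_continuous j z) (@Re_cont R _)).
- exact: (continuous_comp (@coord_continuous j z) (@Im_cont R _)).
- exact: (continuousD (cu z) (cw z)).
- exact: (continuousM (cu z) (cw z)).
Qed.

Lemma rpol_d u : rpol u -> forall v, exists du, rpol du /\ forall z, has_d u z v (du z).
Proof.
elim=> [c|j|j|{}u w pu IHu pw IHw|{}u w pu IHu pw IHw] v.
- exists (fun=> 0); split; [exact: rpol_cst|move=> z; exact: has_d_cst].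
- exists (fun=> complex.Re (v 0 j)); split; [exact: rpol_cst|move=> z; exact: has_d_re].
- exists (fun=> complex.Im (v 0 j)); split; [exact: rpol_cst|move=> z; exact: has_d_im].
- have [du [pdu hu]] := IHu v; have [dw [pdw hw]] := IHw v.
  exists (fun z => du z + dw z); split; first exact: rpolD.
  by move=> z; apply: has_dD.
- have [du [pdu hu]] := IHu v; have [dw [pdw hw]] := IHw v.
  exists (fun z => u z * dw z + w z * du z); split; first by apply: rpolD; apply: rpolM.
  by move=> z; apply: has_dM.
Qed.

Lemma rpol_Ck k u U : rpol u -> Ck_on k U u.
Proof.
elim: k u => [|k IH] u pu; split => //; try by move=> z _; exact: rpol_cont.
move=> v; have [du [pdu hu]] := rpol_d pu v; split.
  by move=> z _; exact: has_d_derivable (hu z).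
rewrite (_ : rderiv v u = du); first exact: IH.
by apply/funext => z; exact: has_d_rderiv.
Qed.

End RealPolynomials.

(** * The polynomial that defines the touching domain *)

Section Touching.
Variable R : realType.
Local Notation C := (Cx R).
Variable n : nat.
Local Notation V := 'rV[C]_n.
Variables (a p : V) (dl M : R).
Hypotheses (dl0 : 0 < dl) (M0 : 0 < M).

(** The form with coefficients [a]; [a] will be the complex gradient of [tu] at [p], so the kernel
    is the complex tangent space there. *)
Definition lin (v : V) : C := \sum_j a 0 j * v 0 j.
Definition sqn (v : V) : R := \sum_j sqmod (v 0 j).
Definition ipr (v w : V) : R := \sum_j (complex.Re (v 0 j) * complex.Re (w 0 j) + complex.Im (v 0 j) * complex.Im (w 0 j)).

Let La := sqn a.
Hypothesis La0 : 0 < La.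

Definition tT (v : V) : R := sqn v - sqmod (lin v) / La.

(* [tu < 0] is a bounded domain touching [p] from inside: [tT] is the squared
   length of the component of [v] killed by [lin], so that [- dl * tT] makes all
   the eigenvalues of the Levi form on the complex tangent space equal to [- dl]. *)
Definition tu (z : V) : R := 2 * complex.Re (lin (z - p)) + M * sqmod (lin (z - p))
  - dl * tT (z - p) + M * tT (z - p) ^+ 2.

Lemma linD v w : lin (v + w) = lin v + lin w.
Proof. by rewrite /lin -big_split; apply: eq_bigr => j _; rewrite mxE mulrDr. Qed.

Lemma linZ c v : lin (c *: v) = c * lin v.
Proof. by rewrite /lin mulr_sumr; apply: eq_bigr => j _; rewrite mxE mulrCA. Qed.

Definition abar : V := \row_j Num.conj (a 0 j).

Lemma toC_sum m (F : 'I_m -> R) : toC (\sum_j F j) = \sum_j toC (F j).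
Proof. exact: rmorph_sum. Qed.

Lemma toC_sqmod (z : C) : toC (sqmod z) = z * Num.conj z.
Proof. by rewrite sqmodE normCK. Qed.

Lemma lin_abar : lin abar = toC La.
Proof.
rewrite /lin /La /sqn toC_sum; apply: eq_bigr => j _.
by rewrite mxE toC_sqmod.
Qed.

(** Orthogonal projection to the kernel of [lin], whose orthogonal complement is spanned by
    [abar]. *)
Definition tpart (v : V) : V := v - (lin v / toC La) *: abar.

Let tLa : toC La != 0.
Proof. by rewrite -nm_eq0 nm_toC normr_eq0 gt_eqF. Qed.

Lemma lin_tpart v : lin (tpart v) = 0.
Proof. by rewrite /tpart -scaleN1r linD !linZ lin_abar divfK // mulN1r subrr. Qed.

Lemma sqn_ge0 v : 0 <= sqn v.
Proof. by apply: sumr_ge0 => j _; exact: sqmod_ge0. Qed.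

Lemma toC_sqn v : toC (sqn v) = \sum_j v 0 j * Num.conj (v 0 j).
Proof.
by rewrite /sqn toC_sum; apply: eq_bigr => j _; rewrite toC_sqmod.
Qed.

(** Pythagoras for the splitting of [v] along [abar]. *)
Lemma tTE v : tT v = sqn (tpart v).
Proof.
apply: (@toC_inj R); rewrite toC_sqn /tT.
have -> : toC (sqn v - sqmod (lin v) / La) = toC (sqn v) - lin v * Num.conj (lin v) / toC La.
  by rewrite -toC_sqmod /toC rmorphB rmorphM fmorphV.
have cLa : Num.conj (toC La) = toC La by rewrite /toC; apply/eqP; rewrite eq_complex /= oppr0 !eqxx.
pose c := lin v / toC La.
have cc : Num.conj c = Num.conj (lin v) / toC La by rewrite -[in RHS]cLa -fmorphV -rmorphM.
rewrite (eq_bigr (fun j => v 0 j * Num.conj (v 0 j) - (Num.conj c * (a 0 j * v 0 j)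
    + c * Num.conj (a 0 j * v 0 j)) + c * Num.conj c * (a 0 j * Num.conj (a 0 j)))).
  rewrite big_split /= sumrB -toC_sqn -mulr_sumr big_split /= -!mulr_sumr -toC_sqn -/La.
  rewrite -(rmorph_sum Num.conj) -/(lin v) cc /c; field; exact: tLa.
move=> j _; rewrite !mxE -/c; move: (c) (v 0 j) (a 0 j) => c0 x y.
rewrite (rmorphB Num.conj) !(rmorphM Num.conj) /=.
have -> : Num.conj (Num.conj y) = y by exact: conjCK.
by ring.
Qed.

Lemma tT_ge0 v : 0 <= tT v.
Proof. by rewrite tTE sqn_ge0. Qed.

(** The completed squares show that [lin] and [tT] are of order [1 / M] where [tu < 0]; this makes
    the domain small. *)
Lemma tuE z : tu z = M * sqmod (lin (z - p) + toC M^-1) + M * (tT (z - p) - dl / (2 * M)) ^+ 2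
   - (1 + dl ^+ 2 / 4) / M.
Proof.
rewrite /tu; case: (lin (z - p)) => x y; move: (tT _) => t; rewrite /sqmod /=.
by field; rewrite !gt_eqF.
Qed.

(** Real inner product of [lin w] and [lin v], half the derivative of [sqmod (lin _)] at [w] along
    [v]. *)
Definition Bf (w v : V) : R := complex.Re (lin w) * complex.Re (lin v) + complex.Im (lin w) * complex.Im (lin v).

Let rpol_lin1 : rpol (fun z => complex.Re (lin (z - p))).
Proof.
rewrite (_ : (fun z => _) = fun z : V => (\sum_j (complex.Re (a 0 j) * complex.Re (z 0 j) +
   (- complex.Im (a 0 j)) * complex.Im (z 0 j))) + (- complex.Re (lin p))).
  apply: rpolD; last exact: rpol_cst.
  apply: rpol_sum => j; apply: rpolD; apply: rpolM; try exact: rpol_cst.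
    exact: rpol_re.
  exact: rpol_im.
apply/funext => z; rewrite -scaleN1r linD linZ mulN1r raddfB /=; congr (_ - _).
by rewrite /lin raddf_sum; apply: eq_bigr => j _; case: (a 0 j) (z 0 j) => ? ? [? ?] /=; ring.
Qed.

Let rpol_lin2 : rpol (fun z => complex.Im (lin (z - p))).
Proof.
rewrite (_ : (fun z => _) = fun z : V => (\sum_j (complex.Re (a 0 j) * complex.Im (z 0 j) +
   (complex.Im (a 0 j)) * complex.Re (z 0 j))) + (- complex.Im (lin p))).
  apply: rpolD; last exact: rpol_cst.
  apply: rpol_sum => j; apply: rpolD; apply: rpolM; try exact: rpol_cst.
    exact: rpol_im.
  exact: rpol_re.
apply/funext => z; rewrite -scaleN1r linD linZ mulN1r raddfB /=; congr (_ - _).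
by rewrite /lin raddf_sum; apply: eq_bigr => j _; case: (a 0 j) (z 0 j) => ? ? [? ?] /=; ring.
Qed.

Let rpol_sqn : rpol (fun z => sqn (z - p)).
Proof.
rewrite (_ : (fun z => _) = fun z : V => (\sum_j ((complex.Re (z 0 j) + - complex.Re (p 0 j)) * (complex.Re (z 0 j) + - complex.Re (p 0 j)) +
   (complex.Im (z 0 j) + - complex.Im (p 0 j)) * (complex.Im (z 0 j) + - complex.Im (p 0 j))))).
  apply: rpol_sum => j; apply: rpolD; apply: rpolM; apply: rpolD;
    by [exact: rpol_re|exact: rpol_im|exact: rpol_cst].
apply/funext => z; rewrite /sqn; apply: eq_bigr => j _; rewrite !mxE /sqmod.
by case: (z 0 j) (p 0 j) => ? ? [? ?] /=; ring.
Qed.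

Let has_lin1 z v : has_d (fun z => complex.Re (lin (z - p))) z v (complex.Re (lin v)).
Proof.
apply: along_affine => t; rewrite /along /= addrAC [in LHS]linD linZ.
by case: (lin (z - p)) (lin v) => ? ? [? ?] /=; ring.
Qed.

Let has_lin2 z v : has_d (fun z => complex.Im (lin (z - p))) z v (complex.Im (lin v)).
Proof.
apply: along_affine => t; rewrite /along /= addrAC [in LHS]linD linZ.
by case: (lin (z - p)) (lin v) => ? ? [? ?] /=; ring.
Qed.

Let has_sqn z v : has_d (fun z => sqn (z - p)) z v (2 * ipr (z - p) v).
Proof.
rewrite /ipr mulr_sumr; apply: has_d_sum => j.
have H1 : has_d (fun y : V => complex.Re (y 0 j) + - complex.Re (p 0 j)) z v (complex.Re (v 0 j) + 0).
  by apply: has_dD; [exact: has_d_re|exact: has_d_cst].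
have H2 : has_d (fun y : V => complex.Im (y 0 j) + - complex.Im (p 0 j)) z v (complex.Im (v 0 j) + 0).
  by apply: has_dD; [exact: has_d_im|exact: has_d_cst].
have := has_dD (has_dM H1 H1) (has_dM H2 H2).
rewrite (_ : (fun y => _) = (fun y => sqmod ((y - p) 0 j))); last first.
  by apply/funext => y; rewrite !mxE /sqmod; case: (y 0 j) (p 0 j) => ? ? [? ?] /=; ring.
congr (has_d _ _ _ _); rewrite !mxE.
by case: (z 0 j) (p 0 j) (v 0 j) => ? ? [? ?] [? ?] /=; ring.
Qed.

Let has_sqlin z v : has_d (fun z => sqmod (lin (z - p))) z v (2 * Bf (z - p) v).
Proof.
have := has_dD (has_dM (has_lin1 z v) (has_lin1 z v)) (has_dM (has_lin2 z v) (has_lin2 z v)).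
rewrite (_ : (fun y => _) = (fun y => sqmod (lin (y - p)))); last first.
  by apply/funext => y; rewrite /sqmod !expr2.
by congr (has_d _ _ _ _); rewrite /Bf; ring.
Qed.

Let rpol_sqlin : rpol (fun z => sqmod (lin (z - p))).
Proof.
rewrite (_ : (fun z => _) = fun z : V => complex.Re (lin (z - p)) * complex.Re (lin (z - p)) +
  complex.Im (lin (z - p)) * complex.Im (lin (z - p))).
  by apply: rpolD; apply: rpolM.
by apply/funext => z; rewrite /sqmod !expr2.
Qed.

Lemma rpol_tT : rpol (fun z => tT (z - p)).
Proof.
rewrite (_ : (fun z => _) = fun z : V => sqn (z - p) + (- La^-1) * sqmod (lin (z - p))).
  by apply: rpolD => //; apply: rpolM => //; exact: rpol_cst.
by apply/funext => z; rewrite /tT; ring.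
Qed.

Definition dtT (w v : V) : R := 2 * ipr w v - 2 * Bf w v / La.

Let has_T z v : has_d (fun z => tT (z - p)) z v (dtT (z - p) v).
Proof.
have := has_dD (has_sqn z v) (has_dM (has_d_cst (- La^-1) z v) (has_sqlin z v)).
rewrite (_ : (fun y => _) = (fun y => tT (y - p))); last by apply/funext => y; rewrite /tT; ring.
by congr (has_d _ _ _ _); rewrite /dtT; ring.
Qed.

Lemma rpol_tu : rpol tu.
Proof.
rewrite (_ : tu = fun z : V => 2 * complex.Re (lin (z - p)) + M * sqmod (lin (z - p))
  + (- dl) * tT (z - p) + M * (tT (z - p) * tT (z - p))); last first.
  by apply/funext => z; rewrite /tu; ring.
by repeat apply: rpolD; apply: rpolM => //; try exact: rpol_cst; try (apply: rpolM); exact: rpol_tT.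
Qed.

Lemma has_tu z v : has_d tu z v (2 * complex.Re (lin v) + 2 * M * Bf (z - p) v +
   (2 * M * tT (z - p) - dl) * dtT (z - p) v).
Proof.
rewrite (_ : tu = fun z : V => 2 * complex.Re (lin (z - p)) + M * sqmod (lin (z - p))
  + (- dl) * tT (z - p) + M * (tT (z - p) * tT (z - p))); last first.
  by apply/funext => y; rewrite /tu; ring.
have := has_dD (has_dD (has_dD (has_dM (has_d_cst 2 z v) (has_lin1 z v))
  (has_dM (has_d_cst M z v) (has_sqlin z v))) (has_dM (has_d_cst (- dl) z v) (has_T z v)))
  (has_dM (has_d_cst M z v) (has_dM (has_T z v) (has_T z v))).
by congr (has_d _ _ _ _); ring.
Qed.

End Touching.

(** * Connectedness and boundary of the touching domain *)

Section TouchingDomain.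
Variable R : realType.
Local Notation C := (Cx R).

Lemma im_unit : 'i%R = (0 +i* 1 : C).
Proof. by []. Qed.

Variable n : nat.
Local Notation V := 'rV[C]_n.

Lemma e_E (j k : 'I_n) : e_ R j 0 k = (k == j)%:R.
Proof. by rewrite /e_ mxE eqxx. Qed.

Lemma ie_E (j k : 'I_n) : ie_ R j 0 k = 'i%R * (k == j)%:R.
Proof. by rewrite /ie_ !mxE eqxx. Qed.

Lemma ipr_e (w : V) k : ipr w (e_ R k) = complex.Re (w 0 k).
Proof.
rewrite /ipr (bigD1 k) //= big1 ?addr0 => [|j jk]; rewrite e_E.
  by rewrite eqxx /=; ring.
by rewrite (negPf jk) /=; ring.
Qed.

Lemma ipr_ie (w : V) k : ipr w (ie_ R k) = complex.Im (w 0 k).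
Proof.
rewrite /ipr (bigD1 k) //= big1 ?addr0 => [|j jk]; rewrite ie_E im_unit.
  by rewrite eqxx /=; ring.
by rewrite (negPf jk) /=; ring.
Qed.

Lemma lin_e (a : V) k : lin a (e_ R k) = a 0 k.
Proof.
rewrite /lin (bigD1 k) //= big1 ?addr0 => [|j jk]; rewrite e_E.
  by rewrite eqxx mulr1.
by rewrite (negPf jk) mulr0.
Qed.

Lemma lin_ie (a : V) k : lin a (ie_ R k) = 'i%R * a 0 k.
Proof.
rewrite /lin (bigD1 k) //= big1 ?addr0 => [|j jk]; rewrite ie_E.
  by rewrite eqxx mulr1 mulrC.
by rewrite (negPf jk) !mulr0.
Qed.

Variables (a p : V) (dl M : R).
Hypotheses (dl0 : 0 < dl) (M0 : 0 < M).
Hypothesis La0 : 0 < sqn a.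
Let La := sqn a.
Let u := tu a p dl M.
Let D : set V := [set z | u z < 0].

Let uc : continuous u.
Proof. by apply: rpol_cont; exact: rpol_tu. Qed.

Lemma touch_open (c : R) : open [set z | u z < c] /\ open [set z | c < u z].
Proof.
split.
  by apply: (open_comp (D := [set t : R | t < c])) => [z _|]; [exact: uc|exact: open_lt].
by apply: (open_comp (D := [set t : R | c < t])) => [z _|]; [exact: uc|exact: open_gt].
Qed.

(** Displacement from [p] to the centre of the domain, where [lin] is [- 1 / M], so that the first
    square of [tuE] vanishes, and the tangential part is 0. *)
Let c0 : V := - (toC (M * La)^-1 *: abar a).

Let tpart_shift (v : V) (b : C) : tpart a (v + b *: abar a) = tpart a v.
Proof.
rewrite /tpart linD linZ lin_abar mulrDl mulfK; last first.
  by rewrite -nm_eq0 nm_toC normr_eq0 gt_eqF.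
by rewrite scalerDl opprD addrACA subrr addr0.
Qed.

Let tpartZ (v : V) (b : C) : tpart a (b *: v) = b *: tpart a v.
Proof. by rewrite /tpart linZ scalerBr scalerA mulrA. Qed.

Let sqnZ (b : C) (v : V) : sqn (b *: v) = sqmod b * sqn v.
Proof. by rewrite /sqn mulr_sumr; apply: eq_bigr => j _; rewrite mxE sqmodM. Qed.

Lemma sqmod_toC (t : R) : sqmod (toC t) = t ^+ 2.
Proof. by rewrite /sqmod /= expr0n addr0. Qed.

Lemma lin_c0 : lin a c0 = - toC M^-1.
Proof.
rewrite /c0 -scaleN1r !linZ lin_abar mulN1r -toCM; congr (- toC _).
by rewrite invfM mulfVK // gt_eqF.
Qed.

Let sqmod0 : sqmod (0 : C) = 0.
Proof. by rewrite /sqmod /= expr0n addr0. Qed.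

Let lin0 : lin a 0 = 0.
Proof. by rewrite /lin big1 // => j _; rewrite mxE mulr0. Qed.

(** Along the segment to the centre [lin + 1 / M] scales by [t] and [tT] by [t ^+ 2]. So [tu]
    depends on [k = t ^+ 2] alone and lies below the chord between its values at the centre and at
    [z], both negative. Star-shapedness supplies the connectedness of the domain. *)
Lemma touch_star z (t : R) : D z -> 0 <= t <= 1 -> D (p + c0 + toC t *: (z - (p + c0))).
Proof.
move=> Dz /andP[t0 t1]; rewrite /D /= /u tuE //.
have : u z < 0 by [].
rewrite /u tuE //.
set v := z - p.
have E : p + c0 + toC t *: (z - (p + c0)) - p = toC t *: v + (1 - toC t) *: c0.
  by rewrite /v; move: c0 => c1; apply/rowP => j; rewrite !mxE; ring.
rewrite E (linD a (toC t *: v)) (linZ a (toC t) v) (linZ a _ c0) lin_c0.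
have -> : toC t * lin a v + (1 - toC t) * - toC M^-1 + toC M^-1 = toC t * (lin a v + toC M^-1) by ring.
rewrite sqmodM sqmod_toC.
have -> : tT a (toC t *: v + (1 - toC t) *: c0) = t ^+ 2 * tT a v.
  by rewrite !tTE // /c0 scalerN -scaleNr scalerA tpart_shift tpartZ sqnZ sqmod_toC.
set s := sqmod _; set T := tT a v; set b := dl / (2 * M) => H.
have b0 : 0 < b by rewrite divr_gt0 // mulr_gt0.
have bE : (1 + dl ^+ 2 / 4) / M = M^-1 + M * b ^+ 2.
  by rewrite /b; field; rewrite gt_eqF.
rewrite bE in H *.
have T0 : 0 <= T by apply: tT_ge0.
have s0 : 0 <= s by exact: sqmod_ge0.
have k01 : 0 <= t ^+ 2 <= 1 by rewrite sqr_ge0 expr_le1.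
have M1 : 0 < M^-1 by rewrite invr_gt0.
move: k01; set k := t ^+ 2 => /andP[k0 k1].
(* convexity in [k] of the quadratic expression *)
have : M * (k * s) + M * (k * T - b) ^+ 2 <= k * (M * s + M * (T - b) ^+ 2) + (1 - k) * (M * b ^+ 2).
  rewrite -subr_ge0 (_ : _ - _ = M * (k * (1 - k)) * T ^+ 2); last by ring.
  by rewrite mulr_ge0 ?sqr_ge0 // mulr_ge0 ?(ltW M0) // mulr_ge0 // subr_ge0.
have P2 : 0 <= (1 - k) * M^-1 by rewrite mulr_ge0 ?subr_ge0 // ltW.
move: k0; rewrite le_eqVlt => /orP[/eqP <-|k0].
  by rewrite !mul0r sub0r sqrrN mulr0 !add0r; lra.
have P1 : 0 < k * (M^-1 + M * b ^+ 2 - (M * s + M * (T - b) ^+ 2)) by rewrite mulr_gt0 //; lra.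
rewrite mulrBr mulrDr in P1; rewrite mulrBl mul1r in P2; lra.
Qed.

Lemma touch_nonempty : D (p + c0).
Proof.
rewrite /D /= /u tuE //.
have -> : p + c0 - p = c0 by rewrite addrC addKr.
rewrite lin_c0 addNr.
have -> : tT a c0 = 0.
  rewrite tTE // /c0 -[X in tpart _ X]add0r -scaleNr tpart_shift /tpart.
  rewrite lin0 mul0r scale0r subr0.
  by rewrite /sqn big1 // => j _; rewrite mxE /sqmod /= expr0n addr0.
rewrite (_ : _ - _ = - M^-1); last first.
  by rewrite sqmod0; field; rewrite gt_eqF.
by rewrite oppr_lt0 invr_gt0.
Qed.

Lemma touch_domain : domain D.
Proof.
split; [by case: (touch_open 0)| |by exists (p + c0); exact: touch_nonempty].
pose seg z := (fun t : R => p + c0 + toC t *: (z - (p + c0))) @` `[0, 1].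
have -> : D = \bigcup_(z in D) seg z.
  apply/seteqP; split => [z Dz|_ [z Dz [t /= t01 <-]]].
    exists z => //; exists 1; first by rewrite /= in_itv /= ler01 lexx.
    by rewrite scale1r subrKC.
  by apply: touch_star => //; rewrite in_itv in t01.
apply: bigcup_connected.
  exists (p + c0) => z Dz; exists 0; first by rewrite /= in_itv /= ler01 lexx.
  by rewrite scale0r addr0.
move=> z Dz; apply: connected_continuous_connected; first exact: segment_connected.
apply: continuous_subspaceT => t.
have tc : {for t, continuous (@toC R)}.
  apply/contRP => e e0; exists e => // h he.
  by rewrite /toC rmorphD addrAC subrr add0r -/(toC h) nm_toC.
exact: (continuous_comp tc (differentiable_continuous (line_diff (p + c0) (z - (p + c0)) (toC t)))).
Qed.

(** At a critical point [lin + 1 / M = 0] and [tT * (2 * M * tT - dl) = 0], and there [tu] is at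
    most [- 1 / M]. The two test vectors point along [abar] and along the tangential part. *)
Lemma touch_grad z : - M^-1 < u z -> exists v, rderiv v u z != 0.
Proof.
move=> uz.
pose s := lin a (z - p) + toC M^-1.
have tLa : toC La != 0 by rewrite -nm_eq0 nm_toC normr_eq0 gt_eqF.
have [s0|s0] := eqVneq s 0; last first.
  pose v := (s / toC La) *: abar a.
  exists v; rewrite (has_d_rderiv (has_tu _ _ _ _ _ _)).
  have lv : lin a v = s by rewrite /v linZ lin_abar divfK.
  have -> : dtT a (z - p) v = 0.
    rewrite /dtT /Bf lv.
    have -> : ipr (z - p) v = (complex.Re (lin a (z - p)) * complex.Re s + complex.Im (lin a (z - p)) * complex.Im s) / La.
      move: (z - p) => w.
      have -> : ipr w v = complex.Re (\sum_j Num.conj (w 0 j) * v 0 j).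
        rewrite raddf_sum; apply: eq_bigr => j _.
        by case: (w 0 j) (v 0 j) => ? ? [? ?] /=; ring.
      have -> : \sum_j Num.conj (w 0 j) * v 0 j = s / toC La * Num.conj (lin a w).
        rewrite /lin (rmorph_sum Num.conj) mulr_sumr; apply: eq_bigr => j _.
        by rewrite (rmorphM Num.conj) !mxE /=; ring.
      have -> : (toC La)^-1 = toC La^-1 by rewrite /toC fmorphV.
      by case: (s) (lin a w) => ? ? [? ?] /=; field; rewrite gt_eqF.
    by rewrite /La; field; rewrite gt_eqF.
  rewrite mulr0 addr0 /Bf lv.
  have -> : 2 * complex.Re s + 2 * M * (complex.Re (lin a (z - p)) * complex.Re s +
     complex.Im (lin a (z - p)) * complex.Im s) = 2 * M * sqmod s.
    rewrite /s; case: (lin a (z - p)) => x y; rewrite /sqmod /=; field; rewrite gt_eqF //.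
  rewrite !mulf_neq0 ?(gt_eqF M0) ?pnatr_eq0 //; apply/eqP => /sqmod_eq0 h.
  by move: s0; rewrite h eqxx.
pose v := tpart a (z - p).
exists v; rewrite (has_d_rderiv (has_tu _ _ _ _ _ _)).
have lv : lin a v = 0 by exact: lin_tpart.
rewrite /dtT /Bf lv /= !(mulr0, addr0, mul0r, subr0, add0r).
have -> : ipr (z - p) v = tT a (z - p).
  have -> : ipr (z - p) v = ipr v v.
    have -> : ipr (z - p) v = ipr v v + ipr ((lin a (z - p) / toC La) *: abar a) v.
      rewrite /ipr -big_split; apply: eq_bigr => j _ /=.
      have -> : (z - p) 0 j = v 0 j + ((lin a (z - p) / toC La) *: abar a) 0 j.
        by rewrite /v /tpart !mxE subrK.
      by case: (v 0 j) (((lin a (z - p) / toC La) *: abar a) 0 j) => ? ? [? ?] /=; ring.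
    rewrite (_ : ipr (_ *: _) v = 0) ?addr0 //.
    move: (_ / _) (v) lv => b {}v lv.
    have -> : ipr (b *: abar a) v = complex.Re (Num.conj b * lin a v).
      rewrite /lin mulr_sumr raddf_sum /ipr; apply: eq_bigr => j _.
      by rewrite !mxE; case: (a 0 j) (v 0 j) (b) => ? ? [? ?] [? ?] /=; ring.
    by rewrite lv mulr0.
  by rewrite tTE // /ipr /sqn; apply: eq_bigr => j _; rewrite /sqmod !expr2.
have := uz; rewrite /u tuE // -/s s0.
rewrite sqmod0.
set T := tT a (z - p) => H.
have T0 : 0 <= T by apply: tT_ge0.
apply/negP => /eqP h.
have : T * (2 * M * T - dl) = 0 by lra.
have Mn : M != 0 by rewrite gt_eqF.
have H2 : - M^-1 < M * (T - dl / (2 * M)) ^+ 2 - (1 + dl ^+ 2 / 4) / M by rewrite mulr0 add0r in H.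
have E : M * (T - dl / (2 * M)) ^+ 2 - (1 + dl ^+ 2 / 4) / M = - M^-1 + T * (M * T - dl) .
  by field.
rewrite E in H2 => h2.
have : T * (M * T) = T * dl / 2 by lra.
have := mulr_ge0 T0 (ltW dl0); lra.
Qed.

Lemma touch_boundary_ge z : boundary D z -> 0 <= u z.
Proof.
move=> [_ nD]; rewrite leNgt; apply/negP => uz; apply: nD.
by have [/interior_id -> _] := touch_open 0.
Qed.

Lemma touch_defining z : boundary D z -> defining_function D z u.
Proof.
move=> /touch_boundary_ge uz.
exists [set y | - M^-1 < u y]; split.
- split; first by case: (touch_open (- M^-1)).
  by rewrite /=; apply: lt_le_trans uz; rewrite oppr_lt0 invr_gt0.
- by apply: rpol_Ck; exact: rpol_tu.
- exact: touch_grad.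
- by [].
Qed.

Lemma touch_C2 : C2_boundary D.
Proof. by move=> z zb; exists u; exact: touch_defining. Qed.

Lemma tu_p : u p = 0.
Proof.
have z0 : lin a (p - p) = 0 by rewrite subrr lin0.
rewrite /u /tu /tT z0 subrr.
have -> : sqn (0 : V) = 0 by rewrite /sqn big1 // => j _; rewrite mxE /sqmod /= expr0n addr0.
by rewrite sqmod0 /=; ring.
Qed.

(** The linear term [- 2 * t * Re (lin a v)] dominates the terms collected in [A], which are at most
    of order [t ^+ 2]; the term with [dl] has the right sign. *)
Lemma touch_inward v : 0 < complex.Re (lin a v) ->
  exists2 t0 : R, 0 < t0 & forall t : R, 0 < t < t0 -> D (p - toC t *: v).
Proof.
move=> lv; pose A := M * sqmod (lin a v) + M * (sqn v + sqmod (lin a v) / La + 1) ^+ 2.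
have q0 := sqmod_ge0 (lin a v); have n0 := sqn_ge0 v.
have r0 : 0 <= sqmod (lin a v) / La by rewrite divr_ge0 // ltW.
have A0 : 0 < A.
  apply: ltr_wpDl; first by rewrite mulr_ge0 // ltW.
  by rewrite mulr_gt0 // exprn_gt0 // ltr_wpDl // addr_ge0.
exists (Num.min 1 (complex.Re (lin a v) / A)) => [|t].
  by rewrite lt_min ltr01 divr_gt0.
rewrite lt_min => /and3P[t0 t1]; rewrite ltr_pdivlMr // => tA.
have E : p - toC t *: v - p = toC (- t) *: v.
  by rewrite addrC addKr -scaleNr /toC rmorphN.
rewrite /D /= /u /tu E linZ.
have T0 : 0 <= tT a (toC (- t) *: v) by apply: tT_ge0.
have TE : tT a (toC (- t) *: v) = t ^+ 2 * tT a v.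
  by rewrite !tTE // tpartZ sqnZ sqmod_toC sqrrN.
rewrite TE sqmodM sqmod_toC sqrrN in T0 *.
have ReE : complex.Re (toC (- t) * lin a v) = - t * complex.Re (lin a v).
  by case: (lin a v) => x y /=; ring.
rewrite ReE.
have Tv0 : 0 <= tT a v by apply: tT_ge0.
have Tv1 : tT a v <= sqn v + sqmod (lin a v) / La + 1 by rewrite /tT -/La; lra.
have Tv2 : tT a v ^+ 2 <= (sqn v + sqmod (lin a v) / La + 1) ^+ 2.
  by rewrite ler_sqr ?nnegrE //; apply: le_trans Tv1.
have t2 : t ^+ 2 <= 1 by rewrite expr_le1 // ltW.
have B1 : M * (t ^+ 2 * tT a v) ^+ 2 <= t ^+ 2 * (M * (sqn v + sqmod (lin a v) / La + 1) ^+ 2).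
  rewrite exprMn -exprM mulrCA; apply: (@le_trans _ _ (t ^+ 2 * (M * tT a v ^+ 2))).
    rewrite ler_wpM2r //; first by rewrite mulr_ge0 ?sqr_ge0 // ltW.
    by rewrite exprM expr2 ler_piMl ?sqr_ge0.
  by rewrite ler_wpM2l ?sqr_ge0 // ler_wpM2l // ltW.
have B2 : 0 <= dl * (t ^+ 2 * tT a v) by rewrite mulr_ge0 // ltW.
have B3 : t * (t * A) < t * complex.Re (lin a v) by rewrite ltr_pM2l.
have B4 : t * (t * A) = M * (t ^+ 2 * sqmod (lin a v)) + t ^+ 2 * (M * (sqn v + sqmod (lin a v) / La + 1) ^+ 2).
  by rewrite /A; ring.
have B5 : 0 < t * complex.Re (lin a v) by rewrite mulr_gt0.
lra.
Qed.

Lemma touch_p : boundary D p.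
Proof.
split; last first.
  by have [/interior_id -> _] := touch_open 0; rewrite /D /= tu_p ltxx.
have [|t0 t00 H] := @touch_inward (abar a); first by rewrite lin_abar.
move=> B /nbhs_nmP[e e0 eB].
pose t := Num.min (t0 / 2) (e / 2 / (nm (abar a) + 1)).
have nb : 0 <= nm (abar a) := nm_ge0 _.
have tp : 0 < t by rewrite lt_min !divr_gt0 //; lra.
exists (p - toC t *: abar a); split.
  by apply: H; rewrite tp /= (@le_lt_trans _ _ (t0 / 2)) ?ge_min ?lexx //; lra.
apply: eB; rewrite addrC addKr nmN nmZ nm_toC gtr0_norm //.
apply: (@le_lt_trans _ _ (e / 2 / (nm (abar a) + 1) * nm (abar a))).
  by rewrite ler_wpM2r // ge_min lexx orbT.
by rewrite mulrAC ltr_pdivrMr; nra.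
Qed.

End TouchingDomain.

Section RowNorm.
Variable R : realType.
Local Notation C := (Cx R).

Lemma nm_rV_lt n (v : 'rV[C]_n) (e : R) : 0 < e -> (nm v < e <-> forall j, nm (v 0 j) < e).
Proof.
move=> e0; have E : nm v < e <-> ball (0 : 'rV[C]_n) (toC e) v.
  by rewrite -ball_normE /= sub0r normrN nmE toC_lt.
apply: (iff_trans E); split=> [[_ H] j|H].
  by have := H 0 j; rewrite mxE -ball_normE /= sub0r normrN nmE toC_lt.
split=> [|i j]; first by rewrite (toC_lt 0).
by rewrite ord1 mxE -ball_normE /= sub0r normrN nmE toC_lt.
Qed.

Lemma nm_entry n (v : 'rV[C]_n) j : nm (v 0 j) <= nm v.
Proof.
rewrite leNgt; apply/negP => h.
have h0 : 0 < nm (v 0 j) by apply: le_lt_trans h; exact: nm_ge0.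
by have := (nm_rV_lt v h0).1 h j; rewrite ltxx.
Qed.

End RowNorm.

(** * Levi form of the touching domain *)

Section TouchingLevi.
Variable R : realType.
Local Notation C := (Cx R).
Variable n : nat.
Local Notation V := 'rV[C]_n.
Variables (a p : V) (dl M : R).
Hypotheses (dl0 : 0 < dl) (M0 : 0 < M).
Hypothesis La0 : 0 < sqn a.
Let La := sqn a.
Let u := tu a p dl M.

Lemma touch_rderiv2 (w v : V) : rderiv w (rderiv v u) p = 2 * M * Bf a w v - dl * dtT a w v.
Proof.
have -> : rderiv v u = fun z => 2 * complex.Re (lin a v) + 2 * M * Bf a (z - p) v +
   (2 * M * tT a (z - p) - dl) * dtT a (z - p) v.
  by apply/funext => z; exact: has_d_rderiv (has_tu _ _ _ _ _ _).
apply: has_d_rderiv.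
have HB : has_d (fun z => Bf a (z - p) v) p w (Bf a w v).
  apply: along_affine => t; rewrite /along /= subrr addrAC subrr add0r /Bf linZ.
  rewrite (_ : lin a 0 = 0); last by rewrite /lin big1 // => j _; rewrite mxE mulr0.
  by case: (lin a w) (lin a v) => ? ? [? ?] /=; ring.
have HT : has_d (fun z => dtT a (z - p) v) p w (dtT a w v).
  apply: along_affine => t; rewrite /along /= subrr addrAC subrr add0r /dtT /Bf linZ.
  rewrite (_ : lin a 0 = 0); last by rewrite /lin big1 // => j _; rewrite mxE mulr0.
  have -> : ipr (toC t *: w) v = t * ipr w v.
    rewrite /ipr mulr_sumr; apply: eq_bigr => j _; rewrite mxE.
    by case: (w 0 j) (v 0 j) => ? ? [? ?] /=; ring.
  have -> : ipr (0 : V) v = 0.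
    by rewrite /ipr big1 // => j _; rewrite mxE /=; ring.
  by case: (lin a w) (lin a v) => ? ? [? ?] /=; ring.
have [T' [_ HT']] := rpol_d (rpol_tT a p) w.
have := has_dD (has_dD (has_d_cst (2 * complex.Re (lin a v)) p w) (has_dM (has_d_cst (2 * M) p w) HB))
  (has_dM (has_dD (has_dM (has_d_cst (2 * M) p w) (HT' p)) (has_d_cst (- dl) p w)) HT).
congr (has_d _ _ _ _); rewrite subrr.
have l0 : lin a 0 = 0 by rewrite /lin big1 // => j _; rewrite mxE mulr0.
have -> : tT a 0 = 0.
  rewrite /tT l0 /sqmod /= /sqn big1 => [|j _]; last by rewrite mxE /sqmod /= expr0n addr0.
  by rewrite expr0n addr0 mul0r subrr.
have -> : dtT a 0 v = 0.
  rewrite /dtT /Bf l0 /= /ipr big1 => [|j _]; last by rewrite mxE /=; ring.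
  by ring.
by ring.
Qed.

Lemma touch_dz : dz u p = a.
Proof.
apply/rowP => j; rewrite mxE.
have l0 : lin a 0 = 0 by rewrite /lin big1 // => k _; rewrite mxE mulr0.
have E v : rderiv v u p = 2 * complex.Re (lin a v).
  rewrite (has_d_rderiv (has_tu _ _ _ _ _ _)) subrr /Bf /dtT /Bf l0 /=.
  rewrite (_ : ipr 0 v = 0); first by ring.
  by rewrite /ipr big1 // => k _; rewrite mxE /=; ring.
rewrite !E lin_e lin_ie im_unit; case: (a 0 j) => x y /=.
have -> : (2 : C)^-1 = toC 2^-1 by rewrite /toC fmorphV rmorph_nat.
by apply/eqP; rewrite eq_complex /=; apply/andP; split; apply/eqP; field.
Qed.

(** The rank one part comes from the squares of [lin] and vanishes on the complex tangent space; the
    multiple of the identity comes from [sqn]. The term in [tT ^+ 2] vanishes to order four at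
    [p]. *)
Lemma touch_levi : levi_mx u p = toC (M + dl / La) *: (a^T *m map_mx Num.conj a) - (toC dl)%:M.
Proof.
have D2 w v : rderiv w (rderiv v u) p = 2 * (M + dl / La) * Bf a w v - 2 * dl * ipr w v.
  rewrite touch_rderiv2 /dtT -/La; field; by rewrite gt_eqF.
apply/matrixP => j k.
have -> : (toC (M + dl / La) *: (a^T *m map_mx Num.conj a) - (toC dl)%:M) j k =
    toC (M + dl / La) * (a 0 j * Num.conj (a 0 k)) - toC dl * (j == k)%:R.
  by rewrite !mxE big_ord1 !mxE mulr_natr.
pose F w v := rderiv w (rderiv v u) p.
have LE : levi_mx u p j k = (toC (F (e_ R j) (e_ R k) + F (ie_ R j) (ie_ R k)) +
    'i%R * toC (F (e_ R j) (ie_ R k) - F (ie_ R j) (e_ R k))) / 4 by rewrite /levi_mx mxE.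
have FE w v : F w v = 2 * (M + dl / La) * Bf a w v - 2 * dl * ipr w v := D2 w v.
clearbody F; rewrite {}LE !FE; set m := M + dl / La.
rewrite !ipr_e !ipr_ie !ie_E !e_E /Bf !lin_e !lin_ie im_unit -/m.
have -> : (4 : C)^-1 = toC 4^-1 by rewrite /toC fmorphV rmorph_nat.
rewrite (eq_sym k j); move: (m) (a 0 j) (a 0 k) => m' [x y] [x' y'].
by case: (j == k) => /=; apply/eqP; rewrite eq_complex /=; apply/andP; split; apply/eqP; field.
Qed.

End TouchingLevi.

(** * Pseudoconcavity and size of the touching domain *)

Section Pseudoconcave.
Variable R : realType.
Local Notation C := (Cx R).
Variable q : nat.
Local Notation V := 'rV[C]_q.+1.
Variables (a p : V) (dl M : R).
Hypotheses (dl0 : 0 < dl) (M0 : 0 < M).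
Hypothesis La0 : 0 < sqn a.
Let u := tu a p dl M.

Lemma char_poly_scalar m (c : C) : char_poly (c%:M : 'M[C]_m) = \prod_(x <- nseq m c) ('X - x%:P).
Proof.
rewrite char_poly_trig ?scalar_mx_is_trig //.
rewrite (eq_bigr (fun=> 'X - c%:P)); last by move=> i _; rewrite mxE eqxx.
by rewrite big_const_ord big_nseq.
Qed.

Lemma touch_levi_neg : levi_neg_eigenvalues_ge q u p.
Proof.
pose K := kermx a^T.
have rK : \rank K = q.
  rewrite mxrank_ker mxrank_tr.
  have -> : \rank a = 1%N; last by rewrite subn1.
  rewrite rank_rV; have [a0|//] := eqVneq a 0.
  by move: La0; rewrite a0 /sqn big1 ?ltxx // => j _; rewrite mxE /sqmod /= expr0n addr0.
(* In an orthonormal basis of the complex tangent space the Levi form is the scalar matrix [- dl];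
   its size is [q] because [a] is nonzero. *)
pose B := schmidt (row_base K).
have BU : B \is unitarymx by apply: schmidt_unitarymx; rewrite rK.
have BK : (B :=: K)%MS.
  by apply: eqmx_trans (eq_row_base K); apply: eqmx_schmidt_free; exact: row_base_free.
have Ba : B *m a^T = 0 by apply/sub_kermxP; rewrite BK.
exists (\rank K), B; split => //.
  rewrite /complex_tangent touch_dz //; exact/eqmxP.
have BB : B *m (map_mx Num.conj B)^T = 1%:M.
  by have /unitarymxP := BU; rewrite map_trmx.
have -> : B *m levi_mx u p *m (map_mx Num.conj B)^T = (- toC dl)%:M.
  rewrite touch_levi // mulmxBr -scalemxAr mulmxA Ba mul0mx scaler0 sub0r.
  by rewrite mul_mx_scalar mulNmx -scalemxAl BB scalemx1 raddfN.
exists (nseq (\rank K) (- toC dl)); first exact: char_poly_scalar.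
rewrite count_nseq rK oppr_lt0.
have -> : 0 < toC dl by rewrite (toC_lt 0).
by rewrite mul1n.
Qed.

Lemma touch_pseudoconcave : pseudoconcave_at q [set z | u z < 0] p.
Proof.
exists u; last exact: touch_levi_neg.
by apply: touch_defining => //; exact: touch_p.
Qed.

(** [tuE] gives [nm (lin a (z - p)) < k] and [tT a (z - p) < k]. Each entry of [z - p] is the sum of
    a tangential part and a multiple of an entry of [abar], whence the bound
    [2 * k * (1 + (sqn a)^-1)] for its square. *)
Lemma touch_small (k eta : R) z : 0 < eta -> 0 < k <= 1 -> (3 + dl) / M <= k ->
  2 * k * (1 + (sqn a)^-1) < eta ^+ 2 -> u z < 0 -> nm (z - p) < eta.
Proof.
move=> eta0 /andP[k0 k1] Mk ke uz.
have La1 : sqn a != 0 by rewrite gt_eqF.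
have Mn : M != 0 by rewrite gt_eqF.
pose s := lin a (z - p); pose T := tT a (z - p).
have T0 : 0 <= T by apply: tT_ge0.
move: uz; rewrite /u tuE // -/s -/T => uz.
have M1 : 0 < M^-1 by rewrite invr_gt0.
have sM : sqmod (s + toC M^-1) < ((2 + dl) / M) ^+ 2.
  rewrite -(ltr_pM2l M0).
  have -> : M * ((2 + dl) / M) ^+ 2 = (2 + dl) ^+ 2 / M by field.
  have : (1 + dl ^+ 2 / 4) / M <= (2 + dl) ^+ 2 / M.
    apply: ler_wpM2r; first exact: ltW.
    have -> : (2 + dl) ^+ 2 = 4 + 4 * dl + dl ^+ 2 by ring.
    have := sqr_ge0 dl; have := dl0; lra.
  have : 0 <= M * (T - dl / (2 * M)) ^+ 2 by rewrite mulr_ge0 ?sqr_ge0 // ltW.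
  lra.
have TM : (T - dl / (2 * M)) ^+ 2 < ((2 + dl / 2) / M) ^+ 2.
  rewrite -(ltr_pM2l M0).
  have -> : M * ((2 + dl / 2) / M) ^+ 2 = (2 + dl / 2) ^+ 2 / M by field.
  have : (1 + dl ^+ 2 / 4) / M <= (2 + dl / 2) ^+ 2 / M.
    apply: ler_wpM2r; first exact: ltW.
    have -> : (2 + dl / 2) ^+ 2 = 4 + 2 * dl + dl ^+ 2 / 4 by field.
    have := sqr_ge0 dl; have := dl0; lra.
  have : 0 <= M * sqmod (s + toC M^-1) by rewrite mulr_ge0 ?sqmod_ge0 // ltW.
  lra.
have s1 : nm s < k.
  have : nm (s + toC M^-1) < (2 + dl) / M.
    by rewrite -(@ltr_sqr _ _ ((2 + dl) / M)) ?nnegrE ?nm_ge0 ?nm_sqmod // divr_ge0 ?ltW // ltr_wpDl // ltW.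
  have := nmD (s + toC M^-1) (- toC M^-1); rewrite addrK nmN nm_toC gtr0_norm //.
  have : (3 + dl) / M = (2 + dl) / M + M^-1 by field.
  lra.
have T1 : T < k.
  have c0 : 0 <= (2 + dl / 2) / M.
    by apply: divr_ge0; [have := dl0; lra|exact: ltW].
  have : `|T - dl / (2 * M)| < (2 + dl / 2) / M.
    by rewrite -(@ltr_sqr _ _ ((2 + dl / 2) / M)) ?nnegrE // real_normK ?num_real.
  rewrite ltr_norml => /andP[_ h].
  have E : (3 + dl) / M = (2 + dl / 2) / M + dl / (2 * M) + M^-1 by field.
  rewrite E in Mk; lra.
apply/(nm_rV_lt _ eta0) => j.
rewrite -(@ltr_sqr _ _ eta) ?nnegrE ?nm_ge0 ?(ltW eta0) //.
apply: le_lt_trans ke.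
have tT' : sqmod (tpart a (z - p) 0 j) <= T.
  rewrite /T tTE // /sqn (bigD1 j) //= lerDl.
  by apply: sumr_ge0 => i _; exact: sqmod_ge0.
have aj : sqmod (a 0 j) <= sqn a.
  by rewrite /sqn (bigD1 j) //= lerDl; apply: sumr_ge0 => i _; exact: sqmod_ge0.
have -> : (z - p) 0 j = tpart a (z - p) 0 j + s / toC (sqn a) * Num.conj (a 0 j).
  by rewrite /tpart !mxE subrK.
set x := tpart _ _ _ _; set y := _ * _.
have sy : sqmod y <= k * (sqn a)^-1.
  rewrite /y !sqmodM -!nm_sqmod nm_conj.
  have -> : nm (toC (sqn a))^-1 = (sqn a)^-1.
    by rewrite /toC -fmorphV -/(toC _) nm_toC gtr0_norm // invr_gt0.
  rewrite (nm_sqmod (a 0 j)).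
  have : (sqn a)^-1 ^+ 2 * sqmod (a 0 j) <= (sqn a)^-1.
    rewrite expr2 -mulrA ger_pMr ?invr_gt0 //.
    by rewrite mulrC ler_pdivrMr // mul1r.
  have : nm s ^+ 2 <= k.
    have := nm_ge0 s; nra.
  have := sqr_ge0 (nm s); have : 0 <= (sqn a)^-1 ^+ 2 * sqmod (a 0 j).
    by rewrite mulr_ge0 ?sqr_ge0 // sqmod_ge0.
  have : 0 < (sqn a)^-1 by rewrite invr_gt0.
  rewrite -mulrA; set A := (sqn a)^-1; set B := _ * sqmod _; set S := _ ^+ 2.
  move=> h1 h2 h3 h4 h5; apply: (@le_trans _ _ (k * B)); first by rewrite ler_wpM2r.
  by rewrite ler_wpM2l // ltW.
have := sqmodD_le x y ltr01 ltr01; rewrite -nm_sqmod => h.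
apply: le_trans h _; rewrite invr1 !mul1r; lra.
Qed.

End Pseudoconcave.

(** * The function minimised over the bad points *)

Section MinimalPoint.
Variable R : realType.
Local Notation C := (Cx R).
Variable q : nat.
Local Notation V := 'rV[C]_q.+1.

Definition sqn' (z : V) : R := \sum_(j | j != ord_max) sqmod (z 0 j).

Definition phi (eps : R) (z : V) : R := sqmod (z 0 ord_max) - eps * sqn' z.

(** The complex gradient of [phi eps] at [x]. *)
Definition avec (eps : R) (x : V) : V :=
  \row_j (if j == ord_max then Num.conj (x 0 j) else - (toC eps * Num.conj (x 0 j))).

Lemma sqmod_sum m (F : 'I_m -> C) : sqmod (\sum_j F j) <= m%:R * \sum_j sqmod (F j).
Proof.
elim: m F => [|m IH] F; first by rewrite !big_ord0 /sqmod /= expr0n addr0 mul0r.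
case: m IH F => [|m] IH F; first by rewrite !big_ord1 mul1r.
rewrite big_ord_recr [in leRHS]big_ord_recr /=.
have m0 : 0 < m.+1%:R :> R by rewrite ltr0n.
apply: le_trans (sqmodD_le _ _ m0 ltr01) _.
have -> : m.+1%:R + 1 = m.+2%:R :> R by rewrite [RHS]mulrSr.
rewrite ler_wpM2l // invr1 mul1r lerD2r.
by rewrite ler_pdivrMl // IH.
Qed.

Lemma sqn_split (z : V) : sqn z = sqmod (z 0 ord_max) + sqn' z.
Proof. by rewrite /sqn (bigD1 ord_max). Qed.

Lemma sqn'_ge0 (z : V) : 0 <= sqn' z.
Proof. by apply: sumr_ge0 => j _; exact: sqmod_ge0. Qed.

Lemma sqmod_conj (c : C) : sqmod (Num.conj c) = sqmod c.
Proof. by rewrite -!nm_sqmod nm_conj. Qed.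

Lemma avec_lin eps x v : lin (avec eps x) v =
  Num.conj (x 0 ord_max) * v 0 ord_max - toC eps * \sum_(j | j != ord_max) Num.conj (x 0 j) * v 0 j.
Proof.
rewrite /lin (bigD1 ord_max) //= mxE eqxx; congr (_ + _).
rewrite mulr_sumr -sumrN; apply: eq_bigr => j jm.
by rewrite mxE (negPf jm) mulNr mulrA.
Qed.

Lemma phi_diff eps (x v : V) : phi eps (x + v) - phi eps x =
  2 * complex.Re (lin (avec eps x) v) + sqmod (v 0 ord_max) - eps * sqn' v.
Proof.
have E (c d : C) : sqmod (c + d) = sqmod c + 2 * complex.Re (Num.conj c * d) + sqmod d.
  by case: c d => ? ? [? ?]; rewrite /sqmod /=; ring.
have S : sqn' (x + v) = sqn' x + 2 * complex.Re (\sum_(j | j != ord_max) Num.conj (x 0 j) * v 0 j) + sqn' v.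
  rewrite /sqn' raddf_sum /= mulr_sumr -!big_split; apply: eq_bigr => j _ /=.
  by rewrite mxE E.
rewrite /phi S mxE E avec_lin.
move: (sqn' x) (sqn' v) (\sum_(_ | _) _) (Num.conj _ * _) (sqmod _) (sqmod _) => s1 s2 [a b] [c d] s3 s4 /=.
by ring.
Qed.

Variables (r eps : R) (x : V).
Hypotheses (r0 : 0 < r) (eps0 : 0 < eps) (eps1 : eps <= 1) (epsr : eps <= r ^+ 2 / (8 * q.+1%:R)).
Hypothesis xw : r <= nm (x 0 ord_max).
Hypothesis xj : forall j, nm (x 0 j) <= 1.

(** The equation [l = lin (avec eps x) v] is solved for the last coordinate of [v] and divided by
    [nm (x 0 ord_max) >= r]; the bound on [eps] turns the share of the other coordinates into
    [eps / 4]. For [l = 0] this says that complex tangent vectors are almost horizontal. *)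
Lemma normal_bound (v : V) : sqmod (v 0 ord_max) <=
  2 / r ^+ 2 * sqmod (lin (avec eps x) v) + eps / 4 * sqn' v.
Proof.
set l := lin _ v; set A := sqmod (v 0 _); set B := sqn' v.
pose S := \sum_(j | j != ord_max) Num.conj (x 0 j) * v 0 j.
have B0 : 0 <= B by exact: sqn'_ge0.
have SB : sqmod S <= q.+1%:R * B.
  rewrite /S big_mkcond; apply: le_trans (sqmod_sum _) _.
  rewrite ler_wpM2l // /B /sqn' [leRHS]big_mkcond; apply: ler_sum => j _.
  case: ifP => _; last by rewrite /sqmod /= expr0n addr0.
  rewrite sqmodM sqmod_conj -nm_sqmod ler_piMl ?sqmod_ge0 //.
  by rewrite expr_le1 // nm_ge0.
have E : Num.conj (x 0 ord_max) * v 0 ord_max = l + toC eps * S.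
  by rewrite /l avec_lin -/S subrK.
have H1 : sqmod (x 0 ord_max) * A <= 2 * sqmod l + 2 * eps ^+ 2 * sqmod S.
  rewrite -sqmod_conj -sqmodM E; apply: le_trans (sqmodD_le _ _ ltr01 ltr01) _.
  rewrite sqmodM sqmod_toC invr1 !mul1r; lra.
have H2 : r ^+ 2 * A <= sqmod (x 0 ord_max) * A.
  rewrite ler_wpM2r ?sqmod_ge0 // -nm_sqmod ler_sqr ?nnegrE ?nm_ge0 //; exact: ltW.
have r2 : 0 < r ^+ 2 by rewrite exprn_gt0.
have q0 : 0 < q.+1%:R :> R by rewrite ltr0n.
have H3 : 2 * eps ^+ 2 * sqmod S <= r ^+ 2 * (eps / 4 * B).
  apply: (@le_trans _ _ (2 * eps ^+ 2 * (q.+1%:R * B))).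
    by rewrite ler_wpM2l // mulr_ge0 // sqr_ge0.
  have -> : 2 * eps ^+ 2 * (q.+1%:R * B) = eps * B * (2 * q.+1%:R * eps) by ring.
  have -> : r ^+ 2 * (eps / 4 * B) = eps * B * (r ^+ 2 / 4) by field.
  rewrite ler_wpM2l ?mulr_ge0 ?(ltW eps0) //.
  move: epsr; rewrite ler_pdivlMr ?mulr_gt0 //; lra.
rewrite -(ler_pM2l r2); apply: le_trans H2 _; apply: le_trans H1 _.
have -> : r ^+ 2 * (2 / r ^+ 2 * sqmod l + eps / 4 * B) = 2 * sqmod l + r ^+ 2 * (eps / 4 * B).
  by field; rewrite gt_eqF.
by rewrite lerD2l.
Qed.

Lemma avec_gt0 : 0 < sqn (avec eps x).
Proof.
rewrite sqn_split mxE eqxx sqmod_conj -nm_sqmod.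
by rewrite ltr_wpDr ?sqn'_ge0 // exprn_gt0 //; exact: lt_le_trans xw.
Qed.

(** In the exact expansion [phi_diff], the condition [tu < 0] bounds the linear term. What is left
    is at most [(1 + eps / 2) * A - eps / 2 * B - M * sqmod l], and [normal_bound] replaces
    [(1 + eps / 2) * A] by [3 / r ^+ 2 * sqmod l + 3 / 8 * eps * B]. *)
Lemma touch_phi (M : R) z : 3 / r ^+ 2 <= M -> tu (avec eps x) x (eps / 2) M z < 0 ->
  phi eps z < phi eps x.
Proof.
move=> Mr; have -> : z = x + (z - x) by rewrite addrC subrK.
move: (z - x) => v; have Ev : x + v - x = v by rewrite addrC addKr.
rewrite /tu Ev => uz.
rewrite -subr_lt0 phi_diff.
have r2 : 0 < r ^+ 2 by rewrite exprn_gt0.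
have M0 : 0 <= M by apply: le_trans Mr; rewrite divr_ge0 // ltW.
have := normal_bound v; set l := lin _ v in uz *; set A := sqmod (v 0 _); set B := sqn' v.
move=> AB.
have A0 : 0 <= A by exact: sqmod_ge0.
have B0 : 0 <= B by exact: sqn'_ge0.
have l0 : 0 <= sqmod l by exact: sqmod_ge0.
have T1 : tT (avec eps x) v <= A + B.
  rewrite /tT sqn_split -/A -/B -/l gerBl divr_ge0 //.
  exact: sqn_ge0.
have T2 : 0 <= M * tT (avec eps x) v ^+ 2 by rewrite mulr_ge0 // sqr_ge0.
have E1 : eps / 2 * tT (avec eps x) v <= eps / 2 * (A + B) by rewrite ler_wpM2l // divr_ge0 // ltW.
have E2 : 3 / r ^+ 2 * sqmod l <= M * sqmod l by rewrite ler_wpM2r.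
have E3 : (1 + eps / 2) * A <= (1 + eps / 2) * (2 / r ^+ 2 * sqmod l + eps / 4 * B).
  by rewrite ler_wpM2l // addr_ge0 // divr_ge0 // ltW.
have E4 : (1 + eps / 2) * (2 / r ^+ 2 * sqmod l + eps / 4 * B) <= 3 / 2 * (2 / r ^+ 2 * sqmod l + eps / 4 * B).
  have h : 0 <= 2 / r ^+ 2 * sqmod l + eps / 4 * B.
    by rewrite addr_ge0 // mulr_ge0 // divr_ge0 // ltW.
  by rewrite ler_wpM2r //; move: eps1; lra.
have E5 : 3 / 2 * (2 / r ^+ 2 * sqmod l + eps / 4 * B) = 3 / r ^+ 2 * sqmod l + 3 / 8 * (eps * B) by field; rewrite gt_eqF.
have E6 : 0 <= eps * B by rewrite mulr_ge0 // ltW.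
rewrite E5 in E4.
move: uz T2 E1 E2 E3 E4 E6; clearbody A B.
move: (complex.Re l) (sqmod l) (tT _ v) => x1 x2 x3 {E5 T1 AB M0 Mr}.
move: (3 / r ^+ 2 * x2) (M * x2) (M * x3 ^+ 2) ((1 + eps / 2) * (2 / r ^+ 2 * x2 + _)) => y1 y2 y3 y4.
clear.
move=> H1 H2 H3 H4 H5 H6 H7; lra.
Qed.

End MinimalPoint.

(** * The Levi condition implies the Hartogs property *)

Section Compactness.
Variable R : realType.
Local Notation C := (Cx R).

Lemma compact_disk (r : R) : compact [set z : C | nm z <= r].
Proof.
pose m (ab : R * R) : C := toC ab.1 + toC ab.2 * 'i%R.
have tc : continuous (@toC R).
  by move=> t; apply/contRP => e e0; exists e => // h he; rewrite toCD addrAC subrr add0r nm_toC.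
have mc : continuous m.
  move=> [x y].
  have h1 : {for (x, y), continuous (fun ab : R * R => toC ab.1)}.
    by apply: (@continuous_comp _ _ _ fst (@toC R)); [exact: cvg_fst|exact: tc].
  have h2 : {for (x, y), continuous (fun ab : R * R => toC ab.2)}.
    by apply: (@continuous_comp _ _ _ snd (@toC R)); [exact: cvg_snd|exact: tc].
  exact: (continuousD h1 (continuousM h2 (@cst_continuous _ _ 'i%R (x, y)))).
apply: (@subclosed_compact _ _ (m @` (`[- r, r] `*` `[- r, r]))).
- apply: (@closed_comp _ _ (@nm R C) [set t : R | t <= r]); last exact: closed_le.
  move=> z _; apply/cont_nmP => A /nbhs_normP[e /= e0 eA]; exists e => // y ye; apply: eA.
  rewrite /ball_ /=; have := @nmD R C (z - y) y; have := @nmD R C (y - z) z; rewrite !subrK => h1 h2.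
  rewrite nmBC in h2; rewrite ltr_norml; apply/andP; split; lra.
- apply: continuous_compact; first exact: continuous_subspaceT.
  by apply: compact_setX; exact: segment_compact.
move=> z /= zr; exists (complex.Re z, complex.Im z) => /=.
  split; rewrite /= in_itv /= -ler_norml.
    exact: le_trans (Re_le_nm z) zr.
  exact: le_trans (Im_le_nm z) zr.
rewrite /m /= im_unit; case: z {zr} => x y /=.
by apply/eqP; rewrite eq_complex /=; apply/andP; split; apply/eqP; ring.
Qed.

Lemma compact_box n (r : 'I_n -> R) : compact [set v : 'rV[C]_n | forall i, nm (v 0 i) <= r i].
Proof.
have := @rV_compact C n (fun i => [set z : C | nm z <= r i]) (fun i => @compact_disk (r i)).
by [].
Qed.

End Compactness.

Section Casts.
Variable R : realType.

Lemma toCB (a b : R) : toC (a - b) = toC a - toC b.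
Proof. exact: rmorphB. Qed.

Lemma toC1 : toC (1 : R) = 1.
Proof. by []. Qed.

Lemma interp01 (s s' t : R) : 0 <= s <= 1 -> 0 <= s' <= 1 -> 0 <= t <= 1 -> 0 <= s + t * (s' - s) <= 1.
Proof.
move=> /andP[s0 s1] /andP[s'0 s'1] /andP[t0 t1].
have h1 := mulr_ge0 t0 s'0; have h2 : 0 <= (1 - t) * s by rewrite mulr_ge0 ?subr_ge0.
have h3 : t * s' <= t * 1 by rewrite ler_wpM2l.
have h4 : (1 - t) * s <= (1 - t) * 1 by rewrite ler_wpM2l ?subr_ge0.
by apply/andP; split; lra.
Qed.

Lemma rVB m (x y : 'rV[Cx R]_m) j : (x - y) 0 j = x 0 j - y 0 j.
Proof. by rewrite !mxE. Qed.

Lemma rVD m (x y : 'rV[Cx R]_m) j : (x + y) 0 j = x 0 j + y 0 j.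
Proof. by rewrite !mxE. Qed.

Lemma rVZ m (c : Cx R) (x : 'rV[Cx R]_m) j : (c *: x) 0 j = c * x 0 j.
Proof. by rewrite !mxE. Qed.

Lemma nm_entryB m (x y : 'rV[Cx R]_m) j : nm (x 0 j - y 0 j) <= nm (x - y).
Proof. by rewrite -rVB nm_entry. Qed.

Lemma nm_rVB_le m (x y : 'rV[Cx R]_m) (c : R) : 0 <= c ->
  (forall j, nm (x 0 j - y 0 j) <= c) -> nm (x - y) <= c.
Proof.
move=> c0 H; apply/ler_addgt0Pr => e e0; apply: ltW.
have h : 0 < c + e by rewrite ltr_wpDl.
by apply/(nm_rV_lt _ h) => j; rewrite rVB; apply: le_lt_trans (H j) _; rewrite ltrDl.
Qed.

Lemma nm_segment_lt m (a b : 'rV[Cx R]_m) (c : R) (t : R) : 0 <= t <= 1 ->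
  nm a < c -> nm b < c -> nm (a + toC t *: (b - a)) < c.
Proof.
move=> /andP[t0 t1] ac bc.
have -> : a + toC t *: (b - a) = toC (1 - t) *: a + toC t *: b.
  by apply/rowP => j; rewrite !(rVB, rVD, rVZ) toCB toC1; ring.
apply: le_lt_trans (nmD _ _) _; rewrite !nmZ !nm_toC !ger0_norm ?subr_ge0 //.
have [->|tn] := eqVneq t 0; first by rewrite subr0 mul1r mul0r addr0.
have tp : 0 < t by rewrite lt_neqAle eq_sym tn.
have : t * nm b < t * c by rewrite ltr_pM2l.
have : (1 - t) * nm a <= (1 - t) * c by apply: ler_wpM2l; [rewrite subr_ge0|exact: ltW].
by move: (nm a) (nm b) => A B; lra.
Qed.

Lemma entry_segment m (a b : 'rV[Cx R]_m) (t : R) j :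
  (a + toC t *: (b - a)) 0 j = a 0 j + toC t * (b 0 j - a 0 j).
Proof. by rewrite rVD rVZ rVB. Qed.

End Casts.

Lemma affine_comb (K : pzRingType) (E : lmodType K) (w u : E) (a b c : K) :
  w + (a + c * (b - a)) *: u = (w + a *: u) + c *: ((w + b *: u) - (w + a *: u)).
Proof.
have -> : w + b *: u - (w + a *: u) = (b - a) *: u.
  by rewrite opprD addrACA subrr add0r scalerBl.
by rewrite scalerDl -scalerA addrA.
Qed.

Lemma affine_diff (K : pzRingType) (E : lmodType K) (a b a' b' : E) (c : K) :
  a + c *: (b - a) - (a' + c *: (b' - a')) = (a - a') + c *: ((b - b') - (a - a')).
Proof.
have -> : b - b' - (a - a') = (b - a) - (b' - a').
  by rewrite !opprB [LHS]addrACA [RHS]addrACA [- b' - a]addrC.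
by rewrite [X in _ = _ + X]scalerBr opprD addrACA.
Qed.

(** * Scaling of the last coordinate *)

Section VerticalScaling.
Variable R : realType.
Local Notation C := (Cx R).
Variable q : nat.
Local Notation V := 'rV[C]_q.+1.

Fact vsc_key : unit. Proof. by []. Qed.
(** For [s] in [0, 1] this runs through the segment from the projection of [x] on [w = 0] to [x].
    Locked, it is opened only by [vscE]. *)
Definition vsc : V -> R -> V := locked_with vsc_key
  (fun (x : V) (s : R) => (x : V) - toC (1 - s) *: (x 0 ord_max *: delta_mx 0 ord_max)).

Lemma vscE x s : vsc x s = x - toC (1 - s) *: (x 0 ord_max *: delta_mx 0 ord_max).
Proof. by rewrite /vsc unlock. Qed.

Lemma vsc_entry x s i : vsc x s 0 i = if i == ord_max then toC s * x 0 i else x 0 i.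
Proof.
rewrite vscE rVB !rVZ mxE eqxx /=; case: eqP => [->|_]; last by rewrite mulr0 mulr0 subr0.
by rewrite toCB toC1 mulr1; ring.
Qed.

Lemma vsc_segment (x y z : V) (s s' t : R) :
  y + toC t *: (z - y) - vsc x (s + t * (s' - s)) =
  (y - vsc x s) + toC t *: ((z - vsc x s') - (y - vsc x s)).
Proof.
rewrite -affine_diff; congr (_ - _).
pose u := x 0 ord_max *: delta_mx 0 ord_max : V.
have vE c : vsc x c = (x - u) + toC c *: u.
  by rewrite vscE toCB toC1 scalerBl scale1r opprB addrA addrAC.
by rewrite !vE toCD toCM toCB; exact: affine_comb.
Qed.

End VerticalScaling.

Section Arithmetic.
Variable R : realFieldType.

Lemma half_lt (a : R) : 0 < a -> a / 2 < a.
Proof. lra. Qed.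

Lemma one_subr_itv (a : R) : 0 < a -> a <= 2^-1 -> 0 < 1 - a <= 1.
Proof. by move=> h1 h2; apply/andP; split; lra. Qed.

Lemma quarter_mul_lt (c d : R) : 0 <= c -> 0 < d -> d / 4 * c < d / 2 * (c + 1).
Proof. by move=> c0 d0; have : 0 <= c * d by [rewrite mulr_ge0 // ltW]; lra. Qed.

Lemma midpoint_lt1 (a : R) : a < 1 -> (1 + a) / 2 < 1.
Proof. lra. Qed.

Lemma le_midpoint (A B B' D w : R) : A - B <= D -> D <= w -> B <= B' -> B' <= (1 - w) / 2 -> A <= (1 + w) / 2.
Proof. lra. Qed.

End Arithmetic.

(** * Good points and the extremal argument *)

Section LeviHartogs.
Variable R : realType.
Local Notation C := (Cx R).
Variable q : nat.
Local Notation V := 'rV[C]_q.+1.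
Variable X : hilbert_manifold R.

Let wc (z : V) : C := z 0 ord_max.
Local Notation sc := (@vsc R q).
Let P : set V := [set z | forall i, nm (z 0 i) < 1].

Let lt1 (z : C) : (`|z| < 1) = (nm z < 1).
Proof. by rewrite nmE; exact: (toC_lt _ 1). Qed.

Let PE : polydisk 1 = P.
Proof.
by apply/seteqP; split => z zP i; have := zP i; rewrite nmE toC_lt.
Qed.

Let P_open : open P.
Proof.
rewrite openE => z zP; apply/nbhs_nmP.
have [e e0 He] : exists2 e : R, 0 < e & forall i, nm (z 0 i) + e < 1.
  have [e He] : exists e : R, 0 < e /\ forall i, i \in enum 'I_q.+1 -> nm (z 0 i) + e < 1.
    elim: (enum _) => [|i s [e [e0 IH]]]; first by exists 1.
    exists (Num.min e ((1 - nm (z 0 i)) / 2)); split.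
      by rewrite lt_min e0 divr_gt0 // subr_gt0.
    move=> j; rewrite in_cons => /orP[/eqP ->|/IH h].
      have : Num.min e ((1 - nm (z 0 i)) / 2) <= (1 - nm (z 0 i)) / 2 by rewrite ge_min lexx orbT.
      by have := zP i; lra.
    have : Num.min e ((1 - nm (z 0 i)) / 2) <= e by rewrite ge_min lexx.
    lra.
  by case: He => e0 He; exists e => // i; apply: He; rewrite mem_enum.
exists e => // y yz i; have := nmD (y 0 i - z 0 i) (z 0 i); rewrite subrK.
have : nm (y 0 i - z 0 i) < e.
  by apply: le_lt_trans yz; exact: nm_entryB.
by have := He i; lra.
Qed.

Let conv_nm (a b : C) (c : R) (t : R) : 0 <= t <= 1 -> nm a < c -> nm b < c -> nm (a + toC t * (b - a)) < c.
Proof.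
move=> /andP[t0 t1] ac bc.
have -> : a + toC t * (b - a) = toC (1 - t) * a + toC t * b by rewrite /toC rmorphB rmorph1; ring.
apply: le_lt_trans (nmD _ _) _; rewrite !nmM !nm_toC !ger0_norm ?subr_ge0 //.
have [->|tn] := eqVneq t 0; first by rewrite subr0 mul1r mul0r addr0.
have tp : 0 < t by rewrite lt_neqAle eq_sym tn.
have : t * nm b < t * c by rewrite ltr_pM2l.
have : (1 - t) * nm a <= (1 - t) * c by apply: ler_wpM2l; [rewrite subr_ge0|exact: ltW].
lra.
Qed.

Let sc_contr x y s : 0 <= s <= 1 -> nm (sc x s - sc y s) <= nm (x - y).
Proof.
move=> /andP[s0 s1]; apply: nm_rVB_le; first exact: nm_ge0.
move=> j; rewrite !vsc_entry; apply: le_trans (nm_entryB x y j).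
case: eqP => _ //; rewrite -mulrBr nmM nm_toC ger0_norm //.
by rewrite ler_piMl ?nm_ge0.
Qed.

Let sc_P x s : 0 <= s <= 1 -> P x -> P (sc x s).
Proof.
move=> /andP[s0 s1] xP i; rewrite vsc_entry; case: eqP => _ //.
by apply: le_lt_trans (xP i); rewrite nmM nm_toC ger0_norm // ler_piMl ?nm_ge0.
Qed.

Let sc1 x : sc x 1 = x.
Proof. by rewrite vscE subrr scale0r subr0. Qed.

Let tube (e : R) (x : V) : set V := [set y | P y /\ exists2 s : R, 0 <= s <= 1 & nm (y - sc x s) < e].

Let tube_open e x : open (tube e x).
Proof.
have -> : tube e x = P `&` \bigcup_(s in [set s : R | 0 <= s <= 1]) [set y | nm (y - sc x s) < e].
  by apply/seteqP; split => [y [Py [s s01 ys]]|y [Py [s s01 ys]]]; split => //; exists s.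
apply: openI; first exact: P_open.
apply: bigcup_open => s _; rewrite openE => y ys; apply/nbhs_nmP.
exists (e - nm (y - sc x s)) => [|z zy]; first by rewrite subr_gt0.
by rewrite /= -[z](subrK y) -addrA; apply: le_lt_trans (nmD _ _) _; lra.
Qed.

Let tube_conv e x y z (t : R) : tube e x y -> tube e x z -> 0 <= t <= 1 -> tube e x (y + toC t *: (z - y)).
Proof.
move=> [Py [s s01 ys]] [Pz [s' s'01 zs]] t01; split.
  by move=> i; rewrite entry_segment; apply: conv_nm.
exists (s + t * (s' - s)).
  exact: interp01.
rewrite vsc_segment.
exact: nm_segment_lt.
Qed.

Let tube_base e x s : 0 < e -> P x -> 0 <= s <= 1 -> tube e x (sc x s).
Proof. by move=> e0 Px s01; split; [exact: sc_P|exists s => //; rewrite subrr nm0]. Qed.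

Let wsc0 x : wc (sc x 0) = 0.
Proof. by rewrite /wc vsc_entry eqxx mul0r. Qed.

Let in01 : 0 <= (0 : R) <= 1. Proof. by rewrite lexx ler01. Qed.
Let in11 : 0 <= (1 : R) <= 1. Proof. by rewrite lexx ler01. Qed.

Variables (r : R) (f : V -> X).
Hypothesis r01 : 0 < r < 1.
Hypothesis fH : holomorphic_on (hartogs_figure r) f.

Let HA z : P z -> nm (wc z) < r -> hartogs_figure r z.
Proof.
move=> Pz zr; left; split; last by rewrite nmE toC_lt.
by move=> i; rewrite mxE nmE toC_lt.
Qed.

Let HB z i : P z -> i != ord_max -> 1 - r < nm (z 0 i) -> hartogs_figure r z.
Proof.
move=> Pz im zi; right; split; last by rewrite lt1; exact: Pz.
have [j ij] : exists j, i = lift ord_max j.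
  by case: (unliftP ord_max i) im => [j ->|->]; [exists j|rewrite eqxx].
split; first by move=> k; rewrite mxE nmE toC_lt.
(* The open set given by [1 - r < nm (y 0 j)] separates the point from the closure of the smaller
   polydisk. *)
move=> /(_ [set y | 1 - r < nm (y 0 j)])[].
  apply/nbhs_nmP; exists (nm (z 0 i) - (1 - r)) => [|y yz]; first by rewrite subr_gt0.
  have h := nm_entryB y (col' ord_max z) j; rewrite [X in nm (_ - X)]mxE -ij in h; rewrite /=.
  have := nmD (z 0 i - y 0 j) (y 0 j); rewrite subrK [nm (z 0 i - _)]nmBC; lra.
move=> y [/(_ j)]; rewrite nmE toC_lt /= => h1 h2; lra.
Qed.

Let HP z : hartogs_figure r z -> P z.
Proof.
have /andP[r0 r1] := r01.
have col (y : V) : polydisk 1 (col' ord_max y) -> nm (wc y) < 1 -> P y.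
  move=> yc yw i; case: (unliftP ord_max i) => [j ->|-> //].
  by have := yc j; rewrite mxE nmE toC_lt.
move=> [[zc zw]|[[zc _] zw]]; apply: col => //.
  by apply: lt_trans r1; rewrite nmE toC_lt in zw.
by rewrite lt1 in zw.
Qed.

(* [tube e x] is a neighbourhood of the segment joining [x] to its projection on
   [w = 0]; being convex, it makes the extension along this segment unique. *)
Let wit (x : V) (e : R) (G : V -> X) := [/\ 0 < e, forall y, tube e x y -> hol_at G y &
  forall y, tube e x y -> nm (wc y) < r -> G y = f y].

Let good x := P x /\ exists e G, wit x e G.

Let wit_le x e e' G : 0 < e' -> e' <= e -> wit x e G -> wit x e' G.
Proof.
move=> e'0 ee' [e0 G1 G2].
have sub y : tube e' x y -> tube e x y.
  by move=> [Py [s s01 ys]]; split => //; exists s => //; exact: lt_le_trans ee'.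
by split => // y /sub; [exact: G1|exact: G2].
Qed.

Let base_near x e : 0 < e -> P x -> exists2 d : R, 0 < d &
  forall y, nm (y - sc x 0) < d -> tube e x y /\ nm (wc y) < r.
Proof.
move=> e0 Px; have /andP[r0 _] := r01.
have /nbhs_nmP[d d0 dT] : nbhs (sc x 0) (tube e x).
  by apply: open_nbhs_nbhs; split; [exact: tube_open|exact: tube_base].
exists (Num.min d r) => [|y]; first by rewrite lt_min d0.
rewrite lt_min => /andP[yd yr]; split; first exact: dT.
have := nm_entryB y (sc x 0) ord_max; rewrite -/(wc (sc x 0)) wsc0 subr0.
by move=> h; apply: le_lt_trans yr.
Qed.

(** Both extensions equal [f] near the foot of the segment, and the smaller tube is convex, so the
    identity theorem applies. *)
Let tuniq x e e' G G' y : P x -> wit x e G -> wit x e' G' -> tube e x y -> tube e' x y -> G y = G' y.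
Proof.
move=> Px w1 w2.
wlog le : e e' G G' w1 w2 / e <= e'.
  move=> H t1 t2; have [le|/ltW le] := leP e e'; first exact: (H e e').
  by apply/esym; apply: (H e' e).
move=> t1 _; have [e0 G1 G2] := w1; have [_ G1' G2'] := wit_le e0 le w2.
have [d d0 Hd] := base_near e0 Px.
apply: (@identity_segment R X V (tube e x) G G' (sc x 0) y d) => //.
- by move=> z tz; split; [exact: G1|exact: G1'].
- by move=> t t01; apply: tube_conv => //; exact: tube_base.
- by move=> z /Hd[tz zr]; rewrite G2 // G2'.
Qed.

Let gsel x : exists G, good x -> exists e, wit x e G.
Proof.
have [[Px [e [G w]]]|ng] := pselect (good x); last by exists f.
by exists G => _; exists e.
Qed.

(** The value at [x] of an arbitrary extension chosen for [x]. By [g_local] a single extension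
    represents [g] in a whole neighbourhood, which makes it holomorphic. *)
Let g x := sval (cid (gsel x)) x.

Let shift_wit x x' e G : P x -> wit x e G -> nm (x' - x) < e / 2 -> wit x' (e / 2) G.
Proof.
move=> Px [e0 G1 G2] xx'.
have sub y : tube (e / 2) x' y -> tube e x y.
  move=> [Py [s s01 ys]]; split => //; exists s => //.
  rewrite -[y](subrK (sc x' s)) -addrA; apply: le_lt_trans (nmD _ _) _.
  by have := sc_contr x' x s01; lra.
by split; [lra|move=> y /sub; exact: G1|move=> y /sub; exact: G2].
Qed.

Let g_local x e G y : P x -> wit x e G -> P y -> nm (y - x) < e / 2 -> good y /\ g y = G y.
Proof.
move=> Px w Py yx; have w' := shift_wit Px w yx.
have gy : good y by split => //; exists (e / 2), G.
split => //; rewrite /g; case: cid => G' /= /(_ gy)[e' w''].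
have [e0 _ _] := w''; have [e1 _ _] := w'.
by apply: (tuniq Py w'' w'); rewrite -[X in tube _ _ X]sc1; exact: tube_base.
Qed.

Let good_nbhs x : good x -> exists2 d : R, 0 < d & forall y, nm (y - x) < d -> good y.
Proof.
move=> [Px [e [G w]]]; have [e0 _ _] := w.
have /nbhs_nmP[d d0 dP] : nbhs x P by apply: open_nbhs_nbhs; split; [exact: P_open|].
exists (Num.min d (e / 2)) => [|y]; first by rewrite lt_min d0; lra.
by rewrite lt_min => /andP[/dP Py ye]; have [] := g_local Px w Py ye.
Qed.

Let g_hol x : good x -> hol_at g x.
Proof.
move=> [Px [e [G w]]]; have [e0 G1 _] := w.
have /nbhs_nmP[d d0 dP] : nbhs x P by apply: open_nbhs_nbhs; split; [exact: P_open|].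
have m0 : 0 < Num.min d (e / 2) by rewrite lt_min d0; lra.
apply: (@hol_at_near R X V G g x _ m0) => [y|].
  by rewrite lt_min => /andP[/dP Py ye]; have [_ ->] := g_local Px w Py ye.
by apply: G1; rewrite -[X in tube _ _ X]sc1; exact: tube_base.
Qed.

Let good_f x e : P x -> 0 < e -> (forall y, tube e x y -> hartogs_figure r y) -> good x /\ g x = f x.
Proof.
move=> Px e0 H; have w : wit x e f by split => // y /H; exact: fH.
by apply: (g_local Px w Px); rewrite subrr nm0; lra.
Qed.

Let good_HA x : P x -> nm (wc x) < r -> good x /\ g x = f x.
Proof.
move=> Px xr; apply: (@good_f x (r - nm (wc x)) Px); first by rewrite subr_gt0.
move=> y [Py [s s01 ys]]; apply: HA => //.
have h := nm_entryB y (sc x s) ord_max.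
have := nmD (wc y - wc (sc x s)) (wc (sc x s)); rewrite subrK.
have : nm (wc (sc x s)) <= nm (wc x).
  move: s01 => /andP[s0 s1].
  by rewrite /wc vsc_entry eqxx nmM nm_toC ger0_norm // ler_piMl ?nm_ge0.
rewrite /wc in h *; lra.
Qed.

Let good_HB x i : P x -> i != ord_max -> 1 - r < nm (x 0 i) -> good x /\ g x = f x.
Proof.
move=> Px im xi; apply: (@good_f x (nm (x 0 i) - (1 - r)) Px); first by rewrite subr_gt0.
move=> y [Py [s s01 ys]]; apply: (HB Py im).
have h := nm_entryB y (sc x s) i; rewrite vsc_entry (negPf im) in h.
by have := nmD (x 0 i - y 0 i) (y 0 i); rewrite subrK [nm (x 0 i - _)]nmBC; lra.
Qed.

Let gf z : hartogs_figure r z -> good z /\ g z = f z.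
Proof.
move=> zH; have Pz := HP zH; case: zH => [[_ zw]|[[zc nz] _]].
  by apply: good_HA; rewrite // /wc nmE toC_lt in zw *.
have [j zj] : exists j, 1 - r < nm (col' ord_max z 0 j).
  apply: contrapT => /forallNP H; apply: nz => B /nbhs_nmP[e e0 eB].
  (* a point whose entries all have modulus at most [1 - r] is a limit of the points [t z], [t < 1] *)
  have /andP[r0 r1] := r01.
  have z0 : 0 <= nm (col' ord_max z) by exact: nm_ge0.
  pose t := Num.min 2^-1 (e / 2 / (nm (col' ord_max z) + 1)).
  have t0 : 0 < t by rewrite lt_min !divr_gt0 ?invr_gt0 //; lra.
  have t1 : t <= 2^-1 by rewrite ge_min lexx.
  exists (toC (1 - t) *: col' ord_max z); split.
    move=> i; rewrite [X in `|X|]mxE nmE nmM nm_toC toC_lt ger0_norm; last by lra.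
    have := H i => /negP; rewrite -leNgt => h.
    apply: (@le_lt_trans _ _ ((1 - t) * (1 - r))); first by rewrite ler_wpM2l //; lra.
    by rewrite -[X in _ < X]mul1r ltr_pM2r; lra.
  apply: eB; rewrite /toC rmorphB rmorph1 -/(toC t) scalerBl scale1r addrAC subrr add0r nmN nmZ nm_toC gtr0_norm //.
  apply: (@le_lt_trans _ _ (e / 2 / (nm (col' ord_max z) + 1) * nm (col' ord_max z))).
    by rewrite ler_wpM2r // ge_min lexx orbT.
  by rewrite mulrAC ltr_pdivrMr; nra.
rewrite mxE in zj; apply: good_HB zj => //.
by rewrite eq_sym neq_lift.
Qed.


Let sc_sc x s t : sc (sc x s) t = sc x (s * t).
Proof.
apply/rowP => j; rewrite !vsc_entry; case: eqP => // _.
by rewrite mulrA -toCM [t * s]mulrC.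
Qed.

Let sc_near x s t : s <= t <= 1 -> nm (sc x t - x) <= nm (sc x s - x).
Proof.
move=> /andP[st t1].
have E c : nm (sc x c - x) = `|1 - c| * nm (x 0 ord_max *: delta_mx 0 ord_max : V).
  by rewrite vscE [X in nm (X - _)]addrC addrK nmN nmZ nm_toC.
rewrite (E s) (E t) ler_wpM2r ?nm_ge0 // !ger0_norm ?subr_ge0 ?lerD2l ?lerN2 //.
exact: le_trans st t1.
Qed.

Let sum_lt2 (a b c d e : R) : a < e -> b <= c -> c < d -> e <= d -> a + b < 2 * d.
Proof. lra. Qed.

Let sum_lt3 (a b d e : R) : a < e -> e <= d -> b < d -> a + b < 2 * d.
Proof. lra. Qed.

Let sum_lt4 (a b c d e : R) : a <= b + c -> b <= d -> d < e - c -> a < e.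
Proof. lra. Qed.

(** [gV] is an extension on a ball about [x], and [G1] one on the tube of the good point [b] below
    [x]. They agree near [b], hence on the convex intersection of ball and tube, and the glued map
    witnesses that [x] is good. *)
Let extend_good x s0 d0 (gV : V -> X) (e2 : R) : P x -> 0 < s0 <= 1 -> 0 < d0 -> 0 < e2 ->
  (forall y, nm (y - x) < 2 * d0 -> P y) -> (forall y, nm (y - x) < 2 * d0 -> hol_at gV y) ->
  nm (sc x s0 - x) < d0 -> good (sc x s0) ->
  (forall y, nm (y - sc x s0) < e2 -> gV y = g y) -> good x.
Proof.
move=> Px /andP[s00 s01] d00 e20 BP gVH xs gd gVg; set b := sc x s0 in xs gd gVg *.
have [Pb [e1 [G1 w1]]] := gd; have [e10 G1H G1f] := w1.
pose B := [set y : V | nm (y - x) < 2 * d0]; pose T1 := tube e1 b.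
have B_open : open B.
  rewrite openE => y yB; apply/nbhs_nmP; exists (2 * d0 - nm (y - x)) => [|z zy].
    by rewrite subr_gt0.
  by rewrite /B /= -[z](subrK y) -addrA; apply: le_lt_trans (nmD _ _) _; lra.
have B_conv y z (t : R) : B y -> B z -> 0 <= t <= 1 -> B (y + toC t *: (z - y)).
  move=> yB zB t01; rewrite /B /=.
  have -> : y + toC t *: (z - y) - x = (y - x) + toC t *: ((z - x) - (y - x)).
    by rewrite opprB addrA subrK addrAC.
  exact: nm_segment_lt.
have bT : T1 b by rewrite /T1 -[X in tube _ _ X]sc1; exact: tube_base.
have bB : B b by rewrite /B /=; lra.
have G1gV y : T1 y -> B y -> gV y = G1 y.
  move=> Ty By; pose d := Num.min (Num.min e2 (e1 / 2)) d0.
  have d_0 : 0 < d by rewrite !lt_min e20 d00; lra.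
  apply: (@identity_segment R X V (T1 `&` B) gV G1 b y d) => //.
  - by apply: openI => //; exact: tube_open.
  - by move=> z [Tz Bz]; split; [exact: gVH|exact: G1H].
  - by move=> t t01; split; [exact: tube_conv|exact: B_conv].
  move=> z; rewrite !lt_min => /andP[/andP[z1 z2] z3].
  have Pz : P z by apply: BP; rewrite -[z](subrK b) -addrA; apply: le_lt_trans (nmD _ _) _; exact: sum_lt3 z3 (lexx _) xs.
  by rewrite gVg //; have [] := g_local Pb w1 Pz z2.
pose Gn y := if `[< B y >] then gV y else G1 y.
have GnB y : B y -> Gn y = gV y by move=> By; rewrite /Gn; case: asboolP.
have GnT y : T1 y -> Gn y = G1 y.
  by move=> Ty; rewrite /Gn; case: asboolP => // By; exact: G1gV.
pose e' := Num.min e1 d0.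
have e'0 : 0 < e' by rewrite lt_min e10.
have e'1 : e' <= e1 by rewrite ge_min lexx.
have e'd : e' <= d0 by rewrite ge_min lexx orbT.
(* The part of the segment below [b] lies in the tube of [b], since scaling [b] by [s / s0] is
   scaling [x] by [s]; the part above stays within [d0] of [x]. *)
have cov y : tube e' x y -> T1 y \/ B y.
  move=> [Py [s /andP[s_0 s_1] ys]]; have [ss|ss] := leP s s0.
    left; split => //; exists (s / s0).
      by rewrite divr_ge0 ?(ltW s00) //= ler_pdivrMr // mul1r.
    rewrite sc_sc mulrCA divff ?gt_eqF // mulr1; exact: lt_le_trans e'1.
  right; rewrite /B /= -[y](subrK (sc x s)) -addrA; apply: le_lt_trans (nmD _ _) _.
  have h : nm (sc x s - x) <= nm (b - x) by apply: sc_near; rewrite (ltW ss).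
  exact: sum_lt2 ys h xs e'd.
have GnH y : tube e' x y -> hol_at Gn y.
  move=> ty; have [By|nB] := pselect (B y).
    have /nbhs_nmP[d d1 dB] : nbhs y B by apply: open_nbhs_nbhs.
    by apply: (hol_at_near d1 _ (gVH _ By)) => z /dB Bz; rewrite GnB.
  have [Ty|//] := cov _ ty.
  have /nbhs_nmP[d d1 dT] : nbhs y T1 by apply: open_nbhs_nbhs; split => //; exact: tube_open.
  by apply: (hol_at_near d1 _ (G1H _ Ty)) => z /dT Tz; rewrite GnT.
split => //; exists e', Gn; split => // y ty yr.
have [d d1 Hd] := base_near e10 Pb; have [d' d1' Hd'] := base_near e'0 Px.
have r0 : 0 < r by have /andP[] := r01.
have b0 : sc b 0 = sc x 0 by rewrite /b sc_sc mulr0.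
rewrite b0 in Hd.
have Wo : open [set z | nm (wc z) < r].
  rewrite openE => z zr; apply/nbhs_nmP; exists (r - nm (wc z)) => [|z' zz]; first by rewrite subr_gt0.
  by rewrite /= -[wc z'](subrK (wc z)); apply: sum_lt4 (nmD _ _) (nm_entryB z' z ord_max) zz.
(* The part of the tube with [nm (wc z) < r] is convex and lies in the Hartogs figure; both maps
   agree near the foot of the segment. *)
apply: (@identity_segment R X V (tube e' x `&` [set z | nm (wc z) < r]) Gn f (sc x 0) y d) => //.
- by apply: openI => //; exact: tube_open.
- move=> z [tz zr]; split; first exact: GnH.
  by apply: fH; apply: HA => //; case: tz.
- move=> t t01; split; first by apply: tube_conv => //; exact: tube_base.
  by rewrite /= /wc entry_segment; apply: conv_nm => //; rewrite -/(wc _) wsc0 nm0.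
by move=> z /Hd[Tz zr]; rewrite GnT // G1f.
Qed.

Let phi_continuous eps : continuous (@phi R q eps).
Proof.
have -> : @phi R q eps = fun z => (complex.Re (z 0 ord_max) * complex.Re (z 0 ord_max) +
    complex.Im (z 0 ord_max) * complex.Im (z 0 ord_max)) +
  - eps * \sum_(j < q.+1) ((if j != ord_max then 1 else 0) *
    (complex.Re (z 0 j) * complex.Re (z 0 j) + complex.Im (z 0 j) * complex.Im (z 0 j))).
  apply/funext => z; rewrite /phi /sqn' big_mkcond -mulNr /sqmod !expr2; congr (_ + _ * _).
  by apply: eq_bigr => j _; case: ifP; rewrite ?mul1r ?mul0r // !expr2.
apply: rpol_cont; apply: rpolD; last apply: rpolM; first last.
- apply: rpol_sum => j; apply: rpolM; first exact: rpol_cst.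
  by apply: rpolD; apply: rpolM; by [exact: rpol_re|exact: rpol_im].
- exact: rpol_cst.
by apply: rpolD; apply: rpolM; by [exact: rpol_re|exact: rpol_im].
Qed.

Let sqn'_le (z : V) : P z -> sqn' z <= q.+1%:R.
Proof.
move=> Pz; rewrite /sqn' big_mkcond -[X in X%:R]card_ord -sumr_const; apply: ler_sum => j _.
case: ifP => _ //; rewrite -nm_sqmod expr_le1 ?nm_ge0 //; exact: ltW.
Qed.

Hypothesis hlevi : q_levi_extension q X.

Let extremal_bad eps x : 0 < eps -> eps <= 1 -> eps <= r ^+ 2 / (8 * q.+1%:R) -> P x ->
  (forall z, P z -> phi eps z < phi eps x -> good z) -> good x.
Proof.
move=> eps0 eps1 epsr Px Hx; have /andP[r0 r1] := r01.
have [xr|xr] := ltP (nm (wc x)) r; first by have [] := good_HA Px xr.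
have xj j : nm (x 0 j) <= 1 by apply: ltW.
pose a := avec eps x; have a0 : 0 < sqn a by exact: (avec_gt0 _ r0 xr).
pose dl := eps / 2; have dl0 : 0 < dl by rewrite divr_gt0.
have /nbhs_nmP[eta eta0 etaP] : nbhs x P by apply: open_nbhs_nbhs; split.
have sa0 : 0 < 1 + (sqn a)^-1 by rewrite addr_gt0 // invr_gt0.
(* [k] is the size that [touch_small] asks for to keep the domain in the polydisk; [M] is chosen
   large enough for this and for [touch_phi]. *)
pose k := Num.min 1 (eta ^+ 2 / (4 * (1 + (sqn a)^-1))).
have k0 : 0 < k by rewrite lt_min ltr01 divr_gt0 ?mulr_gt0 ?exprn_gt0.
have k1 : k <= 1 by rewrite ge_min lexx.
have k2 : 2 * k * (1 + (sqn a)^-1) < eta ^+ 2.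
  apply: (@le_lt_trans _ _ (2 * (eta ^+ 2 / (4 * (1 + (sqn a)^-1))) * (1 + (sqn a)^-1))).
    by rewrite ler_wpM2r ?(ltW sa0) // ler_wpM2l // ge_min lexx orbT.
  have -> : 2 * (eta ^+ 2 / (4 * (1 + (sqn a)^-1))) * (1 + (sqn a)^-1) = eta ^+ 2 / 2.
    by move: (1 + _) sa0 => c c0; field; rewrite gt_eqF.
  have : 0 < eta ^+ 2 by rewrite exprn_gt0.
  move: (eta ^+ 2) => c c0; rewrite ltr_pdivrMr //; lra.
pose M := Num.max (3 / r ^+ 2) ((3 + dl) / k).
have M1 : 3 / r ^+ 2 <= M by rewrite le_max lexx.
have M2 : (3 + dl) / k <= M by rewrite le_max lexx orbT.
have M0 : 0 < M by apply: lt_le_trans M1; rewrite divr_gt0 // exprn_gt0.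
have Mk : (3 + dl) / M <= k by move: M2; rewrite !ler_pdivrMr // mulrC.
pose D : set V := [set z | tu a x dl M z < 0].
have DP z : D z -> P z.
  by move=> Dz; apply: etaP; apply: (touch_small dl0 M0 a0 eta0 _ Mk k2 Dz); rewrite k0.
have Dgood z : D z -> good z.
  move=> Dz; apply: Hx; first exact: DP.
  exact: (touch_phi r0 eps0 eps1 epsr xr xj M1 Dz).
have gD : holomorphic_on D g by move=> z /Dgood; exact: g_hol.
have [V0 [[V0o V0x] [gV gVH gVg]]] := hlevi (@touch_domain R _ a x dl M dl0 M0 a0) (@touch_C2 R _ a x dl M dl0 M0 a0)
  (@touch_p R _ a x dl M dl0 M0 a0) (@touch_pseudoconcave R _ a x dl M dl0 M0 a0) gD.
have /nbhs_nmP[d d0 dV] : nbhs x (V0 `&` P) by apply: open_nbhs_nbhs; split => //; exact: openI.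
(* Subtracting a small multiple of this vertical vector is the scaling [sc], and [lin a v] is the
   squared modulus of the last coordinate of [x], which is positive; so the segment below [x] starts
   inside the domain. *)
pose v : V := x 0 ord_max *: delta_mx 0 ord_max.
have scE c : sc x (1 - c) = x - toC c *: v.
  by rewrite vscE; congr (_ - toC _ *: _); rewrite opprB addrC subrK.
have v0 : 0 < complex.Re (lin a v).
  have vE j : v 0 j = if j == ord_max then x 0 ord_max else 0.
    by rewrite /v rVZ mxE eqxx /=; case: eqP => _; rewrite ?mulr1 ?mulr0.
  rewrite /a avec_lin vE eqxx big1 ?mulr0 ?subr0 => [|j jm]; last by rewrite vE (negPf jm) mulr0.
  have -> : Num.conj (x 0 ord_max) * x 0 ord_max = toC (sqmod (x 0 ord_max)).
    by rewrite mulrC -normCK sqmodE.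
  rewrite -nm_sqmod exprn_gt0 //; exact: lt_le_trans xr.
have [t0 t00 Ht] := @touch_inward R _ a x dl M dl0 M0 a0 v v0.
pose t := Num.min (t0 / 2) (Num.min 2^-1 (d / 4 / (nm v + 1))).
have nv : 0 <= nm v by exact: nm_ge0.
have t_0 : 0 < t by rewrite !lt_min !divr_gt0 ?invr_gt0 // ltr_wpDl.
have t_1 : t <= 2^-1 by rewrite !ge_min lexx orbT.
have t_2 : t <= d / 4 / (nm v + 1) by rewrite !ge_min lexx !orbT.
have t_3 : t <= t0 / 2 by rewrite ge_min lexx.

have Dx : D (sc x (1 - t)).
  by rewrite scE; apply: Ht; rewrite t_0 /=; apply: le_lt_trans t_3 _; exact: half_lt.
have /nbhs_nmP[e2 e20 e2D] : nbhs (sc x (1 - t)) D.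
  by apply: open_nbhs_nbhs; split => //; have [] := touch_open a x dl M 0.
apply: (@extend_good x (1 - t) (d / 2) gV e2) => //.
- exact: one_subr_itv t_0 t_1.
- by rewrite divr_gt0.
- by move=> y; rewrite mulrC divfK // => /dV[].
- by move=> y; rewrite mulrC divfK // => /dV[Vy _]; apply: gVH; right.
- rewrite scE [x - _]addrC addrK nmN nmZ nm_toC gtr0_norm //.
  apply: (@le_lt_trans _ _ (d / 4 / (nm v + 1) * nm v)); first by rewrite ler_wpM2r.
  rewrite mulrAC ltr_pdivrMr ?ltr_wpDl //; exact: quarter_mul_lt.
- exact: Dgood.
by move=> y /e2D; exact: gVg.
Qed.

Let all_good x0 : P x0 -> good x0.
Proof.
move=> Px0; apply: contrapT => bad0; have /andP[r0 r1] := r01.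
pose w2 := sqmod (wc x0).
have w21 : w2 < 1 by rewrite /w2 -nm_sqmod expr_lt1 ?nm_ge0 //; exact: Px0.
have w20 : 0 <= w2 by exact: sqmod_ge0.
have q0 : 0 < q.+1%:R :> R by rewrite ltr0n.
(* The first bound forces [sqmod (wc z) <= (1 + w2) / 2 < 1] wherever [phi] is at most its value at
   [x0]; the other two are those of [extremal_bad]. *)
pose eps := Num.min ((1 - w2) / 2 / q.+1%:R) (Num.min (r ^+ 2 / (8 * q.+1%:R)) 1).
have eps0 : 0 < eps.
  by rewrite !lt_min ltr01 !divr_gt0 ?mulr_gt0 ?exprn_gt0 // subr_gt0.
have eps1 : eps <= 1 by rewrite !ge_min lexx !orbT.
have epsr : eps <= r ^+ 2 / (8 * q.+1%:R) by rewrite !ge_min lexx !orbT.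
have epsw : eps * q.+1%:R <= (1 - w2) / 2 by rewrite -ler_pdivlMr // ge_min lexx.
pose m := (1 + w2) / 2.
have m1 : Num.sqrt m < 1.
  by rewrite -[X in _ < X]sqrtr1 ltr_sqrt //; exact: midpoint_lt1.
have low z : P z -> phi eps z <= phi eps x0 -> nm (wc z) <= Num.sqrt m.
  move=> Pz pz.
  rewrite -[leLHS]ger0_norm ?nm_ge0 // -sqrtr_sqr ler_wsqrtr // nm_sqmod.
  have h1 : phi eps x0 <= w2 by rewrite /phi gerBl mulr_ge0 ?sqn'_ge0 // ltW.
  have h2 : eps * sqn' z <= eps * q.+1%:R by rewrite ler_wpM2l ?sqn'_le // ltW.
  move: pz; rewrite {1}/phi -/(wc z) => pz.
  exact: le_midpoint pz h1 h2 epsw.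
(* A compact box with all the bad points where [phi] does not exceed its value at [x0]: points with
   another coordinate of modulus above [1 - r] are good by the figure. *)
pose K : set V := [set z | forall i, nm (z 0 i) <= if i == ord_max then Num.sqrt m else 1 - r].
have KP z : K z -> P z.
  by move=> Kz i; apply: le_lt_trans (Kz i) _; case: ifP => _ //; rewrite gtrBl.
have badK z : P z -> ~ good z -> phi eps z <= phi eps x0 -> K z.
  move=> Pz bz pz i; case: eqP => [->|/eqP im]; first exact: low.
  by rewrite leNgt; apply/negP => h; apply: bz; have [] := good_HB Pz im h.
pose B0 := K `&` ~` [set z | good z].
have cB : compact B0.
  apply: (@subclosed_compact _ _ K); [|exact: compact_box|by move=> z []].
  apply: closedI.
    by apply: compact_closed; [exact: norm_hausdorff|exact: compact_box].
  apply: open_closedC; rewrite openE => z /good_nbhs[d d0 dg]; apply/nbhs_nmP; exists d => //.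
have [x /set_mem[Kx bx] Hx] : exists2 x, x \in B0 & forall y, y \in B0 -> phi eps x <= phi eps y.
  apply: compact_EVT_min => //; first by exists x0; split => //; apply: badK.
  by apply: continuous_subspaceT; exact: phi_continuous.
have px : phi eps x <= phi eps x0 by apply: Hx; apply/mem_set; split => //; apply: badK.
apply: bx; apply: (extremal_bad eps0 eps1 epsr (KP _ Kx)) => z Pz pz.
apply: contrapT => bz; have Bz : B0 z by split => //; apply: badK => //; exact: ltW (lt_le_trans pz px).
by have := Hx z (mem_set Bz); rewrite leNgt pz.
Qed.

Lemma levi_figure_extension : exists2 G : V -> X, holomorphic_on (polydisk 1) G &
  forall z, hartogs_figure r z -> G z = f z.
Proof.
exists g => [z|z /gf[]//].
by rewrite PE => Pz; apply: g_hol; exact: all_good.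
Qed.

End LeviHartogs.

Theorem levi_hartogs (R : realType) q (X : hilbert_manifold R) :
  q_levi_extension q X -> q_hartogs q X.
Proof. move=> hX r r01 f fH; exact: levi_figure_extension. Qed.

(** * Propagation of joint holomorphy *)

Section ProductSpace.
Variable R : realType.
Local Notation C := (Cx R).

Lemma nm_pair_lt (V W : normedModType C) (a : V) (b : W) (e : R) :
  nm ((a, b) : (V * W)%type) < e <-> nm a < e /\ nm b < e.
Proof.
have E : nm ((a, b) : (V * W)%type) = Num.max (nm a) (nm b).
  apply: toC_inj; rewrite -nmE prod_normE /= !nmE.
  have [h|h] := leP (nm a) (nm b); first by apply: max_r; rewrite toC_le.
  by apply: max_l; rewrite toC_le ltW.
by rewrite E gt_max; split => [/andP//|[-> ->]].
Qed.

Section Scale.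
Variable W : normedModType C.

Let scale_is_bilinear : bilinear_for (GRing.Scale.Law.clone _ _ ( *:%R ) _)
  (GRing.Scale.Law.clone _ _ ( *:%R ) _) (@GRing.scale C W).
Proof.
split => [u|u] a x y /=.
  by rewrite scalerDl scalerA.
by rewrite scalerDr !scalerA mulrC.
Qed.

HB.instance Definition _ := bilinear_isBilinear.Build C C W W _ _ (@GRing.scale C W)
  scale_is_bilinear.

Lemma differentiable_scale (V : normedModType C) (k : V -> C) (f : V -> W) x :
  differentiable k x -> differentiable f x -> differentiable (fun y => k y *: f y) x.
Proof.
move=> dk df.
apply: (@differentiable_comp _ _ _ _ (fun y => (k y, f y)) (fun p : C * W => p.1 *: p.2)).
  exact: differentiable_pair.
apply: (@differentiable_bilin _ _ _ _ (@GRing.scale C W)).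
exact: scale_continuous.
Qed.

End Scale.

(** Local choices of [N] are merged by monotonicity; one index can encode both a bound and the
    inverse of a radius. *)
Lemma compact_uniform (T : normedModType C) (K : set T) (P : nat -> T -> Prop) :
  compact K -> (forall N N' t, (N <= N')%N -> P N t -> P N' t) ->
  (forall t, K t -> exists N, exists2 e : R, 0 < e & forall t', nm (t' - t) < e -> P N t') ->
  exists N, forall t, K t -> P N t.
Proof.
move=> /compact_near_coveringP cK Pm H.
have [N _ HN] : \forall N \near \oo, K `<=` P N.
  apply: cK => t /H[N [e e0 eP]].
  exists ([set t' | nm (t' - t) < e], [set N' | (N <= N')%N]) => /=.
    by split; [apply/nbhs_nmP; exists e|exists N].
  by move=> [t' N'] [/= /eP h1 h2]; exact: Pm h1.
by exists N => t; apply: (HN N (leqnn N)).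
Qed.

End ProductSpace.

(** * Baire's theorem on balls of row vectors *)

Section Baire.
Variable R : realType.
Local Notation C := (Cx R).
Variable n : nat.
Local Notation V := 'rV[C]_n.

Lemma rV_complete (u : nat -> V) (e : nat -> R) :
  (forall k m, (k <= m)%N -> nm (u m - u k) <= e k) -> to0 e ->
  exists l, forall k, nm (u k - l) <= e k.
Proof.
move=> ue e0.
have e_ge k : 0 <= e k by apply: le_trans (ue k k (leqnn k)); exact: nm_ge0.
have H j : exists l : C, forall k, nm (u k 0 j - l) <= e k.
  apply: C_complete => // k m km; apply: le_trans (ue k m km).
  exact: nm_entryB.
have [l Hl] := choice H.
exists (\row_j l j) => k; apply: nm_rVB_le => // j; by rewrite mxE.
Qed.

(** Otherwise nested balls [s k] can be chosen to avoid [E 0], [E 1], and so on in turn, and their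
    common limit is in no [E N]. *)
Lemma baire (E : nat -> set V) (v0 : V) (r0 : R) : 0 < r0 ->
  (forall N v, ~ E N v -> exists2 e : R, 0 < e & forall v', nm (v' - v) < e -> ~ E N v') ->
  (forall v, nm (v - v0) < r0 -> exists N, E N v) ->
  exists N v1, exists2 r1 : R, 0 < r1 &
    forall v, nm (v - v1) < r1 -> nm (v - v0) < r0 /\ E N v.
Proof.
move=> r00 Ec Ecov; apply: contrapT => noball.
(* The factor 2 in the third clause leaves enough room for the limit to lie inside every open ball.
   When the premises fail, the ball itself serves as a default. *)
have step N (b : V * R) : exists b' : V * R, 0 < b.2 -> (forall v, nm (v - b.1) < b.2 -> nm (v - v0) < r0) ->
    [/\ 0 < b'.2, b'.2 <= b.2 / 2, nm (b'.1 - b.1) + 2 * b'.2 <= b.2 &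
      forall v, nm (v - b'.1) < b'.2 -> ~ E N v].
  have [b0|b0] := ltP 0 b.2; last by exists b.
  have [bs|nbs] := pselect (forall v, nm (v - b.1) < b.2 -> nm (v - v0) < r0); last by exists b.
  have [v [vb nE]] : exists v, nm (v - b.1) < b.2 /\ ~ E N v.
    apply: contrapT => H; apply: noball; exists N, b.1, b.2 => // v vb; split; first exact: bs.
    by apply: contrapT => nE; apply: H; exists v.
  have [e e0 eE] := Ec N v nE.
  exists (v, Num.min e ((b.2 - nm (v - b.1)) / 2)) => _ _ /=.
  set rr := Num.min _ _.
  have h1 : rr <= (b.2 - nm (v - b.1)) / 2 by rewrite ge_min lexx orbT.
  have h2 : rr <= e by rewrite ge_min lexx.
  have h3 : 0 < rr by rewrite lt_min e0 divr_gt0 // subr_gt0.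
  have h4 := nm_ge0 (v - b.1).
  clearbody rr; move: (nm (v - b.1)) vb h1 h4 => x vb h1 h4.
  split => //; [lra|lra|].
  by move=> w wv; apply: eE; apply: lt_le_trans wv h2.
have [st Hst] := choice (fun Nb : nat * (V * R) => step Nb.1 Nb.2).
pose s := fix s k : V * R := if k is k'.+1 then st (k', s k') else (v0, r0).
have Hs k : 0 < (s k).2 /\ forall v, nm (v - (s k).1) < (s k).2 -> nm (v - v0) < r0.
  elim: k => [|k [IH1 IH2]] //=; have [h1 h2 h3 h4] := Hst (k, s k) IH1 IH2; split => // v vk.
  apply: IH2; rewrite -[v](subrK (st (k, s k)).1) -addrA; apply: le_lt_trans (nmD _ _) _.
  move: (nm (v - _)) (nm (_ - (s k).1)) vk h3 => x y vk h3; move: (h1); lra.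
have Hs' k : [/\ 0 < (s k.+1).2, (s k.+1).2 <= (s k).2 / 2, nm ((s k.+1).1 - (s k).1) + 2 * (s k.+1).2 <= (s k).2 &
      forall v, nm (v - (s k.+1).1) < (s k.+1).2 -> ~ E k v].
  by have [h1 h2] := Hs k; exact: (Hst (k, s k)).
have cauchy k d : nm ((s (k + d)%N).1 - (s k).1) + 2 * (s (k + d)%N).2 <= 2 * (s k).2.
  elim: d => [|d IH]; first by rewrite addn0 subrr nm0 add0r.
  rewrite addnS; have [h1 h2 h3 _] := Hs' (k + d)%N.
  have : nm ((s (k + d).+1).1 - (s k).1) <= nm ((s (k + d).+1).1 - (s (k + d)%N).1) + nm ((s (k + d)%N).1 - (s k).1).
    by apply: le_trans (nmD _ _); rewrite addrA subrK.
  move: (nm _) (nm _) (nm _) IH h3 => x y z IH h3 h; lra.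
have small k : (s k).2 <= r0 / 2 ^+ k.
  elim: k => [|k IH]; first by rewrite expr0 divr1.
  have [_ h _ _] := Hs' k; apply: le_trans h _; rewrite exprSr invfM mulrA; lra.
have [l Hl] : exists l, forall k, nm ((s k).1 - l) <= 2 * (s k).2.
  apply: rV_complete.
    move=> k m km; have := cauchy k (m - k)%N; rewrite subnKC //.
    have [h _] := Hs m; move: (nm _) => x; lra.
  move=> d d0; have [|N HN] := @geo_to0 R r0 (d / 2); first by rewrite divr_gt0.
  by exists N => k /HN; have := small k; lra.
have lin k : nm (l - (s k).1) < (s k).2.
  have [h1 h2 h3 _] := Hs' k; have [h1' h2' h3' _] := Hs' k.+1.
  have h := Hl k.+2; rewrite nmBC in h.
  have g1 : nm (l - (s k).1) <= nm (l - (s k.+2).1) + nm ((s k.+2).1 - (s k).1).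
    by apply: le_trans (nmD _ _); rewrite addrA subrK.
  have g2 : nm ((s k.+2).1 - (s k).1) <= nm ((s k.+2).1 - (s k.+1).1) + nm ((s k.+1).1 - (s k).1).
    by apply: le_trans (nmD _ _); rewrite addrA subrK.
  move: (nm _) (nm _) (nm _) (nm _) (nm _) h g1 g2 h3 h3' => x1 x2 x3 x4 x5 h g1 g2 h3 h3'.
  lra.
have [_ l0] := Hs 0%N; have [N EN] := Ecov l (l0 _ (lin 0%N)).
by have [_ _ _ h] := Hs' N; exact: (h l (lin N.+1)).
Qed.

End Baire.

Section Expansions.
Variable R : realType.
Local Notation C := (Cx R).
Variable V : normedModType C.

Lemma expansion_ge0 (h : C -> V) z0 c (r M : R) : 0 < r -> expansion h z0 c r M -> 0 <= M.
Proof.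
move=> r0 /(_ 0 0%N); rewrite nm0 mul0r expr0 subr0 divr1 mulr1 => /(_ r0).
by apply: le_trans; exact: nm_ge0.
Qed.

Lemma expansion_shrink (h h' : C -> V) z0 c (r r' M : R) : 0 < r' -> r' <= r ->
  (forall a, nm a < r' -> h (z0 + a) = h' (z0 + a)) -> expansion h z0 c r M -> expansion h' z0 c r' M.
Proof.
move=> r'0 rr hh' hc a n ar'; have r0 : 0 < r by exact: lt_le_trans rr.
have M0 := expansion_ge0 r0 hc; have a0 := nm_ge0 a.
rewrite -hh' //; apply: le_trans (hc a n (lt_le_trans ar' rr)) _.
have le1 : nm a / r <= nm a / r' by rewrite ler_wpM2l // lef_pV2.
have lt1 : nm a / r' < 1 by rewrite ltr_pdivrMr // mul1r.
have ge1 : 0 <= nm a / r by rewrite divr_ge0 // ltW.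
apply: ler_wpM2l => //; apply: ler_pM => //.
- exact: exprn_ge0.
- by rewrite invr_ge0 subr_ge0; apply: le_trans le1 (ltW lt1).
- by apply: lerXn2r => //; rewrite nnegrE // (le_trans ge1).
- by rewrite lef_pV2 ?posrE ?subr_gt0 //; [rewrite lerD2l lerN2|exact: le_lt_trans lt1].
Qed.

Lemma half_geo_sum (u : nat -> V) (N : R) k d : 0 <= N -> (forall j, nm (u j) <= N / 2 ^+ j) ->
  nm (\sum_(j < k + d) u j - \sum_(j < k) u j) <= 2 * N / 2 ^+ k.
Proof.
move=> N0 uN.
have : nm (\sum_(j < k + d) u j - \sum_(j < k) u j) <= 2 * N / 2 ^+ k - 2 * N / 2 ^+ (k + d).
  elim: d => [|d IH]; first by rewrite addn0 !subrr nm0.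
  rewrite addnS big_ord_recr /= addrAC; apply: le_trans (nmD _ _) _.
  have h := uN (k + d)%N.
  have E : 2 * N / 2 ^+ (k + d) - 2 * N / 2 ^+ (k + d).+1 = N / 2 ^+ (k + d).
    by rewrite exprS; field; rewrite expf_neq0.
  move: E IH h; move: (2 * N / 2 ^+ (k + d).+1) (2 * N / 2 ^+ (k + d)) (N / _) => x y z.
  move: (nm _) (nm _) => a b; lra.
move/le_trans; apply; rewrite gerBl divr_ge0 ?mulr_ge0 // exprn_ge0 //.
Qed.

End Expansions.

Lemma shift_diff (R : realType) (V W : normedModType (Cx R)) (h : V -> W) (x a : V) :
  differentiable h (x + a) -> differentiable (fun a => h (x + a)) a.
Proof.
move=> /diffP_nm[L [LK Le]]; apply/diffP_nm; exists L; split => // e /Le[d d0 H].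
by exists d => // v /H; rewrite addrA.
Qed.

(** * Propagation of a joint extension towards [t = 0] *)

Section Propagation.
Variable R : realType.
Local Notation C := (Cx R).
Local Notation W := (ell2 R).
Variables (X : hilbert_manifold R) (n : nat).
Local Notation V := 'rV[C]_n.
Variables (v0 : V) (k0 : R) (G : V -> C -> C -> X).
Hypothesis k00 : 0 < k0.
Hypothesis GH : forall (v : V) (t s : C), nm (v - v0) < k0 -> nm t < 1 -> nm s < 1 ->
  hol_at (fun p : C * C => G v p.1 p.2) (t, s).

(* A joint extension near the apex [y = 0] of the cones, matching [G] on every ray
   [s *: v] only near the apex, at a distance which depends on [v]. *)
Definition sprout (t1 : C) := exists (F : C * V -> X), exists2 d : R, 0 < d &
  (forall (t : C) (y : V), nm (t - t1) < d -> nm y < d -> hol_at F (t, y)) /\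
  forall v : V, nm (v - v0) < k0 -> exists2 e : R, 0 < e &
    forall t s : C, nm (t - t1) < e -> nm s < e -> F (t, s *: v) = G v t s.

Let v0in : nm (v0 - v0) < k0. Proof. by rewrite subrr nm0. Qed.

Lemma slice_diff1 (U T : normedModType C) (s : T) (t : U) : differentiable (fun t : U => (t, s)) t.
Proof. apply: differentiable_pair; [exact: ex_diff|exact: differentiable_cst]. Qed.

Lemma slice_diff2 (U T : normedModType C) (s : T) (t : U) : differentiable (fun s : T => (t, s)) s.
Proof. apply: differentiable_pair; [exact: differentiable_cst|exact: ex_diff]. Qed.

Lemma hol_slice1 (v : V) (t s : C) : nm (v - v0) < k0 -> nm t < 1 -> nm s < 1 -> hol_at (fun t => G v t s) t.
Proof. by move=> vk t1 s1; exact: (hol_at_comp (slice_diff1 s t) (GH vk t1 s1)). Qed.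

Let nm_ball_open (T : normedModType C) (x : T) (e : R) : open [set y | nm (y - x) < e].
Proof.
rewrite openE => y yx; apply/nbhs_nmP; exists (e - nm (y - x)) => [|z zy].
  by rewrite subr_gt0.
rewrite /= -[z](subrK y) -addrA; apply: le_lt_trans (nmD _ _) _.
by rewrite -ltrBrDr.
Qed.

(** Near [t1] both sides are [F (t, 0)], since [s = 0] erases [v]; the identity theorem on the unit
    disc extends the equality. *)
Lemma sprout_axis (t1 : C) (v : V) (t : C) : nm t1 < 1 -> sprout t1 -> nm (v - v0) < k0 -> nm t < 1 -> G v t 0 = G v0 t 0.
Proof.
move=> t11 [F [d d0 [FH FG]]] vk t_1.
have [e e0 He] := FG v vk; have [e' e'0 He'] := FG v0 v0in.
have m0 : 0 < Num.min e e' by rewrite lt_min e0.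
apply: (@identity_segment R X C [set z | nm z < 1] (fun t => G v t 0) (fun t => G v0 t 0) t1 t _ m0).
- by have := @nm_ball_open C 0 1; congr open; apply/seteqP; split => z /=; rewrite subr0.
- by move=> z z1; split; apply: hol_slice1; rewrite ?nm0.
- move=> s /andP[s0 s1] /=; have -> : t1 + toC s * (t - t1) = toC (1 - s) * t1 + toC s * t.
    by rewrite toCB toC1; ring.
  apply: le_lt_trans (nmD _ _) _; rewrite !nmM !nm_toC !ger0_norm ?subr_ge0 //.
  have h1 : (1 - s) * nm t1 <= (1 - s) * Num.max (nm t1) (nm t) by rewrite ler_wpM2l ?subr_ge0 // le_max lexx.
  have h2 : s * nm t <= s * Num.max (nm t1) (nm t) by rewrite ler_wpM2l // le_max lexx orbT.
  have h3 : Num.max (nm t1) (nm t) < 1 by rewrite gt_max t11.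
  apply: le_lt_trans h3; apply: le_trans (lerD h1 h2) _; rewrite -mulrDl subrK mul1r //.
move=> z; rewrite lt_min => /andP[z1 z2].
by rewrite -(He z 0) ?nm0 // -(He' z 0) ?nm0 // !scale0r.
Qed.

Lemma hol_bounded (U : normedModType C) (f : U -> X) (z : U) (c : chart R X) : atlas c ->
  hol_at f z -> chart_dom c (f z) -> exists B : R, exists2 e : R, 0 < e &
    forall y : U, nm (y - z) < e -> chart_dom c (f y) /\ nm (chart_map c (f y)) <= B.
Proof.
move=> ac [fc fd] cz.
have [e1 e10 H1] : exists2 e : R, 0 < e & forall y, nm (y - z) < e -> chart_dom c (f y).
  have /cont_nmP h := fc; apply: (h (chart_dom c)).
  by apply: open_nbhs_nbhs; split => //; exact: chart_dom_open.
have [e2 e20 H2] : exists2 e : R, 0 < e & forall y, nm (y - z) < e ->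
    nm (chart_map c (f y) - chart_map c (f z)) < 1.
  have /differentiable_continuous/contP h := fd c ac cz.
  exact: h ltr01.
exists (nm (chart_map c (f z)) + 1), (Num.min e1 e2) => [|y]; first by rewrite lt_min e10.
rewrite lt_min => /andP[/H1 y1 /H2 y2]; split => //.
move: (chart_map c (f y)) (chart_map c (f z)) y2 => u w uw.
have := nmD (u - w) w; rewrite subrK => /le_trans; apply.
by rewrite addrC lerD2l ltW.
Qed.

Section Step.
Variables (c : chart R X) (t1 : C) (r : R).
Hypotheses (ac : atlas c) (r0 : 0 < r).
Hypothesis disc : forall a : C, nm a <= 2 * r -> nm (t1 + a) < 1 /\ chart_dom c (G v0 (t1 + a) 0).
Hypothesis Gax : forall (v : V) (t : C), nm (v - v0) < k0 -> nm t < 1 -> G v t 0 = G v0 t 0.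

Local Notation cm := (chart_map c).

Let pairB (T : normedModType C) (a b : C) (x y : T) : ((a, x) - (b, y) : (C * T)%type) = (a - b, x - y).
Proof. by []. Qed.

Let shiftB (a b : C) : t1 + a - (t1 + b) = a - b.
Proof. by rewrite opprD addrACA subrr add0r. Qed.

(** The core curve stays in the chart [c] over a closed disc, and compactness of the disc gives a
    thickness in [s] that is uniform in [a], for one [v] at a time. *)
Let ray_tube (v : V) : nm (v - v0) < k0 -> exists M : R, exists2 e : R, 0 < e &
  forall a s : C, nm s < e -> nm a <= 2 * r ->
    [/\ chart_dom c (G v (t1 + a) s), nm (cm (G v (t1 + a) s)) <= M &
      differentiable (fun a => cm (G v (t1 + a) s)) a].
Proof.
move=> vk.
(* [N] bounds the values, and the inverse of [N.+1] is the thickness. *)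
pose Q (N : nat) (a : C) := forall s : C, nm s < N.+1%:R^-1 ->
  chart_dom c (G v (t1 + a) s) /\ nm (cm (G v (t1 + a) s)) <= N%:R.
have [N HN] : exists N, forall a, nm a <= 2 * r -> Q N a.
  apply: (@compact_uniform R C [set a | nm a <= 2 * r] Q); first exact: compact_disk.
    move=> N N' a NN Ha s sN; have [|h1 h2] := Ha s.
      by apply: lt_le_trans sN _; rewrite lef_pV2 ?posrE ?ltr0n // ler_nat ltnS.
    by split => //; apply: le_trans h2 _; rewrite ler_nat.
  move=> a /= ar; have [a1 a2] := disc ar.
  have h0 : nm (0 : C) < 1 by rewrite nm0.
  have dz : chart_dom c ((fun p : C * C => G v p.1 p.2) (t1 + a, 0)) by rewrite /= Gax.
  have [B [e e0 He]] := hol_bounded ac (GH vk a1 h0) dz.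
  pose N := Num.Def.archi_bound (Num.max `|B| e^-1).
  have NB : Num.max `|B| e^-1 < N%:R.
    by apply: archi_boundP; rewrite le_max normr_ge0.
  move: NB; rewrite gt_max => /andP[NB Ne].
  exists N, e => // a' a'a s sN.
  have sp : nm ((t1 + a', s) - (t1 + a, 0) : C * C) < e.
    rewrite pairB shiftB subr0; apply/nm_pair_lt; split => //; apply: lt_le_trans sN _.
    rewrite -[leRHS]invrK lef_pV2 ?posrE ?invr_gt0 ?ltr0n //.
    by apply: ltW; apply: lt_trans Ne _; rewrite ltr_nat.
  have [h1 h2] := He _ sp; split => //; apply: le_trans h2 _.
  by apply: ltW; apply: le_lt_trans NB; rewrite ler_norm.
exists N%:R, (Num.min N.+1%:R^-1 1) => [|a s]; first by rewrite lt_min ltr01 invr_gt0 ltr0n.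
rewrite lt_min => /andP[sN s1] ar; have [h1 h2] := HN a ar s sN; split => //.
have [a1 _] := disc ar.
apply: (@shift_diff _ C W (fun t => cm (G v t s)) t1 a).
by have [_] := hol_slice1 vk a1 s1; apply.
Qed.

Let ray_expansion (v : V) : nm (v - v0) < k0 -> exists M : R, exists2 e : R, 0 < e &
  forall s : C, nm s < e -> exists2 b : nat -> W, (forall j, nm (b j) <= M / r ^+ j) &
    expansion (fun a => cm (G v (t1 + a) s)) 0 b r M.
Proof.
move=> vk; have [M [e e0 H]] := ray_tube vk; exists M, e => // s se.
have rr : r < 2 * r by rewrite ltr_pMl // ltr1n.
apply: (vtaylor r0 rr) => [z|t _].
  by rewrite subr0 => /ltW zr; have [] := H z s se zr.
have [|_ h _] := H (toC r * Ec t) s se; last by rewrite add0r.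
by rewrite nmM nm_Ec mulr1 nm_toC gtr0_norm ?(ltW rr).
Qed.

Hypothesis sp1 : sprout t1.

(** The sprout read in the chart [c] and recentred at [t1]. *)
Let germ : exists (H : C -> V -> W) (d M : R), 0 < d /\ [/\
  forall a y, nm a < d -> nm y < d -> differentiable (fun a => H a y) a,
  forall a y, nm a < d -> nm y < d -> differentiable (H a) y,
  forall a y, nm a < d -> nm y < d -> nm (H a y) <= M &
  forall v : V, nm (v - v0) < k0 -> exists2 e : R, 0 < e &
    forall a s : C, nm a < e -> nm s < e -> H a (s *: v) = cm (G v (t1 + a) s)].
Proof.
have [F [d1 d10 [FH FG]]] := sp1.
have [_ dom0] : nm (t1 + 0) < 1 /\ chart_dom c (G v0 (t1 + 0) 0).
  by apply: disc; rewrite nm0 mulr_ge0 // ltW.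
have F0 : F (t1, 0) = G v0 (t1 + 0) 0.
  have [e e0 He] := FG v0 v0in; rewrite addr0 -(He t1 0) ?scale0r ?nm0 //.
  by rewrite subrr nm0.
have hF0 : hol_at F (t1, 0) by apply: FH; rewrite ?subrr nm0.
rewrite -F0 in dom0; have [M [e e0 HM]] := hol_bounded ac hF0 dom0.
pose d := Num.min d1 e.
have d0 : 0 < d by rewrite lt_min d10.
have inE (a : C) (y : V) : ((t1, 0) + (a, y) : (C * V)%type) = (t1 + a, y).
  by congr (_, _); rewrite /= add0r.
have near (a : C) (y : V) : nm a < d -> nm y < d -> [/\ differentiable (cm \o F) ((t1, 0) + (a, y)),
    chart_dom c (F (t1 + a, y)) & nm (cm (F (t1 + a, y))) <= M].
  rewrite !lt_min => /andP[a1 a2] /andP[y1 y2].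
  have [|h1 h2] := HM (t1 + a, y).
    by rewrite pairB subr0 addrAC subrr add0r; apply/nm_pair_lt.
  rewrite inE; split => //.
  have [|_] := FH (t1 + a) y _ y1; first by rewrite addrAC subrr add0r.
  exact.
exists (fun a y => cm (F ((t1, 0) + (a, y)))), d, M; split => //; split.
- move=> a y ad yd; have [h _ _] := near a y ad yd.
  exact: (differentiable_comp (slice_diff1 y a) (shift_diff h)).
- move=> a y ad yd; have [h _ _] := near a y ad yd.
  exact: (differentiable_comp (slice_diff2 y a) (shift_diff h)).
- by move=> a y ad yd; rewrite inE; have [] := near a y ad yd.
move=> v vk; have [e1 e10 He] := FG v vk; exists e1 => // a s ae se.
by rewrite inE He // addrAC subrr add0r.
Qed.

(** The Taylor coefficients in [a] of the germ are holomorphic in [y], but come with its small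
    radius. On a ray [s *: v] they coincide, by uniqueness, with those of [G v], which satisfy
    Cauchy's estimates on the fixed radius [r]. *)
Let germ_coefs : exists (b : nat -> V -> W) (d : R), [/\ 0 < d,
  forall j y, nm y < d -> differentiable (b j) y &
  forall v : V, nm (v - v0) < k0 -> exists M : R, exists2 e : R, 0 < e & forall s : C, nm s < e ->
    [/\ forall j, nm (b j (s *: v)) <= M / r ^+ j,
      expansion (fun a => cm (G v (t1 + a) s)) 0 (fun j => b j (s *: v)) r M &
      forall a, nm a <= 2 * r -> chart_dom c (G v (t1 + a) s)]].
Proof.
have [H [d [M [d0 [H1 H2 HM HG]]]]] := germ.
have d20 : 0 < d / 2 by rewrite divr_gt0.
have d2d : d / 2 < d by exact: half_lt.
have coef y : exists b : nat -> W, nm y < d -> (forall j, nm (b j) <= M / (d / 2) ^+ j) /\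
    expansion (fun a => H a y) 0 b (d / 2) M.
  have [yd|yd] := ltP (nm y) d; last by exists (fun=> 0).
  have [||b b1 b2] := @vtaylor R (fun a => H a y) 0 d (d / 2) M d20 d2d; last by exists b.
    by move=> z; rewrite subr0 => zd; exact: H1.
  by move=> t _; apply: HM => //; rewrite add0r nmM nm_Ec mulr1 nm_toC gtr0_norm.
have [B HB] := choice coef.
exists (fun j y => B y j), d; split => //.
  move=> j y yd; apply: (@coef_diff R V H (fun j y => B y j) 0 d d (d / 2) M) => //.
  - by move=> a z ad; rewrite subr0 => zd; exact: H2.
  - by move=> k z; rewrite subr0 => zd; have [] := HB z zd.
  - by move=> z; rewrite subr0 => zd; have [] := HB z zd.
  - by rewrite subr0.
move=> v vk; have [Mv [e1 e10 Hv]] := ray_expansion vk.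
have [Mt [e2 e20 Ht]] := ray_tube vk; have [e3 e30 He] := HG v vk.
have nv : 0 < nm v + 1 by rewrite ltr_wpDl ?nm_ge0.
exists Mv, (Num.min (Num.min e1 e2) (Num.min e3 (d / (nm v + 1)))).
  by rewrite !lt_min e10 e20 e30 divr_gt0.
move=> s; rewrite !lt_min => /andP[/andP[s1 s2] /andP[s3 s4]].
have sv : nm (s *: v) < d.
  rewrite nmZ; move: s4; rewrite ltr_pdivlMr //; apply: le_lt_trans.
  by rewrite ler_wpM2l ?nm_ge0 // lerDl.
have [b bM bE] := Hv s s1.
have [_ BE] := HB _ sv.
pose e := Num.min e3 (d / 2).
have e0 : 0 < e by rewrite lt_min e30.
have BE' : expansion (fun a => cm (G v (t1 + a) s)) 0 (B (s *: v)) e M.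
  apply: (expansion_shrink e0 _ _ BE); first by rewrite ge_min lexx orbT.
  by move=> a; rewrite lt_min add0r => /andP[ae _]; exact: He.
have bB := expansion_uniq r0 e0 bE BE'; rewrite bB in bM bE.
split => //.
by move=> a ar; have [] := Ht a s s2 ar.
Qed.

Let archi (a : R) : exists N : nat, a <= N%:R.
Proof.
exists (Num.Def.archi_bound `|a|); apply: ltW; apply: le_lt_trans (ler_norm a) _.
exact: archi_boundP.
Qed.

Let in_ball (v : V) : nm (v - v0) < k0 -> nm v < nm v0 + k0.
Proof. by move=> vk; rewrite -[v](subrK v0); apply: le_lt_trans (nmD _ _) _; rewrite addrC ltrD2l. Qed.

(* The coefficients are bounded on each ray, with constants depending on the ray.
   Baire makes them uniform on a subcone around [v1], and the maximum principle on
   the discs [y + z *: v1] carries the bound over to all small [y]. *)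
Let uniform_coefs : exists (b : nat -> V -> W) (d N : R), [/\ 0 < d,
  forall j y, nm y < d -> differentiable (b j) y, forall j y, nm y < d -> nm (b j y) <= N / r ^+ j &
  forall v : V, nm (v - v0) < k0 -> exists M : R, exists2 e : R, 0 < e & forall s : C, nm s < e ->
    [/\ forall j, nm (b j (s *: v)) <= M / r ^+ j,
      expansion (fun a => cm (G v (t1 + a) s)) 0 (fun j => b j (s *: v)) r M &
      forall a, nm a <= 2 * r -> chart_dom c (G v (t1 + a) s)]].
Proof.
have [b [d [d0 bD Hb]]] := germ_coefs.
pose B1 := nm v0 + k0; have B10 : 0 < B1 by rewrite ltr_wpDl ?nm_ge0.
pose rho := d / 2 / B1.
have rho0 : 0 < rho by rewrite !divr_gt0.
have rj0 j : 0 < r ^+ j by rewrite exprn_gt0.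
have rhoN (N : nat) : 0 < rho / N.+1%:R /\ rho / N.+1%:R <= rho.
  split; first by rewrite divr_gt0.
  by rewrite ler_pdivrMr ?ltr0n // ler_peMr ?(ltW rho0) // ler1n.
have small (s : C) (v : V) (N : nat) : nm (v - v0) < k0 -> nm s < rho / N.+1%:R -> nm (s *: v) < d / 2.
  move=> /in_ball/ltW vB sN; have [h1 h2] := rhoN N.
  rewrite nmZ; apply: (@le_lt_trans _ _ (nm s * B1)); first by rewrite ler_wpM2l ?nm_ge0.
  by rewrite -ltr_pdivlMr //; exact: lt_le_trans h2.
have d2 : d / 2 < d by exact: half_lt.
(* Directions that admit the constant [N] along a ray of length [rho / N.+1]; the choice of [rho]
   keeps these rays where the coefficients are holomorphic. *)
pose E (N : nat) : set V := [set v | nm (v - v0) < k0 -> forall j (s : C), nm s < rho / N.+1%:R -> nm (b j (s *: v)) <= N%:R / r ^+ j].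
have [||N [v1 [r1 r10 HN]]] := @baire R n E v0 k0 k00.
- move=> N v /not_implyP[vk /existsNP[j /existsNP[s /not_implyP[sN /negP]]]].
  rewrite -ltNge => big.
  have /differentiable_continuous/contP/(_ (nm (b j (s *: v)) - N%:R / r ^+ j)) := bD j _ (lt_trans (small s v N vk sN) d2).
  rewrite subr_gt0 => /(_ big)[e e0 He].
  have s10 : 0 < nm s + 1 by rewrite ltr_wpDl ?nm_ge0.
  exists (Num.min (k0 - nm (v - v0)) (e / (nm s + 1))).
    by rewrite lt_min subr_gt0 vk divr_gt0.
  move=> v'; rewrite lt_min => /andP[v'1 v'2] /(_ _ j s sN) h.
  have : nm (v' - v0) < k0.
    rewrite -[v'](subrK v) -addrA; apply: le_lt_trans (nmD _ _) _.
    by rewrite -ltrBrDr.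
  move=> /h {}h.
  have {}He : nm (b j (s *: v') - b j (s *: v)) < nm (b j (s *: v)) - N%:R / r ^+ j.
    apply: He; rewrite -scalerBr nmZ.
    move: v'2; rewrite ltr_pdivlMr //; apply: le_lt_trans; rewrite mulrC ler_wpM2l ?nm_ge0 // lerDl //.
  have := nmD (b j (s *: v) - b j (s *: v')) (b j (s *: v')); rewrite subrK nmBC.
  by move: (nm _) (nm _) (nm _) (N%:R / _) h He => x y z w; lra.
- move=> v vk; have [M [e e0 H]] := Hb v vk.
  have [N HN] := archi (Num.max M (rho / e)).
  move: HN; rewrite ge_max => /andP[N1 N2].
  exists N => _ j s sN; have [|h _ _] := H s.
    apply: lt_le_trans sN _; rewrite ler_pdivrMr ?ltr0n // mulrC -ler_pdivrMr //.
    by apply: le_trans N2 _; rewrite ler_nat.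
  by apply: le_trans (h j) _; rewrite ler_wpM2r // invr_ge0 ltW.
have [rN0 rN1] := rhoN N; pose s0 := rho / N.+1%:R / 2.
have s00 : 0 < s0 by rewrite divr_gt0.
have s02 : 2 * s0 = rho / N.+1%:R by rewrite mulrC divfK.
have [v1k _] : nm (v1 - v0) < k0 /\ E N v1 by apply: HN; rewrite subrr nm0.
pose d' := Num.min (s0 * r1) (d / 2).
have d'd : d' <= d / 2 by rewrite ge_min lexx orbT.
exists b, d', N%:R; split => //.
- by rewrite lt_min mulr_gt0 //= divr_gt0.
- by move=> j y yd; apply: bD; apply: lt_trans (lt_le_trans yd d'd) d2.
move=> j y; rewrite lt_min => /andP[y1 y2].
have s0s : s0 < 2 * s0 by rewrite ltr_pMl // ltr1n.
have := @max_modulus R (fun z : C => b j (y + z *: v1)) 0 (2 * s0) s0 (N%:R / r ^+ j) s00 s0s.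
rewrite scale0r addr0; apply => z; rewrite subr0.
  move=> zs; apply: comp_line_diff; apply: bD; apply: le_lt_trans (nmD _ _) _.
  rewrite s02 in zs; have := small z v1 N v1k zs.
  by move: (nm _) (nm _) y2 => x1 x2; lra.
move=> zs; have zn0 : z != 0 by rewrite -nm_eq0 zs gt_eqF.
(* On the circle [nm z = s0] this point is on a ray directed into the ball of radius [r1] about
   [v1], because [nm y < s0 * r1]. *)
have -> : y + z *: v1 = z *: (v1 + z^-1 *: y).
  by rewrite scalerDr scalerA divff // scale1r addrC.
have near1 : nm (v1 + z^-1 *: y - v1) < r1.
  rewrite addrAC subrr add0r nmZ.
  have nz : nm z^-1 = s0^-1.
    apply: (@mulfI _ s0); first by rewrite gt_eqF.
    by rewrite -{1}zs -nmM divff // nm1 divff // gt_eqF.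
  by rewrite nz mulrC ltr_pdivrMr // mulrC.
have [h1 h2] := HN _ near1; apply: h2 => //.
by rewrite zs -s02.
Qed.

Let fst_diff (p : C * V) : differentiable (@fst C V) p.
Proof. by apply: linear_differentiable; move=> z; exact: cvg_fst. Qed.

Let snd_diff (p : C * V) : differentiable (@snd C V) p.
Proof. by apply: linear_differentiable; move=> z; exact: cvg_snd. Qed.

Let pow_diff j (p : C * V) : differentiable (fun p : C * V => p.1 ^+ j) p.
Proof.
elim: j => [|j IH].
  have -> : (fun p : C * V => p.1 ^+ 0) = cst 1 by apply/funext => z; rewrite expr0.
  exact: differentiable_cst.
rewrite (_ : (fun _ => _) = fun z : C * V => z.1 *: (z.1 ^+ j : C)); last by apply/funext => z; rewrite exprS.
exact: differentiable_scale.
Qed.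

(** On half the radius the terms are bounded by [N / 2 ^+ j], so the partial sums converge uniformly
    and [uniform_limit_diff] applies on the product. *)
Let power_sum (b : nat -> V -> W) (d N : R) : 0 < d ->
  (forall j y, nm y < d -> differentiable (b j) y) -> (forall j y, nm y < d -> nm (b j y) <= N / r ^+ j) ->
  exists H : C * V -> W, forall a y, nm a < r / 2 -> nm y < d -> differentiable H (a, y) /\
    forall k : nat, nm (\sum_(j < k) a ^+ j *: b j y - H (a, y)) <= 2 * N / 2 ^+ k.
Proof.
move=> d0 bD bN.
have N0 : 0 <= N.
  have := bN 0%N 0; rewrite nm0 expr0 divr1 => /(_ d0); apply: le_trans; exact: nm_ge0.
have term (a : C) (y : V) j : nm a < r / 2 -> nm y < d -> nm (a ^+ j *: b j y) <= N / 2 ^+ j.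
  move=> ar yd; rewrite nmZ nmX.
  have E : N / 2 ^+ j = (r / 2) ^+ j * (N / r ^+ j).
    by rewrite expr_div_n; field; rewrite !expf_neq0 // gt_eqF.
  rewrite E; apply: ler_pM; rewrite ?exprn_ge0 ?nm_ge0 //; last exact: bN.
  by apply: lerXn2r; rewrite ?nnegrE ?nm_ge0 // ?divr_ge0 ?ltW.
pose hn k (p : C * V) := \sum_(j < k) p.1 ^+ j *: b j p.2.
have lim (p : C * V) : exists l : W, nm p.1 < r / 2 -> nm p.2 < d -> forall k, nm (hn k p - l) <= 2 * N / 2 ^+ k.
  have [pr|] := ltP (nm p.1) (r / 2); last by exists 0.
  have [pd|] := ltP (nm p.2) d; last by exists 0.
  have [|l Hl] := @ell2_complete R (fun k => hn k p) (fun k => 2 * N / 2 ^+ k) _ (@geo_to0 R _).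
    move=> k m km; rewrite -(subnKC km); 
    apply: (@half_geo_sum R W (fun j => p.1 ^+ j *: b j p.2)) => // j.
    exact: term.
  by exists l.
have [H HH] := choice lim.
exists H => a y ar yd; split; last by move=> k; exact: (HH (a, y) ar yd).
pose R0 := Num.min (r / 2 - nm a) (d - nm y).
have R00 : 0 < R0 by rewrite lt_min !subr_gt0 ar.
have inR (p : C * V) : nm (p - (a, y)) < R0 -> nm p.1 < r / 2 /\ nm p.2 < d.
  case: p => a' y'; rewrite pairB => /nm_pair_lt[] /=; rewrite !lt_min => /andP[h1 _] /andP[_ h2].
  split; first by rewrite -[a'](subrK a); apply: le_lt_trans (nmD _ _) _; rewrite -ltrBrDr.
  by rewrite -[y'](subrK y); apply: le_lt_trans (nmD _ _) _; rewrite -ltrBrDr.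
have pow2 m : 0 < (2 ^+ m : R) by rewrite exprn_gt0.
apply: (@uniform_limit_diff R (C * V)%type hn H (a, y) R0 (2 * N) (fun k => 2 * N / 2 ^+ k)) => //.
- move=> k p /inR[p1 p2]; rewrite /hn.
  rewrite (_ : (fun _ => _) = \sum_(j < k) (fun p : C * V => p.1 ^+ j *: b j p.2)); last first.
    by apply/funext => z; rewrite fct_sumE.
  apply: differentiable_sum => j; apply: differentiable_scale; first exact: pow_diff.
  apply: (@differentiable_comp _ _ _ _ (@snd C V) (b j)); last exact: bD.
  exact: snd_diff.
- move=> k p /inR[p1 p2].
  have := @half_geo_sum R W (fun j => p.1 ^+ j *: b j p.2) N 0 k N0 (fun j => term _ _ j p1 p2).
  by rewrite add0n big_ord0 subr0 expr0 divr1.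
- by move=> k p /inR[p1 p2]; exact: HH.
- move=> k m km; apply: ler_wpM2l; first by rewrite mulr_ge0.
  by rewrite lef_pV2 ?posrE // ler_eXn2l ?ltr1n.
exact: geo_to0.
Qed.

(** The power series with coefficients [b] continues the germ to all [nm a < r / 2]. On each ray it
    equals [G v] in the chart, both having the same coefficients; near [a = t2 - t1], [y = 0] its
    values lie in the open image of the chart, whose inverse brings them back to [X]. *)
Lemma sprout_step (t2 : C) : nm (t2 - t1) < r / 2 -> sprout t2.
Proof.
move=> t12; have [b [d [N [d0 bD bN Hb]]]] := uniform_coefs.
have [H HH] := power_sum d0 bD bN.
have rr : r / 2 < r by exact: half_lt.
have match_ (v : V) : nm (v - v0) < k0 -> exists2 e : R, 0 < e & forall a s : C, nm a < r / 2 -> nm s < e ->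
    chart_dom c (G v (t1 + a) s) /\ H (a, s *: v) = cm (G v (t1 + a) s).
  move=> vk; have [M [e e0 He]] := Hb v vk.
  have nv : 0 < nm v + 1 by rewrite ltr_wpDl ?nm_ge0.
  exists (Num.min e (d / (nm v + 1))) => [|a s ar].
    by rewrite lt_min e0 divr_gt0.
  rewrite lt_min => /andP[/He[h1 h2 h3] sd]; split.
    by apply: h3; apply: ltW; apply: lt_trans ar _; apply: lt_trans rr _; rewrite ltr_pMl // ltr1n.
  have svd : nm (s *: v) < d.
    rewrite nmZ; move: sd; rewrite ltr_pdivlMr //; apply: le_lt_trans.
    by rewrite ler_wpM2l ?nm_ge0 // lerDl.
  have [_ HN] := HH a (s *: v) ar svd.
  have M0 : 0 <= M by exact: expansion_ge0 h2.
  have key k : nm (H (a, s *: v) - cm (G v (t1 + a) s)) <= (2 * N + 2 * `|M|) / 2 ^+ k.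
    have := expansion_half k r0 h2 (ltW ar); rewrite add0r => g1.
    have g2 := HN k; rewrite nmBC in g2; rewrite nmBC in g1.
    have g3 : 2 * `|M| / r ^+ k * nm a ^+ k <= 2 * `|M| / 2 ^+ k.
      have -> : 2 * `|M| / 2 ^+ k = 2 * `|M| / r ^+ k * (r / 2) ^+ k.
        by rewrite expr_div_n; field; rewrite !expf_neq0 // gt_eqF.
      rewrite ler_wpM2l ?divr_ge0 ?mulr_ge0 ?exprn_ge0 ?(ltW r0) //.
      by apply: lerXn2r; rewrite ?nnegrE ?nm_ge0 // ?divr_ge0 ?ltW.
    have g4 := nmD (H (a, s *: v) - \sum_(j < k) a ^+ j *: b j (s *: v))
      (\sum_(j < k) a ^+ j *: b j (s *: v) - cm (G v (t1 + a) s)).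
    rewrite addrA subrK in g4; apply: le_trans g4 _; rewrite mulrDl; apply: lerD => //.
    exact: le_trans g1 g3.
  apply/eqP; rewrite -subr_eq0 -nm_eq0 eq_le nm_ge0 andbT leNgt; apply/negP => pos.
  have [k Hk] := @geo_to0 R (2 * N + 2 * `|M|) _ pos.
  by have := lt_le_trans (Hk k (leqnn k)) (key k); rewrite ltxx.
have [e [e0 He]] : exists e : R, 0 < e /\ forall a y, nm (a - (t2 - t1)) < e -> nm y < e ->
    [/\ nm a < r / 2, nm y < d & chart_cod c (H (a, y))].
  have [e1 e10 He1] := match_ v0 v0in.
  have z0 : nm (0 : C) < e1 by rewrite nm0.
  have [m1 m2] := He1 _ _ t12 z0; rewrite scale0r in m2.
  have hd : nm (0 : V) < d by rewrite nm0.
  have [dH _] := HH (t2 - t1) 0 t12 hd.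
  have /cont_nmP/(_ (chart_cod c))[] := differentiable_continuous dH.
    apply: open_nbhs_nbhs; split; first exact: chart_cod_open.
    by rewrite m2; exact: chart_mapP.
  move=> e2 e20 He2; exists (Num.min (Num.min e2 (r / 2 - nm (t2 - t1))) d).
  split; first by rewrite !lt_min e20 d0 subr_gt0 t12.
  move=> a y; rewrite !lt_min => /andP[/andP[a1 a2] a3] /andP[/andP[y1 y2] y3]; split => //.
    by rewrite -[a](subrK (t2 - t1)); apply: le_lt_trans (nmD _ _) _; rewrite -ltrBrDr.
  by apply: He2; rewrite pairB subr0; apply/nm_pair_lt.
have subE (t : C) : t - t1 - (t2 - t1) = t - t2 by rewrite opprB addrA subrK.
pose F (p : C * V) := chart_inv c (H (p + (- t1, 0))).
have shE (t : C) (y : V) : ((t, y) + (- t1, 0) : (C * V)%type) = (t - t1, y).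
  by congr (_, _); rewrite /= addr0.
exists F, e => //; split.
  move=> t y te ye; have [|h1 h2 h3] := He (t - t1) y _ ye; first by rewrite subE.
  have [dH _] := HH (t - t1) y h1 h2.
  apply: (@hol_at_chart_inv R X (C * V)%type (fun p => H (p + (- t1, 0))) (t, y) c ac); last by rewrite shE.
  have := @shift_diff R (C * V)%type W H (- t1, 0) (t, y); rewrite addrC shE => /(_ dH).
  by under [X in differentiable X _]funext do rewrite addrC.
move=> v vk; have [e1 e10 He1] := match_ v vk.
exists (Num.min e1 (r / 2 - nm (t2 - t1))) => [|t s]; first by rewrite lt_min e10 subr_gt0.
rewrite !lt_min => /andP[_ t2e] /andP[se _]; rewrite /F shE.
have [|m1 m2] := He1 (t - t1) s _ se.
  by rewrite -[t - t1](subrK (t2 - t1)) subE; apply: le_lt_trans (nmD _ _) _; rewrite -ltrBrDr.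
by rewrite m2 chart_mapK // addrC subrK.
Qed.

End Step.

(** The path is the real segment from [tA] to 0. The step length depends only on the core curve
    [G v0 t 0] and its charts, not on the sprout, so the steps cannot shrink. *)
Lemma sprout_propagate (tA : R) : 0 <= tA < 1 -> sprout (toC tA) -> sprout 0.
Proof.
move=> /andP[tA0 tA1] sA.
have tAn : nm (toC tA) < 1 by rewrite nm_toC ger0_norm.
have Gax (v : V) (t : C) : nm (v - v0) < k0 -> nm t < 1 -> G v t 0 = G v0 t 0.
  by move=> vk t1; exact: (sprout_axis tAn sA).
pose ga (s : R) : C := toC (tA * (1 - s)).
have ga_n s : 0 <= s <= 1 -> nm (ga s) < 1.
  move=> /andP[s0 s1]; rewrite /ga nm_toC ger0_norm; last by rewrite mulr_ge0 // subr_ge0.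
  by apply: le_lt_trans tA1; rewrite ler_piMr // gerBl.
have ga_d s s' : nm (ga s - ga s') <= `|s - s'|.
  have E : tA * (1 - s) - tA * (1 - s') = tA * (s' - s) by ring.
  rewrite /ga -toCB nm_toC E normrM distrC.
  by rewrite ler_piMl // ger0_norm // ltW.
have : sprout (ga 1).
  apply: (@interval_chain R (fun s => sprout (ga s))); last by rewrite /ga subr0 mulr1.
  move=> s s01; have s1 := ga_n s s01.
  have h0 : nm (0 : C) < 1 by rewrite nm0.
  have [c ac cz] := atlas_cover (G v0 (ga s) 0).
  have [B [e e0 He]] := hol_bounded ac (hol_slice1 v0in s1 h0) cz.
  pose eta := Num.min e (1 - nm (ga s)).
  have eta0 : 0 < eta by rewrite lt_min e0 subr_gt0.
  have r0 : 0 < eta / 4 by rewrite divr_gt0.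
  (* The disc of radius [2 * (eta / 4)] about [ga t] then stays within [eta] of [ga s], and [ga t']
     is at distance less than [eta / 8] from [ga t], as [sprout_step] demands. *)
  exists (eta / 16) => [|t t' t01 t'01 ts t's st]; first by rewrite divr_gt0.
  have d1 := le_lt_trans (ga_d t s) ts.
  have d2 := le_lt_trans (ga_d t' s) t's.
  apply: (@sprout_step c (ga t) (eta / 4) ac r0 _ Gax st (ga t')).
    move=> a ar.
    have h : nm (ga t + a - ga s) < eta.
      rewrite addrAC; apply: le_lt_trans (nmD _ _) _.
      by move: (nm _) (nm a) d1 ar => x y; move: eta0; lra.
    move: h; rewrite lt_min => /andP[/He[h1 _] h2]; split => //.
    rewrite -[ga t + a](subrK (ga s)); apply: le_lt_trans (nmD _ _) _.
    by rewrite -ltrBrDr.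
  have -> : ga t' - ga t = (ga t' - ga s) - (ga t - ga s) by rewrite opprB addrA subrK.
  apply: le_lt_trans (nmD _ _) _; rewrite nmN.
  by move: (nm _) (nm _) d1 d2 => x y; move: eta0; lra.
by rewrite /ga subrr mulr0.
Qed.

End Propagation.

(** * Second order expansion of a defining function *)

Section RealCalculus.
Variable R : realType.
Local Notation C := (Cx R).

Lemma mvt01 (f df : R -> R) : (forall t : R, 0 <= t <= 1 -> is_derive t (1 : R) f (df t)) ->
  exists2 t : R, 0 <= t <= 1 & f 1 - f 0 = df t.
Proof.
move=> fd.
have [||c ci E] := @MVT R f df 0 1 ltr01.
- by move=> t; rewrite in_itv /= => /andP[t0 t1]; apply: fd; rewrite !ltW.
- apply: continuous_in_subspaceT => t; rewrite inE /= in_itv /= => t01.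
  apply: differentiable_continuous; apply/derivable1_diffP.
  by have [] := fd t t01.
exists c; last by rewrite E subr0 mulr1.
by move: ci; rewrite in_itv /= => /andP[c0 c1]; rewrite !ltW.
Qed.

Lemma continuous_nmP (V : normedModType C) (u : V -> R) z : {for z, continuous u} ->
  forall e : R, 0 < e -> exists2 d : R, 0 < d & forall y : V, nm (y - z) < d -> `|u y - u z| < e.
Proof.
move=> /cont_nmP uc e e0; have [|d d0 H] := uc [set t : R | `|t - u z| < e].
  by apply/nbhs_normP; exists e => // t; rewrite /ball_ /= distrC.
by exists d.
Qed.

Lemma fin_delta (I : finType) (T : Type) (D : T -> R) (P : I -> T -> Prop) :
  (forall i, exists2 d : R, 0 < d & forall y, D y < d -> P i y) ->
  exists2 d : R, 0 < d & forall y, D y < d -> forall i, P i y.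
Proof.
move=> H; have [d [d0 Hd]] : exists d : R, 0 < d /\ forall y, D y < d -> forall i, i \in enum I -> P i y.
  elim: (enum I) => [|i s [d [d0 IH]]]; first by exists 1.
  have [e e0 He] := H i; exists (Num.min d e); split; first by rewrite lt_min d0.
  move=> y; rewrite lt_min => /andP[yd ye] j; rewrite in_cons => /orP[/eqP ->|]; first exact: He.
  exact: IH.
by exists d => // y yd i; apply: Hd => //; rewrite mem_enum.
Qed.

End RealCalculus.

(** * Functions of class C2 given by directional derivatives *)

Section C2.
Variable R : realType.
Local Notation C := (Cx R).
Variable n : nat.
Local Notation V := 'rV[C]_n.
Variables (p : V) (R0 : R).

Let U : set V := [set z | nm (z - p) < R0].

Let U_near z : U z -> exists2 d : R, 0 < d & forall y : V, nm (y - z) < d -> U y.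
Proof.
move=> Uz; exists (R0 - nm (z - p)) => [|y yz]; first by rewrite subr_gt0.
by rewrite /U /= -[y](subrK z) -addrA; apply: le_lt_trans (nmD _ _) _; rewrite -ltrBrDr.
Qed.

Let U_conv (z v : V) (t : R) : U z -> U (z + v) -> 0 <= t <= 1 -> U (z + toC t *: v).
Proof.
move=> zU vU t01; have := nm_segment_lt t01 zU vU.
have -> : z + v - p - (z - p) = v by rewrite opprB addrA subrK addrAC subrr add0r.
by rewrite addrAC.
Qed.

Let sub_along (u : V -> R) z v (t h : R) : along u z v (t + h) = along u (z + toC t *: v) v h.
Proof. by rewrite /along toCD scalerDl addrA. Qed.

Lemma C1_has (u : V -> R) z v : Ck_on 1 U u -> U z -> has_d u z v (rderiv v u z).
Proof.
move=> [_ /(_ v)[ud _]] Uz; rewrite /rderiv derive1E; apply: derivableP; exact: ud.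
Qed.

Lemma C1_line (u : V -> R) z v (t : R) : Ck_on 1 U u -> U (z + toC t *: v) ->
  is_derive t (1 : R) (along u z v) (rderiv v u (z + toC t *: v)).
Proof.
move=> u1 Ut; have /rdP h := C1_has v u1 Ut; apply/rdP => e /h[k k0 H].
have E0 : along u z v t = along u (z + toC t *: v) v 0.
  by rewrite -[in LHS](addr0 t); exact: sub_along.
exists k; first exact: k0.
move=> s sk; have h1 := H s sk; rewrite (add0r s) in h1.
by rewrite E0 (sub_along u z v t s).
Qed.

Lemma C1_mvt (u : V -> R) z v : Ck_on 1 U u -> U z -> U (z + v) ->
  exists2 t : R, 0 <= t <= 1 & u (z + v) - u z = rderiv v u (z + toC t *: v).
Proof.
move=> u1 Uz Uv; have [t t01|t t01 E] := @mvt01 R (along u z v) (fun t => rderiv v u (z + toC t *: v)).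
  by apply: C1_line => //; exact: U_conv.
exists t => //; rewrite -E /along toC1 scale1r.
by have -> : toC (0 : R) = 0 by []; rewrite scale0r addr0.
Qed.

Lemma has_dZ (u : V -> R) z v (c d : R) : has_d u z v d -> has_d u z (toC c *: v) (c * d).
Proof.
move=> /rdP h; apply/rdP => e e0.
have c1 : 0 < `|c| + 1 by rewrite ltr_wpDl.
have [|k k0 H] := h (e / (`|c| + 1)); first by rewrite divr_gt0.
exists (k / (`|c| + 1)) => [|s]; first by rewrite divr_gt0.
rewrite ltr_pdivlMr // => sk.
have E (x : R) : along u z (toC c *: v) x = along u z v (x * c) by rewrite /along scalerA -toCM.
rewrite add0r !E mul0r -[X in along u z v X - _]add0r mulrA.
have sc : `|s * c| <= `|s| * (`|c| + 1) by rewrite normrM ler_wpM2l // lerDl.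
apply: le_trans (H _ (le_lt_trans sc sk)) _.
rewrite mulrAC ler_pdivrMr // -mulrA ler_wpM2l // ltW //.
Qed.

Lemma rderivZ (u : V -> R) z v (c : R) : Ck_on 1 U u -> U z ->
  rderiv (toC c *: v) u z = c * rderiv v u z.
Proof. by move=> u1 Uz; apply: has_d_rderiv; apply: has_dZ; exact: C1_has. Qed.

(** [Ck_on] provides the derivatives in each direction separately. Additivity follows from the mean
    value theorem along [w], after a step along [v], and from the continuity of [rderiv w u]. *)
Lemma rderivD (u : V -> R) z v w : Ck_on 1 U u -> U z ->
  rderiv (v + w) u z = rderiv v u z + rderiv w u z.
Proof.
move=> u1 Uz; apply: has_d_rderiv; apply/rdP => e e0.
have e20 : 0 < e / 2 by rewrite divr_gt0.
have /rdP/(_ _ e20)[k1 k10 H1] := C1_has v u1 Uz.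
have [_ /(_ w)[_ [/(_ z Uz) wc _]]] := u1.
have [d d0 Hd] := continuous_nmP wc e20.
have [d' d'0 Hd'] := U_near Uz.
pose B := nm v + nm w + 1.
have B0 : 0 < B by rewrite ltr_wpDl // addr_ge0 // nm_ge0.
exists (Num.min k1 (Num.min d d' / B)) => [|s]; first by rewrite lt_min k10 divr_gt0 // lt_min d0.
rewrite lt_min => /andP[/H1 h1]; rewrite ltr_pdivlMr // lt_min => /andP[sd sd'].
have near (t : R) : 0 <= t <= 1 -> nm (toC s *: v + toC t *: (toC s *: w)) <= `|s| * B.
  move=> /andP[t0 t1]; apply: le_trans (nmD _ _) _; rewrite !nmZ !nm_toC (ger0_norm t0) /B.
  have : t * (`|s| * nm w) <= `|s| * nm w by rewrite ler_piMl // mulr_ge0 ?nm_ge0.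
  rewrite !mulrDr mulr1; have := normr_ge0 s; lra.
have shift (y : V) : z + y - z = y by rewrite addrAC subrr add0r.
have in01 : 0 <= (0 : R) <= 1 by rewrite lexx ler01.
have in11 : 0 <= (1 : R) <= 1 by rewrite lexx ler01.
have near' (t : R) : 0 <= t <= 1 -> nm (z + toC s *: v + toC t *: (toC s *: w) - z) <= `|s| * B.
  by move=> t01; rewrite -[z + _ + _]addrA shift; exact: near.
have Uv : U (z + toC s *: v).
  have := near' 0 in01; have -> : toC (0 : R) = 0 by [].
  by rewrite scale0r addr0 => h; apply: Hd'; exact: le_lt_trans h sd'.
have Uw : U (z + toC s *: v + toC s *: w).
  have := near' 1 in11; rewrite toC1 scale1r => h; apply: Hd'; exact: le_lt_trans h sd'.
have [t t01 E] := C1_mvt u1 Uv Uw.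
rewrite add0r in h1 *.
have -> : along u z (v + w) s = along u z v s + s * rderiv w u (z + toC s *: v + toC t *: (toC s *: w)).
  rewrite -(rderivZ w s u1); first by rewrite -E /along scalerDr addrA [RHS]addrC subrK.
  by apply: Hd'; apply: le_lt_trans (near' t t01) sd'.
have -> : along u z (v + w) 0 = along u z v 0.
  by rewrite /along; have -> : toC (0 : R) = 0 by []; rewrite !scale0r.
have h2 := Hd _ (le_lt_trans (near' t t01) sd).
have h3 : `|s * (rderiv w u (z + toC s *: v + toC t *: (toC s *: w)) - rderiv w u z)| <= e / 2 * `|s|.
  by rewrite normrM mulrC ler_wpM2r // ltW.
move: h1 h3; move: (along u z v s) (along u z v 0) (rderiv w u _) (rderiv w u z) (rderiv v u z) => a b c d1 d2 h1 h3.
have -> : a + s * c - b - s * (d2 + d1) = (a - b - s * d2) + s * (c - d1) by ring.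
by apply: le_trans (ler_normD _ _) _; lra.
Qed.

Lemma rderiv0 (u : V -> R) z : Ck_on 1 U u -> U z -> rderiv 0 u z = 0.
Proof. by move=> u1 Uz; have := @rderivZ u z 0 0 u1 Uz; rewrite scaler0 mul0r. Qed.

Lemma rderiv_sum (I : Type) (s : seq I) (c : I -> R) (E : I -> V) (u : V -> R) z : Ck_on 1 U u -> U z ->
  rderiv (\sum_(k <- s) toC (c k) *: E k) u z = \sum_(k <- s) c k * rderiv (E k) u z.
Proof.
move=> u1 Uz; elim: s => [|k s IH]; first by rewrite !big_nil rderiv0.
by rewrite !big_cons rderivD // rderivZ // IH.
Qed.

(** Real basis of C^n; the flag marks the imaginary direction of a coordinate, and [co] gives the
    real coordinates. *)
Definition Ek (k : 'I_n * bool) : V := if k.2 then ie_ R k.1 else e_ R k.1.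

Definition co (v : V) (k : 'I_n * bool) : R := if k.2 then complex.Im (v 0 k.1) else complex.Re (v 0 k.1).

Lemma co_sum (v : V) : v = \sum_k toC (co v k) *: Ek k.
Proof.
rewrite -(pair_bigA _ (fun j b => toC (co v (j, b)) *: Ek (j, b))) /= [LHS]row_sum_delta.
apply: eq_bigr => j _; rewrite big_bool /co /Ek /= /ie_ /e_ scalerA -scalerDl; congr (_ *: _).
by rewrite im_unit; case: (v 0 j) => x y; apply/eqP; rewrite eq_complex /=; apply/andP; split; apply/eqP; ring.
Qed.

Lemma co_le v k : `|co v k| <= nm v.
Proof.
rewrite /co; apply: le_trans (nm_entry v k.1).
by case: ifP => _; [exact: Im_le_nm|exact: Re_le_nm].
Qed.

Lemma rderivE (u : V -> R) z v : Ck_on 1 U u -> U z ->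
  rderiv v u z = \sum_k co v k * rderiv (Ek k) u z.
Proof. by move=> u1 Uz; rewrite {1}(co_sum v) rderiv_sum. Qed.

Lemma has_d_near (f g : V -> R) z v d : (forall y, U y -> f y = g y) -> U z -> has_d g z v d -> has_d f z v d.
Proof.
move=> fg Uz /rdP h; apply/rdP => e /h[k k0 H].
have [d' d'0 Hd] := U_near Uz.
have B0 : 0 < nm v + 1 by rewrite ltr_wpDl ?nm_ge0.
exists (Num.min k (d' / (nm v + 1))) => [|s]; first by rewrite lt_min k0 divr_gt0.
rewrite lt_min ltr_pdivlMr // => /andP[sk sd].
have E (t : R) : `|t| <= `|s| -> along f z v t = along g z v t.
  move=> ts; apply: fg; apply: Hd; rewrite addrAC subrr add0r nmZ nm_toC; apply: le_lt_trans sd.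
  by apply: ler_pM => //; [exact: nm_ge0|rewrite lerDl].
have h1 := H s sk; rewrite (add0r s) in h1.
by rewrite (add0r s) (E s) // (E 0) // normr0.
Qed.

Variable u : V -> R.
Hypothesis u2 : Ck_on 2 U u.

Lemma C2_C1 : Ck_on 1 U u.
Proof. by case: u2 => uc ud; split => // v; have [h [h' _]] := ud v; split. Qed.

Lemma C2_rderiv w : Ck_on 1 U (rderiv w u).
Proof. by case: u2 => _ /(_ w)[]. Qed.

Definition hess z v w := rderiv v (rderiv w u) z.

Lemma hessZl z v w c : U z -> hess z (toC c *: v) w = c * hess z v w.
Proof. by move=> Uz; apply: rderivZ => //; exact: C2_rderiv. Qed.

Lemma hessDl z v v' w : U z -> hess z (v + v') w = hess z v w + hess z v' w.
Proof. by move=> Uz; apply: rderivD => //; exact: C2_rderiv. Qed.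

Lemma hessZr z v w c : U z -> hess z v (toC c *: w) = c * hess z v w.
Proof.
move=> Uz; apply: has_d_rderiv; apply: (@has_d_near _ (fun y => c * rderiv w u y)) => //.
  by move=> y Uy; rewrite rderivZ //; exact: C2_C1.
have := has_dM (has_d_cst c z v) (C1_has v (C2_rderiv w) Uz).
by rewrite mulr0 addr0.
Qed.

Lemma hess_sumr (I : Type) (s : seq I) (c : I -> R) (E : I -> V) z v : U z ->
  hess z v (\sum_(k <- s) toC (c k) *: E k) = \sum_(k <- s) c k * hess z v (E k).
Proof.
move=> Uz; apply: has_d_rderiv.
apply: (@has_d_near _ (fun y => \sum_(k <- s) c k * rderiv (E k) u y)) => //.
  by move=> y Uy; rewrite rderiv_sum //; exact: C2_C1.
elim: s => [|k s IH].
  rewrite big_nil (_ : (fun y => _) = fun=> 0); first exact: has_d_cst.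
  by apply/funext => y; rewrite big_nil.
rewrite big_cons (_ : (fun y => _) = fun y => c k * rderiv (E k) u y + \sum_(j <- s) c j * rderiv (E j) u y).
  apply: has_dD => //.
  have := has_dM (has_d_cst (c k) z v) (C1_has v (C2_rderiv (E k)) Uz).
  by rewrite mulr0 addr0.
by apply/funext => y; rewrite big_cons.
Qed.

Lemma hessE z v w : U z -> hess z v w = \sum_k \sum_l co v k * co w l * hess z (Ek k) (Ek l).
Proof.
move=> Uz; rewrite {1}(co_sum w) hess_sumr // exchange_big /=; apply: eq_bigr => l _.
rewrite /hess rderivE //; last exact: C2_rderiv.
by rewrite mulr_sumr; apply: eq_bigr => k _; rewrite mulrCA mulrA.
Qed.

(** Bilinearity reduces the uniformity in [v] and [w] to finitely many pairs of basis vectors. *)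
Lemma hess_close z (e : R) : U z -> 0 < e -> exists2 d : R, 0 < d & forall y, nm (y - z) < d ->
  U y /\ forall v w, `|hess y v w - hess z v w| <= e * (nm v * nm w).
Proof.
move=> Uz e0; pose m : R := #|{: ('I_n * bool) * ('I_n * bool)}|%:R + 1.
have m0 : 0 < m by rewrite ltr_wpDl.
have [|d d0 Hd] := @fin_delta R (('I_n * bool) * ('I_n * bool))%type V (fun y => nm (y - z))
  (fun kl y => `|hess y (Ek kl.1) (Ek kl.2) - hess z (Ek kl.1) (Ek kl.2)| < e / m).
  move=> kl; have [_ /(_ (Ek kl.1))[_ [/(_ z Uz) hc _]]] := C2_rderiv (Ek kl.2).
  by apply: (continuous_nmP hc); rewrite divr_gt0.
have [d' d'0 Hd'] := U_near Uz.
exists (Num.min d d') => [|y]; first by rewrite lt_min d0.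
rewrite lt_min => /andP[/Hd yd /Hd' Uy]; split => // v w.
rewrite !hessE // -sumrB; under eq_bigr do rewrite -sumrB.
rewrite pair_bigA /=; apply: le_trans (ler_norm_sum _ _ _) _.
apply: (@le_trans _ _ (\sum_(kl : ('I_n * bool) * ('I_n * bool)) e / m * (nm v * nm w))).
  apply: ler_sum => kl _; rewrite -mulrBr normrM mulrC.
  apply: ler_pM => //; first by apply: ltW; exact: yd.
  by rewrite normrM; apply: ler_pM => //; exact: co_le.
rewrite sumr_const -mulr_natl mulrA ler_wpM2r ?mulr_ge0 ?nm_ge0 //.
rewrite mulrCA -[leRHS]mulr1 ler_wpM2l ?(ltW e0) // ler_pdivrMr // mul1r /m lerDl //.
Qed.

Lemma hess_bounded z : U z -> exists2 B : R, 0 <= B & forall v w, `|hess z v w| <= B * (nm v * nm w).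
Proof.
move=> Uz; exists (\sum_k \sum_l `|hess z (Ek k) (Ek l)|).
  by apply: sumr_ge0 => k _; apply: sumr_ge0.
move=> v w; rewrite hessE // mulr_suml; apply: le_trans (ler_norm_sum _ _ _) _.
apply: ler_sum => k _; rewrite mulr_suml; apply: le_trans (ler_norm_sum _ _ _) _.
apply: ler_sum => l _; rewrite normrM mulrC ler_wpM2l // normrM.
by apply: ler_pM => //; exact: co_le.
Qed.

Let sw (x y w : V) : x + y + w = x + w + y.
Proof. by rewrite addrAC. Qed.

Let along1 (w : V -> R) z v : along w z v 1 = w (z + v).
Proof. by rewrite /along toC1 scale1r. Qed.

Let along0 (w : V -> R) z v : along w z v 0 = w z.
Proof. by rewrite /along; have -> : toC (0 : R) = 0 by []; rewrite scale0r addr0. Qed.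

Let derive_sub (f g : R -> R) (t a b : R) : is_derive t (1 : R) f a -> is_derive t (1 : R) g b ->
  is_derive t (1 : R) (fun s => f s - g s) (a - b).
Proof. exact: is_deriveB. Qed.

Let second_diff z a b zab : zab = z + a + b -> U z -> U (z + a) -> U (z + b) -> U zab ->
  exists s t : R, [/\ 0 <= s <= 1, 0 <= t <= 1 &
    u zab - u (z + a) - (u (z + b) - u z) = hess (z + toC s *: a + toC t *: b) b a].
Proof.
move=> -> Uz Ua Ub Uab.
have Uab' : U (z + b + a) by rewrite (sw z).
pose f s := along u (z + b) a s - along u z a s.
pose df s := rderiv a u (z + b + toC s *: a) - rderiv a u (z + toC s *: a).
have [s s01|s s01 E] := @mvt01 R f df.
  have U1 := U_conv Ub Uab' s01; have U2 := U_conv Uz Ua s01.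
  have D1 := C1_line C2_C1 U1; have D2 := C1_line C2_C1 U2.
  exact: (@derive_sub (along u (z + b) a) (along u z a) s _ _ D1 D2).
have Us : U (z + toC s *: a) by exact: U_conv.
have Usb : U (z + toC s *: a + b) by rewrite (sw z); exact: U_conv.
have [t t01 E'] := C1_mvt (C2_rderiv a) Us Usb.
exists s, t; split => //; rewrite /hess -E' (sw z (toC s *: a) b).
by move: E; rewrite /f /df !along1 !along0 (sw z b a).
Qed.

Let tri (x y w e1 e2 : R) : `|x - y| <= e1 -> `|x - w| <= e2 -> `|y - w| <= e1 + e2.
Proof. by move=> h1 h2; apply: le_trans (ler_distD x _ _) _; rewrite distrC lerD. Qed.

Let scaled_prod (e A x y : R) : 0 < e -> 0 < A -> 0 <= x -> 0 <= y -> x <= A -> y <= A ->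
  e / (2 * (A * A)) * (x * y) <= e / 2.
Proof.
move=> e0 A0 x0 y0 xA yA; have -> : e / 2 = e / (2 * (A * A)) * (A * A) by field; rewrite gt_eqF.
by rewrite ler_wpM2l ?ler_pM // divr_ge0 ?mulr_ge0 // ltW.
Qed.

Let swap4 (x1 x2 x3 x4 t h h' : R) : t != 0 -> x1 - x2 - (x3 - x4) = t * h ->
  x1 - x3 - (x2 - x4) = t * h' -> h = h'.
Proof. by move=> t0 E E'; apply: (mulfI t0); rewrite -E -E'; ring. Qed.

Let hessZZ z v w c : U z -> hess z (toC c *: v) (toC c *: w) = c * c * hess z v w.
Proof. by move=> Uz; rewrite (hessZl _ _ _ Uz) (hessZr _ _ _ Uz) mulrA. Qed.

(** The second difference over a small parallelogram is symmetric in [a] and [b], and the mean value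
    theorem writes it as a second derivative in either order, at points close to [z]. *)
Lemma hess_sym z a b : U z -> hess z a b = hess z b a.
Proof.
move=> Uz; apply/eqP; rewrite -subr_eq0 -normr_eq0 eq_le normr_ge0 andbT.
apply/ler_addgt0Pr => e e0; rewrite add0r.
pose A := nm a + nm b + 1.
have na := nm_ge0 a; have nb := nm_ge0 b.
have A0 : 0 < A by rewrite ltr_wpDl // addr_ge0.
have [|d d0 Hd] := @hess_close z (e / (2 * (A * A))) Uz; first by rewrite divr_gt0 // !mulr_gt0.
pose t := d / 2 / A; have t0 : 0 < t by rewrite !divr_gt0.
have tA : t * A < d by rewrite /t divfK ?gt_eqF //; exact: half_lt.
have near (w : V) (x y : R) : w = z + toC x *: (toC t *: a) + toC y *: (toC t *: b) ->
    0 <= x <= 1 -> 0 <= y <= 1 -> nm (w - z) < d.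
  move=> -> /andP[x0 x1] /andP[y0 y1]; rewrite addrAC [z + _]addrC addrK.
  apply: le_lt_trans (nmD _ _) _; apply: le_lt_trans tA; rewrite !nmZ !nm_toC !ger0_norm ?(ltW t0) // /A.
  have h1 : x * (t * nm a) <= t * nm a by rewrite ler_piMl // mulr_ge0 // ltW.
  have h2 : y * (t * nm b) <= t * nm b by rewrite ler_piMl // mulr_ge0 // ltW.
  by move: h1 h2 t0; rewrite !mulrDr mulr1; lra.
have i0 : 0 <= (0 : R) <= 1 by rewrite lexx ler01.
have i1 : 0 <= (1 : R) <= 1 by rewrite lexx ler01.
have z0 : toC (0 : R) = 0 by [].
have Ua : U (z + toC t *: a) by have [] := Hd _ (near (z + toC t *: a) 1 0 _ i1 i0); rewrite // toC1 z0 scale1r scale0r addr0.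
have Ub : U (z + toC t *: b) by have [] := Hd _ (near (z + toC t *: b) 0 1 _ i0 i1); rewrite // toC1 z0 scale1r scale0r addr0.
have Uab : U (z + toC t *: a + toC t *: b) by have [] := Hd _ (near (z + toC t *: a + toC t *: b) 1 1 _ i1 i1); rewrite // toC1 !scale1r.
have [s1 [t1 [s1i t1i E1]]] := second_diff (erefl _) Uz Ua Ub Uab.
have [s2 [t2 [s2i t2i E2]]] := second_diff (sw z (toC t *: a) (toC t *: b)) Uz Ub Ua Uab.
have [U1 H1] := Hd _ (near _ s1 t1 (erefl _) s1i t1i).
have near2 : nm (z + toC s2 *: (toC t *: b) + toC t2 *: (toC t *: a) - z) < d.
  exact: (near _ t2 s2 (sw _ _ _) t2i s2i).
have [U2 H2] := Hd _ near2.
rewrite (hessZZ _ _ _ U1) in E1; rewrite (hessZZ _ _ _ U2) in E2.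
have E : hess (z + toC s1 *: (toC t *: a) + toC t1 *: (toC t *: b)) b a =
    hess (z + toC s2 *: (toC t *: b) + toC t2 *: (toC t *: a)) a b.
  have tn : t * t != 0 by rewrite gt_eqF // mulr_gt0.
  exact: (swap4 tn E1 E2).
have h1 := H1 b a; have h2 := H2 a b; rewrite E [nm b * nm a]mulrC in h1.
have aA : nm a <= A by rewrite /A -addrA lerDl addr_ge0.
have bA : nm b <= A by rewrite /A addrAC lerDr addr_ge0.
have eA := scaled_prod e0 A0 na nb aA bA.
rewrite [e]splitr; exact: (tri (le_trans h2 eA) (le_trans h1 eA)).
Qed.

(** Subtracting [t * rderiv v u z + t ^+ 2 * (M / 2)] from [u] along the segment leaves a function
    of [t] with nonpositive derivative. *)
Lemma taylor_le z v (M : R) : U z -> U (z + v) ->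
  (forall t : R, 0 <= t <= 1 -> hess (z + toC t *: v) v v <= M) ->
  u (z + v) <= u z + rderiv v u z + M / 2.
Proof.
move=> Uz Uv HM.
pose f t := along u z v t - t * rderiv v u z - t ^+ 2 * (M / 2).
have [t t01|t /andP[t0 t1] E] := @mvt01 R f (fun t => rderiv v u (z + toC t *: v) - rderiv v u z - t * M).
  have h := C1_line C2_C1 (U_conv Uz Uv t01).
  apply: is_deriveB; first apply: is_deriveB => //.
    by apply/rdP => e e0; exists 1 => // s _; rewrite (_ : _ - _ = 0) ?normr0 ?mulr_ge0 // ?ltW //; ring.
  apply/rdP => e e0; exists (e / (`|M / 2| + 1)) => [|s]; first by rewrite divr_gt0 // ltr_wpDl.
  rewrite ltr_pdivlMr ?ltr_wpDl // => sk.
  have -> : (t + s) ^+ 2 * (M / 2) - t ^+ 2 * (M / 2) - s * (t * M) = s * (s * (M / 2)) by field.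
  rewrite normrM mulrC ler_wpM2r // normrM; apply: le_trans (ltW sk).
  by rewrite ler_wpM2l // lerDl.
have Ut : U (z + toC t *: v) by apply: U_conv; rewrite ?t0.
have tv : z + toC t *: v = z + toC t *: v by [].
have [s s01 E'] := C1_mvt (C2_rderiv v) Uz Ut.
move: s01 => /andP[s0 s1].
have st01 : 0 <= s * t <= 1 by rewrite mulr_ge0 //=; apply: mulr_ile1.
have h : rderiv v u (z + toC t *: v) - rderiv v u z <= t * M.
  have Ust : U (z + toC (s * t) *: v) by exact: U_conv.
  rewrite E' scalerA -toCM -/(hess _ _ _) hessZl // ler_wpM2l //.
  exact: HM.
have : f 1 - f 0 <= 0 by rewrite E subr_le0.
rewrite /f /along toC1 scale1r.
have -> : toC (0 : R) = 0 by [].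
rewrite scale0r addr0; lra.
Qed.

End C2.

(** * Negative directions of a hermitian matrix *)

Lemma prod_XsubC_perm (F : fieldType) (s t : seq F) :
  \prod_(a <- s) ('X - a%:P) = \prod_(a <- t) ('X - a%:P) -> perm_eq s t.
Proof.
elim: s t => [|a s IH] t E.
  have := congr1 (fun p : {poly F} => size p) E; rewrite big_nil size_poly1 size_prod_XsubC.
  by case: t {E}.
have at_ : a \in t.
  by rewrite -root_prod_XsubC -E big_cons rootM root_XsubC eqxx.
have pt := perm_to_rem at_.
rewrite perm_sym (permPl pt) perm_cons perm_sym; apply: IH; have nz : 'X - a%:P != 0 by rewrite polyXsubC_eq0.
by apply: (mulfI nz); move: E; rewrite big_cons (perm_big _ pt) big_cons.
Qed.

Lemma char_poly_conj (F : fieldType) m (P D : 'M[F]_m) : P \in unitmx ->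
  char_poly (invmx P *m D *m P) = char_poly D.
Proof.
move=> Pu; rewrite /char_poly /char_poly_mx.
pose Q := map_mx polyC P; pose Q' := map_mx polyC (invmx P).
have QQ : Q' *m Q = 1%:M by rewrite -map_mxM mulVmx // map_mx1.
have -> : 'X%:M - map_mx polyC (invmx P *m D *m P) = Q' *m ('X%:M - map_mx polyC D) *m Q.
  by rewrite !map_mxM mulmxBr mulmxBl scalar_mxC -['X%:M *m Q' *m Q]mulmxA QQ mulmx1.
rewrite !det_mulmx mulrAC -det_mulmx QQ det1 mul1r //.
Qed.

Section NegativeDirections.
Variable R : realType.
Local Notation C := (Cx R).

Definition herm m (M : 'M[C]_m) (v : 'rV[C]_m) : C := (v *m M *m (map_mx Num.conj v)^T) 0 0.

Lemma herm_conj m n (M : 'M[C]_n) (B : 'M[C]_(m, n)) (v : 'rV[C]_m) :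
  herm M (v *m B) = herm (B *m M *m (map_mx Num.conj B)^T) v.
Proof. by rewrite /herm map_mxM trmx_mul !mulmxA. Qed.

Lemma herm_diag m (d v : 'rV[C]_m) : herm (diag_mx d) v = \sum_i d 0 i * toC (sqmod (v 0 i)).
Proof.
rewrite /herm mxE; apply: eq_bigr => i _; rewrite !mxE mulrC.
rewrite (bigD1 i) //= big1 ?addr0 => [|j ji]; first by rewrite mxE eqxx mulr1n sqmodE normCK; ring.
by rewrite mxE (negPf ji) mulr0n mulr0.
Qed.

(** [neg_eigenvalues_ge] speaks of the roots of the characteristic polynomial; the spectral theorem
    identifies them, up to order, with the diagonal entries. The rows of [P] are eigenvectors for
    [q] negative entries at distinct places, all of them at most [- c]. *)
Lemma negative_directions m q (M : 'M[C]_m) : M = (map_mx Num.conj M)^T -> neg_eigenvalues_ge q M ->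
  exists (P : 'M[C]_(q, m)) (c : R), 0 < c /\
    forall z : 'rV[C]_q, complex.Re (herm M (z *m P)) <= - c * \sum_i sqmod (z 0 i).
Proof.
move=> Mh [s Ms qs].
have Mn : M \is normalmx by apply/normalmxP; rewrite map_trmx in Mh; rewrite -Mh.
have /orthomx_spectralP := Mn.
set Q := spectralmx M; set d := spectral_diag M => ME.
have Qu : Q \is unitarymx by exact: spectral_unitarymx.
have Qi : invmx Q = (map_mx Num.conj Q)^T by rewrite map_trmx invmx_unitary.
have Qm : Q \in unitmx by exact: unitarymx_unit.
have sd : perm_eq s [seq d 0 i | i : 'I_m].
  apply: prod_XsubC_perm; rewrite -Ms ME char_poly_conj // char_poly_trig ?diag_mx_is_trig //.
  by rewrite big_image /=; apply: eq_bigr => i _; rewrite mxE eqxx mulr1n.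
have [f [finj fneg]] : exists f : 'I_q -> 'I_m, injective f /\ forall i, d 0 (f i) < 0.
  pose A := [pred i : 'I_m | d 0 i < 0].
  have cA : (q <= #|A|)%N.
    rewrite (permP sd) count_map enumT in qs; apply: leq_trans qs _.
    by rewrite cardE /enum_mem size_filter; apply: eq_leq; exact: eq_count.
  pose i0 (i : 'I_q) : 'I_#|A| := widen_ord cA i.
  exists (fun i => enum_val (i0 i)); split.
    by move=> i j /enum_val_inj /(congr1 val) /= h; exact: val_inj.
  by move=> i; have := enum_valP (i0 i).
have dre i : d 0 (f i) = toC (complex.Re (d 0 (f i))).
  have := fneg i; case: (d 0 (f i)) => x y; rewrite ltcE /= => /andP[/eqP /= y0 _].
  by rewrite -y0.
have dneg i : complex.Re (d 0 (f i)) < 0.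
  by rewrite -toC_lt -dre; exact: fneg.
have [c c0 Hc] : exists2 c : R, 0 < c & forall i, complex.Re (d 0 (f i)) <= - c.
  have [|c c0 Hc] := @fin_delta R 'I_q R id (fun i c => complex.Re (d 0 (f i)) < - c).
    by move=> i; exists (- complex.Re (d 0 (f i))) => [|y]; [rewrite oppr_gt0|rewrite ltrNr].
  exists (c / 2) => [|i]; first by rewrite divr_gt0.
  by apply: ltW; apply: Hc; exact: half_lt.
pose S : 'M[C]_(q, m) := \matrix_(i, j) (j == f i)%:R.
exists (S *m Q), c; split => // z.
rewrite mulmxA {1}ME -mulmxA.
have -> : herm (invmx Q *m (diag_mx d *m Q)) (z *m S *m Q) = herm (diag_mx d) (z *m S).
  rewrite herm_conj Qi; congr herm.
  have QQ : Q *m (map_mx Num.conj Q)^T = 1%:M by rewrite -Qi mulmxV.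
  by rewrite !mulmxA QQ mul1mx -mulmxA QQ mulmx1.
have zS j : (z *m S) 0 j = \sum_i (j == f i)%:R * z 0 i.
  by rewrite mxE; apply: eq_bigr => i _; rewrite mxE mulrC.
have zSf i : (z *m S) 0 (f i) = z 0 i.
  rewrite zS (bigD1 i) //= eqxx mul1r big1 ?addr0 // => k ki.
  by rewrite (inj_eq finj) eq_sym (negPf ki) mul0r.
rewrite herm_diag.
have -> : \sum_i d 0 i * toC (sqmod ((z *m S) 0 i)) = \sum_i d 0 (f i) * toC (sqmod (z 0 i)).
  rewrite (bigID (fun j => j \in codom f)) /= [X in _ + X]big1 ?addr0; last first.
    move=> j jf; rewrite zS big1 ?mulr0 => [|i _]; first by rewrite /sqmod /= expr0n addr0 mulr0.
    by have /negPf -> : j != f i; [apply: contraNneq jf => ->; exact: codom_f|rewrite mul0r].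
  transitivity (\sum_(j <- codom f) d 0 j * toC (sqmod ((z *m S) 0 j))).
    by rewrite big_uniq //; rewrite map_inj_uniq ?enum_uniq.
  by rewrite big_image /=; apply: eq_bigr => i _; rewrite zSf.
rewrite raddf_sum /= mulr_sumr; apply: ler_sum => i _.
rewrite dre; have -> : complex.Re (toC (complex.Re (d 0 (f i))) * toC (sqmod (z 0 i))) =
  complex.Re (d 0 (f i)) * sqmod (z 0 i) by rewrite -toCM.
by rewrite ler_wpM2r ?sqmod_ge0.
Qed.

End NegativeDirections.

Lemma hermE (R : realType) n (M : 'M[Cx R]_n) (v : 'rV[Cx R]_n) :
  herm M v = \sum_j \sum_k M j k * (v 0 j * Num.conj (v 0 k)).
Proof.
rewrite /herm mxE exchange_big /=; apply: eq_bigr => k _.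
rewrite !mxE mulr_suml; apply: eq_bigr => j _; by rewrite [v 0 j * M j k]mulrC mulrA.
Qed.

(** * Second order model of a defining function *)

Section LeviModel.
Variable R : realType.
Local Notation C := (Cx R).
Variable n : nat.
Local Notation V := 'rV[C]_n.
Variables (p : V) (R0 : R) (u : V -> R).
Hypothesis R00 : 0 < R0.
Let U : set V := [set z | nm (z - p) < R0].
Hypothesis u2 : Ck_on 2 U u.

Let Up : U p. Proof. by rewrite /U /= subrr nm0. Qed.
Let u1 : Ck_on 1 U u. Proof. exact: C2_C1 u2. Qed.

Local Notation hs := (hess u p).

Let hess_Dr (v w w' : V) : hs v (w + w') = hs v w + hs v w'.
Proof.
by rewrite (hess_sym u2 v (w + w') Up) (hessDl u2 w w' v Up) (hess_sym u2 w v Up) (hess_sym u2 w' v Up).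
Qed.

Let quad_expand (a b : V) (t : R) : hs (a + toC t *: b) (a + toC t *: b) =
  hs a a + t * (hs a b + hs b a) + t ^+ 2 * hs b b.
Proof.
have hb (w : V) : hs (toC t *: b) w = t * hs b w by exact: (hessZl u2 b w t Up).
have hb' (w : V) : hs w (toC t *: b) = t * hs w b by exact: (hessZr u2 w b t Up).
rewrite (hessDl u2 a (toC t *: b) (a + toC t *: b) Up) (hess_Dr a) (hess_Dr (toC t *: b)).
rewrite hb' !hb hb'; move: (hs a a) (hs a b) (hs b a) (hs b b) => x y z w; ring.
Qed.

Let cross_arith (rho x y z K : R) : 0 < rho -> rho <= 1 -> 0 <= K -> x <= K -> y <= K -> z <= K ->
  rho * (x + y) + rho ^+ 2 * z <= 3 * rho * K.
Proof.
move=> r0 r1 K0 xK yK zK.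
have h1 : rho * (x + y) <= rho * (2 * K) by rewrite ler_wpM2l ?(ltW r0) //; lra.
have h2 : rho ^+ 2 * z <= rho ^+ 2 * K by rewrite ler_wpM2l // exprn_ge0 // ltW.
have h3 : rho ^+ 2 * K <= rho * K by rewrite ler_wpM2r // expr2 ler_piMl // ltW.
lra.
Qed.

Let close_arith (e A x : R) : 0 < e -> 0 < A -> 0 <= x -> x <= 2 * A -> e / (4 * A ^+ 2) * (x * x) <= e.
Proof.
move=> e0 A0 x0 xA; have A2 : 0 < 4 * A ^+ 2 by rewrite mulr_gt0 // exprn_gt0.
rewrite mulrAC ler_pdivrMr // ler_wpM2l ?(ltW e0) //.
have -> : 4 * A ^+ 2 = 2 * A * (2 * A) by ring.
exact: ler_pM.
Qed.

Let quad_arith (rho e A B x : R) : 0 < A -> 0 < e -> 0 <= B -> 0 < rho -> rho <= e / (3 * B * A ^+ 2 + 1) ->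
  x <= 3 * rho * (B * A ^+ 2) -> x <= e.
Proof.
move=> A0 e0 B0 r0; have k0 : 0 < 3 * B * A ^+ 2 + 1.
  by rewrite ltr_wpDl // !mulr_ge0 ?exprn_ge0 // ltW.
rewrite ler_pdivlMr // => h hx; apply: le_trans hx _.
have : 0 <= rho by exact: ltW.
by move: (A ^+ 2) h => a; lra.
Qed.

(** The tangential vector [a] is scaled by [rho] and [b] by [rho ^+ 2], so that the derivative along
    [b] and the Hessian along [a] meet at the same order. *)
Lemma quad_upper (A e : R) : 0 < A -> 0 < e -> exists2 rho0 : R, 0 < rho0 &
  forall rho, 0 < rho < rho0 -> forall a b : V, nm a <= A -> nm b <= A -> rderiv a u p = 0 ->
    nm (toC rho *: (a + toC rho *: b)) < R0 /\
    u (p + toC rho *: (a + toC rho *: b)) <= u p + rho ^+ 2 * (rderiv b u p + hs a a / 2 + e).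
Proof.
move=> A0 e0; have [B B0 HB] := hess_bounded u2 Up.
have A20 : 0 < A ^+ 2 by rewrite exprn_gt0.
have [|d d0 Hd] := @hess_close R n p R0 u u2 p (e / (4 * A ^+ 2)) Up; first by rewrite divr_gt0 // mulr_gt0.
have k0 : 0 < 3 * B * A ^+ 2 + 1 by rewrite ltr_wpDl // !mulr_ge0 ?exprn_ge0 // ltW.
exists (Num.min (Num.min 1 (e / (3 * B * A ^+ 2 + 1))) (Num.min R0 d / (2 * A))).
  by rewrite !lt_min ltr01 !divr_gt0 ?mulr_gt0 // lt_min R00.
move=> rho /andP[r0]; rewrite !lt_min => /andP[/andP[r1 re]].
rewrite ltr_pdivlMr ?mulr_gt0 // lt_min => /andP[rR rd] a b aA bA da.
pose c := a + toC rho *: b.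
have cA : nm c <= 2 * A.
  apply: le_trans (nmD _ _) _; rewrite nmZ nm_toC gtr0_norm //.
  have : rho * nm b <= 1 * A by apply: ler_pM => //; [exact: ltW|exact: nm_ge0|exact: ltW].
  by move: (nm a) (nm b) aA => x y; lra.
have tc (t : R) : 0 <= t <= 1 -> nm (toC t *: (toC rho *: c)) <= rho * (2 * A).
  move=> /andP[t0 t1]; rewrite !nmZ !nm_toC (ger0_norm t0) (gtr0_norm r0).
  apply: (@le_trans _ _ (rho * nm c)); last by rewrite ler_wpM2l // ltW.
  by rewrite ler_piMl // mulr_ge0 ?nm_ge0 // ltW.
have shift (y : V) : p + y - p = y by rewrite addrAC subrr add0r.
have i1 : 0 <= (1 : R) <= 1 by rewrite lexx ler01.
have cR : nm (toC rho *: c) < R0 by have := tc 1 i1; rewrite toC1 scale1r => h; exact: le_lt_trans h rR.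
split; first exact: cR.
have Uc : U (p + toC rho *: c) by rewrite /U /= shift.
have rr : 0 < rho ^+ 2 by rewrite exprn_gt0.
pose M := rho ^+ 2 * (hs a a + 2 * e).
have := @taylor_le R n p R0 u u2 p (toC rho *: c) M Up Uc.
have -> : rderiv (toC rho *: c) u p = rho ^+ 2 * rderiv b u p.
  by rewrite (rderivZ _ _ u1 Up) (rderivD _ _ u1 Up) (rderivZ _ _ u1 Up) da add0r mulrA expr2.
have -> : u p + rho ^+ 2 * rderiv b u p + M / 2 = u p + rho ^+ 2 * (rderiv b u p + hs a a / 2 + e).
  by rewrite /M; field.
apply=> t t01.
have pd : nm (p + toC t *: (toC rho *: c) - p) < d.
  by rewrite shift; exact: le_lt_trans (tc t t01) rd.
have [Ut /(_ c c) Ht] := Hd _ pd.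
rewrite (hessZl u2 _ _ _ Ut) (hessZr u2 _ _ _ Ut) mulrA -expr2 ler_pM2l //.
have hcc : hs c c <= hs a a + e.
  have E := quad_expand a b rho; rewrite -/c in E.
  rewrite E -addrA lerD2l.
  have bd x y : nm x <= A -> nm y <= A -> hs x y <= B * A ^+ 2.
    move=> xA yA; apply: le_trans (ler_norm _) _; apply: le_trans (HB x y) _.
    by rewrite ler_wpM2l // expr2; apply: ler_pM => //; exact: nm_ge0.
  have BA : 0 <= B * A ^+ 2 by rewrite mulr_ge0 // ltW.
  exact: (quad_arith A0 e0 B0 r0 (ltW re) (cross_arith r0 (ltW r1) BA (bd a b aA bA) (bd b a bA aA) (bd b b bA bA))).
have hc := close_arith e0 A0 (nm_ge0 c) cA.
have := le_trans (ler_norm _) Ht.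
by move: hc hcc; move: (_ * (nm c * nm c)) (hess u _ c c) (hs c c) => x y z; lra.
Qed.

(** The complex linear form whose real part is the differential of [u] at [p]. *)
Definition ell (w : V) : C := 2 * lin (dz u p) w.

Lemma rderiv_ell w : rderiv w u p = complex.Re (ell w).
Proof.
rewrite (rderivE _ u1 Up) -(pair_bigA _ (fun j b => co w (j, b) * rderiv (Ek _ (j, b)) u p)) /=.
have E (Z W : C) : 2 * (Z / 2 * W) = Z * W by rewrite mulrA [2 * _]mulrC divfK // pnatr_eq0.
rewrite /ell /lin mulr_sumr raddf_sum; apply: eq_bigr => j _.
rewrite big_bool [dz u p 0 j]mxE E im_unit /co /Ek /=.
move: (rderiv _ u p) (rderiv _ u p) (w 0 j) => x y [a b] /=; ring.
Qed.

(** The quadratic form with coefficients d^2u / dz_j dz_k. Its real part is what separates half the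
    Hessian from the Levi form, and it has no sign. *)
Definition hol2 (v : V) : C := \sum_j \sum_k
  ((toC (hs (e_ R j) (e_ R k) - hs (ie_ R j) (ie_ R k)) -
    'i%R * toC (hs (e_ R j) (ie_ R k) + hs (ie_ R j) (e_ R k))) / 4) * (v 0 j * v 0 k).

Let sum_Ek (F : 'I_n * bool -> R) : \sum_k F k = \sum_j (F (j, true) + F (j, false)).
Proof.
rewrite (eq_bigr (fun k => F (k.1, k.2))); last by case.
by rewrite -(pair_bigA _ (fun j b => F (j, b))); apply: eq_bigr => j _; rewrite big_bool.
Qed.

Let Re_sum (F : 'I_n -> C) : complex.Re (\sum_j F j) = \sum_j complex.Re (F j).
Proof. exact: raddf_sum. Qed.

Let quad_split (B : 'I_n * bool -> 'I_n * bool -> R) (v : V) :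
  (\sum_k \sum_l co v k * co v l * B k l) / 2 =
  complex.Re (\sum_j \sum_k ((toC (B (j, false) (k, false) + B (j, true) (k, true)) +
    'i%R * toC (B (j, false) (k, true) - B (j, true) (k, false))) / 4) * (v 0 j * Num.conj (v 0 k))) +
  complex.Re (\sum_j \sum_k ((toC (B (j, false) (k, false) - B (j, true) (k, true)) -
    'i%R * toC (B (j, false) (k, true) + B (j, true) (k, false))) / 4) * (v 0 j * v 0 k)).
Proof.
have Q (z w : C) : complex.Re (z / 4 * w) = complex.Re (z * w) / 4.
  have -> : z / 4 * w = toC (4^-1) * (z * w).
    by rewrite /toC fmorphV rmorph_nat mulrAC mulrC.
  by case: (z * w) => a b /=; field.
rewrite sum_Ek !Re_sum -big_split mulr_suml; apply: eq_bigr => j _.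
rewrite !sum_Ek -big_split !Re_sum -big_split mulr_suml; apply: eq_bigr => k _.
rewrite !Q /co /= im_unit.
move: (B _ _) (B _ _) (B _ _) (B _ _) (v 0 j) (v 0 k) => b1 b2 b3 b4 [x y] [x' y'] /=.
by field.
Qed.

Lemma hess_levi v : hs v v / 2 = complex.Re (herm (levi_mx u p) v) + complex.Re (hol2 v).
Proof.
rewrite hermE (hessE u2 v v Up) (quad_split (fun k l => hs (Ek _ k) (Ek _ l))); congr (complex.Re _ + _).
by apply: eq_bigr => j _; apply: eq_bigr => k _; rewrite mxE.
Qed.

Let conj_entry (A A' B B' D D' E E' : R) : A = A' -> E = E' -> B = D' -> D = B' ->
  (toC (A + E) + 'i%R * toC (B - D)) / 4 = Num.conj ((toC (A' + E') + 'i%R * toC (B' - D')) / 4) :> C.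
Proof.
move=> -> -> -> ->; rewrite rmorphM fmorphV rmorph_nat im_unit; congr (_ / _).
by apply/eqP; rewrite eq_complex /=; apply/andP; split; apply/eqP; ring.
Qed.

Lemma levi_hermitian : levi_mx u p = (map_mx Num.conj (levi_mx u p))^T.
Proof.
have T (M : 'M[C]_n) i j : (map_mx Num.conj M)^T i j = Num.conj (M j i) by rewrite !mxE.
have leviE j k : levi_mx u p j k = (toC (hs (e_ R j) (e_ R k) + hs (ie_ R j) (ie_ R k)) +
    'i%R * toC (hs (e_ R j) (ie_ R k) - hs (ie_ R j) (e_ R k))) / 4 by rewrite mxE.
apply/matrixP => j k; rewrite T (leviE j k) (leviE k j).
have s1 := hess_sym u2 (e_ R j) (e_ R k) Up.
have s2 := hess_sym u2 (ie_ R j) (ie_ R k) Up.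
have s3 := hess_sym u2 (e_ R j) (ie_ R k) Up.
have s4 := hess_sym u2 (ie_ R j) (e_ R k) Up.
exact: (conj_entry s1 s2 s3 s4).
Qed.

End LeviModel.

(** * Hartogs figures mapped into the domain *)

Section HartogsFamily.
Variable R : realType.
Local Notation C := (Cx R).
Variables (n q : nat).
Local Notation V := 'rV[C]_n.
Variables (p : V) (R0 : R) (u : V -> R).
Hypothesis R00 : 0 < R0.
Let U : set V := [set z | nm (z - p) < R0].
Hypothesis u2 : Ck_on 2 U u.
Hypothesis up0 : u p = 0.
Hypothesis nondeg : exists v, rderiv v u p != 0.
Hypothesis levi_neg : levi_neg_eigenvalues_ge q u p.

Let Up : U p. Proof. by rewrite /U /= subrr nm0. Qed.
Let u1 : Ck_on 1 U u. Proof. exact: C2_C1 u2. Qed.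

Local Notation hs := (hess u p).
Local Notation el := (ell p u).
Local Notation Hq := (hol2 p u).

Lemma rderiv_close (e : R) : 0 < e -> exists2 d : R, 0 < d & forall y, nm (y - p) < d ->
  U y /\ forall v, `|rderiv v u y - rderiv v u p| <= e * nm v.
Proof.
move=> e0; pose m : R := #|{: 'I_n * bool}|%:R + 1.
have m0 : 0 < m by rewrite ltr_wpDl.
have [|d d0 Hd] := @fin_delta R ('I_n * bool)%type V (fun y => nm (y - p))
  (fun k y => `|rderiv (Ek R k) u y - rderiv (Ek R k) u p| < e / m).
  move=> k; have [_ /(_ (Ek R k))[_ [/(_ p Up) hc _]]] := u1.
  by apply: (continuous_nmP hc); rewrite divr_gt0.
exists (Num.min d R0) => [|y]; first by rewrite lt_min d0.
rewrite lt_min => /andP[/Hd yd Uy]; split => // v.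
rewrite (rderivE v u1 Uy) (rderivE v u1 Up) -sumrB; apply: le_trans (ler_norm_sum _ _ _) _.
apply: (@le_trans _ _ (\sum_(k : 'I_n * bool) e / m * nm v)).
  apply: ler_sum => k _; rewrite -mulrBr normrM mulrC.
  by apply: ler_pM => //; [apply: ltW; exact: yd|exact: co_le].
rewrite sumr_const -mulr_natl mulrA ler_wpM2r ?nm_ge0 //.
by rewrite mulrCA -[leRHS]mulr1 ler_wpM2l ?(ltW e0) // ler_pdivrMr // mul1r /m lerDl.
Qed.

Lemma nm_lin_le (a w : V) : nm (lin a w) <= (\sum_j nm (a 0 j)) * nm w.
Proof.
rewrite /lin mulr_suml; apply: le_trans (nm_sum _) _; apply: ler_sum => j _.
by rewrite nmM ler_wpM2l ?nm_ge0 // nm_entry.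
Qed.

Let nm_mulmx_le (z : 'rV[C]_q) (W : 'M[C]_(q, n)) : (forall i, nm (z 0 i) <= 1) ->
  nm (z *m W) <= \sum_i \sum_j nm (W i j).
Proof.
move=> z1; have S0 : 0 <= \sum_i \sum_j nm (W i j).
  by apply: sumr_ge0 => i _; apply: sumr_ge0 => j _; exact: nm_ge0.
rewrite -[X in nm X]subr0; apply: nm_rVB_le => // j; rewrite mxE [X in _ - X]mxE subr0.
apply: le_trans (nm_sum _) _; apply: ler_sum => i _; rewrite nmM.
apply: (@le_trans _ _ (nm (W i j))); first by rewrite ler_piMl ?nm_ge0.
by rewrite (bigD1 j) //= lerDl; apply: sumr_ge0 => k _; exact: nm_ge0.
Qed.

Let hol2_le (A : R) : 0 <= A -> exists2 B : R, 0 <= B & forall a : V, nm a <= A -> nm (Hq a) <= B.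
Proof.
move=> A0; exists (\sum_j \sum_k nm ((toC (hs (e_ R j) (e_ R k) - hs (ie_ R j) (ie_ R k)) -
    'i%R * toC (hs (e_ R j) (ie_ R k) + hs (ie_ R j) (e_ R k))) / 4 : C) * (A * A)).
  apply: sumr_ge0 => j _; apply: sumr_ge0 => k _; apply: mulr_ge0; first exact: nm_ge0.
  exact: mulr_ge0.
move=> a aA; rewrite /hol2; apply: le_trans (nm_sum _) _; apply: ler_sum => j _.
apply: le_trans (nm_sum _) _; apply: ler_sum => k _.
rewrite nmM; apply: ler_wpM2l; first exact: nm_ge0.
rewrite nmM; apply: ler_pM; rewrite ?nm_ge0 //; apply: le_trans aA; exact: nm_entry.
Qed.

Lemma nm2 : nm (2 : C) = 2.
Proof.
have E : (2 : C) = toC 2 by rewrite /toC rmorph_nat.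
by rewrite E nm_toC ger0_norm.
Qed.

(* The term [- Hq a *: nu] cancels the pluriharmonic part of the second order
   expansion of [u], leaving the Levi form of [a]. *)
Definition fam (W : 'M[C]_(q, n)) (nu v : V) (rho : R) (x : 'rV[C]_q.+1) : V :=
  let a := col' ord_max x *m W in
  p + toC rho *: (a + toC rho *: ((1 + 2 * x 0 ord_max) *: v - Hq a *: nu)).

Let neg_small (kp y dr : R) : kp * (1 / 2) <= y -> dr <= kp / 4 -> - y + dr <= - kp / 4.
Proof. lra. Qed.

Let neg_large (kp y dr : R) : kp * - 1 <= y -> dr <= kp / 4 -> - y + dr <= 5 / 4 * kp.
Proof. lra. Qed.

Let re_half (w rx : R) : w < 4^-1 -> - w <= rx -> 1 / 2 <= 1 + 2 * rx.
Proof. lra. Qed.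

Let re_one (w rx : R) : w <= 1 -> - w <= rx -> - 1 <= 1 + 2 * rx.
Proof. lra. Qed.

Let final_neg (kp du hh L c S : R) : 0 < kp -> c = 8 * kp -> 0 <= S -> L <= - c * S ->
  (du <= - kp / 4 \/ (du <= 5 / 4 * kp /\ 9 / 16 <= S)) -> du - hh + (L + hh) + kp / 8 < 0.
Proof.
move=> k0 -> S0 hL; have h0 : 0 <= kp * S by rewrite mulr_ge0 // ltW.
case=> [h|[h1 h2]]; first by lra.
have : kp * (9 / 16) <= kp * S by rewrite ler_wpM2l // ltW.
lra.
Qed.

Let figure_cases (x : 'rV[C]_q.+1) : hartogs_figure (4^-1) x ->
  [/\ forall i, nm (col' ord_max x 0 i) <= 1, nm (x 0 ord_max) <= 1 &
    nm (x 0 ord_max) < 4^-1 \/ 9 / 16 <= \sum_i sqmod (col' ord_max x 0 i)].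
Proof.
have lt1 (z : C) : `|z| < 1 -> nm z <= 1 by rewrite nmE (toC_lt _ 1) => /ltW.
have q0 : (4^-1 : R) <= 1 by rewrite invf_le1 // ler1n.
case=> [[xc xw]|[[xc nx] xw]].
  rewrite nmE toC_lt in xw; split; [|by apply: ltW; exact: lt_le_trans q0|by left].
  by move=> i; apply: lt1; exact: xc.
split; [by move=> i; apply: lt1; exact: xc|exact: lt1|right].
have [i xi] : exists i, 3 / 4 <= nm (col' ord_max x 0 i).
  apply: contrapT => /forallNP H; apply: nx; apply: subset_closure => i.
  rewrite nmE toC_lt ltNge; apply/negP => h; apply: (H i); apply: le_trans h; lra.
rewrite (bigD1 i) //= -nm_sqmod; apply: ler_wpDr; first by apply: sumr_ge0 => j _; exact: sqmod_ge0.
have -> : 9 / 16 = (3 / 4) ^+ 2 :> R by field.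
by rewrite ler_sqr ?nnegrE ?nm_ge0 // divr_ge0.
Qed.

(** At order [rho ^+ 2] the value of [u] is the real part of [(1 + 2 * s) * el v] plus the Levi form
    of [a], with [s] the last coordinate of [x]. As [el v] is close to [- kp], the first term is at
    most [- kp / 4] when [nm s < 1 / 4], and at most [5 / 4 * kp] in general. On the rim the Levi
    form is at most [- 8 * kp * 9 / 16] and wins. The error term takes [kp / 8]. *)
Lemma hartogs_family : exists (W : 'M[C]_(q, n)) (nu v0 : V) (k0 : R), 0 < k0 /\
  (exists2 R1 : R, 0 < R1 & forall y, nm (y - p) < R1 -> U y /\
    forall v, nm (v - v0) < k0 -> rderiv v u y < 0) /\
  exists2 rho0 : R, 0 < rho0 & forall rho, 0 < rho < rho0 -> forall v, nm (v - v0) < k0 ->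
    forall x, hartogs_figure (4^-1) x -> U (fam W nu v rho x) /\ u (fam W nu v rho x) < 0.
Proof.
have [m [B [Bu /andP[Bt _] Bn]]] := levi_neg.
have Lh := levi_hermitian R00 u2.
have Mh : B *m levi_mx u p *m (map_mx Num.conj B)^T =
    (map_mx Num.conj (B *m levi_mx u p *m (map_mx Num.conj B)^T))^T.
  have cc k l (M : 'M[C]_(k, l)) : (map_mx Num.conj (map_mx Num.conj M)^T)^T = M.
    by apply/matrixP => i j; rewrite !mxE; exact: conjCK.
  by rewrite !map_mxM !trmx_mul cc -Lh mulmxA.
have [P [c [c0 Pc]]] := negative_directions Mh Bn.
pose W := P *m B; pose kp := c / 8.
have kp0 : 0 < kp by rewrite divr_gt0.
have ellW z : el (z *m W) = 0.
  have /sub_kermxP BK := Bt.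
  have WK : W *m (dz u p)^T = 0 by rewrite /W -mulmxA BK mulmx0.
  rewrite /ell; have -> : lin (dz u p) (z *m W) = ((z *m W) *m (dz u p)^T) 0 0.
    rewrite /lin mxE; apply: eq_bigr => j _; rewrite [(dz u p)^T j 0]mxE mulrC //.
  by rewrite -mulmxA WK mulmx0 mxE mulr0.
have ellD a b : el (a + b) = el a + el b by rewrite /ell linD mulrDr.
have ellZ t a : el (t *: a) = t * el a by rewrite /ell linZ mulrCA.
have [nu nu1] : exists nu, el nu = 1.
  have [v] := nondeg; rewrite (rderiv_ell R00 u2) => ev.
  have ev0 : el v != 0 by apply: contraNneq ev => ->.
  by exists ((el v)^-1 *: v); rewrite ellZ mulVf.
pose v0 : V := - toC kp *: nu.
have ev0 : el v0 = - toC kp by rewrite /v0 ellZ nu1 mulr1.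
pose K := 2 * (\sum_j nm (dz u p 0 j)) + 1.
have S0 : 0 <= \sum_j nm (dz u p 0 j) by apply: sumr_ge0 => j _; exact: nm_ge0.
have K0 : 0 < K by rewrite ltr_wpDl // mulr_ge0.
have ellK w : nm (el w) <= K * nm w.
  rewrite /ell nmM nm2.
  apply: (@le_trans _ _ (2 * ((\sum_j nm (dz u p 0 j)) * nm w))).
    by rewrite ler_wpM2l // nm_lin_le.
  by rewrite mulrA ler_wpM2r ?nm_ge0 // /K lerDl.
(* This keeps [el v] within [kp / 12] of [- kp]; the factor [sg], of modulus at most 3, makes it
   [kp / 4]. *)
pose k0 := kp / 12 / K.
have k00 : 0 < k0 by rewrite !divr_gt0.
have near v : nm (v - v0) < k0 -> exists2 dl : C, nm dl <= kp / 12 & el v = - toC kp + dl.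
  move=> vk; exists (el (v - v0)).
    apply: le_trans (ellK _) _; apply: (@le_trans _ _ (K * k0)).
      by rewrite ler_wpM2l // ltW.
    by rewrite /k0 mulrC divfK // gt_eqF.
  by rewrite -ev0 -ellD addrC subrK.
exists W, nu, v0, k0; split => //; split.
  pose Bv := nm v0 + k0 + 1.
  have Bv0 : 0 < Bv by rewrite ltr_wpDl // addr_ge0 ?nm_ge0 // ltW.
  have [|R1 R10 H1] := @rderiv_close (kp / 4 / Bv); first by rewrite !divr_gt0.
  exists R1 => // y /H1[Uy Hy]; split => // v vk.
  have [dl dlk ev] := near v vk.
  have h1 : rderiv v u p <= - kp + kp / 12.
    rewrite (rderiv_ell R00 u2) ev raddfD /= lerD2l.
    by apply: le_trans (ler_norm _) _; apply: le_trans (Re_le_nm _) dlk.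
  have vB : nm v <= Bv.
    rewrite -[v](subrK v0); apply: le_trans (nmD _ _) _; rewrite /Bv.
    by move: (nm (v - v0)) (nm v0) vk => x1 x2; lra.
  have h2 : kp / 4 / Bv * nm v <= kp / 4.
    rewrite mulrAC ler_pdivrMr // ler_wpM2l // divr_ge0 // ltW //.
  have := le_trans (le_trans (ler_norm _) (Hy v)) h2.
  by move: (rderiv v u y) (rderiv v u p) h1 kp0 => x1 x2; lra.
pose A1 := \sum_i \sum_j nm (W i j).
have A10 : 0 <= A1 by apply: sumr_ge0 => i _; apply: sumr_ge0 => j _; exact: nm_ge0.
have [B2 B20 HB2] := hol2_le A10.
pose A := A1 + 3 * (nm v0 + k0) + B2 * nm nu + 1.
have nn := nm_ge0 nu; have nv0 := nm_ge0 v0.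
have A2 : 0 <= 3 * (nm v0 + k0) by rewrite mulr_ge0 // addr_ge0 // ltW.
have A3 : 0 <= B2 * nm nu by rewrite mulr_ge0.
have A0 : 0 < A by rewrite ltr_wpDl // !addr_ge0.
have kp80 : 0 < kp / 8 by rewrite divr_gt0.
have [rho0 rho00 Hrho] := quad_upper R00 u2 A0 kp80.
exists rho0 => // rho rr v vk x xH.
have [xc xw xcase] := figure_cases xH.
have [dl dlk ev] := near v vk.
pose z := col' ord_max x; pose a := z *m W.
pose sg : C := 1 + 2 * x 0 ord_max.
pose b := sg *: v - Hq a *: nu.
have aA1 : nm a <= A1 by exact: nm_mulmx_le.
have aA : nm a <= A by apply: le_trans aA1 _; rewrite /A -!addrA lerDl !addr_ge0.
have sg3 : nm sg <= 3.
  apply: le_trans (nmD _ _) _; rewrite nm1 nmM nm2.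
  by move: (nm (x 0 ord_max)) xw => w; lra.
have bA : nm b <= A.
  have h1 : nm (sg *: v) <= 3 * (nm v0 + k0).
    rewrite nmZ; apply: ler_pM; rewrite ?nm_ge0 //.
    rewrite -[v](subrK v0); apply: le_trans (nmD _ _) _.
    by rewrite addrC lerD2l ltW.
  have h2 : nm (Hq a *: nu) <= B2 * nm nu by rewrite nmZ ler_wpM2r // HB2.
  apply: le_trans (nmD _ _) _; rewrite nmN /A.
  by move: (nm (sg *: v)) (nm (Hq a *: nu)) h1 h2 => y1 y2; move: A10; lra.
have da : rderiv a u p = 0 by rewrite (rderiv_ell R00 u2) ellW.
have [h1 h2] := Hrho rho rr a b aA bA da.
have /andP[r0 _] := rr.
split; first by rewrite /U /= /fam addrAC subrr add0r.
apply: le_lt_trans h2 _; rewrite up0 add0r pmulr_rlt0 ?exprn_gt0 //.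
rewrite (rderiv_ell R00 u2) (hess_levi R00 u2).
have -> : el b = sg * el v - Hq a.
  by rewrite /b ellD ellZ -scaleNr ellZ nu1 mulr1.
rewrite raddfB /=.
apply: (@final_neg kp _ _ _ c (\sum_i sqmod (z 0 i))) => //.
- by rewrite /kp mulrC divfK.
- by apply: sumr_ge0 => i _; exact: sqmod_ge0.
- by rewrite /a /W mulmxA herm_conj; exact: Pc.
rewrite ev mulrDr raddfD /= -/(complex.Re _).
have d4 : `|complex.Re (sg * dl)| <= kp / 4.
  apply: le_trans (Re_le_nm _) _; rewrite nmM.
  apply: (@le_trans _ _ (3 * (kp / 12))); first by apply: ler_pM; rewrite ?nm_ge0.
  by have -> : 3 * (kp / 12) = kp / 4 by field.
have rE : complex.Re (sg * - toC kp) = - (kp * complex.Re sg).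
  by case: sg {sg3 b bA h1 d4} => y1 y2 /=; ring.
have sE : complex.Re sg = 1 + 2 * complex.Re (x 0 ord_max).
  by rewrite /sg; case: (x 0 ord_max) => y1 y2 /=; ring.
have xr := Re_le_nm (x 0 ord_max).
rewrite rE; move: (complex.Re (sg * dl)) d4 => dr; rewrite ler_norml => /andP[d1 d2].
move: xr sE; move: (complex.Re sg) (complex.Re (x 0 ord_max)) => rs rx; rewrite ler_norml => /andP[x1 x2] sE.
case: xcase => [xs|xs]; [left|right; split => //].
  have rs2 : 1 / 2 <= rs by rewrite sE; exact: re_half xs x1.
  exact: neg_small (ler_wpM2l (ltW kp0) rs2) d2.
have rs1 : - 1 <= rs by rewrite sE; exact: re_one xw x1.
exact: neg_large (ler_wpM2l (ltW kp0) rs1) d2.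
Qed.

End HartogsFamily.

(** * The Hartogs property implies the Levi condition *)

Section FamilyMaps.
Variable R : realType.
Local Notation C := (Cx R).
Variables (n q : nat).
Local Notation V := 'rV[C]_n.
Variables (p : V) (u : V -> R).

Lemma hol2Z (t : C) (w : V) : hol2 p u (t *: w) = t ^+ 2 * hol2 p u w.
Proof.
rewrite /hol2 mulr_sumr; apply: eq_bigr => j _; rewrite mulr_sumr; apply: eq_bigr => k _.
by rewrite !rVZ [RHS]mulrCA; congr (_ * _); rewrite mulrACA expr2.
Qed.

Lemma hol2_diff (w : V) : differentiable (hol2 p u) w.
Proof.
have cd j : differentiable (fun v : V => v 0 j) w by exact: differentiable_coord.
rewrite (_ : hol2 p u = \sum_j \sum_k (fun v : V => (toC (hess u p (e_ R j) (e_ R k) - hess u p (ie_ R j) (ie_ R k)) -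
    'i%R * toC (hess u p (e_ R j) (ie_ R k) + hess u p (ie_ R j) (e_ R k))) / 4 *: (v 0 j *: (v 0 k : C)))); last first.
  by apply/funext => v; rewrite fct_sumE; apply: eq_bigr => j _; rewrite fct_sumE.
apply: differentiable_sum => j; apply: differentiable_sum => k.
by apply: differentiable_scale; [exact: differentiable_cst|exact: differentiable_scale].
Qed.

Lemma fam_diff (W : 'M[C]_(q, n)) (nu v : V) (rho : R) x : differentiable (fam p u W nu v rho) x.
Proof.
have ad : differentiable (fun x : 'rV[C]_q.+1 => col' ord_max x *m W) x.
  rewrite (_ : (fun _ => _) = \sum_i (fun x : 'rV[C]_q.+1 => x 0 (lift ord_max i) *: row i W)); last first.
    by apply/funext => y; rewrite fct_sumE mulmx_sum_row; apply: eq_bigr => i _; rewrite mxE.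
  apply: differentiable_sum => i; apply: differentiable_scale; last exact: differentiable_cst.
  exact: differentiable_coord.
apply: differentiableD; first exact: differentiable_cst.
apply: differentiable_scale; first exact: differentiable_cst.
apply: differentiableD => //.
apply: differentiable_scale; first exact: differentiable_cst.
apply: differentiableB.
  apply: differentiable_scale; last exact: differentiable_cst.
  apply: differentiableD; first exact: differentiable_cst.
  apply: (@differentiable_scale R C 'rV[C]_q.+1 (fun=> 2) (fun x => x 0 ord_max)).
    exact: differentiable_cst.
  exact: differentiable_coord.
apply: differentiable_scale; last exact: differentiable_cst.
exact: (differentiable_comp ad (hol2_diff _)).
Qed.

(** [fam] on a two-dimensional slice, with [s *: v] replaced by a free vector: one map that
    restricts to every member of the family. *)
Definition psi (w nu : V) (h : C) (rho : R) (ty : C * V) : V :=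
  p + toC rho *: (ty.1 *: w + toC rho *: (ty.2 - (ty.1 ^+ 2 * h) *: nu)).

Lemma psi_diff w nu h rho ty : differentiable (psi w nu h rho) ty.
Proof.
have d1 : differentiable (@fst C V) ty by apply: linear_differentiable; move=> z; exact: cvg_fst.
have d2 : differentiable (@snd C V) ty by apply: linear_differentiable; move=> z; exact: cvg_snd.
apply: differentiableD; first exact: differentiable_cst.
apply: differentiable_scale; first exact: differentiable_cst.
apply: differentiableD.
  by apply: differentiable_scale => //; exact: differentiable_cst.
apply: differentiable_scale; first exact: differentiable_cst.
apply: differentiableB => //.
apply: differentiable_scale; last exact: differentiable_cst.
rewrite (_ : (fun _ => _) = fun z : C * V => z.1 *: (z.1 *: (h : C))); last first.
  by apply/funext => z; rewrite expr2 -mulrA.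
apply: (@differentiable_scale R C _ (@fst C V) (fun z => z.1 *: (h : C)) _ d1).
exact: (@differentiable_scale R C _ (@fst C V) (fun=> h) _ d1 (differentiable_cst _ _)).
Qed.

End FamilyMaps.

Section Slice.
Variable R : realType.
Local Notation C := (Cx R).
Variable q : nat.
Local Notation Z := 'rV[C]_q.+2.

(* The last coordinate [s] of the figure is recentred so that the centre of the
   figure is [s = 1] and the apex of the cones is [s = 0]. *)
Definition slice (t s : C) : Z := t *: delta_mx 0 ord0 + ((s - 1) / 2) *: delta_mx 0 ord_max.

Lemma slice_max t s : slice t s 0 ord_max = (s - 1) / 2.
Proof. by rewrite rVD !rVZ !mxE !eqxx /= mulr0 mulr1 add0r. Qed.

Lemma slice_col t s : col' ord_max (slice t s) = t *: col' ord_max (delta_mx 0 ord0 : Z).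
Proof.
have h i : (lift ord_max i == ord_max :> 'I_q.+2) = false by apply/negbTE; rewrite eq_sym neq_lift.
by apply/rowP => i; rewrite !mxE !eqxx /= h mulr0 addr0.
Qed.

Lemma slice_diff ts : differentiable (fun ts : C * C => slice ts.1 ts.2) ts.
Proof.
have d1 : differentiable (@fst C C) ts by apply: linear_differentiable; move=> z; exact: cvg_fst.
have d2 : differentiable (@snd C C) ts by apply: linear_differentiable; move=> z; exact: cvg_snd.
apply: differentiableD; apply: differentiable_scale => //; try exact: differentiable_cst.
rewrite (_ : (fun _ => _) = fun z : C * C => (2^-1 : C) *: (z.2 - 1)); last first.
  by apply/funext => z; rewrite mulrC.
apply: differentiable_scale; first exact: differentiable_cst.
by apply: differentiableB => //; exact: differentiable_cst.
Qed.

Lemma slice_entry t s i : slice t s 0 i = if i == ord0 then t else if i == ord_max then (s - 1) / 2 else 0.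
Proof.
rewrite rVD !rVZ !mxE !eqxx /=; case: eqP => [->|_].
  by rewrite mulr1 mulr0 addr0.
by case: eqP => _; rewrite ?mulr1 !mulr0 add0r.
Qed.

Let half_sub_lt (s : C) (e : R) : nm (s - 1) < 2 * e -> nm ((s - 1) / 2) < e.
Proof.
move=> h; have n0 : nm (2 : C) != 0 by rewrite nm2.
have E : nm ((s - 1) / 2) * 2 = nm (s - 1) by rewrite -nm2 -nmM divfK // pnatr_eq0.
by rewrite -E mulrC in h; rewrite ltr_pM2l in h.
Qed.

Lemma slice_polydisk (t s : C) : nm t < 1 -> nm (s - 1) < 2 -> polydisk 1 (slice t s).
Proof.
move=> t1 s1 i; rewrite nmE toC_lt slice_entry; case: eqP => _ //; case: eqP => _; last by rewrite nm0.
by apply: half_sub_lt; rewrite mulr1.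
Qed.

Lemma slice_col_polydisk (t s : C) : nm t < 1 -> polydisk 1 (col' ord_max (slice t s)).
Proof.
move=> t1 i; rewrite mxE nmE toC_lt slice_entry; case: eqP => _ //.
by rewrite eq_sym (negPf (neq_lift _ _)) nm0.
Qed.

Lemma slice_centre (t s : C) : nm t < 1 -> nm (s - 1) < 1 / 2 -> hartogs_figure (4^-1) (slice t s).
Proof.
move=> t1 s1; left; split; first exact: slice_col_polydisk.
rewrite slice_max nmE toC_lt; apply: half_sub_lt; apply: lt_le_trans s1 _; lra.
Qed.

Let rim_arith (a b c : R) : b <= a + c -> a < b - 3 / 4 -> 3 / 4 < c.
Proof. lra. Qed.

Lemma slice_rim (t s : C) : 3 / 4 < nm t -> nm t < 1 -> nm (s - 1) < 2 -> hartogs_figure (4^-1) (slice t s).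
Proof.
move=> t0 t1 s1; right; split; last first.
  by rewrite slice_max nmE (toC_lt _ 1); apply: half_sub_lt; rewrite mulr1.
split; first exact: slice_col_polydisk.
have [j j0] : exists j : 'I_q.+1, lift ord_max j = ord0.
  by case: (unliftP ord_max (ord0 : 'I_q.+2)) => [j ->|//]; exists j.
have cj : col' ord_max (slice t s) 0 j = t by rewrite mxE j0 slice_entry eqxx.
move=> /(_ [set y | 3 / 4 < nm (y 0 j)])[].
  apply/nbhs_nmP; exists (nm t - 3 / 4) => [|y yz]; first by rewrite subr_gt0.
  have h := le_lt_trans (nm_entryB y (col' ord_max (slice t s)) j) yz; rewrite cj nmBC in h.
  have h' := nmD (t - y 0 j) (y 0 j); rewrite subrK in h'.
  exact: (rim_arith h' h).
move=> y [/(_ j)]; rewrite nmE toC_lt /= => h1 h2; lra.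
Qed.

End Slice.

(** * Extension near the boundary point *)

Section LocalExtension.
Variable R : realType.
Local Notation C := (Cx R).
Variables (n q : nat) (X : hilbert_manifold R).
Local Notation V := 'rV[C]_n.
Hypothesis hX : q_hartogs q.+1 X.
Variables (D : set V) (p : V) (R0 : R) (u : V -> R) (f : V -> X).
Hypotheses (D_open : open D) (R00 : 0 < R0) (u2 : Ck_on 2 [set z | nm (z - p) < R0] u).
Hypothesis DU : forall z, nm (z - p) < R0 -> (D z <-> u z < 0).
Hypotheses (up0 : u p = 0) (nondeg : exists v, rderiv v u p != 0).
Hypothesis levi_neg : levi_neg_eigenvalues_ge q.+1 u p.
Hypothesis fD : holomorphic_on D f.

Let shift (x y : V) : x + y - x = y. Proof. by rewrite addrAC subrr add0r. Qed.

Let back_segment (z v : V) (c s : C) : z + c *: v + s *: (z - (z + c *: v)) = z + (c * (1 - s)) *: v.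
Proof. by rewrite opprD addrA subrr sub0r scalerN scalerA -addrA -scalerBl mulrBr mulr1 [s * c]mulrC. Qed.

Let cone_point (x y z w : V) : y = x + (w + (y - (z + w) + (z - x))).
Proof. by apply/rowP => j; rewrite !(rVB, rVD); ring. Qed.

Lemma local_extension : exists (d : R) (g : V -> X), 0 < d /\
  forall z, nm (z - p) < d -> hol_at g z /\ (D z -> g z = f z).
Proof.
have [W [nu [v0 [k0 [k00 [[R1 R10 HR1] [rho0 rho00 Hrho]]]]]]] := hartogs_family R00 u2 up0 nondeg levi_neg.
pose Bv := nm v0 + k0 + 1.
have Bv0 : 0 < Bv by rewrite ltr_wpDl // addr_ge0 ?nm_ge0 // ltW.
have vB (v : V) : nm (v - v0) < k0 -> nm v <= Bv.
  move=> vk; rewrite -[v](subrK v0); apply: le_trans (nmD _ _) _; rewrite /Bv.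
  by apply: le_trans (_ : k0 + nm v0 <= _); [rewrite lerD2r ltW|rewrite [k0 + _]addrC lerDl].
(* Small enough for the family to map the figure into [D], and for the cone with apex [p] and height
   [rho ^+ 2] to stay in the ball of radius [R1], where [u] decreases along every admissible [v]. *)
pose rho := Num.min (Num.min 1 (rho0 / 2)) (R1 / 2 / Bv).
have r0 : 0 < rho by rewrite !lt_min ltr01 !divr_gt0.
have r1 : rho <= 1 by rewrite !ge_min lexx.
have rr0 : rho < rho0 by apply: (@le_lt_trans _ _ (rho0 / 2)); [rewrite !ge_min lexx orbT|exact: half_lt].
pose c2 := rho ^+ 2.
have c20 : 0 < c2 by rewrite exprn_gt0.
have c2B : c2 * Bv <= R1 / 2.
  apply: (@le_trans _ _ (rho * Bv)).
    by rewrite ler_wpM2r ?(ltW Bv0) // /c2 expr2 ler_piMl // ltW.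
  by rewrite -ler_pdivlMr // ge_min lexx orbT.
have R1h : R1 / 2 < R1 by exact: half_lt.
pose F (v : V) x := fam p u W nu v rho x.
have FD (v : V) x : nm (v - v0) < k0 -> hartogs_figure (4^-1) x -> D (F v x).
  move=> vk xH; have rr : 0 < rho < rho0 by rewrite r0.
  have [h1 h2] := Hrho rho rr v vk x xH; exact/DU.
have q14 : 0 < (4^-1 : R) < 1 by rewrite invr_gt0 ltr0n /= invf_lt1 // ltr1n.
have ext (v : V) : exists g : 'rV[C]_q.+2 -> X, nm (v - v0) < k0 -> holomorphic_on (polydisk 1) g /\
    forall x, hartogs_figure (4^-1) x -> g x = f (F v x).
  have [vk|nvk] := ltP (nm (v - v0)) k0; last by exists (fun=> f 0).
  have fF : holomorphic_on (hartogs_figure (4^-1)) (f \o F v).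
    move=> x xH; exact: (hol_at_comp (@fam_diff R n q.+1 p u W nu v rho x) (fD (FD v x vk xH))).
  by have [g g1 g2] := hX q14 fF; exists g.
have [gg Hgg] := choice ext.
pose w : V := col' ord_max (delta_mx 0 ord0 : 'rV[C]_q.+2) *m W.
pose h := hol2 p u w.
pose Psi := psi p w nu h rho.
have FPsi v t s : F v (slice q t s) = Psi (t, s *: v).
  rewrite /F /fam slice_max slice_col -scalemxAl -/w hol2Z -/h /Psi /psi /=.
  have -> : 1 + 2 * ((s - 1) / 2) = s :> C by rewrite mulrCA mulfV ?pnatr_eq0 // mulr1 addrC subrK.
  by [].
have Psi0 (y : V) : Psi (0, y) = p + toC c2 *: y.
  by rewrite /Psi /psi /= scale0r add0r expr0n mul0r scale0r subr0 scalerA -toCM.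
pose G (v : V) (t s : C) := gg v (slice q t s).
have Gs (v : V) (t s : C) : nm (v - v0) < k0 -> nm t < 1 -> nm (s - 1) < 2 ->
    hol_at (fun ts : C * C => G v ts.1 ts.2) (t, s).
  move=> vk t1 s1; have [g1 _] := Hgg v vk.
  by apply: (hol_at_comp (@slice_diff R q (t, s))); apply: g1; exact: slice_polydisk.
have s2 (s : C) : nm s < 1 -> nm (s - 1) < 2.
  by move=> s1; apply: le_lt_trans (nmD _ _) _; rewrite nmN nm1; move: (nm s) s1 => x; lra.
have GH (v : V) (t s : C) : nm (v - v0) < k0 -> nm t < 1 -> nm s < 1 ->
    hol_at (fun ts : C * C => G v ts.1 ts.2) (t, s).
  by move=> vk t1 /s2; exact: Gs.
have v0in : nm (v0 - v0) < k0 by rewrite subrr nm0.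
have n78 : nm (toC (7 / 8) : C) = 7 / 8 by rewrite nm_toC ger0_norm // divr_ge0.
(* For [3 / 4 < nm t < 1] the slice is in the rim, where the extensions equal [f] composed with
   [F v]. So [f \o Psi] is a joint extension there; 7/8 is the middle and 1/16 a safe margin. *)
have sA : sprout v0 k0 G (toC (7 / 8)).
  have DA : D (Psi (toC (7 / 8), 0)).
    rewrite -(scale0r v0) -FPsi; apply: FD => //; apply: slice_rim; rewrite ?n78; [lra|lra|].
    by apply: s2; rewrite nm0.
  have /cont_nmP/(_ D)[] := differentiable_continuous (@psi_diff R n p w nu h rho (toC (7 / 8), 0)).
    by apply: open_nbhs_nbhs; split.
  move=> e e0 He; exists (f \o Psi), e => //; split.
    move=> t y te ye; apply: (hol_at_comp (@psi_diff R n p w nu h rho (t, y))).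
    by apply: fD; apply: He; apply/nm_pair_lt; rewrite subr0.
  move=> v vk; exists (1 / 16) => [|t s te se]; first by rewrite divr_gt0.
  have [_ g2] := Hgg v vk; rewrite /= -FPsi /G g2 //.
  have t1 : nm t < 1.
    rewrite -[t](subrK (toC (7 / 8))); apply: le_lt_trans (nmD _ _) _; rewrite n78.
    by move: (nm _) te => x; lra.
  apply: slice_rim => //; last by apply: s2; move: (nm s) se => x; lra.
  have := nmD (toC (7 / 8) - t) t; rewrite subrK n78 nmBC.
  by move: (nm _) (nm _) te => x y; lra.
have t78 : 0 <= (7 / 8 : R) < 1 by apply/andP; split; lra.
have [Gh [d d0 [GhH GhG]]] := sprout_propagate k00 GH t78 sA.
have Gh0 (y : V) : nm y < d -> hol_at (fun y => Gh (0, y)) y.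
  move=> yd; have h0 := GhH 0 y; rewrite subr0 nm0 in h0.
  exact: (hol_at_comp (slice_diff2 y (0 : C)) (h0 d0 yd)).
have z1 : nm (0 : C) < 1 by rewrite nm0.
have G0 (v : V) (s : C) : nm (v - v0) < k0 -> nm (s - 1) < 2 -> hol_at (fun s => G v 0 s) s.
  by move=> vk s1; exact: (hol_at_comp (slice_diff2 s (0 : C)) (Gs v 0 s vk z1 s1)).
have inw (z v : V) (c : R) : 0 <= c -> nm (v - v0) < k0 -> nm (z - p) < R1 -> nm (z + toC c *: v - p) < R1 ->
    u (z + toC c *: v) <= u z /\ (0 < c -> u (z + toC c *: v) < u z).
  move=> c0 vk zR cR; have u1 := C2_C1 u2.
  have [Uz _] := HR1 z zR; have [Uc _] := HR1 _ cR.
  have [t t01 E] := C1_mvt u1 Uz Uc.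
  have tR : nm (z + toC t *: (toC c *: v) - p) < R1.
    have := nm_segment_lt t01 zR cR.
    have -> : z + toC c *: v - p - (z - p) = toC c *: v by rewrite opprB addrA subrK shift.
    by rewrite addrAC.
  have [Ut /(_ v vk) neg] := HR1 _ tR.
  rewrite (rderivZ _ _ u1 Ut) in E.
  split; first by rewrite -subr_le0 E mulr_ge0_le0 // ltW.
  by move=> cp; rewrite -subr_lt0 E pmulr_rlt0.
have pR : nm (p - p) < R1 by rewrite subrr nm0.
have coneR (v : V) (c : R) : nm (v - v0) < k0 -> 0 <= c <= c2 -> nm (p + toC c *: v - p) < R1.
  move=> vk /andP[c0 cc]; rewrite shift nmZ nm_toC ger0_norm //.
  apply: le_lt_trans R1h; apply: le_trans c2B; apply: ler_pM => //; [exact: nm_ge0|exact: vB].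
have coneD (v : V) (t : R) : nm (v - v0) < k0 -> 0 < t <= 1 -> D (p + toC c2 *: (toC t *: v)).
  move=> vk /andP[t0 t1]; rewrite scalerA -toCM.
  have ct : 0 <= c2 * t <= c2 by rewrite mulr_ge0 ?(ltW c20) ?(ltW t0) //= ler_piMr // ltW.
  have cR := coneR v _ vk ct; have [Uc _] := HR1 _ cR.
  apply/(DU Uc); have /andP[ct0 _] := ct; have [_] := inw p v _ ct0 vk pR cR.
  by rewrite up0; apply; rewrite mulr_gt0.
(* For first argument 0, [G v] is given by [f] near the centre [s = 1], and the segment from 1 to
   [t] is mapped into the cone without its apex, which lies in [D]. *)
have Gf (v : V) (t : R) : nm (v - v0) < k0 -> 0 < t <= 1 -> G v 0 (toC t) = f (p + toC c2 *: (toC t *: v)).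
  move=> vk t01; have /andP[t0 t1] := t01; have [_ g2] := Hgg v vk.
  pose Lp (s : C) : V := p + s *: (toC c2 *: v).
  have LpE s : p + toC c2 *: (s *: v) = Lp s by rewrite /Lp !scalerA mulrC.
  have Ld s : differentiable Lp s by exact: line_diff.
  have hlf : 0 < (1 / 2 : R) by rewrite divr_gt0.
  rewrite LpE; apply: (@identity_segment R X C [set s : C | nm (s - 1) < 2 /\ D (Lp s)] (fun s => G v 0 s) (f \o Lp) 1 (toC t) _ hlf).
  - rewrite openE => s [s1 sD]; apply/nbhs_nmP.
    have /cont_nmP/(_ D)[] := differentiable_continuous (Ld s); first by apply: open_nbhs_nbhs; split.
    move=> e e0 He; exists (Num.min e (2 - nm (s - 1))) => [|y]; first by rewrite lt_min e0 subr_gt0.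
    rewrite lt_min => /andP[/He yD ys]; split => //.
    by rewrite -[y](subrK s) -addrA; apply: le_lt_trans (nmD _ _) _; rewrite -ltrBrDr.
  - move=> s [s1 sD]; split; first exact: G0.
    exact: (hol_at_comp (Ld s) (fD sD)).
  - move=> s /andP[s0 s1]; pose x := 1 + s * (t - 1).
    have -> : 1 + toC s * (toC t - 1) = toC x :> C by rewrite /x toCD toCM toCB toC1.
    have st : s * (1 - t) <= 1 - t by rewrite ler_piMl // subr_ge0.
    have st0 : 0 <= s * (1 - t) by rewrite mulr_ge0 // subr_ge0.
    have x01 : 0 < x <= 1 by apply/andP; split; rewrite /x; lra.
    split; last by rewrite /= -LpE; exact: coneD.
    have /andP[x0 x1] := x01; rewrite /= -toC1 -toCB nm_toC ler0_norm ?subr_le0 //; lra.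
  move=> s s1; rewrite /G g2; first by rewrite -/(F v _) FPsi Psi0 LpE.
  exact: slice_centre.
have dB0 : 0 < d / Bv by rewrite divr_gt0.
(* The sprout matches [G v] for [s] small depending on [v]; the identity theorem extends this up to
   a bound that does not depend on [v]. *)
have GhGv (v : V) (t : R) : nm (v - v0) < k0 -> 0 < t < Num.min 1 (d / Bv) -> Gh (0, toC t *: v) = G v 0 (toC t).
  move=> vk /andP[t0 tm]; have [e e0 He] := GhG v vk.
  pose m := Num.min 1 (d / Bv).
  have sv (s : C) : nm s < m -> nm s < 1 /\ nm (s *: v) < d.
    rewrite lt_min => /andP[s1]; rewrite ltr_pdivlMr // => sd; split => //.
    by rewrite nmZ; apply: le_lt_trans sd; rewrite ler_wpM2l ?nm_ge0 // vB.
  apply: (@identity_segment R X C [set s : C | nm s < m] (fun s => Gh (0, s *: v)) (fun s => G v 0 s) 0 (toC t) _ e0).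
  - rewrite openE => s sm; apply/nbhs_nmP; exists (m - nm s) => [|y ys]; first by rewrite subr_gt0.
    by rewrite /= -[y](subrK s); apply: le_lt_trans (nmD _ _) _; rewrite -ltrBrDr.
  - move=> s /sv[s1 sd]; split; last by apply: G0 => //; exact: s2.
    have ld : differentiable (fun s : C => s *: v) s by apply: differentiableZl; exact: ex_diff.
    exact: (hol_at_comp ld (Gh0 _ sd)).
  - move=> s /andP[s0 s1] /=; rewrite add0r subr0 nmM !nm_toC !ger0_norm ?(ltW t0) //.
    by apply: le_lt_trans tm; rewrite ler_piMl // ltW.
  by move=> s; rewrite subr0 => se; apply: He => //; rewrite subr0 nm0.
(* One height in the cone that serves for all [v]: around the axis at this height the extension and
   [f] agree on an open set. *)
pose t := Num.min (1 / 2) (d / 4 / Bv).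
have t0 : 0 < t by rewrite lt_min !divr_gt0.
have t1 : t <= 1 / 2 by rewrite ge_min lexx.
have tB : t * Bv <= d / 4 by rewrite -ler_pdivlMr // ge_min lexx orbT.
have t1' : 0 < t <= 1 by rewrite t0 /=; lra.
have tm : 0 < t < Num.min 1 (d / Bv).
  rewrite t0 lt_min /=; apply/andP; split; first by lra.
  have d4 : d / 4 < d by rewrite ltr_pdivrMr // ltr_pMr // ltr1n.
  have tBd : t * Bv < d := le_lt_trans tB d4.
  by rewrite -(ltr_pdivlMr t d Bv0) in tBd.
pose ct := c2 * t.
have ct0 : 0 < ct by rewrite mulr_gt0.
have ctc : ct <= c2 by rewrite /ct ler_piMr ?(ltW c20) //; lra.
(* The first two bounds keep the path from [z] in direction [v0] where [u] decreases and where [g]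
   is holomorphic; the third puts a neighbourhood of its end in the cone. *)
pose de := Num.min (Num.min (R1 / 4) (c2 * d / 4)) (ct * k0 / 2).
have de0 : 0 < de by rewrite !lt_min !divr_gt0 ?mulr_gt0.
have de1 : de <= R1 / 4 by rewrite !ge_min lexx.
have de2 : de <= c2 * d / 4 by rewrite !ge_min lexx !orbT.
have de3 : de <= ct * k0 / 2 by rewrite !ge_min lexx !orbT.
pose g (z : V) := Gh (0, toC c2^-1 *: (z - p)).
have c2n : toC c2 != 0 :> C by rewrite -nm_eq0 nm_toC gtr0_norm // gt_eqF.
have cK (y : V) : toC c2^-1 *: (toC c2 *: y) = y.
  by rewrite scalerA -toCM mulVf ?gt_eqF // toC1 scale1r.
have gH (z : V) : nm (z - p) < c2 * d -> hol_at g z.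
  move=> zd; have h1 : nm (toC c2^-1 *: (z - p)) < d.
    by rewrite nmZ nm_toC gtr0_norm ?invr_gt0 // mulrC ltr_pdivrMr // mulrC.
  have ld : differentiable (fun z : V => toC c2^-1 *: (z - p)) z.
    by apply: differentiableZ; apply: differentiableB; [exact: ex_diff|exact: differentiable_cst].
  exact: (hol_at_comp ld (Gh0 _ h1)).
have gcone (v : V) : nm (v - v0) < k0 -> g (p + toC ct *: v) = f (p + toC ct *: v).
  move=> vk; have E : p + toC ct *: v = p + toC c2 *: (toC t *: v) by rewrite scalerA -toCM.
  by rewrite E -Gf // -GhGv // /g shift cK.
have cv0 : ct * nm v0 <= R1 / 4 /\ ct * nm v0 <= c2 * d / 4.
  have h1 : t * nm v0 <= t * Bv by rewrite ler_wpM2l ?(ltW t0) // vB.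
  have E1 : ct * nm v0 = c2 * (t * nm v0) by rewrite /ct mulrA.
  have E2 : c2 * d / 4 = c2 * (d / 4) by rewrite mulrA.
  rewrite E1 E2; split; last exact: (ler_wpM2l (ltW c20) (le_trans h1 tB)).
  have h3 : t * Bv <= 1 / 2 * Bv by rewrite ler_wpM2r // ltW.
  apply: le_trans (ler_wpM2l (ltW c20) (le_trans h1 h3)) _.
  by rewrite mulrCA; move: (c2 * Bv) c2B => x; lra.
have [cv1 cv2] := cv0.
exists de, g; split => // z zde; split.
  have cd : 0 < c2 * d by rewrite mulr_gt0.
  apply: gH; apply: lt_le_trans zde _; apply: le_trans de2 _.
  by rewrite ler_pdivrMr // ler_peMr ?(ltW cd) // ler1n.
move=> Dz.
have path (c : R) : 0 <= c <= ct -> nm (z + toC c *: v0 - p) < R1 /\ nm (z + toC c *: v0 - p) < c2 * d.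
  move=> /andP[c0 cc].
  have h1 : nm (z + toC c *: v0 - p) <= nm (z - p) + ct * nm v0.
    rewrite addrAC; apply: le_trans (nmD _ _) _; rewrite lerD2l nmZ nm_toC ger0_norm //.
    by rewrite ler_wpM2r ?nm_ge0.
  have cd : 0 < c2 * d by rewrite mulr_gt0.
  split; apply: le_lt_trans h1 _.
    by move: (nm (z - p)) (ct * nm v0) zde cv1 de1 R10 => x y; lra.
  by move: (nm (z - p)) (ct * nm v0) zde cv2 de2 cd => x y; lra.
have zR : nm (z - p) < R1.
  by have := path 0; rewrite lexx (ltW ct0) => /(_ isT)[]; have -> : toC (0 : R) = 0 by []; rewrite scale0r addr0.
have [Uz _] := HR1 z zR.
pose b := z + toC ct *: v0.
(* Both maps agree near [b], which is in the cone; the segment from [b] to [z] stays in [D] because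
   [u] is at most [u z] along it. *)
apply: (@identity_segment R X V [set y | D y /\ nm (y - p) < c2 * d] g f b z de de0).
- rewrite openE => y [yD yd]; apply/nbhs_nmP.
  have /nbhs_nmP[e e0 He] : nbhs y D by apply: open_nbhs_nbhs.
  exists (Num.min e (c2 * d - nm (y - p))) => [|y']; first by rewrite lt_min e0 subr_gt0.
  rewrite lt_min => /andP[/He y'D yy]; split => //.
  by rewrite -[y'](subrK y) -addrA; apply: le_lt_trans (nmD _ _) _; rewrite -ltrBrDr.
- by move=> y [yD yd]; split; [exact: gH|exact: fD].
- move=> s /andP[s0 s1].
  have E : b + toC s *: (z - b) = z + toC (ct * (1 - s)) *: v0.
    by rewrite toCM toCB toC1; exact: back_segment.
  have cs : 0 <= ct * (1 - s) <= ct.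
    by rewrite mulr_ge0 ?(ltW ct0) ?subr_ge0 //= ler_piMr ?(ltW ct0) // gerBl.
  have [h1 h2] := path _ cs; have /andP[cs0 _] := cs; rewrite E; split => //.
  have [Uc _] := HR1 _ h1; apply/(DU Uc).
  have [le _] := inw z v0 _ cs0 v0in zR h1; apply: le_lt_trans le _; exact/(DU Uz).
move=> y yb.
(* The direction with [y = p + toC ct *: v]; both displacements are less than [de], so it differs
   from [v0] by less than [k0]. *)
pose v := v0 + toC ct^-1 *: ((y - b) + (z - p)).
have yE : y = p + toC ct *: v.
  have cc : toC ct * toC ct^-1 = 1 :> C by rewrite -toCM divff ?gt_eqF.
  by rewrite /v scalerDr scalerA cc scale1r; exact: cone_point.
rewrite yE; apply: gcone; rewrite /v addrAC subrr add0r nmZ nm_toC gtr0_norm ?invr_gt0 //.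
rewrite mulrC ltr_pdivrMr //; apply: le_lt_trans (nmD _ _) _.
by rewrite mulrC; move: (nm _) (nm _) yb zde de3 => x1 x2; lra.
Qed.

End LocalExtension.

Lemma Ck_on_sub (R : realType) n k (U U' : set 'rV[Cx R]_n) (u : 'rV[Cx R]_n -> R) :
  U' `<=` U -> Ck_on k U u -> Ck_on k U' u.
Proof.
move=> UU; elim: k u => [|k IH] u [uc ud]; split => //; try by move=> z /UU; exact: uc.
move=> v; have [h1 h2] := ud v; split; last exact: IH.
by move=> z /UU; exact: h1.
Qed.

Theorem hartogs_levi (R : realType) q (X : hilbert_manifold R) :
  q_hartogs q.+1 X -> q_levi_extension q.+1 X.
Proof.
move=> hX n D [Do _ _] _ p [pcl pint] [u [U [[Uo Up] uC2 und uD]] lev] f fD.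
have /nbhs_nmP[R0 R00 HR0] : nbhs p U by apply: open_nbhs_nbhs.
have u2 : Ck_on 2 [set z | nm (z - p) < R0] u by apply: (Ck_on_sub _ uC2) => z /HR0.
have uc : {for p, continuous u} by case: uC2 => h _; exact: h.
(* If [u p > 0], continuity would keep [D] away from [p]; if [u p < 0], the point would be interior
   to [D]. *)
have up0 : u p = 0.
  apply/eqP; rewrite eq_le; apply/andP; split; rewrite leNgt; apply/negP => up.
    have [d d0 Hd] := continuous_nmP uc up.
    have [|y [Dy [yd yU]]] := pcl ([set y | nm (y - p) < d] `&` U).
      by apply: filterI; [apply/nbhs_nmP; exists d|apply: open_nbhs_nbhs].
    have := Hd y yd; rewrite ltr_norml => /andP[h _].
    by have := (uD y yU).1 Dy; lra.
  by apply: pint; rewrite (interior_id _).1 //; apply/(uD p Up).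
have DU (z : 'rV[Cx R]_n) : nm (z - p) < R0 -> (D z <-> u z < 0) by move=> /HR0; exact: uD.
have [d [g [d0 Hg]]] := local_extension hX Do R00 u2 DU up0 (und p Up) lev fD.
pose V : set 'rV[Cx R]_n := [set z | nm (z - p) < d].
have Vo : open V.
  rewrite openE => z zV; apply/nbhs_nmP; exists (d - nm (z - p)) => [|y yz].
    by rewrite subr_gt0.
  by rewrite /V /= -[y](subrK z) -addrA; apply: le_lt_trans (nmD _ _) _; rewrite -ltrBrDr.
(* [local_extension] gives the agreement at every point of [D] near [p], so the overlap need not be
   connected. *)
pose G z := if `[< D z >] then f z else g z.
have GD z : D z -> G z = f z by move=> Dz; rewrite /G; case: asboolP.
have GV z : V z -> G z = g z.
  by move=> /Hg[_ h]; rewrite /G; case: asboolP => // Dz; rewrite h.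
exists V; split; first by split => //; rewrite /V /= subrr nm0.
exists G => // z [Dz|Vz].
  have /nbhs_nmP[e e0 He] : nbhs z D by apply: open_nbhs_nbhs.
  by apply: (hol_at_near e0 _ (fD z Dz)) => y /He Dy; rewrite GD.
have /nbhs_nmP[e e0 He] : nbhs z V by apply: open_nbhs_nbhs.
have [gz _] := Hg z Vz.
by apply: (hol_at_near e0 _ gz) => y /He Vy; rewrite GV.
Qed.

Theorem theorem1 (R : realType) (q : nat) (X : hilbert_manifold R) :
  (1 <= q)%N -> (q_levi_extension q X <-> q_hartogs q X).
Proof.
(* The slices of the figure use a first coordinate besides the distinguished one, hence the
   successor. *)
case: q => // q _; split; first exact: levi_hartogs.
exact: hartogs_levi.
Qed.
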